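(* Let $k \geq 2$ be an integer. Then there exists a weight $k$ newform $f_k(z) = \sum_{n=1}^{\infty} \gamma_k(n) q^n$ (with $q = e^{2\pi i z}$) with complex multiplication by $\mathbb{Q}(\sqrt{-3})$, lying in $$ \begin{cases} S_k(\Gamma_0(36)), & \text{if } k \equiv 0,2 \pmod 6,\\ S_k(\Gamma_0(3),(\tfrac{-3}{\cdot})), & \text{if } k \equiv 1 \pmod 6,\\ S_k(\Gamma_0(12),(\tfrac{-3}{\cdot})), & \text{if } k \equiv 3,5 \pmod 6,\\ S_k(\Gamma_0(9)), & \text{if } k \equiv 4 \pmod 6, \end{cases} $$ such that for every odd prime $p$, $$ \gamma_k(p)= \begin{cases} (a+ b\sqrt{-3})^{k-1} + (a-b \sqrt{-3})^{k-1} & \text{if } p \equiv 1 \pmod 6,\\ (-3)^{\frac{k-1}{2}} & \text{if } p =3 \text{ and } k \text{ is odd},\\ 0 & \text{otherwise}, \end{cases} $$ where, when $p \equiv 1 \pmod 6$, $a,b$ are the integers with $p=a^2+3b^2$, $a\equiv 1 \pmod 3$ and $b>0$. Moreover, $\gamma_k(n)$ is an integer for all $n\geq 1$ and all $k \geq 2$.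
   Context: $(\tfrac{-3}{\cdot})$ denotes the Kronecker symbol, used as a Nebentypus character. A newform $f=\sum \gamma(n)q^n$ has complex multiplication (CM) by an imaginary quadratic field $K$ with associated quadratic character $\psi$ if $\gamma(p)=\psi(p)\gamma(p)$ for all primes $p$ in a set of density one. Every prime $p\equiv 1 \pmod 6$ can be written as $p=a^2+3b^2$ with integers $a,b$, uniquely up to signs. *)

(* Defs.v *)
From HB Require Import structures.
From mathcomp Require Import all_boot all_order all_algebra.
From mathcomp Require Import all_classical all_reals all_analysis.
From mathcomp Require Import complex.

Set Implicit Arguments.
Unset Strict Implicit.
Unset Printing Implicit Defensive.

Import Order.TTheory GRing.Theory Num.Theory numFieldNormedType.Exports.

Local Open Scope classical_set_scope.
Local Open Scope ring_scope.

(** * Complex numbers and the upper half-plane *)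

(* Seen as a numClosedFieldType, so that R[i] inherits the topology and the
   normed-module structure that MathComp-Analysis puts on such fields; in
   particular [derivable f z 1] is complex differentiability of f at z. *)
Definition Cplx (R : realType) : numClosedFieldType := R[i].

Definition upper_half (R : realType) : set (Cplx R) :=
  [set z | 0 < complex.Im z].

Definition cexp (R : realType) (z : Cplx R) : Cplx R :=
  Complex (expR (complex.Re z) * cos (complex.Im z))
          (expR (complex.Re z) * sin (complex.Im z)).

(* e(z) = exp(2 pi i z) *)
Definition e2ipi (R : realType) (z : Cplx R) : Cplx R :=
  cexp ((Complex 0 (2 * pi) : Cplx R) * z).

(* F(z) = \sum_{n >= 1} a(n) exp(2 pi i n z / h) on the upper half-plane; for
   h = 1 this is the expansion \sum_{n >= 1} a(n) q^n. *)
Definition cusp_expansion (R : realType) (h : nat) (a : nat -> Cplx R)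
    (F : Cplx R -> Cplx R) : Prop :=
  forall z : Cplx R, upper_half z ->
    (fun m : nat => \sum_(1 <= n < m) a n * e2ipi (n%:R * z / h%:R))
      @ \oo --> F z.

(** * The modular group *)

Definition SL2Z (g : 'M[int]_2) : Prop := \det g = 1.

Definition Gamma0 (N : nat) (g : 'M[int]_2) : Prop :=
  SL2Z g /\ (N%:Z %| g 1%R 0%R)%Z.

Definition automorphy (R : realType) (g : 'M[int]_2) (z : Cplx R) : Cplx R :=
  (g 1 0)%:~R * z + (g 1 1)%:~R.

Definition moebius (R : realType) (g : 'M[int]_2) (z : Cplx R) : Cplx R :=
  ((g 0 0)%:~R * z + (g 0 1)%:~R) / automorphy g z.

(* the weight k action f |_k g, for g of determinant 1 *)
Definition slash (R : realType) (k : nat) (f : Cplx R -> Cplx R)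
    (g : 'M[int]_2) (z : Cplx R) : Cplx R :=
  automorphy g z ^- k * f (moebius g z).

(** * Characters *)

Definition dirichlet_character (R : realType) (M : nat)
    (chi : int -> Cplx R) : Prop :=
  [/\ forall m n, chi (m * n) = chi m * chi n,
      forall n, chi (n + M%:Z) = chi n
    & forall n, chi n != 0 <-> coprimez n M%:Z].

Definition kronecker_prime (a : int) (p : nat) : int :=
  if p == 2%N then
    if (2 %| a)%Z then 0
    else if ((a %% 8)%Z == 1) || ((a %% 8)%Z == 7) then 1 else -1
  else
    if (p%:Z %| a)%Z then 0
    else if [exists x : 'I_p, (x%:Z ^+ 2 == a %[mod p%:Z])%Z] then 1 else -1.

(* the Kronecker symbol (a / n) *)
Definition kronecker (a n : int) : int :=
  if n == 0 then (if `|a| == 1 then 1 else 0)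
  else (if (n < 0) && (a < 0) then -1 else 1)
       * \prod_(p <- primes `|n|%N) kronecker_prime a p ^+ logn p `|n|%N.

(** * Cusp forms on Gamma_0(N) with Nebentypus *)

(* S_k(Gamma_0(N), chi). Only the values of chi at integers prime to N matter
   here and below, so chi stands for the Dirichlet character modulo N which
   agrees with it at those integers. The last clause is the vanishing at all
   cusps: every f |_k g has an expansion without constant term in
   exp(2 pi i z / h) for some width h >= 1. *)
Definition cusp_form (R : realType) (k N : nat) (chi : int -> Cplx R)
    (f : Cplx R -> Cplx R) : Prop :=
  [/\ forall z : Cplx R, upper_half z -> derivable f z 1,
      forall g (z : Cplx R), Gamma0 N g -> upper_half z ->
        f (moebius g z) = chi (g 1 1) * automorphy g z ^+ k * f z
    & forall g, SL2Z g ->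
        exists h : nat, (0 < h)%N /\
          exists a : nat -> Cplx R, cusp_expansion h a (slash k f g)].

(* (T_n f)(z) = n^(k-1) \sum_{a d = n, (a, N) = 1} chi(a) d^(-k)
                  \sum_{0 <= b < d} f((a z + b) / d) *)
Definition hecke (R : realType) (k N : nat) (chi : int -> Cplx R) (n : nat)
    (f : Cplx R -> Cplx R) (z : Cplx R) : Cplx R :=
  n%:R ^+ k.-1 *
  \sum_(a <- divisors n | coprime a N)
    chi a%:Z * (n %/ a)%:R ^- k *
    \sum_(b < (n %/ a)%N) f ((a%:R * z + b%:R) / (n %/ a)%:R).

(** * Petersson inner product *)

Definition fundamental_domain (R : realType) : set (R * R) :=
  [set p | [/\ `|p.1| <= 2^-1, 1 <= p.1 ^+ 2 + p.2 ^+ 2 & 0 < p.2]].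

(* s lists one element of each coset Gamma_0(N) \ SL_2(Z) *)
Definition coset_transversal (N : nat) (s : seq 'M[int]_2) : Prop :=
  [/\ uniq s,
      forall g, g \in s -> SL2Z g
    & forall g, SL2Z g ->
        exists! r, r \in s /\ exists2 c, Gamma0 N c & g = c *m r].

Definition coset_reps (N : nat) : seq 'M[int]_2 :=
  xget [::] [set s | coset_transversal N s].

(* The product on Gamma_0(N) \ H of f(z) conj(g(z)) y^k dx dy / y^2, written
   on the translates of the fundamental domain of SL_2(Z) and not normalised
   by the volume. *)
Definition petersson (R : realType) (k N : nat) (f g : Cplx R -> Cplx R) :
    Cplx R :=
  let mu := (@lebesgue_measure R \x @lebesgue_measure R)%E in
  let F (p : R * R) : Cplx R :=
    \sum_(r <- coset_reps N)
      slash k f r (Complex p.1 p.2) * (slash k g r (Complex p.1 p.2))^* in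
  Complex
    (\int[mu]_(p in @fundamental_domain R)
        (complex.Re (F p) * p.2 ^+ k / p.2 ^+ 2))
    (\int[mu]_(p in @fundamental_domain R)
        (complex.Im (F p) * p.2 ^+ k / p.2 ^+ 2)).

(** * Newforms *)

(* z |-> h(d z) with h in S_k(Gamma_0(M), chi'), d M | N, M < N, and chi
   induced by the character chi' modulo M *)
Definition old_generator (R : realType) (k N : nat) (chi : int -> Cplx R)
    (g : Cplx R -> Cplx R) : Prop :=
  exists (M d : nat) (chi' : int -> Cplx R) (h : Cplx R -> Cplx R),
    [/\ (d * M %| N)%N /\ (M < N)%N,
        dirichlet_character M chi',
        forall n, coprimez n N%:Z -> chi' n = chi n,
        cusp_form k M chi' h
      & forall z : Cplx R, upper_half z -> g z = h (d%:R * z)].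

(* The span of the generators, which are already stable under scaling. *)
Definition oldform (R : realType) (k N : nat) (chi : int -> Cplx R)
    (g : Cplx R -> Cplx R) : Prop :=
  exists (m : nat) (G : 'I_m -> Cplx R -> Cplx R),
    (forall i, old_generator k N chi (G i)) /\
    (forall z : Cplx R, upper_half z -> g z = \sum_(i < m) G i z).

(* f is a (normalised) newform in S_k(Gamma_0(N), chi), of level N, with
   q-expansion \sum_{n >= 1} gamma(n) q^n *)
Definition newform (R : realType) (k N : nat) (chi : int -> Cplx R)
    (f : Cplx R -> Cplx R) (gamma : nat -> Cplx R) : Prop :=
  [/\ cusp_form k N chi f,
      cusp_expansion 1 gamma f,
      gamma 1%N = 1,
      forall g, oldform k N chi g -> petersson k N f g = 0
    & forall n : nat, (0 < n)%N ->
        exists lambda : Cplx R, forall z : Cplx R, upper_half z ->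
          hecke k N chi n f z = lambda * f z].

(** * Complex multiplication *)

Definition prime_density_one (R : realType) (S : pred nat) : Prop :=
  (fun x : nat =>
     (count (fun p => prime p && S p) (iota 0 x.+1))%:R
     / (count prime (iota 0 x.+1))%:R : R) @ \oo --> (1 : R).

(* the discriminant of Q(sqrt d), for d squarefree and d != 1 *)
Definition quad_disc (d : int) : int :=
  if (d %% 4)%Z == 1 then d else 4 * d.

(* CM by Q(sqrt d), d < 0 squarefree; the quadratic character associated with
   that field is the Kronecker symbol of its discriminant. *)
Definition has_CM_by (R : realType) (d : int) (gamma : nat -> Cplx R) : Prop :=
  exists S : pred nat, prime_density_one R S /\
    forall p : nat, prime p -> S p ->
      gamma p = (kronecker (quad_disc d) p%:Z)%:~R * gamma p.

(** * Representations p = a^2 + 3 b^2 *)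

Definition normalized_rep (p : nat) (ab : int * int) : Prop :=
  [/\ p%:Z = ab.1 ^+ 2 + 3 * ab.2 ^+ 2, (ab.1 = 1 %[mod 3])%Z & 0 < ab.2].

(* Main.v *)
Require Import Defs.
From HB Require Import structures.
From mathcomp Require Import all_boot all_order all_algebra.
From mathcomp Require Import all_classical all_reals all_analysis.
From mathcomp Require Import complex measurable_realfun.
From mathcomp Require Import ring lra zify.

(* Write x = x1 + x2 zeta for the Eisenstein integers and N for the norm. The
   newform is the Hecke theta series f(z) = 1/6 sum_x eps(x) x^(k-1) e(N(x) z),
   where eps is a character modulo a conductor depending on k mod 6, chosen so
   that eps(x) x^(k-1) only depends on the ideal (x).
   - Modularity. Finite Fourier analysis on a window of length 2M+1 gives theta
     inversion in one variable; comparing multipliers gives it for the hexagonal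
     lattice, hence the behaviour of f under z -> -1/(Nz) and z -> z + 1/m.
     Euclid's algorithm on the first column of a matrix reaches all of Gamma_0(N)
     and all cusps.
   - Hecke relations. They follow from the factorisation of rational primes in
     Z[zeta] and the multiplicativity of eps(x) x^(k-1).
   - Orthogonality to oldforms h(dz), h of level M < N. For a prime q dividing
     N/M, either V = [1, 0; N/q, 1] (q prime to d) or the translation by 1/q
     (q | d) normalises Gamma_0(N), fixes h(dz) and multiplies f by a root of
     unity different from 1. In the
     first case the sum over cosets vanishes pointwise; in the second the integral
     over a fundamental domain vanishes because the hyperbolic measure is
     invariant under the translation, by unfolding. *)

Set Implicit Arguments.
Unset Strict Implicit.
Unset Printing Implicit Defensive.

Import Order.TTheory GRing.Theory Num.Theory numFieldNormedType.Exports.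

Local Open Scope classical_set_scope.
Local Open Scope ring_scope.

(** * Complex numbers and unordered sums *)

(** The obstacle in theta inversion is the square root in its multiplier. The one-variable argument
    yields some factor c(t), classically sqrt(i/t). The norm form is (u + v/2)^2 + 3 v^2 / 4, so the
    lattice requires z c(2z) c(3z/2) to be constant. Comparing grids of different odd sizes shows
    that this function agrees at z and r z for ratios r of odd squares; such r accumulate at 1, so
    its derivative vanishes. The weight x^(k-1) is produced by shifting the lattice along an
    isotropic direction of the norm form, where the exponent is affine in the shift. Write N = q m^2
    with q in {1, 3}. Then f(z/m) is modular on Gamma_0(q) up to m-th roots of unity, whose exponent
    is that of the multiplier of eta^4. These roots of unity serve twice: they become trivial after
    conjugating back to Gamma_0(N), and they are the factors that separate f from oldforms. Every
    prime dividing N/M divides m: for odd k the Nebentypus has conductor 3, which forces 3 to divide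
    M. *)

Section ComplexBasics.
Variable R : realType.
Local Notation C := (Cplx R).
Implicit Types (z w : C) (x y : R).

Definition cabs (z : C) : R := Num.sqrt (complex.Re z ^+ 2 + complex.Im z ^+ 2).

Lemma normCE z : `|z| = (cabs z)%:C%C.
Proof. exact: normc_def. Qed.

Lemma cabs_ge0 z : 0 <= cabs z.
Proof. exact: sqrtr_ge0. Qed.

Lemma cabs0 : cabs 0 = 0.
Proof. by apply: complexI; rewrite -normCE normr0. Qed.

Lemma cabs1 : cabs 1 = 1.
Proof. by apply: complexI; rewrite -normCE normr1. Qed.

Lemma cabs_eq0 z : (cabs z == 0) = (z == 0).
Proof. by rewrite -(inj_eq (@complexI R)) -normCE normr_eq0. Qed.

Lemma cabs_gt0 z : (0 < cabs z) = (z != 0).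
Proof. by rewrite lt_neqAle cabs_ge0 andbT eq_sym cabs_eq0. Qed.

Lemma cabsM z w : cabs (z * w) = cabs z * cabs w.
Proof. by apply: complexI; rewrite rmorphM /= -!normCE normrM. Qed.

Lemma cabsD z w : cabs (z + w) <= cabs z + cabs w.
Proof. by rewrite -lecR rmorphD /= -!normCE ler_normD. Qed.

Lemma cabsN z : cabs (- z) = cabs z.
Proof. by apply: complexI; rewrite -!normCE normrN. Qed.

Lemma cabsB z w : cabs (z - w) <= cabs z + cabs w.
Proof. by rewrite -(cabsN w) cabsD. Qed.

Lemma cabs_distC z w : cabs (z - w) = cabs (w - z).
Proof. by rewrite -cabsN opprB. Qed.

Lemma cabsX z n : cabs (z ^+ n) = cabs z ^+ n.
Proof. by elim: n => [|n IH]; rewrite ?expr0 ?cabs1 // !exprS cabsM IH. Qed.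

Lemma cabsV z : cabs z^-1 = (cabs z)^-1.
Proof.
apply: complexI; rewrite -normCE normfV normCE.
by rewrite [RHS]fmorphV.
Qed.

Lemma cabs_sum (I : Type) (r : seq I) (P : pred I) (F : I -> C) :
  cabs (\sum_(i <- r | P i) F i) <= \sum_(i <- r | P i) cabs (F i).
Proof.
elim/big_ind2 : _ => [|a b c d h1 h2|//]; first by rewrite cabs0.
exact: le_trans (cabsD _ _) (lerD h1 h2).
Qed.

Lemma cabs_real x : cabs (x%:C%C) = `|x|.
Proof. by rewrite /cabs /= expr0n addr0 sqrtr_sqr. Qed.

Lemma cabs_nat n : cabs n%:R = n%:R.
Proof.
by rewrite -[n%:R](rmorph_nat (real_complex R)) cabs_real ger0_norm ?ler0n.
Qed.

Lemma cabs_int (n : int) : cabs n%:~R = `|n%:~R|.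
Proof. by rewrite -[n%:~R](rmorph_int (real_complex R)) cabs_real. Qed.

Lemma cabs_Re z : `|complex.Re z| <= cabs z.
Proof. by rewrite -sqrtr_sqr ler_sqrt ?addr_ge0 ?sqr_ge0 // lerDl sqr_ge0. Qed.

Lemma cabs_Im z : `|complex.Im z| <= cabs z.
Proof. by rewrite -sqrtr_sqr ler_sqrt ?addr_ge0 ?sqr_ge0 // lerDr sqr_ge0. Qed.

Lemma cabs_le_ReIm z : cabs z <= `|complex.Re z| + `|complex.Im z|.
Proof.
rewrite -[leRHS]ger0_norm ?addr_ge0 // -[leRHS]sqrtr_sqr /cabs ler_sqrt ?sqr_ge0 //.
rewrite sqrrD !real_normK ?num_real // addrAC lerDl.
by rewrite mulrn_wge0 // mulr_ge0.
Qed.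

(** Limits in [Cplx R] are defined with radii in the field [R[i]] itself; real radii bring the
    estimates within reach of [lra] and [nra]. *)
Lemma cvgCP (T : Type) (F : set_system T) (FF : Filter F) (u : T -> C) (l : C) :
  (u @ F --> l) <-> (forall e : R, 0 < e -> \forall n \near F, cabs (u n - l) < e).
Proof.
split=> [/cvgrPdist_lt H e e0|H].
  have e0' : 0 < e%:C%C :> C by rewrite ltcR.
  have := H _ e0'; apply: filterS => n /=.
  by rewrite normCE ltcR cabs_distC.
apply/cvgrPdist_lt => e e0.
have : 0 < complex.Re e by move: e0; rewrite ltcE => /andP[].
move=> /H; apply: filterS => n /= h; rewrite normCE.
have -> : e = (complex.Re e)%:C%C.
  by case: e e0 {h} => a b; rewrite ltcE /= => /andP[/eqP ->].
by rewrite ltcR cabs_distC.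
Qed.

Lemma cvgC_unique (T : Type) (F : set_system T) (FF : ProperFilter F)
    (u : T -> C) (l l' : C) : u @ F --> l -> u @ F --> l' -> l = l'.
Proof. by move=> h1 h2; apply: cvg_unique h1 h2. Qed.

Lemma cexpD z w : cexp (z + w) = cexp z * cexp w.
Proof.
case: z w => a b [c d]; rewrite /cexp /= expRD cosD sinD.
by apply/eqP; rewrite eq_complex /=; apply/andP; split; apply/eqP; ring.
Qed.

Lemma cexp0 : cexp (0 : C) = 1.
Proof. by rewrite /cexp /= expR0 cos0 sin0 mulr1 mulr0. Qed.

Lemma cexpN z : cexp (- z) * cexp z = 1.
Proof. by rewrite -cexpD addNr cexp0. Qed.

Lemma cexp_neq0 z : cexp z != 0.
Proof. by apply/eqP => h; have := cexpN z; rewrite h mulr0 => /eqP; rewrite eq_sym oner_eq0. Qed.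

Lemma cabs_cexp z : cabs (cexp z) = expR (complex.Re z).
Proof.
case: z => a b; rewrite /cabs /cexp /= !exprMn -mulrDr cos2Dsin2 mulr1 sqrtr_sqr.
by rewrite ger0_norm ?expR_ge0.
Qed.

Lemma cexp_nat z n : cexp (n%:R * z) = cexp z ^+ n.
Proof.
elim: n => [|n IH]; first by rewrite mul0r cexp0.
by rewrite -natr1 mulrDl mul1r cexpD IH exprSr.
Qed.

Lemma expR_sub1_le x : `|expR x - 1| <= `|x| * expR `|x|.
Proof.
have h1 := expR_ge1Dx x; have h2 := expR_ge1Dx (- x).
have hp : 0 < expR x by exact: expR_gt0.
have hm : expR (- x) * expR x = 1 by rewrite -expRD addNr expR0.
have [x0|x0] := leP 0 x.
  rewrite (ger0_norm x0) ger0_norm; last lra.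
  have := ler_wpM2r (ltW hp) h2; rewrite hm; nra.
rewrite (ltr0_norm x0) ler0_norm; last first.
  rewrite subr_le0 -expR0 ler_expR; lra.
have : 1 <= expR (- x) by rewrite -expR0 ler_expR; lra.
nra.
Qed.

Lemma expR_taylor1 x : `|expR x - 1 - x| <= x ^+ 2 * expR `|x|.
Proof.
have h1 := expR_ge1Dx x; have h2 := expR_ge1Dx (- x).
rewrite ger0_norm; last lra.
have h := expR_sub1_le x.
have : expR x - 1 - x <= x * (expR x - 1).
  have hp : 0 < expR x by exact: expR_gt0.
  have hm : expR (- x) * expR x = 1 by rewrite -expRD addNr expR0.
  have := ler_wpM2r (ltW hp) h2; rewrite hm; nra.
move=> /le_trans; apply.
apply: le_trans (ler_norm _) _; rewrite normrM.
apply: le_trans (ler_wpM2l (normr_ge0 x) h) _.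
by rewrite mulrA -expr2 real_normK ?num_real.
Qed.

Lemma abs_sin_le y : `|sin y| <= `|y|.
Proof.
wlog y0 : y / 0 <= y.
  move=> H; have [/H//|y0] := leP 0 y.
  rewrite -(normrN y) -(normrN (sin y)) -sinN; apply: H; lra.
have [->|yn0] := eqVneq y 0; first by rewrite sin0.
have y1 : 0 < y by lra.
have [|c _] := @MVT R sin cos 0 y y1 (fun x _ => is_derive_sin x).
  by apply: continuous_subspaceT => x; exact: continuous_sin.
rewrite sin0 !subr0 => ->.
by rewrite normrM ler_piMl //; exact: cos_max.
Qed.

Lemma one_sub_cos y : 1 - cos y = 2 * sin (y / 2) ^+ 2.
Proof.
rewrite {1}(_ : y = y / 2 + y / 2); last by field.
by rewrite cosD -!expr2 cos2sin2; ring.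
Qed.

Lemma abs_sin_sub_le y : `|sin y - y| <= y ^+ 2.
Proof.
wlog y0 : y / 0 <= y.
  move=> H; have [/H//|y0] := leP 0 y.
  rewrite -sqrrN -normrN (_ : - (_ - _) = sin (- y) - - y); last by rewrite sinN; ring.
  apply: H; lra.
have [->|yn0] := eqVneq y 0; first by rewrite sin0 subrr normr0 expr0n.
have y1 : 0 < y by lra.
have [|c cin] := @MVT R sin cos 0 y y1 (fun x _ => is_derive_sin x).
  by apply: continuous_subspaceT => x; exact: continuous_sin.
rewrite sin0 !subr0 => ->.
rewrite -{2}(mul1r y) -mulrBl normrM expr2 (ger0_norm y0).
rewrite ler_wpM2r // distrC one_sub_cos normrM normrX.
have h1 := abs_sin_le (c / 2); have h2 := sin_max (c / 2).
move: cin; rewrite in_itv /= => /andP[c0 cy].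
have e1 : `|c / 2| = c / 2 by rewrite ger0_norm //; lra.
rewrite e1 in h1; have e2 : `|2| = 2 :> R by rewrite ger0_norm.
rewrite e2.
have h3 : 0 <= `|sin (c / 2)| by [].
nra.
Qed.

(** Real and imaginary parts are bounded separately and added; the factor 2 absorbs the cross term.
    This quadratic remainder is the source of every termwise differentiation below. *)
Lemma cexp_taylor1 z : cabs (cexp z - 1 - z) <= 2 * (cabs z ^+ 2 * expR (cabs z)).
Proof.
have hsq : cabs z ^+ 2 = complex.Re z ^+ 2 + complex.Im z ^+ 2.
  by rewrite sqr_sqrtr // addr_ge0 ?sqr_ge0.
have hRe := cabs_Re z.
case: z hsq hRe => x y /= hsq hRe.
set c := cabs _ in hsq hRe *.
have E1 : expR `|x| <= expR c by rewrite ler_expR.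
have E2 : expR x <= expR `|x| by rewrite ler_expR ler_norm.
have E3 : 1 <= expR `|x| by rewrite -expR0 ler_expR.
apply: le_trans (cabs_le_ReIm _) _; rewrite /= hsq.
have h1 := expR_taylor1 x; have h2 := abs_sin_sub_le y.
have h3 := expR_sub1_le x; have h4 := abs_sin_le y.
have h5 : `|1 - cos y| <= y ^+ 2 / 2.
  rewrite one_sub_cos normrM normrX.
  have e2 : `|2| = 2 :> R by rewrite ger0_norm.
  have := abs_sin_le (y / 2); rewrite normrM normfV e2 => h.
  have h0 : 0 <= `|sin (y / 2)| by [].
  rewrite -(real_normK (num_real y)).
  nra.
have hx : 0 <= expR x by exact: expR_ge0.
have A1 : `|expR x * cos y - 1 - x| <= x ^+ 2 * expR c + expR c * (y ^+ 2 / 2).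
  rewrite (_ : _ - _ - _ = (expR x - 1 - x) - expR x * (1 - cos y)); last ring.
  apply: le_trans (ler_normB _ _) _; rewrite lerD //.
    by apply: le_trans h1 _; rewrite ler_wpM2l ?sqr_ge0.
  rewrite normrM (ger0_norm hx) ler_pM //; lra.
have A2 : `|expR x * sin y - 0 - y| <= `|x| * expR c * `|y| + y ^+ 2 * expR c.
  rewrite (_ : _ - _ - _ = (expR x - 1) * sin y + (sin y - y)); last ring.
  apply: le_trans (ler_normD _ _) _; rewrite lerD //.
    rewrite normrM ler_pM //; apply: le_trans h3 _.
    by rewrite ler_wpM2l.
  apply: le_trans h2 _; rewrite ler_peMr ?sqr_ge0 //; lra.
have h6 : `|x| * `|y| <= (x ^+ 2 + y ^+ 2) / 2.
  rewrite -(real_normK (num_real y)) -(real_normK (num_real x)).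
  have := sqr_ge0 (`|x| - `|y|); nra.
have hc : 0 <= expR c by exact: expR_ge0.
apply: le_trans (lerD A1 A2) _.
rewrite (_ : `|x| * expR c * `|y| = (`|x| * `|y|) * expR c); last ring.
have := ler_wpM2r hc h6; have := mulr_ge0 (sqr_ge0 x) hc.
have := mulr_ge0 (sqr_ge0 y) hc; nra.
Qed.

Lemma e2ipiD z w : e2ipi (z + w) = e2ipi z * e2ipi w.
Proof. by rewrite /e2ipi mulrDr cexpD. Qed.

Lemma e2ipi0 : e2ipi (0 : C) = 1.
Proof. by rewrite /e2ipi mulr0 cexp0. Qed.

Lemma e2ipi_neq0 z : e2ipi z != 0.
Proof. exact: cexp_neq0. Qed.

Lemma e2ipiN z : e2ipi (- z) = (e2ipi z)^-1.
Proof. by apply: (mulIf (e2ipi_neq0 z)); rewrite -e2ipiD addNr e2ipi0 mulVf ?e2ipi_neq0. Qed.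

Lemma e2ipi_natM n z : e2ipi (n%:R * z) = e2ipi z ^+ n.
Proof. by rewrite /e2ipi mulrCA cexp_nat. Qed.

Lemma cabs_e2ipi z : cabs (e2ipi z) = expR (- (2 * pi * complex.Im z)).
Proof. by rewrite /e2ipi cabs_cexp; case: z => a b /=; congr expR; ring. Qed.

Lemma e2ipi1 : e2ipi (1 : C) = 1.
Proof.
rewrite /e2ipi mulr1 /cexp /= expR0 !mul1r.
have -> : 2 * pi = pi *+ 2 :> R by rewrite mulr_natl.
by rewrite cos2pi sin2pi.
Qed.

Lemma e2ipi_nat n : e2ipi (n%:R : C) = 1.
Proof. by rewrite -(mulr1 n%:R) e2ipi_natM e2ipi1 expr1n. Qed.

Lemma e2ipi_int (n : int) : e2ipi (n%:~R : C) = 1.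
Proof.
case: n => n; first exact: e2ipi_nat.
by rewrite NegzE rmorphN /= e2ipiN -pmulrn e2ipi_nat invr1.
Qed.

Lemma e2ipi_half : e2ipi (2^-1 : C) = -1.
Proof.
rewrite /e2ipi (_ : _ * _ = Complex 0 pi).
  by rewrite /cexp /= expR0 cospi sinpi !mul1r; apply/eqP; rewrite eq_complex /= oppr0 !eqxx.
have -> : (2^-1 : C) = (2^-1)%:C%C by rewrite fmorphV rmorph_nat.
by apply/eqP; rewrite eq_complex /=; apply/andP; split; apply/eqP; field.
Qed.

End ComplexBasics.

(** * Unordered summation of complex families *)

Section UnorderedSums.
Variable R : realType.
Local Notation C := (Cplx R).

Lemma big_subseq_split (V : nmodType) (I : eqType) (A B : seq I) (F : I -> V) :
  uniq A -> uniq B -> {subset A <= B} ->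
  \sum_(i <- B) F i = \sum_(i <- A) F i + \sum_(i <- B | i \notin A) F i.
Proof.
move=> uA uB sAB; rewrite (bigID (fun i => i \in A)) /=; congr (_ + _).
rewrite -big_filter; apply: perm_big; apply: uniq_perm => //.
  exact: filter_uniq.
move=> i; rewrite mem_filter; case iA: (i \in A) => //=; exact: sAB.
Qed.

(** For a non-negative [g] this is summability. Duplicate-free lists play the role of finite
    subsets, so any [eqType] can serve as index set. *)
Definition bsum (I : eqType) (g : I -> R) : Prop :=
  exists M : R, forall A : seq I, uniq A -> \sum_(i <- A) g i <= M.

Definition asum (I : eqType) (f : I -> C) : Prop := bsum (fun i => cabs (f i)).

Definition has_csum (I : eqType) (f : I -> C) (s : C) : Prop :=
  forall e : R, 0 < e -> exists A : seq I, forall B : seq I, uniq B ->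
    {subset A <= B} -> cabs (\sum_(i <- B) f i - s) < e.

(** The value is 0 when no sum exists, which is why the algebraic rules below carry an [asum]
    hypothesis. *)
Definition csum (I : eqType) (f : I -> C) : C := xget 0 [set s | has_csum f s].

Lemma bsum_le (I : eqType) (g h : I -> R) :
  (forall i, g i <= h i) -> bsum h -> bsum g.
Proof.
by move=> gh [M HM]; exists M => A uA; apply: le_trans (HM A uA); apply: ler_sum.
Qed.

Lemma bsumD (I : eqType) (g h : I -> R) :
  bsum g -> bsum h -> bsum (fun i => g i + h i).
Proof.
by move=> [M HM] [N HN]; exists (M + N) => A uA; rewrite big_split lerD ?HM ?HN.
Qed.

Lemma bsumZ (I : eqType) (c : R) (g : I -> R) :
  0 <= c -> bsum g -> bsum (fun i => c * g i).
Proof.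
by move=> c0 [M HM]; exists (c * M) => A uA; rewrite -mulr_sumr ler_wpM2l ?HM.
Qed.

Lemma bsum_inj (I J : eqType) (phi : J -> I) (g : I -> R) :
  injective phi -> bsum g -> bsum (fun j => g (phi j)).
Proof.
move=> ip [M HM]; exists M => A uA.
by rewrite -(big_map phi predT g) HM // map_inj_uniq.
Qed.

Lemma ler_sum_sub (I : eqType) (g : I -> R) (A B : seq I) :
  (forall i, 0 <= g i) -> uniq A -> uniq B -> {subset A <= B} ->
  \sum_(i <- A) g i <= \sum_(i <- B) g i.
Proof.
by move=> g0 uA uB sAB; rewrite (big_subseq_split _ uA uB sAB) lerDl sumr_ge0.
Qed.

Lemma bsum_prod (I J : eqType) (g : I -> R) (h : J -> R) :
  (forall i, 0 <= g i) -> (forall j, 0 <= h j) -> bsum g -> bsum h ->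
  bsum (fun p : I * J => g p.1 * h p.2).
Proof.
move=> g0 h0 [M HM] [N HN]; exists (M * N) => A uA.
pose D := [seq (i, j) | i <- undup (map fst A), j <- undup (map snd A)].
have uD : uniq D by apply: allpairs_uniq; rewrite ?undup_uniq // => -[? ?] [].
have sAD : {subset A <= D}.
  move=> [i j] ijA; apply/allpairsP; exists (i, j) => /=; split => //.
    by rewrite mem_undup; apply/mapP; exists (i, j).
  by rewrite mem_undup; apply/mapP; exists (i, j).
apply: le_trans (ler_sum_sub _ uA uD sAD) _; first by move=> i; rewrite mulr_ge0.
rewrite big_allpairs_dep /=.
under eq_bigr do rewrite -mulr_sumr.
by rewrite -mulr_suml ler_pM ?sumr_ge0 ?HM ?HN ?undup_uniq.
Qed.

(** [A] nearly attains the supremum of all finite sums; a disjoint set of weight [e] would push the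
    sum beyond it. *)
Lemma bsum_tail (I : eqType) (g : I -> R) : (forall i, 0 <= g i) -> bsum g ->
  forall e, 0 < e -> exists2 A : seq I, uniq A &
  forall B, uniq B -> (forall i, i \in B -> i \notin A) -> \sum_(i <- B) g i < e.
Proof.
move=> g0 [M HM] e e0.
pose E := [set x | exists2 A : seq I, uniq A & x = \sum_(i <- A) g i].
have hE : has_sup E.
  split; first by exists (\sum_(i <- [::]) g i); exists [::].
  by exists M => x [A uA ->]; exact: HM.
have [_ [A uA ->] hA] := sup_adherent e0 hE.
exists A => // B uB dis.
have uAB : uniq (A ++ B).
  rewrite cat_uniq uA uB andbT /=; apply/hasPn => i /dis; by [].
have : \sum_(i <- A ++ B) g i <= sup E by apply: ub_le_sup; [case: hE | exists (A ++ B)].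
rewrite big_cat /=; lra.
Qed.

Lemma has_csum_uniq (I : eqType) (f : I -> C) s t :
  has_csum f s -> has_csum f t -> s = t.
Proof.
move=> hs ht; apply/eqP; rewrite -subr_eq0 -cabs_eq0; apply/negPn/negP => h.
have d0 : 0 < cabs (s - t) / 2 by rewrite divr_gt0 // lt_neqAle eq_sym h cabs_ge0.
have [A hA] := hs _ d0; have [B hB] := ht _ d0.
have uAB := undup_uniq (A ++ B).
have h1 := hA _ uAB; have h2 := hB _ uAB.
have := cabsB (\sum_(i <- undup (A ++ B)) f i - t) (\sum_(i <- undup (A ++ B)) f i - s).
rewrite (_ : _ - _ - (_ - _) = s - t); last ring.
have {}h1 := h1 (fun i iA => ltac:(by rewrite mem_undup mem_cat iA)).
have {}h2 := h2 (fun i iA => ltac:(by rewrite mem_undup mem_cat iA orbT)).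
lra.
Qed.

Lemma csumE (I : eqType) (f : I -> C) s : has_csum f s -> csum f = s.
Proof. by move=> h; apply: (has_csum_uniq _ h); apply: xgetPex; exists s. Qed.

Let has_rsum (I : eqType) (g : I -> R) (s : R) :=
  forall e : R, 0 < e -> exists A : seq I, forall B : seq I, uniq B ->
    {subset A <= B} -> `|\sum_(i <- B) g i - s| < e.

Let has_rsum_ge0 (I : eqType) (g : I -> R) : (forall i, 0 <= g i) -> bsum g ->
  exists s, has_rsum g s.
Proof.
move=> g0 [M HM].
pose E := [set x | exists2 A : seq I, uniq A & x = \sum_(i <- A) g i].
have hE : has_sup E.
  split; first by exists (\sum_(i <- [::]) g i); exists [::].
  by exists M => x [A uA ->]; exact: HM.
exists (sup E) => e e0.
have [_ [A uA ->] hA] := sup_adherent e0 hE.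
exists A => B uB sAB.
have h1 := ler_sum_sub g0 uA uB sAB.
have h2 : \sum_(i <- B) g i <= sup E by apply: ub_le_sup; [case: hE | exists B].
rewrite ltr_norml; apply/andP; split; lra.
Qed.

(** A real family is the difference of the non-negative families g + |g| and |g|. *)
Let has_rsum_ex (I : eqType) (g : I -> R) : bsum (fun i => `|g i|) ->
  exists s, has_rsum g s.
Proof.
move=> hg.
have [s hs] : exists s, has_rsum (fun i => g i + `|g i|) s.
  apply: has_rsum_ge0 => [i|].
    have : - `|g i| <= g i by rewrite lerNnormlW.
    lra.
  apply: (@bsum_le _ _ (fun i => `|g i| + `|g i|)); last exact: bsumD.
  by move=> i; rewrite lerD2r ler_norm.
have [t ht] : exists s, has_rsum (fun i => `|g i|) s by apply: has_rsum_ge0.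
exists (s - t) => e e0.
have e2 : 0 < e / 2 by lra.
have [A hA] := hs _ e2; have [B hB] := ht _ e2.
exists (A ++ B) => D uD sD.
have {}hA := hA D uD (fun i iA => sD i ltac:(by rewrite mem_cat iA)).
have {}hB := hB D uD (fun i iA => sD i ltac:(by rewrite mem_cat iA orbT)).
rewrite big_split /= in hA.
set x := \sum_(i <- D) g i in hA *; set y := \sum_(i <- D) `|g i| in hA hB.
have -> : x - (s - t) = (x + y - s) - (y - t) by ring.
apply: le_lt_trans (ler_normB _ _) _; lra.
Qed.

Lemma has_csum_ex (I : eqType) (f : I -> C) : asum f -> exists s, has_csum f s.
Proof.
move=> hf.
have [a ha] : exists s, has_rsum (fun i => complex.Re (f i)) s.
  by apply: has_rsum_ex; apply: bsum_le hf => i; exact: cabs_Re.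
have [b hb] : exists s, has_rsum (fun i => complex.Im (f i)) s.
  by apply: has_rsum_ex; apply: bsum_le hf => i; exact: cabs_Im.
exists (Complex a b) => e e0.
have e2 : 0 < e / 2 by lra.
have [A hA] := ha _ e2; have [B hB] := hb _ e2.
exists (A ++ B) => D uD sD.
have {}hA := hA D uD (fun i iA => sD i ltac:(by rewrite mem_cat iA)).
have {}hB := hB D uD (fun i iA => sD i ltac:(by rewrite mem_cat iA orbT)).
apply: le_lt_trans (cabs_le_ReIm _) _.
have -> : \sum_(i <- D) f i =
  Complex (\sum_(i <- D) complex.Re (f i)) (\sum_(i <- D) complex.Im (f i)).
  elim: D {uD sD hA hB} => [|i D IH]; first by rewrite !big_nil.
  by rewrite !big_cons IH; case: (f i).
rewrite /=; lra.
Qed.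

Lemma csumP (I : eqType) (f : I -> C) : asum f -> has_csum f (csum f).
Proof. by move=> /has_csum_ex h; apply: xgetPex. Qed.

Lemma eq_csum (I : eqType) (f g : I -> C) : f =1 g -> csum f = csum g.
Proof. by move=> /funext ->. Qed.

Lemma asum_le (I : eqType) (f : I -> C) (g : I -> R) :
  (forall i, cabs (f i) <= g i) -> bsum g -> asum f.
Proof. by move=> h; apply: bsum_le. Qed.

Lemma asumD (I : eqType) (f g : I -> C) : asum f -> asum g -> asum (fun i => f i + g i).
Proof.
by move=> hf hg; apply: asum_le (bsumD hf hg) => i; exact: cabsD.
Qed.

Lemma asumZ (I : eqType) c (f : I -> C) : asum f -> asum (fun i => c * f i).
Proof.
move=> hf; apply: asum_le (bsumZ (cabs_ge0 c) hf) => i; by rewrite cabsM.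
Qed.

Lemma csumD (I : eqType) (f g : I -> C) : asum f -> asum g ->
  csum (fun i => f i + g i) = csum f + csum g.
Proof.
move=> /csumP hf /csumP hg; apply: csumE => e e0.
have e2 : 0 < e / 2 by lra.
have [A hA] := hf _ e2; have [B hB] := hg _ e2.
exists (A ++ B) => D uD sD.
have {}hA := hA D uD (fun i iA => sD i ltac:(by rewrite mem_cat iA)).
have {}hB := hB D uD (fun i iA => sD i ltac:(by rewrite mem_cat iA orbT)).
rewrite big_split /= opprD addrACA; apply: le_lt_trans (cabsD _ _) _; lra.
Qed.

Lemma csumZ (I : eqType) c (f : I -> C) : asum f ->
  csum (fun i => c * f i) = c * csum f.
Proof.
move=> /csumP hf; apply: csumE => e e0.
have c1 : 0 < cabs c + 1 by have := cabs_ge0 c; lra.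
have [A hA] := hf _ (divr_gt0 e0 c1); exists A => B uB sAB.
have {}hA := hA B uB sAB.
rewrite -mulr_sumr -mulrBr cabsM.
apply: le_lt_trans (_ : (cabs c + 1) * cabs (\sum_(i <- B) f i - csum f) < e).
  by rewrite ler_wpM2r ?cabs_ge0 // lerDl.
by rewrite mulrC -ltr_pdivlMr.
Qed.

Lemma csum0 (I : eqType) : csum (fun _ : I => 0 : C) = 0.
Proof.
by apply: csumE => e e0; exists [::] => B _ _; rewrite big1 // subrr cabs0.
Qed.

Lemma asum_sum (I : eqType) (J : Type) (r : seq J) (f : J -> I -> C) :
  (forall j, asum (f j)) -> asum (fun i => \sum_(j <- r) f j i).
Proof.
move=> h; elim: r => [|j r IH].
  by exists 0 => A _; rewrite big1 // => i _; rewrite big_nil cabs0.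
apply: bsum_le (asumD (h j) IH) => i; by rewrite big_cons.
Qed.

Lemma csum_sum (I : eqType) (J : Type) (r : seq J) (f : J -> I -> C) :
  (forall j, asum (f j)) ->
  csum (fun i => \sum_(j <- r) f j i) = \sum_(j <- r) csum (f j).
Proof.
move=> h; elim: r => [|j r IH].
  by rewrite big_nil -[RHS](csum0 I); apply: eq_csum => i; rewrite big_nil.
rewrite big_cons -IH -csumD //; last exact: asum_sum.
by apply: eq_csum => i; rewrite big_cons.
Qed.

Lemma csum_le (I : eqType) (f : I -> C) (M : R) :
  (forall A, uniq A -> \sum_(i <- A) cabs (f i) <= M) -> cabs (csum f) <= M.
Proof.
move=> HM; have /csumP hf : asum f by exists M.
apply/ler_addgt0Pr => e e0; have [A hA] := hf _ e0.
have h := hA _ (undup_uniq A) (fun i iA => ltac:(by rewrite mem_undup)).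
have h1 := HM _ (undup_uniq A).
have h2 := cabs_sum (undup A) predT f.
rewrite cabs_distC in h.
have := cabsD (csum f - \sum_(i <- undup A) f i) (\sum_(i <- undup A) f i).
rewrite subrK; lra.
Qed.

Lemma has_csum_bij (I J : eqType) (phi : J -> I) (psi : I -> J) (f : I -> C) s :
  cancel phi psi -> cancel psi phi -> has_csum f s -> has_csum (f \o phi) s.
Proof.
move=> pK qK hf e e0; have [A hA] := hf _ e0.
exists (map psi A) => B uB sAB.
rewrite -(big_map phi predT f); apply: hA.
  by rewrite map_inj_uniq //; exact: can_inj pK.
move=> i iA; rewrite -(qK i) map_f //; apply: sAB; exact: map_f.
Qed.

Lemma csum_bij (I J : eqType) (phi : J -> I) (psi : I -> J) (f : I -> C) :
  cancel phi psi -> cancel psi phi -> asum f -> csum f = csum (f \o phi).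
Proof. by move=> pK qK /csumP hf; apply/esym/csumE/(has_csum_bij pK qK). Qed.

Lemma asum_inj (I J : eqType) (phi : J -> I) (f : I -> C) :
  injective phi -> asum f -> asum (f \o phi).
Proof. by move=> ip hf; apply: (bsum_inj ip hf). Qed.

Lemma has_csum_supp (I : eqType) (f : I -> C) (A : seq I) : uniq A ->
  (forall i, i \notin A -> f i = 0) -> has_csum f (\sum_(i <- A) f i).
Proof.
move=> uA h e e0; exists A => B uB sAB.
suff -> : \sum_(i <- B) f i = \sum_(i <- A) f i by rewrite subrr cabs0.
by rewrite (big_subseq_split _ uA uB sAB) [X in _ + X]big1 // addr0.
Qed.

Lemma csum_supp (I : eqType) (f : I -> C) (A : seq I) : uniq A ->
  (forall i, i \notin A -> f i = 0) -> csum f = \sum_(i <- A) f i.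
Proof. by move=> uA h; apply: csumE; apply: has_csum_supp. Qed.

Lemma asum_supp (I : eqType) (f : I -> C) (A : seq I) : uniq A ->
  (forall i, i \notin A -> f i = 0) -> asum f.
Proof.
move=> uA h; exists (\sum_(i <- A) cabs (f i)) => B uB.
apply: le_trans (ler_sum_sub _ uB (undup_uniq (A ++ B)) _) _.
- by move=> i; exact: cabs_ge0.
- by move=> i iB; rewrite mem_undup mem_cat iB orbT.
rewrite (big_subseq_split _ uA (undup_uniq _)).
  by rewrite [X in _ + X]big1 ?addr0 // => i /h ->; rewrite cabs0.
by move=> i iA; rewrite mem_undup mem_cat iA.
Qed.

(** Finitely many rows can be truncated at one common finite set; this is what turns an iterated sum
    into a sum over a rectangle in the proofs of Fubini. *)
Lemma has_csum_uniform (I J : eqType) (f : I -> J -> C) (F : I -> C) (B : seq I) d :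
  0 < d -> (forall i, has_csum (f i) (F i)) ->
  exists A : seq J, forall D, uniq D -> {subset A <= D} ->
    forall i, i \in B -> cabs (\sum_(j <- D) f i j - F i) < d.
Proof.
move=> d0 h; elim: B => [|i B [A hA]]; first by exists [::].
have [A' hA'] := h i _ d0; exists (A' ++ A) => D uD sD i'.
rewrite in_cons => /orP[/eqP ->|].
  by apply: hA' => // j jA; apply: sD; rewrite mem_cat jA.
by apply: hA => // j jA; apply: sD; rewrite mem_cat jA orbT.
Qed.

Section Fubini.
Variables (I J : eqType) (f : I * J -> C).
Hypothesis hf : asum f.

Lemma asum_row i : asum (fun j => f (i, j)).
Proof. by apply: (bsum_inj (phi := fun j => (i, j)) _ hf) => ? ? []. Qed.

Lemma asum_csum_row : asum (fun i => csum (fun j => f (i, j))).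
Proof.
have [M HM] := hf; exists M => B uB; apply/ler_addgt0Pr => e e0.
have d0 : 0 < e / (size B).+1%:R by rewrite divr_gt0 // ltr0n.
have [A hA] := has_csum_uniform B d0 (fun i => csumP (asum_row i)).
have {}hA := hA _ (undup_uniq A) (fun i iA => ltac:(by rewrite mem_undup)).
pose D := [seq (i, j) | i <- B, j <- undup A].
have uD : uniq D by apply: allpairs_uniq; rewrite ?undup_uniq // => -[? ?] [].
have h1 : \sum_(i <- B) cabs (csum (fun j => f (i, j))) <=
    \sum_(i <- B) (\sum_(j <- undup A) cabs (f (i, j)) + e / (size B).+1%:R).
  rewrite !big_seq; apply: ler_sum => i iB.
  have := hA i iB; rewrite cabs_distC => h.
  have h2 : cabs (\sum_(j <- undup A) f (i, j)) <= \sum_(j <- undup A) cabs (f (i, j)).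
    exact: cabs_sum.
  have := cabsD (csum (fun j => f (i, j)) - \sum_(j <- undup A) f (i, j))
     (\sum_(j <- undup A) f (i, j)).
  rewrite subrK => h3; apply: le_trans h3 _.
  by rewrite [leRHS]addrC; apply: lerD => //; exact: ltW.
apply: le_trans h1 _; rewrite big_split /= lerD //.
  by have := HM D uD; rewrite big_allpairs_dep.
rewrite big_const_seq count_predT iter_addr_0 -[_ *+ _]mulr_natr.
rewrite mulrAC ler_pdivrMr ?ltr0n // ler_wpM2l ?ler_nat // ltW //.
Qed.

(** For finitely many rows [B], a common truncation [E] of the rows costs at most e/2, and the
    rectangle B x E is made large enough to contain the set [A0] that approximates the double
    sum. *)
Lemma csum_fubini : csum f = csum (fun i => csum (fun j => f (i, j))).
Proof.
apply/esym/csumE => e e0; have e2 : 0 < e / 2 by lra.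
have [A0 hA0] := csumP hf e2; exists (map fst A0) => B uB sB.
have d0 : 0 < (e / 2) / (size B).+1%:R by rewrite divr_gt0 // ltr0n.
have [A hA] := has_csum_uniform B d0 (fun i => csumP (asum_row i)).
pose E := undup (A ++ map snd A0).
have {}hA := hA E (undup_uniq _) (fun i iA => ltac:(by rewrite mem_undup mem_cat iA)).
pose D := [seq (i, j) | i <- B, j <- E].
have uD : uniq D by apply: allpairs_uniq; rewrite ?undup_uniq // => -[? ?] [].
have {}hA0 : cabs (\sum_(p <- D) f p - csum f) < e / 2.
  apply: hA0 => // -[i j] ij; apply/allpairsP; exists (i, j); split => //=.
    by apply: sB; apply/mapP; exists (i, j).
  by rewrite mem_undup mem_cat; apply/orP; right; apply/mapP; exists (i, j).
have h1 : cabs (\sum_(i <- B) csum (fun j => f (i, j)) - \sum_(p <- D) f p) <= e / 2.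
  rewrite big_allpairs_dep /= -sumrB.
  apply: le_trans (cabs_sum _ _ _) _.
  apply: (@le_trans _ _ (\sum_(i <- B) (e / 2) / (size B).+1%:R)).
    rewrite !big_seq; apply: ler_sum => i iB; rewrite cabs_distC; exact/ltW/hA.
  rewrite big_const_seq count_predT iter_addr_0 -[_ *+ _]mulr_natr.
  by rewrite mulrAC ler_pdivrMr ?ltr0n // ler_wpM2l ?ler_nat // ltW.
rewrite -(subrKA (\sum_(p <- D) f p)).
apply: le_lt_trans (cabsD _ _) _; lra.
Qed.

End Fubini.

Lemma csum_swap (I J : eqType) (f : I -> J -> C) :
  asum (fun p : I * J => f p.1 p.2) ->
  csum (fun i => csum (f i)) = csum (fun j => csum (fun i => f i j)).
Proof.
move=> hf.
have hs : cancel (fun p : J * I => (p.2, p.1)) (fun p : I * J => (p.2, p.1)) by case.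
have hs' : cancel (fun p : I * J => (p.2, p.1)) (fun p : J * I => (p.2, p.1)) by case.
transitivity (csum (fun p : I * J => f p.1 p.2)).
  by rewrite (csum_fubini hf).
rewrite (csum_bij hs hs' hf) csum_fubini //.
by apply: (asum_inj _ hf); exact: can_inj hs.
Qed.

(** The family is spread over J x I by placing [f i] on the graph of [pr]; summing this in the two
    orders gives both sides. *)
Lemma csum_fiber (I J : eqType) (pr : I -> J) (f : I -> C) : asum f ->
  asum (fun j => csum (fun i => if pr i == j then f i else 0)) /\
  csum f = csum (fun j => csum (fun i => if pr i == j then f i else 0)).
Proof.
move=> hf; pose h (p : J * I) : C := if pr p.2 == p.1 then f p.2 else 0.
have hh : asum h.
  have [M HM] := hf; exists M => A uA.
  rewrite (bigID (fun p : J * I => pr p.2 == p.1)) /= [X in _ + X]big1; last first.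
    by move=> p /negbTE hp; rewrite /h hp cabs0.
  rewrite addr0 -big_filter.
  pose A' := [seq p <- A | pr p.2 == p.1].
  have -> : \sum_(p <- A') cabs (h p) = \sum_(i <- map snd A') cabs (f i).
    rewrite big_map !big_seq; apply: eq_bigr => p.
    by rewrite mem_filter /h => /andP[->].
  apply: HM; rewrite map_inj_in_uniq; first exact: filter_uniq.
  move=> [j i] [j' i']; rewrite !mem_filter /= => /andP[/eqP <- _] /andP[/eqP <- _].
  by move=> ->.
split; first exact: (asum_csum_row hh).
rewrite -(csum_fubini hh).
have hh' : asum (fun p : I * J => if pr p.1 == p.2 then f p.1 else 0).
  apply: (asum_inj (phi := fun p : I * J => (p.2, p.1)) _ hh).
  by case=> a b [c d] [-> ->].
have hs : cancel (fun p : I * J => (p.2, p.1)) (fun p : J * I => (p.2, p.1)) by case.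
have hs' : cancel (fun p : J * I => (p.2, p.1)) (fun p : I * J => (p.2, p.1)) by case.
rewrite (csum_bij hs hs' hh) (csum_fubini hh').
apply: eq_csum => i; rewrite (@csum_supp _ _ [:: pr i]) //=.
  by rewrite big_seq1 eqxx.
by move=> j; rewrite inE /= eq_sym => /negbTE ->.
Qed.

(** Dominated convergence. The majorant also bounds the limit [v]; outside a finite set both
    families are controlled by its tail, and inside it the pointwise limits suffice. *)
Lemma csum_tannery (I : eqType) (T : Type) (F : set_system T) (FF : ProperFilter F)
    (u : T -> I -> C) (v : I -> C) (g : I -> R) :
  bsum g -> (\forall t \near F, forall i, cabs (u t i) <= g i) ->
  (forall i, (fun t => u t i) @ F --> v i) ->
  (fun t => csum (u t)) @ F --> csum v.
Proof.
move=> hg hu hv.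
have g0 i : 0 <= g i.
  by have [t /(_ i)] := filter_ex hu; apply: le_trans; exact: cabs_ge0.
have vg i : cabs (v i) <= g i.
  apply/ler_addgt0Pr => e e0; have /cvgCP/(_ e e0) h := hv i.
  have [t [h1 h2]] := filter_ex (filterI h hu).
  have := cabsB (u t i) (u t i - v i); rewrite opprB addrC subrK => h3.
  have := h2 i; lra.
have av : asum v by exact: asum_le hg.
apply/cvgCP => e e0.
have [|A uA hA] := bsum_tail g0 hg (e := e / 8); first by lra.
have d0 : 0 < (e / 4) / (size A).+1%:R by rewrite !divr_gt0 // ltr0n.
have near : \forall t \near F, forall i, i \in A ->
    cabs (u t i - v i) < (e / 4) / (size A).+1%:R.
  have : forall B : seq I, \forall t \near F, forall i, i \in B ->
    cabs (u t i - v i) < (e / 4) / (size A).+1%:R.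
    elim=> [|i B IH]; first by apply: nearW.
    have /cvgCP/(_ _ d0) h := hv i.
    apply: filterS (filterI h IH) => t [h1 h2] j.
    by rewrite in_cons => /orP[/eqP ->//|]; exact: h2.
  by apply.
apply: filterS (filterI hu near) => t [h1 h2].
have au : asum (u t) by exact: asum_le hg.
have -> : csum (u t) - csum v = csum (fun i => u t i - v i).
  have -> : csum (fun i => u t i - v i) = csum (fun i => u t i + (-1) * v i).
    by apply: eq_csum => i; rewrite mulN1r.
  by rewrite csumD ?csumZ ?mulN1r //; exact: asumZ.
apply: (@le_lt_trans _ _ (e / 2)); last lra.
apply: csum_le => B uB.
rewrite (bigID (fun i => i \in A)) /=.
have B1 : \sum_(i <- B | i \in A) cabs (u t i - v i) <= e / 4.
  rewrite -big_filter.
  apply: (@le_trans _ _ (\sum_(i <- A) (e / 4) / (size A).+1%:R)); last first.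
    rewrite big_const_seq count_predT iter_addr_0 -[_ *+ _]mulr_natr.
    rewrite mulrAC ler_pdivrMr ?ltr0n // ler_wpM2l ?ler_nat //; lra.
  apply: (@le_trans _ _ (\sum_(i <- A) cabs (u t i - v i))).
    apply: ler_sum_sub; rewrite ?filter_uniq //; first by move=> i; exact: cabs_ge0.
    by move=> i; rewrite mem_filter => /andP[].
  by rewrite !big_seq; apply: ler_sum => i iA; exact/ltW/h2.
have B2 : \sum_(i <- B | i \notin A) cabs (u t i - v i) <= 2 * (e / 8).
  rewrite -big_filter.
  apply: (@le_trans _ _ (\sum_(i <- [seq i <- B | i \notin A]) 2 * g i)).
    apply: ler_sum => i _; apply: le_trans (cabsB _ _) _.
    have := h1 i; have := vg i; lra.
  rewrite -mulr_sumr ler_wpM2l //; apply/ltW/hA; first exact: filter_uniq.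
  by move=> i; rewrite mem_filter => /andP[].
lra.
Qed.

Lemma csum_series (f : nat -> C) : asum f ->
  (fun m => \sum_(0 <= n < m) f n) @ \oo --> csum f.
Proof.
move=> /csumP hf; apply/cvgCP => e e0; have [A hA] := hf e e0.
exists (\max_(i <- A) i).+1 => //= m hm; apply: hA; first exact: iota_uniq.
move=> i iA; rewrite mem_index_iota /=; apply: leq_trans hm; rewrite ltnS.
exact: leq_bigmax_seq.
Qed.

End UnorderedSums.

(** * Theta inversion in one variable *)

Section GaussianSums.
Variable R : realType.
Local Notation C := (Cplx R).

Lemma sum_geom_le (r : R) (A : seq nat) : 0 <= r -> r < 1 -> uniq A ->
  \sum_(i <- A) r ^+ i <= (1 - r)^-1.
Proof.
move=> r0 r1 uA.
apply: (@le_trans _ _ (\sum_(i <- iota 0 (\max_(j <- A) j).+1) r ^+ i)).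
  apply: ler_sum_sub; rewrite ?iota_uniq //; first by move=> i; exact: exprn_ge0.
  by move=> i iA; rewrite mem_iota /= add0n ltnS leq_bigmax_seq.
move: (_.+1) => N.
rewrite -{1}(subn0 N) -/(index_iota 0 N) big_mkord.
have h : (1 - r) * \sum_(i < N) r ^+ i = 1 - r ^+ N by rewrite -(opprB r 1) mulNr -subrX1 opprB.
have p : 0 < 1 - r by lra.
rewrite -(ler_pM2l p) h divff ?gt_eqF //.
have := exprn_ge0 N r0; lra.
Qed.

Lemma bsum_int (g : int -> R) (M : R) :
  (forall A : seq nat, uniq A -> \sum_(n <- A) g n%:Z <= M) ->
  (forall A : seq nat, uniq A -> \sum_(n <- A) g (- n.+1%:Z) <= M) -> bsum g.
Proof.
move=> h1 h2; exists (M + M) => A uA.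
rewrite (bigID (fun n : int => 0 <= n)) /=; apply: lerD.
  have -> : \sum_(n <- A | 0 <= n) g n =
      \sum_(n <- [seq absz n | n <- [seq n <- A | 0 <= n]]) g n%:Z.
    rewrite big_map -[LHS]big_filter big_seq [RHS]big_seq; apply: eq_bigr => n.
    by rewrite mem_filter => /andP[n0 _]; rewrite gez0_abs.
  apply: h1; rewrite map_inj_in_uniq ?filter_uniq // => m n.
  by rewrite !mem_filter => /andP[m0 _] /andP[n0 _] e; rewrite -(gez0_abs m0) -(gez0_abs n0) e.
have -> : \sum_(n <- A | ~~ (0 <= n)) g n =
    \sum_(n <- [seq (absz n).-1 | n <- [seq n <- A | ~~ (0 <= n)]]) g (- n.+1%:Z).
  rewrite big_map -[LHS]big_filter big_seq [RHS]big_seq; apply: eq_bigr => n.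
  by rewrite mem_filter => /andP[n0 _]; congr g; lia.
apply: h2; rewrite map_inj_in_uniq ?filter_uniq // => m n.
rewrite !mem_filter => /andP[m0 _] /andP[n0 _]; lia.
Qed.

(** The linear part [b] absorbs elliptic variables and the exponential losses of Taylor remainders
    without harming summability. *)
Definition gau (a b : R) (n : int) : R := expR (b * `|n%:~R| - a * n%:~R ^+ 2).

Lemma gau_ge0 a b n : 0 <= gau a b n. Proof. exact: expR_ge0. Qed.

Lemma bsum_gau (a b : R) : 0 < a -> bsum (gau a b).
Proof.
(* Completing the square gives b x - a x^2 <= K - x, hence domination by a geometric sequence of
   ratio exp(-1). *)
move=> a0; pose K := (b + 1) ^+ 2 / (4 * a); pose r := expR (-1) : R.
have r1 : r < 1 by rewrite /r -[X in _ < X]expR0 ltr_expR; lra.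
have r0 : 0 <= r by exact: expR_ge0.
have le n : gau a b n <= expR K * r ^+ absz n.
  rewrite /gau -expRM_natl -expRD ler_expR.
  have -> : `|n|%N%:R = `|n%:~R| :> R by rewrite -intr_norm -abszE.
  rewrite -(real_normK (num_real (n%:~R : R))).
  set x := `|_|; rewrite /K -subr_ge0.
  have -> : (b + 1) ^+ 2 / (4 * a) + x * -1 - (b * x - a * x ^+ 2) =
    ((b + 1) - 2 * a * x) ^+ 2 / (4 * a) by field; rewrite gt_eqF.
  by rewrite divr_ge0 ?sqr_ge0 //; lra.
apply: bsum_le le _; apply: bsumZ; first exact: expR_ge0.
apply: (bsum_int (M := (1 - r)^-1)) => A uA; first exact: sum_geom_le.
apply: le_trans (sum_geom_le r0 r1 uA); apply: ler_sum => i _.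
by rewrite abszN absz_nat exprS ler_piMl ?exprn_ge0 // ltW.
Qed.

Lemma gauM a b a' b' n : gau a b n * gau a' b' n = gau (a + a') (b + b') n.
Proof. by rewrite /gau -expRD; congr expR; ring. Qed.

(** A majorant for Fourier coefficients, with a separate value at 0 where decay in m gives nothing.
    The partial sums telescope through 1/(n+1)^2 <= 1/n - 1/(n+1). *)
Lemma bsum_inv_sq (c : R) : 0 <= c ->
  bsum (fun m : int => if m == 0 then c else c / m%:~R ^+ 2).
Proof.
move=> c0.
have tele N : \sum_(i < N.+1) c / (i.+1%:R ^+ 2) <= c * (2 - 1 / N.+1%:R).
  elim: N => [|N IH]; first by rewrite big_ord1 expr1n; lra.
  rewrite big_ord_recr /=; apply: le_trans (lerD IH (lexx _)) _.
  rewrite -mulrDr ler_wpM2l // -[N.+2%:R]natr1.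
  have : 1 <= N.+1%:R :> R by rewrite ler1n.
  move: (N.+1%:R) => x x1; rewrite -subr_ge0.
  have -> : 2 - 1 / (x + 1) - (2 - 1 / x + (x + 1) ^- 2) = (x * (x + 1) ^+ 2)^-1 :> R.
    by field; apply/andP; split; lra.
  by rewrite invr_ge0 mulr_ge0 ?sqr_ge0 //; lra.
have tele' (A : seq nat) : uniq A -> \sum_(i <- A) c / (i.+1%:R ^+ 2) <= c * 2.
  move=> uA.
  apply: (@le_trans _ _ (\sum_(i <- iota 0 (\max_(j <- A) j).+1) c / (i.+1%:R ^+ 2))).
    apply: ler_sum_sub; rewrite ?iota_uniq //.
      by move=> i; rewrite divr_ge0 ?sqr_ge0.
    by move=> i iA; rewrite mem_iota /= add0n ltnS leq_bigmax_seq.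
  rewrite -[X in iota 0 X]subn0 -/(index_iota 0 _) big_mkord.
  apply: le_trans (tele _) _; rewrite ler_wpM2l //.
  by rewrite lerBlDr lerDl divr_ge0.
apply: (bsum_int (M := c + c * 2)) => A uA.
  rewrite (bigID (fun n => n == 0%N)) /=; apply: lerD.
    rewrite -big_filter.
    apply: (@le_trans _ _ (\sum_(n <- [:: 0%N]) c)); last by rewrite big_seq1.
    rewrite [leLHS](_ : _ = \sum_(n <- [seq n <- A | n == 0%N]) c).
      apply: ler_sum_sub; rewrite ?filter_uniq // => i.
      by rewrite mem_filter inE => /andP[].
    by rewrite big_seq [RHS]big_seq; apply: eq_bigr => n; rewrite mem_filter => /andP[/eqP ->].
  rewrite -big_filter.
  have -> : \sum_(n <- [seq n <- A | n != 0%N]) (if n%:Z == 0 then c else c / n%:~R ^+ 2) =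
     \sum_(n <- [seq n.-1 | n <- [seq n <- A | n != 0%N]]) c / n.+1%:R ^+ 2.
    rewrite big_map big_seq [RHS]big_seq; apply: eq_bigr => n.
    by rewrite mem_filter => /andP[n0 _]; rewrite eqz_nat (negbTE n0) prednK // lt0n.
  apply: tele'; rewrite map_inj_in_uniq ?filter_uniq // => m n.
  rewrite !mem_filter => /andP[m0 _] /andP[n0 _]; lia.
apply: le_trans (_ : c * 2 <= _); last by rewrite lerDr.
apply: le_trans (tele' _ uA); apply: ler_sum => i _.
by rewrite rmorphN /= sqrrN.
Qed.

End GaussianSums.

(** * One-variable theta series and their first-order expansion *)

Section ThetaSeries.
Variable R : realType.
Local Notation C := (Cplx R).

Lemma csumB (I : eqType) (f g : I -> C) : asum f -> asum g ->
  csum (fun i => f i - g i) = csum f - csum g.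
Proof.
move=> hf hg.
have -> : csum (fun i => f i - g i) = csum (fun i => f i + (-1) * g i).
  by apply: eq_csum => i; rewrite mulN1r.
by rewrite csumD ?csumZ ?mulN1r //; exact: asumZ.
Qed.

Lemma asumB (I : eqType) (f g : I -> C) : asum f -> asum g -> asum (fun i => f i - g i).
Proof. by move=> hf hg; apply: asum_le (bsumD hf hg) => i; exact: cabsB. Qed.

Lemma ReD (z w : C) : complex.Re (z + w) = complex.Re z + complex.Re w.
Proof. by case: z w => ? ? []. Qed.
Lemma ImD (z w : C) : complex.Im (z + w) = complex.Im z + complex.Im w.
Proof. by case: z w => ? ? []. Qed.
Lemma ReN (z : C) : complex.Re (- z) = - complex.Re z. Proof. by case: z. Qed.
Lemma ImN (z : C) : complex.Im (- z) = - complex.Im z. Proof. by case: z. Qed.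
Lemma ReZ (x : R) (z : C) : complex.Re (x%:C%C * z) = x * complex.Re z.
Proof. by case: z => a b /=; ring. Qed.
Lemma ImZ (x : R) (z : C) : complex.Im (x%:C%C * z) = x * complex.Im z.
Proof. by case: z => a b /=; ring. Qed.
Lemma real_int (n : int) : n%:~R = (n%:~R : R)%:C%C :> C.
Proof. by rewrite rmorph_int. Qed.
Lemma real_nat (n : nat) : n%:R = (n%:R : R)%:C%C :> C.
Proof. by rewrite rmorph_nat. Qed.

Lemma expR_ge_sq (x : R) : 0 <= x -> x ^+ 2 <= 2 * expR x.
Proof.
move=> x0; have := expR_ge1Dxn 1 x0; rewrite (_ : (2`!)%:R = 2 :> R) //; lra.
Qed.

Definition twopii : C := Complex 0 (2 * pi).

Lemma cabs_twopii : cabs twopii = 2 * pi.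
Proof.
by rewrite /cabs /= expr0n add0r sqrtr_sqr ger0_norm // mulr_ge0 // pi_ge0.
Qed.

(** The factor e(-m y) turns the theta function sum_n e(t (y+n)^2 / 2) into the integrand of its
    m-th Fourier coefficient, still of period 1 in [y]. *)
Definition thterm (t : C) (m : int) (y : C) (n : int) : C :=
  e2ipi (t * (y + n%:~R) ^+ 2 / 2 - m%:~R * y).

Definition dthterm (t : C) (m : int) (y : C) (n : int) : C :=
  twopii * (t * (y + n%:~R) - m%:~R) * thterm t m y n.

Definition theta (t : C) (m : int) (y : C) : C := csum (thterm t m y).

Lemma thterm_bound (t : C) (m : int) (Y : R) (y : C) (n : int) : cabs y <= Y ->
  cabs (thterm t m y n) <= expR (pi * cabs t * Y ^+ 2 + 2 * pi * `|m%:~R| * Y) *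
     gau (pi * complex.Im t) (2 * pi * cabs t * Y) n.
Proof.
move=> yY; have pi0 : 0 < pi :> R by exact: pi_gt0.
have Y0 : 0 <= Y by exact: le_trans (cabs_ge0 _) yY.
rewrite /thterm cabs_e2ipi /gau -expRD ler_expR.
have -> : t * (y + n%:~R) ^+ 2 / 2 - m%:~R * y =
   (2^-1)%:C%C * (t * y ^+ 2) + ((n%:~R : R)%:C%C * (t * y) +
     (((n%:~R ^+ 2 / 2)%:C%C * t) - (m%:~R : R)%:C%C * y)) :> C.
  rewrite rmorphM rmorphXn /= fmorphV /= !rmorph_int rmorph_nat.
  by field.
rewrite !ImD ImN !ImZ.
have h1 : - complex.Im (t * y ^+ 2) <= cabs t * Y ^+ 2.
  rewrite lerNl; apply: le_trans (_ : - cabs (t * y ^+ 2) <= _).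
    by rewrite lerN2 cabsM cabsX ler_wpM2l ?cabs_ge0 // lerXn2r ?nnegrE ?cabs_ge0.
  by rewrite lerNl; apply: le_trans (cabs_Im _); rewrite -normrN ler_norm.
have h2 : - (n%:~R * complex.Im (t * y)) <= `|n%:~R| * (cabs t * Y).
  apply: le_trans (ler_norm _) _; rewrite normrN normrM ler_wpM2l //.
  by apply: le_trans (cabs_Im _) _; rewrite cabsM ler_wpM2l ?cabs_ge0.
have h3 : m%:~R * complex.Im y <= `|m%:~R| * Y.
  apply: le_trans (ler_norm _) _; rewrite normrM ler_wpM2l //.
  by apply: le_trans (cabs_Im _) _.
nra.
Qed.

Section Taylor.
Variables (t : C) (m : int) (Y : R).
Hypotheses (t0 : 0 < complex.Im t) (Y0 : 0 <= Y).

(** [L n] bounds the linear coefficient of the exponent in a displacement s with |s| <= 1, with a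
    margin 2 pi |t| for its quadratic part. The majorant [G] then dominates a term, its derivative
    and its Taylor remainder at once; its factor 5 is 4 from [cexp_taylor1] plus 1 from the
    quadratic part. *)
Let L (n : int) : R := 2 * pi * (cabs t * (Y + `|n%:~R|) + `|m%:~R| + cabs t).

Let L0 n : 0 <= L n.
Proof.
by rewrite /L !mulr_ge0 ?pi_ge0 // !addr_ge0 ?mulr_ge0 ?addr_ge0 ?cabs_ge0.
Qed.

Let G n : R := 5 * expR (2 * L n) * (expR (pi * cabs t * Y ^+ 2 + 2 * pi * `|m%:~R| * Y) *
     gau (pi * complex.Im t) (2 * pi * cabs t * Y) n).

Let G0 n : 0 <= G n.
Proof. by rewrite /G !mulr_ge0 ?expR_ge0 ?gau_ge0. Qed.

Let bsumG : bsum G.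
Proof.
pose K := 5 * expR (2 * (2 * pi * (cabs t * Y + `|m%:~R| + cabs t))) *
  expR (pi * cabs t * Y ^+ 2 + 2 * pi * `|m%:~R| * Y).
have : bsum (fun n => K * gau (pi * complex.Im t) (2 * pi * cabs t * Y + 4 * pi * cabs t) n).
  by apply: bsumZ; rewrite ?mulr_ge0 ?expR_ge0 //; apply: bsum_gau; rewrite mulr_gt0 ?pi_gt0.
apply: bsum_le => n; rewrite le_eqVlt; apply/orP; left; apply/eqP.
rewrite /G /K /gau /L -!mulrA; congr (_ * _).
by rewrite -!expRD; congr expR; ring.
Qed.

Lemma thterm_leG y n : cabs y <= Y -> cabs (thterm t m y n) <= G n.
Proof.
move=> /thterm_bound h; apply: le_trans (h t m n) _; rewrite /G ler_peMl //.
  by rewrite !mulr_ge0 ?expR_ge0 ?gau_ge0.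
have : 1 <= expR (2 * L n) by rewrite -expR0 ler_expR mulr_ge0.
lra.
Qed.

Let lin_le y n : cabs y <= Y -> cabs (t * (y + n%:~R) - m%:~R) * (2 * pi) +
   cabs t * (2 * pi) <= L n.
Proof.
move=> yY; rewrite -mulrDl [leLHS]mulrC /L ler_wpM2l ?mulr_ge0 ?pi_ge0 //.
rewrite lerD2r; apply: le_trans (cabsB _ _) _; rewrite cabs_int lerD2r cabsM.
rewrite ler_wpM2l ?cabs_ge0 //; apply: le_trans (cabsD _ _) _.
by rewrite cabs_int lerD2r.
Qed.

Lemma dthterm_leG y n : cabs y <= Y -> cabs (dthterm t m y n) <= G n.
Proof.
move=> yY; rewrite /dthterm cabsM /G; apply: ler_pM; rewrite ?cabs_ge0 //.
  rewrite cabsM cabs_twopii mulrC.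
  have h := lin_le n yY; have := expR_ge1Dx (L n).
  have : expR (L n) <= expR (2 * L n) by rewrite ler_expR; have := L0 n; lra.
  have : 0 <= cabs t * (2 * pi) by rewrite !mulr_ge0 ?cabs_ge0 ?pi_ge0.
  have := expR_ge0 (2 * L n); lra.
exact: thterm_bound.
Qed.

Lemma asum_thterm y : cabs y <= Y -> asum (thterm t m y).
Proof. by move=> yY; apply: asum_le bsumG => n; exact: thterm_leG. Qed.

(** The constant is uniform for [y] in a disk, so that the expansion can be summed over all points
    of a grid, however fine. *)
Lemma theta_taylor : exists2 K : R, 0 <= K & forall y s : C,
  cabs y <= Y -> cabs s <= 1 ->
  cabs (theta t m (y + s) - theta t m y - s * csum (dthterm t m y)) <= K * cabs s ^+ 2 /\
  cabs (theta t m y) <= K.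
Proof.
have [K HK] := bsumG.
exists K; first by have := HK [::] isT; rewrite big_nil.
move=> y s yY s1; split; last first.
  apply: csum_le => A uA; apply: le_trans (HK A uA).
  by apply: ler_sum => n _; exact: thterm_leG.
have ad : asum (dthterm t m y) by apply: asum_le bsumG => n; exact: dthterm_leG.
have key n : cabs (thterm t m (y + s) n - thterm t m y n - s * dthterm t m y n)
    <= cabs s ^+ 2 * G n.
  pose u := twopii * (s * ((t * (y + n%:~R) - m%:~R) + t * s / 2)).
  have -> : thterm t m (y + s) n = thterm t m y n * cexp u.
    by rewrite /thterm /e2ipi -cexpD -mulrDr; congr (cexp (_ * _)); field.
  have -> : thterm t m y n * cexp u - thterm t m y n - s * dthterm t m y n =
    thterm t m y n * ((cexp u - 1 - u) + twopii * t / 2 * s ^+ 2).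
    by rewrite /dthterm /u; field.
  rewrite cabsM /G; set W := (X in _ <= _ * (_ * X)).
  rewrite (_ : _ * (_ * W) = W * (cabs s ^+ 2 * (5 * expR (2 * L n)))); last by ring.
  apply: ler_pM; rewrite ?cabs_ge0 //; first exact: thterm_bound.
  have hl := lin_le n yY.
  have hu : cabs u <= cabs s * L n.
    rewrite /u !cabsM cabs_twopii mulrCA ler_wpM2l ?cabs_ge0 //.
    apply: le_trans hl; rewrite -mulrDl mulrC ler_wpM2r ?mulr_ge0 ?pi_ge0 //.
    apply: le_trans (cabsD _ _) _; rewrite lerD2l !cabsM cabsV cabs_nat.
    have := cabs_ge0 t; have := cabs_ge0 s; nra.
  have hu2 : cabs u <= L n.
    by apply: le_trans hu _; rewrite ler_piMl.
  apply: le_trans (cabsD _ _) _.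
  have h1 := cexp_taylor1 u.
  have h2 : cabs u ^+ 2 * expR (cabs u) <= cabs s ^+ 2 * (2 * expR (2 * L n)).
    apply: (@le_trans _ _ ((cabs s * L n) ^+ 2 * expR (L n))).
      apply: ler_pM; rewrite ?sqr_ge0 ?expR_ge0 ?ler_expR //.
      by apply: lerXn2r => //; rewrite nnegrE ?cabs_ge0 // mulr_ge0 ?cabs_ge0 ?L0.
    rewrite exprMn -mulrA ler_wpM2l ?sqr_ge0 //.
    have := expR_ge_sq (L0 n).
    have -> : 2 * L n = L n + L n by ring.
    rewrite expRD mulrA => h; rewrite ler_wpM2r ?expR_ge0 //.
  have h3 : cabs (twopii * t / 2 * s ^+ 2) <= cabs s ^+ 2 * expR (2 * L n).
    rewrite [cabs (_ * s ^+ 2)]cabsM cabsX [leLHS]mulrC ler_wpM2l ?sqr_ge0 //.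
    rewrite 2!cabsM cabs_twopii cabsV cabs_nat.
    have := cabs_ge0 (t * (y + n%:~R) - m%:~R).
    have := expR_ge1Dx (2 * L n).
    have := L0 n; have := pi_gt0 R; have := cabs_ge0 t; nra.
  have -> : cabs s ^+ 2 * (5 * expR (2 * L n)) =
    2 * (cabs s ^+ 2 * (2 * expR (2 * L n))) + cabs s ^+ 2 * expR (2 * L n) by ring.
  lra.
have as1 : asum (thterm t m (y + s)).
  have [a1 a2] := (asum_thterm yY, ad).
  apply: asum_le (_ : bsum (fun n => cabs s ^+ 2 * G n + (G n + cabs s * G n))).
    move=> n; have -> : thterm t m (y + s) n = (thterm t m (y + s) n -
       thterm t m y n - s * dthterm t m y n) + (thterm t m y n + s * dthterm t m y n) by ring.
    apply: le_trans (cabsD _ _) _; apply: lerD => //.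
    apply: le_trans (cabsD _ _) _; apply: lerD; first exact: thterm_leG.
    by rewrite cabsM ler_wpM2l ?cabs_ge0 // dthterm_leG.
  apply: bsumD; first by apply: bsumZ; rewrite ?sqr_ge0.
  by apply: bsumD => //; apply: bsumZ; rewrite ?cabs_ge0.
rewrite /theta -csumZ // -!csumB //; try exact: asum_thterm; try exact: asumZ.
  apply: csum_le => A uA; rewrite mulrC; apply: (@le_trans _ _ (\sum_(n <- A) cabs s ^+ 2 * G n)).
    by apply: ler_sum => n _; exact: key.
  by rewrite -mulr_sumr ler_wpM2l ?sqr_ge0 // HK.
by apply: asumB => //; exact: asum_thterm.
Qed.

End Taylor.

End ThetaSeries.

(** * Fourier coefficients of theta through Riemann sums *)

Section FiniteFourier.
Variable R : realType.
Local Notation C := (Cplx R).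

Lemma int_nat_ratio (j q : nat) : (j%:R / q%:R : C) = (j%:R / q%:R : R)%:C%C.
Proof. by rewrite rmorphM fmorphV /= !rmorph_nat. Qed.

Lemma cabs_ratio_le1 (j q : nat) : (j <= q)%N -> cabs (j%:R / q%:R : C) <= 1.
Proof.
move=> jq; rewrite int_nat_ratio cabs_real ger0_norm ?divr_ge0 //.
case: q jq => [|q] jq; first by rewrite invr0 mulr0.
by rewrite ler_pdivrMr ?ltr0n // mul1r ler_nat.
Qed.

Lemma mul_e2ipi_int (z : C) (n : int) : z = z * e2ipi n%:~R.
Proof. by rewrite e2ipi_int mulr1. Qed.

Lemma e2ipi_real (x : R) : e2ipi x%:C%C = Complex (cos (2 * pi * x)) (sin (2 * pi * x)) :> C.
Proof.
rewrite /e2ipi /cexp /= !mul0r mulr0 subr0 expR0 !mul1r add0r //.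
Qed.

Section FixedParameter.
Variable t : C.
Hypothesis t0 : 0 < complex.Im t.

Lemma tneq0 : t != 0.
Proof. by apply: contraTneq t0 => ->; rewrite ltxx. Qed.

Lemma asum_thtermT m y : asum (thterm t m y).
Proof. exact: (asum_thterm m t0 (cabs_ge0 y)). Qed.

Lemma theta_twist m y : theta t m y = e2ipi (- (m%:~R * y)) * theta t 0 y.
Proof.
rewrite /theta -csumZ; last exact: asum_thtermT.
by apply: eq_csum => n; rewrite /thterm -e2ipiD; congr e2ipi; rewrite mul0r subr0 addrC.
Qed.

Lemma theta_per m y : theta t m (y + 1) = theta t m y.
Proof.
have pK : cancel (fun n : int => n + 1) (fun n => n - 1) by move=> n; rewrite addrK.
have qK : cancel (fun n : int => n - 1) (fun n => n + 1) by move=> n; rewrite subrK.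
rewrite [RHS](csum_bij pK qK (asum_thtermT _ _)); apply: eq_csum => n /=.
rewrite /thterm [LHS](mul_e2ipi_int _ m) -e2ipiD; congr e2ipi.
by rewrite rmorphD /=; ring.
Qed.

(** A shift by 1/t completes the square and trades the frequency m for m - 1. Together with
    [gridsum_move] it expresses every Fourier coefficient through the zeroth one. *)
Lemma theta_quasi m y :
  theta t m (y + t^-1) = e2ipi ((1 - 2 * m%:~R) / (2 * t)) * theta t (m - 1) y.
Proof.
rewrite /theta -csumZ; last exact: asum_thtermT.
apply: eq_csum => n; rewrite /thterm [RHS](mul_e2ipi_int _ n) -!e2ipiD.
by congr e2ipi; rewrite rmorphB /=; field; rewrite tneq0.
Qed.

(** Divided by q, this is the q-point Riemann sum of the m-th Fourier coefficient with base point
    [y]; Riemann sums stand in for integrals throughout. *)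
Definition gridsum (q : nat) (m : int) (y : C) : C :=
  \sum_(0 <= j < q) theta t m (y + j%:R / q%:R).

Lemma sum_per (q : nat) (g : nat -> C) : g q = g 0%N ->
  \sum_(0 <= j < q) g j.+1 = \sum_(0 <= j < q) g j.
Proof.
move=> h; apply/eqP; rewrite -subr_eq0 -sumrB telescope_sumr ?h ?subrr //.
Qed.

Lemma ratioS (j q : nat) : (j.+1%:R / q%:R : C) = j%:R / q%:R + q%:R^-1.
Proof. by rewrite -natr1 mulrDl mul1r. Qed.

(** The derivatives at the q grid points have a bounded sum: by periodicity the increments between
    consecutive grid points add up to 0, and q times the Taylor errors of size q^-2 remains bounded
    after summation. *)
Lemma gridsum_step (m : int) (Y : R) : 0 <= Y -> exists2 K : R, 0 <= K & forall q y s,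
  (0 < q)%N -> cabs y + 1 <= Y -> cabs s <= 1 ->
  cabs (gridsum q m (y + s) - gridsum q m y) <= K * (cabs s + q%:R * cabs s ^+ 2).
Proof.
move=> Y0; have [K K0 HK] := theta_taylor m t0 Y0.
exists K => // q y s q0 yY s1.
have qn0 : (q%:R : C) != 0 by rewrite pnatr_eq0 -lt0n.
have qr0 : 0 < (q%:R : R) by rewrite ltr0n.
pose yj j : C := y + j%:R / q%:R.
have hyj j : (j <= q)%N -> cabs (yj j) <= Y.
  move=> jq; apply: le_trans (cabsD _ _) _; apply: le_trans yY.
  by rewrite lerD2l cabs_ratio_le1.
pose d j := csum (dthterm t m (yj j)).
have iq : cabs (q%:R^-1 : C) = q%:R^-1 by rewrite cabsV cabs_nat.
have iq1 : cabs (q%:R^-1 : C) <= 1 by rewrite iq invf_le1 // ler1n.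
have hd : cabs (\sum_(0 <= j < q) d j) <= K.
  have e : \sum_(0 <= j < q) d j = - (q%:R * \sum_(0 <= j < q)
     (theta t m (yj j + q%:R^-1) - theta t m (yj j) - q%:R^-1 * d j)).
    rewrite sumrB -mulr_sumr mulrBr mulVKf // sumrB.
    have -> : \sum_(0 <= j < q) theta t m (yj j + q%:R^-1) =
              \sum_(0 <= j < q) theta t m (yj j.+1).
      by apply: eq_bigr => j _; rewrite /yj ratioS addrA.
    rewrite (@sum_per _ (fun j => theta t m (yj j))) ?subrr ?mulr0 ?sub0r ?opprK //.
    by rewrite /yj divff // mul0r addr0 theta_per.
  rewrite e cabsN cabsM cabs_nat.
  apply: (@le_trans _ _ (q%:R * \sum_(0 <= j < q) (K * q%:R^-1 ^+ 2))).
    rewrite ler_wpM2l ?ler0n //; apply: le_trans (cabs_sum _ _ _) _.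
    rewrite big_seq [leRHS]big_seq; apply: ler_sum => j.
    rewrite mem_index_iota => /andP[_ jq].
    by have [] := HK (yj j) q%:R^-1 (hyj _ (ltnW jq)) iq1; rewrite iq.
  rewrite sumr_const_nat subn0 -[_ *+ _]mulr_natr.
  by rewrite le_eqVlt; apply/orP; left; apply/eqP; field; rewrite gt_eqF.
have -> : gridsum q m (y + s) - gridsum q m y = s * (\sum_(0 <= j < q) d j) +
   \sum_(0 <= j < q) (theta t m (yj j + s) - theta t m (yj j) - s * d j).
  rewrite sumrB -mulr_sumr [RHS]addrC subrK -sumrB; apply: eq_bigr => j _.
  by rewrite /yj addrAC.
apply: le_trans (cabsD _ _) _; rewrite mulrDr; apply: lerD.
  by rewrite cabsM mulrC ler_wpM2r ?cabs_ge0.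
apply: le_trans (cabs_sum _ _ _) _.
rewrite mulrCA mulr_natl -[q in leRHS]subn0 -sumr_const_nat.
rewrite big_seq [leRHS]big_seq; apply: ler_sum => j.
rewrite mem_index_iota => /andP[_ jq].
by have [] := HK (yj j) s (hyj _ (ltnW jq)) s1.
Qed.

(** The discrete form of moving a contour: q steps of length |v|/q change the grid sum by a bounded
    amount in total, hence the Riemann mean by O(1/q), even for complex [v]. *)
Lemma gridsum_move (m : int) (x v : C) : exists K : R, forall q,
  (0 < q)%N -> cabs v <= q%:R -> cabs (gridsum q m (x + v) - gridsum q m x) <= K.
Proof.
have Y0 : 0 <= cabs x + cabs v + 1 by rewrite !addr_ge0 ?cabs_ge0.
have [K K0 HK] := gridsum_step m Y0.
exists (K * (cabs v + cabs v ^+ 2)) => q q0 vq.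
have qr0 : 0 < (q%:R : R) by rewrite ltr0n.
have qn0 : (q%:R : C) != 0 by rewrite pnatr_eq0 -lt0n.
have hs : cabs (v / q%:R) = cabs v / q%:R by rewrite cabsM cabsV cabs_nat.
have s1 : cabs (v / q%:R) <= 1 by rewrite hs ler_pdivrMr // mul1r.
have H i : (i <= q)%N -> cabs (gridsum q m (x + i%:R / q%:R * v) - gridsum q m x) <=
    (K * (cabs v + cabs v ^+ 2)) * (i%:R / q%:R).
  elim: i => [|i IH] iq; first by rewrite !mul0r addr0 subrr cabs0 mulr0.
  have -> : x + i.+1%:R / q%:R * v = (x + i%:R / q%:R * v) + v / q%:R.
    by rewrite ratioS mulrDl addrA [q%:R^-1 * v]mulrC.
  rewrite -(subrKA (gridsum q m (x + i%:R / q%:R * v))).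
  apply: le_trans (cabsD _ _) _.
  have hb : cabs (x + i%:R / q%:R * v) + 1 <= cabs x + cabs v + 1.
    rewrite lerD2r; apply: le_trans (cabsD _ _) _; rewrite lerD2l cabsM.
    by rewrite ler_piMl ?cabs_ge0 // cabs_ratio_le1 // ltnW.
  have := HK q _ _ q0 hb s1; rewrite hs => h1.
  have h2 := IH (ltnW iq).
  apply: le_trans (lerD h1 h2) _.
  rewrite -[i.+1%:R]natr1 le_eqVlt; apply/orP; left; apply/eqP.
  by field; rewrite gt_eqF.
by have := H q (leqnn q); rewrite divff // mul1r divff ?mulr1 ?gt_eqF.
Qed.

(** Each application of [theta_quasi] lowers or raises the frequency by one at the cost of a bounded
    error; the accumulated factors multiply to e(-m^2 / (2t)). *)
Lemma gridsum_coef (x : C) (m : int) : exists K : R, forall q,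
  (0 < q)%N -> cabs t^-1 <= q%:R ->
  cabs (gridsum q m x - e2ipi (- (m%:~R ^+ 2 / (2 * t))) * gridsum q 0 x) <= K.
Proof.
have step (m1 : int) : exists K : R, forall q, (0 < q)%N -> cabs t^-1 <= q%:R ->
    cabs (gridsum q m1 x - e2ipi ((1 - 2 * m1%:~R) / (2 * t)) * gridsum q (m1 - 1) x) <= K.
  have [K HK] := gridsum_move m1 x t^-1; exists K => q q0 vq.
  have := HK q q0 vq; rewrite cabs_distC.
  suff -> : gridsum q m1 (x + t^-1) = e2ipi ((1 - 2 * m1%:~R) / (2 * t)) * gridsum q (m1 - 1) x by [].
  rewrite /gridsum mulr_sumr; apply: eq_bigr => j _.
  by rewrite addrAC theta_quasi.
elim: m => [|m [K HK]|m [K HK]].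
- exists 0 => q _ _; rewrite expr0n /= mul0r oppr0 e2ipi0 mul1r subrr cabs0 //.
- have [K' HK'] := step m.+1.
  pose c : C := e2ipi ((1 - 2 * m.+1%:Z%:~R) / (2 * t)).
  exists (K' + cabs c * K) => q q0 vq.
  have h1 := HK q q0 vq; have h2 := HK' q q0 vq.
  rewrite (_ : m.+1%:Z - 1 = m) in h2; last by lia.
  have -> : e2ipi (- (m.+1%:Z%:~R ^+ 2 / (2 * t))) =
      c * e2ipi (- (m%:Z%:~R ^+ 2 / (2 * t))).
    by rewrite /c -e2ipiD; congr e2ipi; rewrite -addn1 PoszD rmorphD /=; field; rewrite tneq0.
  rewrite -(subrKA (c * gridsum q m x)) -mulrA -mulrBr.
  apply: le_trans (cabsD _ _) _; rewrite cabsM; apply: lerD => //.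
  by rewrite ler_wpM2l ?cabs_ge0.
- have [K' HK'] := step (- m%:Z).
  pose c : C := e2ipi ((1 - 2 * (- m%:Z)%:~R) / (2 * t)).
  exists (cabs c^-1 * (K' + K)) => q q0 vq.
  have h1 := HK q q0 vq; have h2 := HK' q q0 vq.
  rewrite (_ : - m%:Z - 1 = - m.+1%:Z) in h2; last by lia.
  have cn0 : c != 0 by exact: e2ipi_neq0.
  have -> : e2ipi (- ((- m.+1%:Z)%:~R ^+ 2 / (2 * t))) =
      c^-1 * e2ipi (- ((- m%:Z)%:~R ^+ 2 / (2 * t))).
    rewrite /c -e2ipiN -e2ipiD; congr e2ipi.
    by rewrite -addn1 PoszD !rmorphN !rmorphD /=; field; rewrite tneq0.
  rewrite -[X in X - _](mulKf cn0) -mulrA -mulrBr cabsM.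
  rewrite ler_wpM2l ?cabs_ge0 //.
  rewrite -(subrKA (gridsum q (- m%:Z) x)) [leRHS]addrC.
  apply: le_trans (cabsD _ _) _; rewrite addrC; apply: lerD => //.
  by rewrite cabs_distC.
Qed.

Lemma sum_unity (q : nat) (M j : nat) : (j < q)%N ->
  \sum_(0 <= i < q) e2ipi (- ((i%:Z - M%:Z)%:~R * (j%:R / q%:R))) =
  (if j == 0%N then q%:R else 0) :> C.
Proof.
move=> jq; case: eqP => [->|/eqP j0].
  under eq_bigr do rewrite mul0r mulr0 oppr0 e2ipi0.
  by rewrite sumr_const_nat subn0.
have q0 : (0 < q)%N by exact: leq_ltn_trans jq.
have qn0 : (q%:R : C) != 0 by rewrite pnatr_eq0 -lt0n.
have qr0 : 0 < (q%:R : R) by rewrite ltr0n.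
pose w : C := e2ipi (- (j%:R / q%:R)).
have -> : \sum_(0 <= i < q) e2ipi (- ((i%:Z - M%:Z)%:~R * (j%:R / q%:R))) =
   e2ipi (M%:R * (j%:R / q%:R)) * \sum_(0 <= i < q) w ^+ i :> C.
  rewrite mulr_sumr; apply: eq_bigr => i _; rewrite -e2ipi_natM -e2ipiD.
  by congr e2ipi; rewrite rmorphB /=; ring.
have w1 : w ^+ q = 1.
  rewrite -e2ipi_natM (_ : _ * _ = (- j%:Z)%:~R) ?e2ipi_int // rmorphN /=.
  by field.
have wn1 : w != 1.
  rewrite /w e2ipiN invr_eq1; apply/negP => /eqP.
  rewrite int_nat_ratio /e2ipi /cexp /=.
  set x : R := j%:R / q%:R => -[] + _.
  rewrite !mul0r mulr0 subr0 expR0 mul1r add0r => h.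
  have : sin (2 * pi * x / 2) ^+ 2 = 0.
    by have := one_sub_cos (2 * pi * x); rewrite h subrr => /esym/eqP; rewrite mulf_eq0 pnatr_eq0 /= => /eqP.
  move/eqP; rewrite expf_eq0 /= gt_eqF // sin_gt0_pi //.
  have x0 : 0 < x by rewrite divr_gt0 // ltr0n lt0n.
  have x1 : x < 1 by rewrite ltr_pdivrMr // mul1r ltr_nat.
  have := pi_gt0 R; nra.
have : (w - 1) * \sum_(0 <= i < q) w ^+ i = 0.
  by rewrite big_mkord -subrX1 w1 subrr.
move/eqP; rewrite mulf_eq0 subr_eq0 (negbTE wn1) /= => /eqP ->.
by rewrite mulr0.
Qed.

(* The window -M <= m <= M is a full set of residues modulo 2M+1. *)
Lemma fourier_inversion (M : nat) (x : C) : let q := M.*2.+1 in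
  \sum_(0 <= i < q) e2ipi ((i%:Z - M%:Z)%:~R * x) * gridsum q (i%:Z - M%:Z) x / q%:R
  = theta t 0 x.
Proof.
move=> q; have qn0 : (q%:R : C) != 0 by rewrite pnatr_eq0.
rewrite -mulr_suml.
under eq_bigr => i _.
  rewrite /gridsum mulr_sumr.
  under eq_bigr => j _.
    rewrite theta_twist mulrA -e2ipiD mulrDr opprD addNKr mulrC.
    over.
  over.
rewrite exchange_big_nat //=.
under eq_big_nat => j /andP[_ jq] do rewrite -mulr_sumr sum_unity //.
rewrite big_ltn //= mul0r addr0.
rewrite big_nat_cond big1 ?addr0 ?mulfK // => j /andP[/andP[j0 _] _].
by rewrite gtn_eqF // mulr0.
Qed.

(** A weak Jordan inequality, obtained by halving the angle twice; it feeds the lower bound of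
    [e2ipi_second_diff]. *)
Lemma sin_ge_quarter (x : R) : 0 <= x <= pi / 2 -> x / 4 <= sin x.
Proof.
move=> /andP[x0 x1].
have pi4 : pi <= 4 :> R by have [/andP[_ +] _] := pihalf_02_cos_pihalf R; lra.
have e : x = x / 2 + x / 2 by field.
have hc : 1 / 2 <= cos (x / 2).
  have := one_sub_cos (x / 2) ; have := abs_sin_le (x / 2 / 2).
  have h0 : 0 <= x / 2 / 2 by lra.
  rewrite [`|x / 2 / 2|]ger0_norm // => h.
  have : `|sin (x / 2 / 2)| ^+ 2 <= (x / 2 / 2) ^+ 2 by rewrite lerXn2r ?nnegrE.
  rewrite real_normK ?num_real //; nra.
have hs : x / 2 - (x / 2) ^+ 2 <= sin (x / 2).
  have := abs_sin_sub_le (x / 2); rewrite ler_norml => /andP[]; lra.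
have [->|xn0] := eqVneq x 0; first by rewrite sin0 mul0r.
have xp : 0 < x by lra.
have xp2 : 0 < x / 2 by lra.
have hs2 : (x / 2) / 2 <= sin (x / 2).
  have [|c cin] := @MVT R sin cos 0 (x / 2) xp2 (fun x _ => is_derive_sin x).
    by apply: continuous_subspaceT => y; exact: continuous_sin.
  rewrite sin0 !subr0 => ->.
  move: cin; rewrite in_itv /= => /andP[c0 cx].
  have h1 := one_sub_cos c ; have := abs_sin_le (c / 2).
  have h0 : 0 <= c / 2 by lra.
  rewrite [`|c / 2|]ger0_norm // => h.
  have : `|sin (c / 2)| ^+ 2 <= (c / 2) ^+ 2 by rewrite lerXn2r ?nnegrE.
  rewrite real_normK ?num_real // => h2.
  have : 1 / 2 <= cos c by nra.
  nra.
rewrite [in sin x]e sinD; nra.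
Qed.

(** The modulus is 4 sin^2(pi m / q), and |m/q| <= 1/2 keeps the sine away from its other zeros. *)
Lemma e2ipi_second_diff (m : int) (q : nat) : (0 < q)%N -> (`|m|.*2 <= q)%N ->
  (m%:~R / q%:R) ^+ 2 <=
  cabs (e2ipi (m%:~R / q%:R) + e2ipi (- (m%:~R / q%:R)) - 2 : C).
Proof.
move=> q0 mq; have qr0 : 0 < (q%:R : R) by rewrite ltr0n.
set x : R := m%:~R / q%:R.
have -> : (m%:~R / q%:R : C) = x%:C%C by rewrite rmorphM fmorphV /= rmorph_int rmorph_nat.
have -> : e2ipi (x%:C)%C + e2ipi (- (x%:C)%C) - 2 = (- (4 * sin (pi * x) ^+ 2))%:C%C :> C.
  rewrite -rmorphN !e2ipi_real mulrN cosN sinN.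
  have -> : (2 : C) = (2 : R)%:C%C by rewrite rmorph_nat.
  apply/eqP; rewrite eq_complex /= subrr oppr0 addr0 eqxx andbT; apply/eqP.
  have := one_sub_cos (2 * pi * x).
  have -> : 2 * pi * x / 2 = pi * x by field.
  lra.
rewrite cabs_real normrN ger0_norm; last by apply: mulr_ge0 => //; exact: sqr_ge0.
wlog x0 : x / 0 <= x /\ x <= 2^-1.
  move=> H.
  have hx : `|x| <= 2^-1.
    rewrite /x normrM normfV (ger0_norm (ltW qr0)) ler_pdivrMr //.
    have -> : `|m%:~R| = `|m|%N%:R :> R by rewrite -intr_norm -abszE.
    have : (`|m|.*2)%:R <= q%:R :> R by rewrite ler_nat.
    rewrite -muln2 natrM; lra.
  have [x0|x0] := leP 0 x.
    by apply: H; split=> //; rewrite -(ger0_norm x0).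
  rewrite -(sqrrN x) -(sqrrN (sin _)) -sinN -(mulrN pi x); apply: H; split; first lra.
  by rewrite -(ltr0_norm x0).
have [x1 x2] := x0; have p2 : 2 <= pi :> R by exact: pi_ge2.
have h : pi * x / 4 <= sin (pi * x).
  apply: sin_ge_quarter; apply/andP; split; nra.
have h2 : x / 2 <= sin (pi * x) by nra.
nra.
Qed.

(** Discrete version of integrating by parts twice: a second difference in the grid multiplies the
    coefficient by e(m/q) + e(-m/q) - 2, of size at least (m/q)^2, while second differences of theta
    are O(q^-2). The bound does not depend on q. *)
Lemma fourier_decay (x : C) : exists2 K : R, 0 <= K & forall q (m : int),
  (0 < q)%N -> (`|m|.*2 <= q)%N -> m != 0 ->
  cabs (e2ipi (m%:~R * x) * gridsum q m x / q%:R) <= K / m%:~R ^+ 2.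
Proof.
have Y0 : 0 <= cabs x + 1 by rewrite addr_ge0 ?cabs_ge0.
have [K K0 HK] := theta_taylor 0 t0 Y0.
exists (2 * K); first by rewrite mulr_ge0.
move=> q m q0 mq m0.
have qn0 : (q%:R : C) != 0 by rewrite pnatr_eq0 -lt0n.
have qr0 : 0 < (q%:R : R) by rewrite ltr0n.
set A := e2ipi _ * _.
have EA : A = \sum_(0 <= j < q) theta t 0 (x + j%:R / q%:R) * e2ipi (- (m%:~R * (j%:R / q%:R))).
  rewrite /A /gridsum mulr_sumr; apply: eq_bigr => j _.
  by rewrite theta_twist mulrA -e2ipiD mulrDr opprD addNKr mulrC.
pose g (d : C) (j : nat) : C := theta t 0 (x + d + j%:R / q%:R) * e2ipi (- (m%:~R * (d + j%:R / q%:R))).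
have gper d : g d q = g d 0%N.
  rewrite /g divff // mul0r !addr0 theta_per; congr (_ * _).
  by rewrite mulrDr opprD e2ipiD mulr1 [X in _ * X]e2ipiN e2ipi_int invr1 mulr1.
have e1 : \sum_(0 <= j < q) theta t 0 (x + j%:R / q%:R + q%:R^-1) * e2ipi (- (m%:~R * (j%:R / q%:R)))
   = e2ipi (m%:~R / q%:R) * A.
  rewrite EA -[in RHS](@sum_per q (fun j => theta t 0 (x + j%:R / q%:R) * e2ipi (- (m%:~R * (j%:R / q%:R))))).
    rewrite mulr_sumr; apply: eq_bigr => j _; rewrite [RHS]mulrCA -e2ipiD ratioS addrA.
    by congr (_ * e2ipi _); ring.
  by have := gper 0; rewrite /g !addr0 !add0r.
have e2 : \sum_(0 <= j < q) theta t 0 (x + j%:R / q%:R - q%:R^-1) * e2ipi (- (m%:~R * (j%:R / q%:R)))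
   = e2ipi (- (m%:~R / q%:R)) * A.
  have -> : A = \sum_(0 <= j < q) g (- q%:R^-1) j.
    rewrite -(sum_per (gper _)) EA; apply: eq_bigr => j _.
    by rewrite /g ratioS; congr (theta _ _ _ * e2ipi (- (_ * _))); ring.
  rewrite mulr_sumr; apply: eq_bigr => j _; rewrite /g [RHS]mulrCA -e2ipiD addrAC.
  by congr (_ * e2ipi _); ring.
have e3 : (e2ipi (m%:~R / q%:R) + e2ipi (- (m%:~R / q%:R)) - 2) * A =
   \sum_(0 <= j < q) ((theta t 0 (x + j%:R / q%:R + q%:R^-1) - theta t 0 (x + j%:R / q%:R)
      - q%:R^-1 * csum (dthterm t 0 (x + j%:R / q%:R))) +
     (theta t 0 (x + j%:R / q%:R - q%:R^-1) - theta t 0 (x + j%:R / q%:R)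
      - (- q%:R^-1) * csum (dthterm t 0 (x + j%:R / q%:R)))) * e2ipi (- (m%:~R * (j%:R / q%:R))).
  rewrite mulrBl mulrDl -e1 -e2 EA mulr_sumr -!big_split -sumrB /=.
  by apply: eq_bigr => j _; ring.
have b3 : cabs ((e2ipi (m%:~R / q%:R) + e2ipi (- (m%:~R / q%:R)) - 2) * A) <=
    2 * K / q%:R.
  rewrite e3; apply: le_trans (cabs_sum _ _ _) _.
  apply: (@le_trans _ _ (\sum_(0 <= j < q) (2 * K / q%:R ^+ 2))); last first.
    rewrite sumr_const_nat subn0 -[_ *+ _]mulr_natr.
    by rewrite le_eqVlt; apply/orP; left; apply/eqP; field; rewrite gt_eqF.
  rewrite big_seq [leRHS]big_seq; apply: ler_sum => j.
  rewrite mem_index_iota => /andP[_ jq].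
  have iq : cabs (q%:R^-1 : C) = q%:R^-1 by rewrite cabsV cabs_nat.
  have iq1 : cabs (q%:R^-1 : C) <= 1 by rewrite iq invf_le1 // ler1n.
  have hy : cabs (x + j%:R / q%:R) <= cabs x + 1.
    by apply: le_trans (cabsD _ _) _; rewrite lerD2l cabs_ratio_le1 // ltnW.
  have [h1 _] := HK _ _ hy iq1.
  have [|h2 _] := HK _ (- q%:R^-1) hy; first by rewrite cabsN.
  rewrite cabsM (_ : cabs (e2ipi _) = 1); last first.
    rewrite cabs_e2ipi int_nat_ratio real_int -rmorphM /= oppr0 mulr0 oppr0 expR0 //.
  rewrite mulr1; apply: le_trans (cabsD _ _) _.
  apply: le_trans (lerD h1 h2) _; rewrite cabsN iq.
  by rewrite le_eqVlt; apply/orP; left; apply/eqP; field; rewrite gt_eqF.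
have h := e2ipi_second_diff q0 mq.
have mr0 : 0 < (m%:~R : R) ^+ 2 by rewrite exprn_even_gt0 //= intr_eq0.
rewrite cabsM cabsV cabs_nat ler_pdivlMr // mulrAC ler_pdivrMr //.
move: b3; rewrite cabsM ler_pdivlMr // => b3.
have := ler_wpM2r (cabs_ge0 A) h; rewrite expr_div_n mulrAC ler_pdivrMr ?exprn_gt0 // => b4.
rewrite [leLHS]mulrC; apply: le_trans b4 _.
rewrite expr2 mulrA.
by rewrite ler_wpM2r ?ler0n // mulrC.
Qed.

End FixedParameter.
End FiniteFourier.

(** * Inversion up to an unknown multiplier *)

Section ThetaInversion.
Variable R : realType.
Local Notation C := (Cplx R).

Lemma Im_inv_opp (t : C) : complex.Im (- t^-1) = complex.Im t / cabs t ^+ 2.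
Proof.
rewrite /cabs sqr_sqrtr ?addr_ge0 ?sqr_ge0 //.
by case: t => a b /=; rewrite opprK.
Qed.

Lemma Im_inv_opp_gt0 (t : C) : 0 < complex.Im t -> 0 < complex.Im (- t^-1).
Proof.
move=> t0; rewrite Im_inv_opp divr_gt0 // exprn_gt0 // cabs_gt0.
by apply: contraTneq t0 => ->; rewrite ltxx.
Qed.

(** The m-th term of the Fourier expansion of theta at [x], normalised by the zeroth coefficient. *)
Definition vterm (t x : C) (m : int) : C := e2ipi (m%:~R * x - m%:~R ^+ 2 / (2 * t)).

Definition theta_dual (t x : C) : C := csum (vterm t x).

Lemma vtermE (t x : C) m : t != 0 ->
  vterm t x m = e2ipi (t * x ^+ 2 / 2) * thterm (- t^-1) 0 (- t * x) m.
Proof.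
by move=> t0; rewrite /vterm /thterm -e2ipiD; congr e2ipi; field.
Qed.

Lemma asum_vterm (t x : C) : 0 < complex.Im t -> asum (vterm t x).
Proof.
move=> t0; have h := asum_thtermT (Im_inv_opp_gt0 t0) 0 (- t * x).
have := asumZ (e2ipi (t * x ^+ 2 / 2)) h.
by apply: bsum_le => m; rewrite vtermE // (tneq0 t0).
Qed.

Lemma theta_dualE (t x : C) : 0 < complex.Im t ->
  theta_dual t x = e2ipi (t * x ^+ 2 / 2) * theta (- t^-1) 0 (- t * x).
Proof.
move=> t0; rewrite /theta -csumZ; last exact: asum_thtermT (Im_inv_opp_gt0 t0) _ _.
by apply: eq_csum => m; rewrite vtermE // (tneq0 t0).
Qed.

Lemma near_small (K e : R) : 0 < e -> \forall M \near \oo, K / (M.*2.+1)%:R < e.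
Proof.
move=> e0; have [N hN] : exists N, K / e < N%:R.
  have := archi_boundP (normr_ge0 (K / e)) => h; exists (Num.Def.archi_bound `|K / e|).
  by apply: le_lt_trans h; rewrite ler_norm.
exists N => //= M hM; rewrite ltr_pdivrMr ?ltr0n // mulrC -ltr_pdivrMr //.
apply: lt_le_trans hN _; rewrite ler_nat; apply: leq_trans hM _.
by rewrite -addnn -addnS leq_addr.
Qed.

Lemma cvg_mulcl (T : Type) (F : set_system T) {FF : Filter F} (c : C) (u : T -> C) l :
  u @ F --> l -> (fun n => c * u n) @ F --> c * l.
Proof.
move=> /cvgCP h; apply/cvgCP => e e0.
have c0 : 0 < cabs c + 1 by have := cabs_ge0 c; lra.
have := h _ (divr_gt0 e0 c0); apply: filterS => n hn.
rewrite -mulrBr cabsM; apply: le_lt_trans (_ : (cabs c + 1) * cabs (u n - l) < e).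
  by rewrite ler_wpM2r ?cabs_ge0 // lerDl.
by rewrite mulrC -ltr_pdivlMr.
Qed.

Section FixedParameter.
Variable t : C.
Hypothesis t0 : 0 < complex.Im t.

(** In [fourier_inversion] the m-th coefficient differs from [vterm t x m] times the zeroth Riemann
    mean by O(1/q), and [fourier_decay] gives a summable majorant, so the total error tends to 0 by
    [csum_tannery]. *)
Lemma theta_dual_limit (x : C) :
  (fun M : nat => theta_dual t x * (gridsum t M.*2.+1 0 x / (M.*2.+1)%:R))
    @ \oo --> theta t 0 x.
Proof.
pose A M (m : int) := e2ipi (m%:~R * x) * gridsum t M.*2.+1 m x / (M.*2.+1)%:R.
pose a M (m : int) : C := if (`|m| <= M)%N then A M m else 0.
pose u M (m : int) := a M m - gridsum t M.*2.+1 0 x / (M.*2.+1)%:R * vterm t x m.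
have aa M : asum (a M).
  apply: (@asum_supp _ _ _ [seq i%:Z - M%:Z | i <- index_iota 0 M.*2.+1]).
    by rewrite map_inj_uniq ?iota_uniq // => i j /addIr [].
  move=> m hm; rewrite /a; case: ifP => // h; case/mapP: hm.
  by exists (absz (m + M%:Z)); rewrite ?mem_index_iota; lia.
have sa M : csum (a M) = theta t 0 x.
  rewrite -(fourier_inversion t0 M x).
  rewrite (@csum_supp _ _ _ [seq i%:Z - M%:Z | i <- index_iota 0 M.*2.+1]).
  - rewrite big_map big_seq [RHS]big_seq; apply: eq_bigr => i.
    rewrite mem_index_iota => hi; rewrite /a ifT /A //; lia.
  - by rewrite map_inj_uniq ?iota_uniq // => i j /addIr [].
  - move=> m hm; rewrite /a; case: ifP => // h; case/mapP: hm.
    by exists (absz (m + M%:Z)); rewrite ?mem_index_iota; lia.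
have su M : csum (u M) = theta t 0 x - theta_dual t x * (gridsum t M.*2.+1 0 x / (M.*2.+1)%:R).
  rewrite /u csumB ?csumZ; last 3 first.
  - exact: asum_vterm.
  - exact: aa.
  - by apply: asumZ; exact: asum_vterm.
  by rewrite sa [X in _ - X]mulrC.
have Y0 : 0 <= cabs x + 1 by rewrite addr_ge0 ?cabs_ge0.
have [K0 K00 HK0] := theta_taylor 0 t0 Y0.
have g0b M : cabs (gridsum t M.*2.+1 0 x / (M.*2.+1)%:R) <= K0.
  rewrite cabsM cabsV cabs_nat ler_pdivrMr ?ltr0n //.
  apply: le_trans (cabs_sum _ _ _) _.
  rewrite mulr_natr -[X in K0 *+ X]subn0 -sumr_const_nat.
  rewrite big_seq [leRHS]big_seq; apply: ler_sum => j.
  rewrite mem_index_iota => /andP[_ jq].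
  have [||_ //] := HK0 (x + j%:R / (M.*2.+1)%:R) 0; last by rewrite cabs0.
  by apply: le_trans (cabsD _ _) _; rewrite lerD2l cabs_ratio_le1 // ltnW.
have [K K1 HK] := fourier_decay t0 x.
pose g (m : int) := (if m == 0 then K0 + K else (K0 + K) / m%:~R ^+ 2) + K0 * cabs (vterm t x m).
have hg : bsum g.
  apply: bsumD; first by apply: bsum_inv_sq; rewrite addr_ge0.
  by apply: bsumZ => //; exact: asum_vterm.
have ug M m : cabs (u M m) <= g m.
  rewrite /u /g; apply: le_trans (cabsB _ _) _; apply: lerD; last first.
    by rewrite cabsM ler_wpM2r ?cabs_ge0.
  rewrite /a; case: ifP => hm; last first.
    rewrite cabs0; case: ifP => _; rewrite ?divr_ge0 ?addr_ge0 ?sqr_ge0 //.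
  case: eqP => [->|/eqP m0].
    rewrite /A mul0r e2ipi0 mul1r; apply: le_trans (g0b M) _; lra.
  apply: le_trans (HK _ _ _ _ m0) _ => //; first by lia.
  rewrite ler_wpM2r ?invr_ge0 ?sqr_ge0 //; lra.
have ul m : (fun M => u M m) @ \oo --> (0 : C).
  apply/cvgCP => e e0.
  have [K2 HK2] := gridsum_coef t0 x m.
  have n1 := near_small (cabs (e2ipi (m%:~R * x)) * K2) e0.
  have n2 := near_small (cabs t^-1) ltr01.
  have n3 : \forall M \near \oo, (`|m| <= M)%N by exists `|m|%N.
  apply: filterS (filterI n1 (filterI n2 n3)) => M [h1 [h2 h3]].
  rewrite subr0 /u /a h3 /A /vterm.
  have -> : e2ipi (m%:~R * x) * gridsum t M.*2.+1 m x / (M.*2.+1)%:R -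
    gridsum t M.*2.+1 0 x / (M.*2.+1)%:R * e2ipi (m%:~R * x - m%:~R ^+ 2 / (2 * t)) =
    e2ipi (m%:~R * x) * (gridsum t M.*2.+1 m x - e2ipi (- (m%:~R ^+ 2 / (2 * t))) * gridsum t M.*2.+1 0 x) / (M.*2.+1)%:R.
    by rewrite e2ipiD; ring.
  rewrite !cabsM cabsV cabs_nat; apply: le_lt_trans h1.
  rewrite ler_wpM2r ?invr_ge0 // ler_wpM2l ?cabs_ge0 // HK2 //.
  by move: h2; rewrite ltr_pdivrMr ?ltr0n // mul1r => /ltW.
have H0 : (fun M => csum (u M)) @ \oo --> csum (fun _ : int => 0 : C).
  by apply: (csum_tannery _ hg) => //; exact: nearW.
move: H0; rewrite csum0 => /cvgCP H; apply/cvgCP => e e0.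
by have := H e e0; apply: filterS => M; rewrite su subr0 cabs_distC.
Qed.

Lemma gridsum_indep (sb : nat -> nat) (x : C) (l : C) : sb @ \oo --> \oo ->
  (fun M => gridsum t (sb M).*2.+1 0 0 / ((sb M).*2.+1)%:R) @ \oo --> l ->
  (fun M => gridsum t (sb M).*2.+1 0 x / ((sb M).*2.+1)%:R) @ \oo --> l.
Proof.
move=> hs /cvgCP H; apply/cvgCP => e e0.
have e2 : 0 < e / 2 by lra.
have [K HK] := gridsum_move t0 0 0 x.
have n1 := hs _ (near_small K e2); have n2 := hs _ (near_small (cabs x) ltr01).
apply: filterS (filterI (H _ e2) (filterI n1 n2)) => M [h1 [h2 h3]].
rewrite -(subrKA (gridsum t (sb M).*2.+1 0 0 / ((sb M).*2.+1)%:R)).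
apply: le_lt_trans (cabsD _ _) _.
have : cabs (gridsum t (sb M).*2.+1 0 x / ((sb M).*2.+1)%:R -
    gridsum t (sb M).*2.+1 0 0 / ((sb M).*2.+1)%:R) < e / 2.
  rewrite -mulrBl cabsM cabsV cabs_nat; apply: le_lt_trans h2.
  rewrite ler_wpM2r ?invr_ge0 // -{1}(add0r x) HK //.
  by move: h3; rewrite /= ltr_pdivrMr ?ltr0n // mul1r => /ltW.
lra.
Qed.

Lemma Im_scale_inv (q : nat) : (0 < q)%N -> 0 < complex.Im (t / q%:R ^+ 2).
Proof.
move=> q0; rewrite mulrC -natrX real_nat -fmorphV ImZ mulr_gt0 //.
by rewrite invr_gt0 ltr0n expn_gt0 q0.
Qed.

(** Writing l = n q + j, the numbers n + j/q run over all l/q. The zeroth coefficient is thereby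
    itself a theta value, at a smaller parameter. *)
Lemma gridsum0E (q : nat) : gridsum t q.+1 0 0 = theta (t / q.+1%:R ^+ 2) 0 0.
Proof.
have t1 := Im_scale_inv (ltn0Sn q).
have qn0 : (q.+1%:R : C) != 0 by rewrite pnatr_eq0.
pose phi (p : 'I_q.+1 * int) : int := p.2 * q.+1%:Z + p.1%:Z.
pose psi (l : int) : 'I_q.+1 * int := (inord `|(l %% q.+1%:Z)%Z|%N, (l %/ q.+1%:Z)%Z).
have pK : cancel phi psi.
  move=> [j n]; rewrite /phi /psi /=; congr (_, _).
    by apply: val_inj; rewrite /= inordK modzMDl modz_small ?ltn_ord // ltz_nat ltn_ord.
  by rewrite divzMDl // divz_small ?addr0 // ltz_nat ltn_ord.
have qK : cancel psi phi.
  move=> l; rewrite /phi /psi /= inordK.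
    by rewrite gez0_abs ?modz_ge0 // -divz_eq.
  have := ltz_pmod l (ltn0Sn q : (0 < q.+1%:Z)).
  by have := modz_ge0 l (erefl : q.+1%:Z != 0); lia.
rewrite /theta (csum_bij pK qK (asum_thtermT t1 _ _)) csum_fubini; last first.
  by apply: (asum_inj (can_inj pK)); exact: asum_thtermT.
rewrite (@csum_supp _ _ _ (enum 'I_q.+1)) ?enum_uniq //; last first.
  by move=> i; rewrite mem_enum.
rewrite big_enum /gridsum big_mkord /=; apply: eq_bigr => j _.
apply: eq_csum => n /=; rewrite /thterm /phi /=; congr e2ipi.
by rewrite rmorphD rmorphM /= -!pmulrn; field.
Qed.

(** The multiplier in the inversion formula, classically sqrt(i/s). The quotient is 0 by convention
    where the denominator vanishes. *)
Definition cmult (s : C) : C := theta s 0 0 / theta_dual s 0.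

End FixedParameter.

(** By [gridsum0E], a grid of size p q for [t] has the same sum as a grid of size q for t/p^2. The
    limit of the Riemann means for [t] can therefore be read off at t/p^2, where the dual theta
    value is known not to vanish. *)
Lemma theta_inversion (P : nat) (t x : C) : 0 < complex.Im t ->
  theta_dual (t / P.*2.+1%:R ^+ 2) 0 != 0 ->
  theta t 0 x = cmult (t / P.*2.+1%:R ^+ 2) / P.*2.+1%:R * theta_dual t x.
Proof.
move=> t0; set p : C := P.*2.+1%:R => hp.
have pn0 : p != 0 by rewrite pnatr_eq0.
have t1 : 0 < complex.Im (t / p ^+ 2) := Im_scale_inv t0 (ltn0Sn P.*2).
(* Chosen so that 2 (sb M) + 1 = (2P + 1)(2M + 1). *)
pose sb M := (P * M.*2.+1 + M)%N.
have sbE M : (sb M).*2.+1 = (P.*2.+1 * M.*2.+1)%N by rewrite /sb; lia.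
have hs : sb @ \oo --> \oo.
  move=> A [N _ hN]; exists N => //= M /= hM; apply: hN => /=.
  by apply: leq_trans hM _; rewrite /sb leq_addl.
have L1 : (fun M => gridsum t (sb M).*2.+1 0 0 / ((sb M).*2.+1)%:R) @ \oo
    --> cmult (t / p ^+ 2) / p.
  have -> : cmult (t / p ^+ 2) / p = (theta_dual (t / p ^+ 2) 0)^-1 / p * theta (t / p ^+ 2) 0 0.
    by rewrite /cmult; ring.
  rewrite (_ : (fun M => _) = (fun n : nat =>
      (theta_dual (t / p ^+ 2) 0)^-1 / p *
      (theta_dual (t / p ^+ 2) 0 *
       (gridsum (t / p ^+ 2) n.*2.+1 0 0 / n.*2.+1%:R)))).
    exact: cvg_mulcl (theta_dual_limit t1 (x := 0)).
  apply/funext => M; rewrite !gridsum0E // sbE natrM -/p.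
  set q : C := M.*2.+1%:R; have qn0 : q != 0 by rewrite pnatr_eq0.
  clearbody p q.
  have -> : t / (p * q) ^+ 2 = t / p ^+ 2 / q ^+ 2 by field; rewrite pn0 qn0.
  by field; rewrite hp pn0 qn0.
have L2 := gridsum_indep t0 x hs L1.
have L3 := cvg_comp _ _ hs (theta_dual_limit t0 (x := x)).
rewrite [RHS]mulrC.
apply: (@cvgC_unique _ _ \oo _ (fun M => theta_dual t x *
  (gridsum t (sb M).*2.+1 0 x / ((sb M).*2.+1)%:R)) _ _ L3).
exact: cvg_mulcl L2.
Qed.

(** The term m = 0 equals 1, and the others are bounded by powers of exp(-pi) <= 1/4, adding up to
    at most 1/3 on each side. *)
Lemma theta_dual_neq0 (t : C) : 1 <= complex.Im (- t^-1) -> theta_dual t 0 != 0.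
Proof.
move=> h1; pose r : R := expR (- pi).
have r0 : 0 <= r by exact: expR_ge0.
have r4 : r <= 1 / 4.
  have p2 := pi_ge2 R.
  have h : 4 <= expR pi :> R.
    have -> : pi = pi / 2 + pi / 2 :> R by field.
    rewrite expRD; have := expR_ge1Dx (pi / 2 : R); nra.
  have hm : r * expR pi = 1 by rewrite -expRD addNr expR0.
  nra.
have t0 : 0 < complex.Im t.
  have : 0 < complex.Im (- t^-1) by lra.
  by move/Im_inv_opp_gt0; rewrite invrN invrK opprK.
have tn0 := tneq0 t0.
have bd m : cabs (vterm t 0 m) <= r ^+ `|m|%N.
  rewrite /vterm mulr0 add0r cabs_e2ipi.
  have -> : - (m%:~R ^+ 2 / (2 * t)) = (m%:~R ^+ 2 / 2 : R)%:C%C * (- t^-1) :> C.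
    by rewrite rmorphM rmorphXn /= fmorphV rmorph_int rmorph_nat; field.
  rewrite ImZ -expRM_natl ler_expR.
  have -> : `|m|%N%:R = `|m%:~R| :> R by rewrite -intr_norm -abszE.
  have hm : `|m%:~R| <= m%:~R ^+ 2 :> R.
    rewrite -intr_norm -rmorphXn ler_int /=; nia.
  have m0 : 0 <= `|m%:~R : R| by [].
  have p0 := pi_ge0 R.
  have : `|m%:~R| <= m%:~R ^+ 2 * complex.Im (- t^-1) by nra.
  nra.
have ap := asum_vterm 0 t0.
pose f m : C := if m == 0 then 0 else vterm t 0 m.
have af : asum f.
  by apply: bsum_le ap => m; rewrite /f; case: ifP => _; rewrite ?cabs0 ?cabs_ge0.
pose f0 m : C := if m == 0 :> int then 1 else 0.
have hz : forall i, i \notin [:: 0 : int] -> f0 i = 0.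
  by move=> i; rewrite inE /f0 => /negbTE ->.
have E : theta_dual t 0 = 1 + csum f.
  have -> : 1 = csum f0 by rewrite (csum_supp (A := [:: 0]) _ hz) // big_seq1.
  rewrite -csumD //; last exact: asum_supp hz.
  apply: eq_csum => m; rewrite /f /f0; case: eqP => [->|_]; last by rewrite add0r.
  by rewrite /vterm mul0r expr0n mul0r subrr e2ipi0 addr0.
have B : cabs (csum f) <= 2 / 3.
  apply: csum_le => A uA.
  apply: (@le_trans _ _ (\sum_(n <- A) (if n == 0 then 0 else r ^+ `|n|%N))).
    by apply: ler_sum => n _; rewrite /f; case: ifP => _; rewrite ?cabs0.
  have pos (B : seq nat) : uniq B -> \sum_(n <- B) r ^+ n.+1 <= 1 / 3.
    move=> uB; under eq_bigr do rewrite exprS.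
    rewrite -mulr_sumr; have := @sum_geom_le _ r B r0 _ uB.
    have r1 : r < 1 by lra.
    move=> /(_ r1) h; apply: le_trans (ler_wpM2l r0 h) _.
    rewrite ler_pdivrMr; lra.
  rewrite (bigID (fun n : int => 0 <= n)) /=.
  have -> : 2 / 3 = 1 / 3 + 1 / 3 :> R by field.
  apply: lerD.
    rewrite (bigID (fun n : int => n == 0)) /= big1 ?add0r; last first.
      by move=> n /andP[_ ->].
    rewrite -big_filter; set B := [seq _ <- _ | _].
    have -> : \sum_(n <- B) (if n == 0 then 0 else r ^+ `|n|%N) =
        \sum_(n <- [seq (absz n).-1 | n <- B]) r ^+ n.+1.
      rewrite big_map big_seq [RHS]big_seq; apply: eq_bigr => n.
      rewrite mem_filter => /andP[/andP[n0 n1] _]; rewrite (negbTE n1); congr (_ ^+ _); lia.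
    apply: pos; rewrite map_inj_in_uniq ?filter_uniq // => m n.
    by rewrite !mem_filter => /andP[/andP[m0 m1] _] /andP[/andP[n0 n1] _]; lia.
  rewrite -big_filter; set B := [seq _ <- _ | _].
  have -> : \sum_(n <- B) (if n == 0 then 0 else r ^+ `|n|%N) =
      \sum_(n <- [seq (absz n).-1 | n <- B]) r ^+ n.+1.
    rewrite big_map big_seq [RHS]big_seq; apply: eq_bigr => n.
    rewrite mem_filter => /andP[n0 _]; rewrite ifF; last by apply/negP => /eqP; lia.
    congr (_ ^+ _); lia.
  apply: pos; rewrite map_inj_in_uniq ?filter_uniq // => m n.
  by rewrite !mem_filter => /andP[m0 _] /andP[n0 _]; lia.
apply/negP => /eqP h; move: B; have : csum f = -1.
  by apply/eqP; rewrite -subr_eq0 opprK addrC -E h.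
by move=> ->; rewrite cabsN cabs1; lra.
Qed.

Lemma cmult_scale (P : nat) (t : C) : 0 < complex.Im t -> theta_dual t 0 != 0 ->
  theta_dual (t / P.*2.+1%:R ^+ 2) 0 != 0 ->
  cmult t = cmult (t / P.*2.+1%:R ^+ 2) / P.*2.+1%:R.
Proof.
by move=> t0 h1 h2; rewrite {1}/cmult (theta_inversion _ t0 h2) mulfK.
Qed.

End ThetaInversion.

(** * The hexagonal theta series *)

Section ComplexDerivative.
Variable R : realType.
Local Notation C := (Cplx R).

Section LimitRules.
Variables (T : Type) (F : set_system T) (FF : Filter F).
Implicit Types u v : T -> C.

Lemma cvgC_cst (a : C) : (fun=> a) @ F --> a.
Proof. exact: cvg_cst. Qed.
Lemma cvgC_D u v (a b : C) : u @ F --> a -> v @ F --> b -> (fun x => u x + v x) @ F --> a + b.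
Proof. by move=> h k; exact: (cvgD h k). Qed.
Lemma cvgC_M u v (a b : C) : u @ F --> a -> v @ F --> b -> (fun x => u x * v x) @ F --> a * b.
Proof. by move=> h k; exact: (cvgM h k). Qed.
Lemma cvgC_N u (a : C) : u @ F --> a -> (fun x => - u x) @ F --> - a.
Proof. by move=> h; exact: (cvgN h). Qed.
Lemma cvgC_V u (a : C) : a != 0 -> u @ F --> a -> (fun x => (u x)^-1) @ F --> a^-1.
Proof. by move=> n h; exact: (cvgV n h). Qed.

End LimitRules.

(* Kept as a constant so that unification does not unfold the filter [nbhs 0]. *)
Definition lim0 (u : C -> C) (a : C) : Prop := u @ nbhs (0 : C) --> a.

Lemma lim0P u a : lim0 u a <-> forall e : R, 0 < e -> exists2 d : R, 0 < d &
  forall s, cabs s < d -> cabs (u s - a) < e.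
Proof.
split=> [/(cvgCP (nbhs_filter (0 : C)))h e e0|h].
  have /nbhs_ballP[d /= d0 hd] := h e e0.
  exists (complex.Re d); first by move: d0; rewrite ltcE => /andP[].
  move=> s sd; apply: hd; rewrite -ball_normE /= sub0r normrN normCE.
  by move: d0; rewrite !ltcE /= => /andP[/eqP <- _]; rewrite eqxx.
apply/(cvgCP (nbhs_filter (0 : C))) => e e0; have [d d0 hd] := h e e0.
have d0' : 0 < d%:C%C :> C by rewrite ltcR.
apply: filterS (nbhsx_ballx (0 : C) _ d0') => s.
by rewrite -ball_normE /= sub0r normrN normCE ltcR; exact: hd.
Qed.

Lemma lim0_cst a : lim0 (fun=> a) a.
Proof. by apply/lim0P => e e0; exists 1 => // s _; rewrite subrr cabs0. Qed.
Lemma lim0_id : lim0 id 0.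
Proof. by apply/lim0P => e e0; exists e => // s; rewrite subr0. Qed.
Lemma lim0D u v a b : lim0 u a -> lim0 v b -> lim0 (fun s => u s + v s) (a + b).
Proof. by move=> h k; exact: (cvgC_D (nbhs_filter (0 : C)) h k). Qed.
Lemma lim0M u v a b : lim0 u a -> lim0 v b -> lim0 (fun s => u s * v s) (a * b).
Proof. by move=> h k; exact: (cvgC_M (nbhs_filter (0 : C)) h k). Qed.
Lemma lim0N u a : lim0 u a -> lim0 (fun s => - u s) (- a).
Proof. by move=> h; exact: (cvgC_N (nbhs_filter (0 : C)) h). Qed.
Lemma lim0V u a : a != 0 -> lim0 u a -> lim0 (fun s => (u s)^-1) a^-1.
Proof. by move=> n h; exact: (cvgC_V (nbhs_filter (0 : C)) n h). Qed.
Lemma lim0_comp u v a : lim0 u 0 -> lim0 v a -> lim0 (fun s => v (u s)) a.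
Proof.
move=> /lim0P h /lim0P k; apply/lim0P => e e0.
have [d d0 hd] := k e e0; have [d' d0' hd'] := h d d0.
by exists d' => // s /hd'; rewrite subr0; exact: hd.
Qed.

(* Caratheodory's form of complex differentiability. *)
Definition cdiff (f : C -> C) (z d : C) : Prop :=
  exists phi : C -> C, (forall s, f (z + s) = f z + s * phi s) /\ lim0 phi d.

Lemma cdiff_quadratic (f : C -> C) (z d : C) (K r : R) : 0 < r ->
  (forall s, cabs s <= r -> cabs (f (z + s) - f z - s * d) <= K * cabs s ^+ 2) ->
  cdiff f z d.
Proof.
move=> r0 h; exists (fun s => if s == 0 then d else (f (z + s) - f z) / s); split.
  move=> s; case: eqP => [->|/eqP s0]; first by rewrite mul0r !addr0.
  by rewrite [s * _]mulrC divfK // [RHS]addrC subrK.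
apply/lim0P => e e0.
have K0 : 0 < `|K| + 1 by rewrite ltr_pwDr.
exists (Num.min r (e / (`|K| + 1))); first by rewrite lt_min r0 divr_gt0.
move=> s; case: eqP => [->|/eqP s0]; first by rewrite subrr cabs0.
rewrite lt_min => /andP[/ltW h1 h2].
have cs0 : 0 < cabs s by rewrite cabs_gt0.
have -> : (f (z + s) - f z) / s - d = (f (z + s) - f z - s * d) / s by field.
rewrite cabsM cabsV ltr_pdivrMr //.
apply: le_lt_trans (h s h1) _.
move: h2; rewrite ltr_pdivlMr // => h2.
rewrite expr2 mulrA ltr_pM2r //; apply: le_lt_trans h2.
by rewrite mulrC ler_wpM2l ?cabs_ge0 // (le_trans (ler_norm K)) // lerDl.
Qed.

Lemma cdiff_derivable (f : C -> C) (z d : C) : cdiff f z d -> derivable f z 1.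
Proof.
move=> [phi [h hphi]]; apply: (cvgP d).
have : phi s @[s --> (0 : C)^'] --> d by apply: cvg_trans hphi; apply: cvg_app; exact: nbhs_dnbhs.
apply: cvg_trans; apply: near_eq_cvg; near=> s.
have s0 : s != 0 by near: s; exact: nbhs_dnbhs_neq.
rewrite /= /shift /= [s *: 1]mulr1 [s + z]addrC h addrAC subrr add0r.
by rewrite [_ *: _]mulrA mulVf // mul1r.
Unshelve. all: by end_near. Qed.

Lemma cdiff_cont (f : C -> C) (z d : C) : cdiff f z d -> lim0 (fun s => f (z + s)) (f z).
Proof.
move=> [phi [h hphi]].
rewrite (_ : (fun s => f (z + s)) = (fun s => f z + s * phi s)); last by apply/funext => s.
rewrite -[X in lim0 _ X]addr0 -[X in lim0 _ (_ + X)](mul0r d).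
exact: (lim0D (@lim0_cst _) (lim0M lim0_id hphi)).
Qed.

Lemma cdiffM f g z d e : cdiff f z d -> cdiff g z e ->
  cdiff (fun s => f s * g s) z (d * g z + f z * e).
Proof.
move=> hf hg; have cg := cdiff_cont hg.
move: hf hg => [phi [h hphi]] [psi [k hpsi]].
exists (fun s => phi s * g (z + s) + f z * psi s); split.
  by move=> s; rewrite h [in RHS]k [in LHS]k; ring.
exact: (lim0D (lim0M hphi cg) (lim0M (@lim0_cst _) hpsi)).
Qed.

Lemma cdiffV f z d : cdiff f z d -> f z != 0 ->
  cdiff (fun s => (f s)^-1) z (- d / (f z * f z)).
Proof.
move=> hf n0; have cf := cdiff_cont hf.
move: hf => [phi [h hphi]].
(* Where f(z + s) vanishes its inverse is 0 by convention, which dictates this quotient; continuity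
   excludes the branch for small s. *)
exists (fun s => if f (z + s) == 0 then - (f z)^-1 / s else - phi s * (f (z + s) * f z)^-1); split.
  move=> s; case: eqP => [e|/eqP n1].
    rewrite e invr0; have s0 : s != 0.
      by apply/eqP => s0; move: e n0; rewrite s0 addr0 => ->; rewrite eqxx.
    by rewrite mulrC divfK // subrr.
  move: n1; rewrite h => n1; field; by rewrite n0 n1.
have H := lim0M (lim0N hphi) (lim0V (mulf_neq0 n0 n0) (lim0M cf (@lim0_cst (f z)))).
have /lim0P h1 := cf; have /lim0P h2 := H; apply/lim0P => e e0.
have cz : 0 < cabs (f z) by rewrite cabs_gt0.
have [d1 d10 hd1] := h1 _ cz; have [d2 d20 hd2] := h2 _ e0.
exists (Num.min d1 d2); first by rewrite lt_min d10.
move=> s; rewrite lt_min => /andP[a b]; case: eqP => [e1|_]; last exact: hd2.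
by have := hd1 s a; rewrite e1 sub0r cabsN ltxx.
Qed.

Lemma cdiff_comp f g z d e : cdiff g z d -> cdiff f (g z) e ->
  cdiff (fun s => f (g s)) z (d * e).
Proof.
move=> [phi [h hphi]] [psi [k hpsi]].
exists (fun s => phi s * psi (s * phi s)); split.
  by move=> s; rewrite h k; ring.
apply: (lim0M hphi (lim0_comp _ hpsi)).
by have := lim0M lim0_id hphi; rewrite mul0r.
Qed.

Lemma cdiff_eq f g z d : cdiff f z d -> f =1 g -> cdiff g z d.
Proof. by move=> h /funext <-. Qed.

Lemma cdiff_lin (a b z : C) : cdiff (fun s => a * s + b) z a.
Proof. by exists (fun=> a); split => [s|]; [ring | exact: (@lim0_cst _)]. Qed.

Lemma cdiff_cst (a z : C) : cdiff (fun=> a) z 0.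
Proof. by exists (fun=> 0); split => [s|]; [ring | exact: (@lim0_cst _)]. Qed.

(** Used to pass from the invariance of a function under scalings accumulating at 1 to the vanishing
    of its derivative. *)
Lemma cdiff_seq0 f z d (s : nat -> C) : cdiff f z d ->
  (forall e : R, 0 < e -> exists n, cabs (s n) < e) ->
  (forall n, s n != 0) -> (forall n, f (z + s n) = f z) -> d = 0.
Proof.
move=> [phi [h /lim0P hphi]] hs s0 hf.
have e n : phi (s n) = 0.
  have := hf n; rewrite h => /eqP; rewrite -subr_eq0 addrAC subrr add0r mulf_eq0 (negbTE (s0 n)) /=.
  by move/eqP.
apply/eqP; rewrite -cabs_eq0; apply/negPn/negP => dn0.
have d0 : 0 < cabs d by rewrite lt_neqAle eq_sym dn0 cabs_ge0.
have [r r0 hr] := hphi _ d0; have [n hn] := hs _ r0.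
by have := hr _ hn; rewrite e sub0r cabsN ltxx.
Qed.

(** The real mean value theorem along the segment, for the real and the imaginary part; [L] stands
    for either. *)
Lemma cdiff_const_segment (f : C -> C) (z0 z1 : C) :
  (forall t : R, 0 <= t <= 1 -> cdiff f (z0 + t%:C%C * (z1 - z0)) 0) -> f z0 = f z1.
Proof.
move=> h; pose p (t : R) : C := z0 + t%:C%C * (z1 - z0).
have key (L : C -> R) : (forall a b, L (a + b) = L a + L b) -> (forall a, `|L a| <= cabs a) ->
    (forall a (t : R), L (t%:C%C * a) = t * L a) -> L (f z0) = L (f z1).
  move=> LD Lb LZ; pose g t := L (f (p t)).
  have LN a : L (- a) = - L a.
    by have := LZ a (-1); rewrite rmorphN rmorph1 !mulN1r.
  have d (t : R^o) : 0 <= t <= 1 -> is_derive t 1 g 0.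
    move=> t01; have [phi [hp /lim0P hphi]] := h t t01.
    have c : (fun u : R => u^-1 *: ((g \o shift t) (u *: (1 : R)) - g t)) @ (0 : R)^' --> (0 : R).
      apply/cvgrPdist_lt => e e0.
      have cz : 0 < cabs (z1 - z0) + 1 by have := cabs_ge0 (z1 - z0); lra.
      have [r r0 hr] := hphi _ (divr_gt0 e0 cz).
      near=> u.
      have u0 : u != 0 by near: u; exact: nbhs_dnbhs_neq.
      have ur : `|u| < r / (cabs (z1 - z0) + 1).
        near: u; apply: nbhs_dnbhs.
        exact: (@cvgr0_norm_lt _ _ _ _ _ (@idfun R) cvg_id _ (divr_gt0 r0 cz)).
      rewrite sub0r normrN /= /shift /= [u *: 1]mulr1 /g /p.
      have -> : z0 + (u + t)%:C%C * (z1 - z0) = z0 + t%:C%C * (z1 - z0) + u%:C%C * (z1 - z0).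
        by rewrite rmorphD /=; ring.
      rewrite hp LD addrAC subrr add0r -mulrA LZ [_ *: _]mulrA mulVf // mul1r.
      apply: le_lt_trans (Lb _) _; rewrite cabsM.
      have : cabs (phi (u%:C%C * (z1 - z0)) - 0) < e / (cabs (z1 - z0) + 1).
        apply: hr; rewrite cabsM cabs_real.
        apply: le_lt_trans (_ : `|u| * (cabs (z1 - z0) + 1) < r).
          by rewrite ler_wpM2l // lerDl.
        by rewrite -ltr_pdivlMr.
      rewrite subr0 ltr_pdivlMr // mulrC; apply: le_lt_trans.
      by rewrite ler_wpM2r ?cabs_ge0 // lerDl.
    by apply: DeriveDef; [exact: cvgP c | exact: cvg_lim c].
  have [||t _] := @MVT R g (fun=> 0) 0 1 ltr01.
  - by move=> t; rewrite in_itv /= => /andP[a b]; apply: d; rewrite !ltW.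
  - apply: derivable_within_continuous => t; rewrite in_itv /= => t01.
    by have := d t t01 => dd; exact: ex_derive.
  rewrite mul0r /g /p mul0r addr0 mul1r [z0 + _]addrC subrK => /eqP.
  by rewrite subr_eq0 => /eqP ->.
have e1 : complex.Re (f z0) = complex.Re (f z1).
  apply: key; [exact: ReD | exact: cabs_Re | by move=> a t; exact: ReZ].
have e2 : complex.Im (f z0) = complex.Im (f z1).
  apply: key; [exact: ImD | exact: cabs_Im | by move=> a t; exact: ImZ].
by apply/eqP; rewrite eq_complex e1 e2 !eqxx.
Unshelve. all: by end_near. Qed.

End ComplexDerivative.

(** * Holomorphy of exponential series *)

Section ExponentialSeries.
Variable R : realType.
Local Notation C := (Cplx R).
Variables (I : eqType) (a : I -> C) (w : I -> R).
Hypothesis w0 : forall i, 0 <= w i.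
Hypothesis hsum : forall y : R, 0 < y -> bsum (fun i => cabs (a i) * expR (- (2 * pi * (w i * y)))).

Definition eser (z : C) : C := csum (fun i => a i * e2ipi ((w i)%:C%C * z)).

Lemma cabs_eser_term z i :
  cabs (a i * e2ipi ((w i)%:C%C * z)) = cabs (a i) * expR (- (2 * pi * (w i * complex.Im z))).
Proof. by rewrite cabsM cabs_e2ipi ImZ. Qed.

Lemma asum_eser z : 0 < complex.Im z -> asum (fun i => a i * e2ipi ((w i)%:C%C * z)).
Proof. by move=> z0; apply: bsum_le (hsum z0) => i; rewrite cabs_eser_term. Qed.

(** Of the decay at height y, one half is kept for summability at height y/2; the other half, split
    as two factors [expR (x i)], pays for the powers of [w i] and for the exponential in the Taylor
    remainder when |s| <= y/4. *)
Lemma eser_diff z : 0 < complex.Im z -> exists d, cdiff eser z d.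
Proof.
move=> z0; set y := complex.Im z in z0.
pose x i := 2 * pi * w i * (y / 4).
have x0 i : 0 <= x i by rewrite /x !mulr_ge0 ?pi_ge0 //; lra.
have y2 : 0 < y / 2 by lra.
pose b i := cabs (a i) * expR (- (2 * pi * (w i * (y / 2)))).
have hb : bsum b := hsum y2.
have ebb i : expR (- (2 * pi * (w i * y))) * (expR (x i) * expR (x i)) =
    expR (- (2 * pi * (w i * (y / 2)))).
  by rewrite -!expRD; congr (expR _); rewrite /x; field.
have wle i : 2 * pi * w i <= (4 / y) * expR (x i).
  have := expR_ge1Dx (x i); have -> : 2 * pi * w i = (4 / y) * x i by rewrite /x; field; lra.
  move=> h; rewrite ler_wpM2l ?divr_ge0 //; lra.
pose d i : C := twopii R * (w i)%:C%C * (a i * e2ipi ((w i)%:C%C * z)).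
have e1 i : 1 <= expR (x i) by rewrite -expR0 ler_expR.
have db i : cabs (d i) <= (4 / y) * b i.
  rewrite /d 2!cabsM cabs_eser_term -/y cabs_twopii cabs_real (ger0_norm (w0 i)).
  rewrite /b -ebb.
  rewrite [X in X <= _]mulrCA [X in _ <= X]mulrCA ler_wpM2l ?cabs_ge0 //.
  rewrite [X in _ <= X]mulrCA [X in X <= _]mulrC ler_wpM2l ?expR_ge0 //.
  apply: le_trans (wle i) _; rewrite ler_wpM2l ?divr_ge0 //; first lra.
  by rewrite ler_peMl ?expR_ge0.
have ad : asum d by apply: asum_le db _; apply: bsumZ; rewrite // divr_ge0 //; lra.
have az := asum_eser z0.
exists (csum d).
have [M HM] := hb.
apply: (@cdiff_quadratic _ _ _ _ (64 / y ^+ 2 * M) (y / 4)); first lra.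
move=> s hs.
have zs0 : 0 < complex.Im (z + s).
  rewrite ImD -/y; have := cabs_Im s; rewrite ler_norml => /andP[h _]; lra.
have azs := asum_eser zs0; have ads := asumZ s ad.
rewrite /eser -csumZ // -csumB // -csumB //; last exact: asumB.
apply: csum_le => A uA.
apply: (@le_trans _ _ (\sum_(i <- A) 64 / y ^+ 2 * cabs s ^+ 2 * b i)); last first.
  rewrite -mulr_sumr [leRHS]mulrAC ler_wpM2l ?HM // mulr_ge0 ?divr_ge0 ?sqr_ge0 //.
apply: ler_sum => i _.
pose u := twopii R * ((w i)%:C%C * s).
have -> : a i * e2ipi ((w i)%:C%C * (z + s)) - a i * e2ipi ((w i)%:C%C * z) - s * d i =
   a i * e2ipi ((w i)%:C%C * z) * (cexp u - 1 - u).
  by rewrite mulrDr e2ipiD [e2ipi (_ * s)]/e2ipi -/(twopii R) -/u /d /u; ring.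
rewrite cabsM cabs_eser_term -/y /b -ebb.
set ey := expR (- (2 * pi * (w i * y))); set ex := expR (x i) in ebb e1 *.
have -> : 64 / y ^+ 2 * cabs s ^+ 2 * (cabs (a i) * (ey * (ex * ex))) =
  cabs (a i) * (ey * (64 / y ^+ 2 * cabs s ^+ 2 * (ex * ex))) by ring.
rewrite -[leLHS]mulrA ler_wpM2l ?cabs_ge0 // ler_wpM2l ?expR_ge0 //.
apply: le_trans (cexp_taylor1 u) _.
have cu : cabs u = 2 * pi * w i * cabs s.
  by rewrite /u !cabsM cabs_twopii cabs_real (ger0_norm (w0 i)) !mulrA.
have ux : cabs u <= x i.
  by rewrite cu /x ler_wpM2l // !mulr_ge0 ?pi_ge0.
have h1 : expR (cabs u) <= expR (x i) by rewrite ler_expR.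
have h2 : cabs u ^+ 2 <= cabs s ^+ 2 * (16 / y ^+ 2) * (2 * expR (x i)).
  have -> : cabs u ^+ 2 = cabs s ^+ 2 * (16 / y ^+ 2) * x i ^+ 2.
    by rewrite cu /x; field; lra.
  by rewrite ler_wpM2l ?expR_ge_sq // mulr_ge0 ?divr_ge0 ?sqr_ge0.
apply: (@le_trans _ _ (2 * ((cabs s ^+ 2 * (16 / y ^+ 2) * (2 * expR (x i))) * expR (x i)))).
  by rewrite ler_wpM2l // ler_pM ?sqr_ge0 ?expR_ge0.
by rewrite -/ex le_eqVlt; apply/orP; left; apply/eqP; move: (ex) => e0; field; lra.
Qed.

End ExponentialSeries.

(** * Constancy of the product of two multipliers *)

Section ThetaMultiplier.
Variable R : realType.
Local Notation C := (Cplx R).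

Definition theta0 (z : C) : C :=
  eser (fun _ : int => 1) (fun n : int => n%:~R ^+ 2 / 2) z.

Lemma bsum_theta0 (y : R) : 0 < y ->
  bsum (fun n : int => cabs (1 : C) * expR (- (2 * pi * (n%:~R ^+ 2 / 2 * y)))).
Proof.
move=> y0; have := bsum_gau 0 (mulr_gt0 (pi_gt0 R) y0).
apply: bsum_le => n; rewrite cabs1 mul1r /gau ler_expR mul0r sub0r le_eqVlt.
by apply/orP; left; apply/eqP; field.
Qed.

Lemma theta0E (t : C) : theta t 0 0 = theta0 t.
Proof.
apply: eq_csum => n; rewrite /thterm mul1r; congr e2ipi.
by rewrite rmorphM rmorphXn fmorphV /= rmorph_int rmorph_nat; field.
Qed.

Lemma theta_dual0E (t : C) : 0 < complex.Im t -> theta_dual t 0 = theta0 (- t^-1).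
Proof. by move=> t0; rewrite theta_dualE // expr0n mulr0 mul0r e2ipi0 mul1r mulr0 theta0E. Qed.

Lemma theta0_diff (z : C) : 0 < complex.Im z -> exists d, cdiff theta0 z d.
Proof.
apply: eser_diff; last exact: bsum_theta0.
by move=> n; rewrite divr_ge0 ?sqr_ge0.
Qed.

Lemma Im_inv_scale (r : R) (z : C) :
  complex.Im (- (r%:C%C * z)^-1) = complex.Im (- z^-1) / r.
Proof. by rewrite invfM -mulrN -fmorphV ImZ mulrC. Qed.

(** The region is the disk of centre i/4 tangent to the real axis at 0. Its convexity is what
    [multE_const] relies on. *)
Lemma inv_regionP (z : C) : (2 < complex.Im (- z^-1)) =
  (2 * (complex.Re z ^+ 2 + complex.Im z ^+ 2) < complex.Im z).
Proof.
case: z => x y; rewrite Im_inv_opp /cabs /= sqr_sqrtr ?addr_ge0 ?sqr_ge0 //.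
have [h|h] := eqVneq (x ^+ 2 + y ^+ 2) 0.
  rewrite h invr0 !mulr0.
  have y0 : y = 0.
    by apply/eqP; rewrite -sqrf_eq0 eq_le sqr_ge0 andbT -h lerDr sqr_ge0.
  by rewrite y0 ltxx; apply/negbTE; rewrite -leNgt.
by rewrite ltr_pdivlMr // lt_neqAle eq_sym h addr_ge0 ?sqr_ge0.
Qed.

(** On the region below this is z c(2z) c(3z/2) with c = [cmult], written through theta values so as
    to be visibly holomorphic. The parameters come from u^2 + u v + v^2 = (u + v/2)^2 + 3 v^2 /
    4. *)
Definition multE (z : C) : C :=
  z * (theta0 (2 * z) * theta0 (3 / 2 * z)) *
    (theta0 (- (2 * z)^-1) * theta0 (- (3 / 2 * z)^-1))^-1.

Lemma two_C : (2 : C) = (2 : R)%:C%C. Proof. by rewrite rmorph_nat. Qed.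
Lemma thalf_C : (3 / 2 : C) = (3 / 2 : R)%:C%C.
Proof. by rewrite rmorphM fmorphV /= !rmorph_nat. Qed.

Section Region.
Variable z : C.
Hypothesis hz : (2 : R) < complex.Im (- z^-1).

Lemma region_gt0 : 0 < complex.Im z.
Proof.
have : (0 : R) < complex.Im (- z^-1) by apply: lt_trans hz.
by move/Im_inv_opp_gt0; rewrite invrN invrK opprK.
Qed.

Lemma region2 : 0 < complex.Im (2 * z) /\ 0 < complex.Im (3 / 2 * z).
Proof.
have z0 := region_gt0.
by rewrite thalf_C two_C !ImZ; split; rewrite mulr_gt0 //; lra.
Qed.

Lemma region_neq0 : theta_dual (2 * z) 0 != 0 /\ theta_dual (3 / 2 * z) 0 != 0.
Proof.
have h := hz.
by split; apply: theta_dual_neq0; rewrite ?thalf_C ?two_C Im_inv_scale ler_pdivlMr //; lra.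
Qed.

Lemma multEE : multE z = z * (cmult (2 * z) * cmult (3 / 2 * z)).
Proof.
have [h1 h2] := region2.
rewrite /multE /cmult !theta0E !theta_dual0E // invfM.
by move: (theta0 _)^-1 (theta0 _)^-1 (theta0 _) (theta0 _) => a b c d; ring.
Qed.

Lemma multE_diff : exists d, cdiff multE z d.
Proof.
have [h1 h2] := region2; have [n1 n2] := region_neq0.
rewrite !theta_dual0E // in n1 n2.
have l1 : cdiff (fun s => 2 * s) z 2 by apply: cdiff_eq (cdiff_lin _ 0 _) _ => s; rewrite addr0.
have l2 : cdiff (fun s => 3 / 2 * s) z (3 / 2) by apply: cdiff_eq (cdiff_lin _ 0 _) _ => s; rewrite addr0.
have l0 : cdiff (fun s => s) z 1 by apply: cdiff_eq (cdiff_lin _ 0 _) _ => s; rewrite addr0 mul1r.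
have [d1 D1] := theta0_diff h1; have [d2 D2] := theta0_diff h2.
have [d3 D3] := theta0_diff (Im_inv_opp_gt0 h1).
have [d4 D4] := theta0_diff (Im_inv_opp_gt0 h2).
have v1 := cdiffV l1 (tneq0 h1); have v2 := cdiffV l2 (tneq0 h2).
have o (u : C) : cdiff (fun s => - s) u (-1).
  by apply: cdiff_eq (cdiff_lin (-1) 0 u) _ => s; rewrite addr0 mulN1r.
have E3 := cdiff_comp (cdiff_comp v1 (o _)) D3.
have E4 := cdiff_comp (cdiff_comp v2 (o _)) D4.
have E := cdiffM (cdiffM l0 (cdiffM (cdiff_comp l1 D1) (cdiff_comp l2 D2)))
  (cdiffV (cdiffM E3 E4) (mulf_neq0 n1 n2)).
by eexists; exact: E.
Qed.

(** The points u / (2n+1)^2 and r u / (2n+3)^2 coincide, so both multipliers reduce by [cmult_scale]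
    to the multiplier at one point. *)
Lemma cmult_ratio (n : nat) (u : C) : 0 < complex.Im u ->
  let r : R := (n.*2.+3%:R / n.*2.+1%:R) ^+ 2 in
  1 <= complex.Im (- u^-1) -> r <= complex.Im (- u^-1) ->
  cmult (r%:C%C * u) = cmult u * (n.*2.+1%:R / n.*2.+3%:R).
Proof.
move=> u0 r hu1 hur.
pose p' : C := n.*2.+1%:R; pose p : C := n.*2.+3%:R.
have p0 : p != 0 by rewrite pnatr_eq0.
have p0' : p' != 0 by rewrite pnatr_eq0.
have rC : r%:C%C = (p / p') ^+ 2 :> C.
  by rewrite /r rmorphXn rmorphM fmorphV /= !rmorph_nat.
have r0 : 0 < r by rewrite /r exprn_gt0 // divr_gt0 // ltr0n.
have ru0 : 0 < complex.Im (r%:C%C * u) by rewrite ImZ mulr_gt0.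
have n1 : theta_dual u 0 != 0 by apply: theta_dual_neq0.
have n2 : theta_dual (r%:C%C * u) 0 != 0.
  by apply: theta_dual_neq0; rewrite Im_inv_scale ler_pdivlMr // mul1r.
have sc (q : nat) : (0 < q)%N -> u / q%:R ^+ 2 = ((q%:R ^- 2 : R))%:C%C * u.
  by move=> q0; rewrite fmorphV rmorphXn rmorph_nat mulrC.
have n3 : theta_dual (u / n.*2.+1%:R ^+ 2) 0 != 0.
  apply: theta_dual_neq0; rewrite sc // Im_inv_scale invrK.
  apply: le_trans hu1 _; rewrite ler_peMr //; first lra.
  by rewrite -natrX ler1n expn_gt0.
have E1 := cmult_scale u0 n1 n3.
have e2 : r%:C%C * u / n.+1.*2.+1%:R ^+ 2 = u / n.*2.+1%:R ^+ 2.
  rewrite rC -/p -/p'; clearbody p p'; field; by rewrite p0 p0'.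
have n4 : theta_dual (r%:C%C * u / n.+1.*2.+1%:R ^+ 2) 0 != 0 by rewrite e2.
have E2 := cmult_scale ru0 n2 n4.
rewrite e2 in E2.
rewrite E2 E1 -/p -/p'; clearbody p p'; field; by rewrite p0 p0'.
Qed.

(** Each of the two multipliers contributes (2n+1)/(2n+3), and their product cancels the factor r of
    r z. *)
Lemma multE_ratio (n : nat) :
  let r : R := (n.*2.+3%:R / n.*2.+1%:R) ^+ 2 in
  2 * r < complex.Im (- z^-1) -> multE (r%:C%C * z) = multE z.
Proof.
move=> r hr; have [h1 h2] := region2.
have r1 : 1 <= r.
  rewrite /r exprn_ege1 // ler_pdivlMr ?ltr0n // mul1r ler_nat; lia.
have rz : 2 < complex.Im (- (r%:C%C * z)^-1).
  by rewrite Im_inv_scale ltr_pdivlMr //; lra.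
have rC : r%:C%C = (n.*2.+3%:R / n.*2.+1%:R) ^+ 2 :> C.
  by rewrite /r rmorphXn rmorphM fmorphV /= !rmorph_nat.
rewrite multEE.
have -> : multE (r%:C%C * z) = r%:C%C * z * (cmult (r%:C%C * (2 * z)) * cmult (r%:C%C * (3 / 2 * z))).
  rewrite /multE /cmult !theta0E; have [h3 h4] : 0 < complex.Im (2 * (r%:C%C * z)) /\ 0 < complex.Im (3 / 2 * (r%:C%C * z)).
    have z0 := region_gt0.
    by rewrite thalf_C two_C !ImZ; split; rewrite !mulr_gt0 //; lra.
  rewrite ![r%:C%C * (_ * z)]mulrCA !theta_dual0E // invfM.
  by move: (theta0 _)^-1 (theta0 _)^-1 (theta0 _) (theta0 _) => a b c d; ring.
have hz' := hz.
have [a1 a2] : 1 <= complex.Im (- (2 * z)^-1) /\ r <= complex.Im (- (2 * z)^-1).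
  by rewrite two_C Im_inv_scale; split; rewrite ler_pdivlMr //; lra.
have [b1 b2] : 1 <= complex.Im (- (3 / 2 * z)^-1) /\ r <= complex.Im (- (3 / 2 * z)^-1).
  by rewrite thalf_C Im_inv_scale; split; rewrite ler_pdivlMr //; lra.
rewrite (cmult_ratio h1 a1 a2) (cmult_ratio h2 b1 b2) rC.
set p : C := n.*2.+3%:R; set p' : C := n.*2.+1%:R.
have p0 : p != 0 by rewrite pnatr_eq0.
have p0' : p' != 0 by rewrite pnatr_eq0.
move: (cmult (2 * z)) (cmult (3 / 2 * z)) => x y.
clearbody p p'; field; by rewrite p0 p0'.
Qed.

(** The ratios ((2n+3)/(2n+1))^2 tend to 1, so the value at z is repeated at points accumulating at
    z. *)
Lemma multE_diff0 : cdiff multE z 0.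
Proof.
have [d D] := multE_diff.
suff -> : 0 = d by [].
have z0 := region_gt0; have zn0 := tneq0 z0.
pose Y := complex.Im (- z^-1); have hY : 2 < Y := hz.
pose rr n : R := (n.*2.+3%:R / n.*2.+1%:R) ^+ 2.
have rE n : rr n - 1 <= 8 / n.*2.+1%:R /\ 1 < rr n.
  have h : 1 <= n.*2.+1%:R :> R by rewrite ler1n.
  have -> : rr n = (1 + 2 / n.*2.+1%:R) ^+ 2.
    rewrite /rr; congr (_ ^+ 2); rewrite (_ : n.*2.+3 = n.*2.+1 + 2)%N; last by lia.
    by rewrite natrD; field; lra.
  set q : R := _%:R in h *.
  have -> : 8 / q = 4 * (2 / q) by field; lra.
  have : 0 < 2 / q by rewrite divr_gt0 //; lra.
  have : 2 / q <= 2 by rewrite ler_pdivrMr; lra.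
  move: (2 / q) => x h1 h2; split; nra.
have small (e : R) : 0 < e -> exists N, forall n, (N <= n)%N -> rr n - 1 < e.
  move=> e0; have [N _ hN] := near_small 8 e0; exists N => n hn.
  by have [h _] := rE n; apply: le_lt_trans h _; exact: hN.
have Y0 : 0 < Y / 2 - 1 by lra.
have [N hN] := small _ Y0.
pose s n : C := (rr (N + n) - 1)%:C%C * z.
apply/esym/(cdiff_seq0 D (s := s)).
- move=> e e0; have cz : 0 < cabs z by rewrite cabs_gt0.
  have [M hM] := small _ (divr_gt0 e0 cz); exists M.
  have [_ h1] := rE (N + M)%N; have := hM (N + M)%N (leq_addl _ _).
  by rewrite /s cabsM cabs_real ger0_norm ?ltr_pdivlMr //; lra.
- move=> n; rewrite /s mulf_neq0 // -(rmorph0 (real_complex R)) (inj_eq (@complexI R)).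
  have [_ h1] := rE (N + n)%N; apply/eqP; lra.
- move=> n; have -> : z + s n = (rr (N + n))%:C%C * z.
    by rewrite /s rmorphB rmorph1; ring.
  by apply: multE_ratio; have := hN (N + n)%N (leq_addr _ _); rewrite -/(rr _) -/Y; lra.
Qed.

End Region.

Lemma multE_const (z0 z1 : C) : 2 < complex.Im (- z0^-1) -> 2 < complex.Im (- z1^-1) ->
  multE z0 = multE z1.
Proof.
move=> h0 h1; apply: cdiff_const_segment => t /andP[t0 t1].
apply: multE_diff0; move: h0 h1; rewrite !inv_regionP.
case: z0 z1 => x0 y0 [x1 y1] /=; rewrite !mul0r !subr0 !addr0 => h0 h1.
have hx := mulr_ge0 (mulr_ge0 t0 (_ : 0 <= 1 - t)) (sqr_ge0 (x1 - x0)).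
have hy := mulr_ge0 (mulr_ge0 t0 (_ : 0 <= 1 - t)) (sqr_ge0 (y1 - y0)).
have t2 : 0 <= 1 - t by lra.
have {}hx := hx t2; have {}hy := hy t2.
have a1 : (1 - t) * (2 * (x0 ^+ 2 + y0 ^+ 2) - y0) <= 0 by nra.
have [te|tp] := eqVneq t 0; first by rewrite te; nra.
have tp' : 0 < t by rewrite lt_neqAle eq_sym tp.
have a2 : t * (2 * (x1 ^+ 2 + y1 ^+ 2) - y1) < 0 by nra.
nra.
Qed.

(** The base point is the centre of the disk; the classical value of the constant is i / sqrt(3). *)
Definition kappa : C := multE (Complex 0 (1 / 4)).

Lemma multE_kappa (z : C) : 2 < complex.Im (- z^-1) -> multE z = kappa.
Proof. by move=> h; apply: multE_const => //; rewrite inv_regionP /=; lra. Qed.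

(** P is taken so large that z / (2P+1)^2 falls into the disk. Separately [c1] and [c2] hide square
    roots; their product is explicit. *)
Lemma theta_multipliers (z : C) : 0 < complex.Im z -> exists c1 c2 : C,
  [/\ c1 * c2 = kappa / z, forall x, theta (2 * z) 0 x = c1 * theta_dual (2 * z) x
    & forall x, theta (3 / 2 * z) 0 x = c2 * theta_dual (3 / 2 * z) x].
Proof.
move=> z0; have zn0 := tneq0 z0.
set Y := complex.Im (- z^-1); have Y0 : 0 < Y by exact: Im_inv_opp_gt0.
have [P hP] : exists P : nat, 2 / Y < P.*2.+1%:R.
  exists (Num.Def.archi_bound (2 / Y)).
  apply: lt_trans (archi_boundP _) _; first by rewrite divr_ge0 // ltW.
  by rewrite ltr_nat; lia.
set q : R := P.*2.+1%:R in hP.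
have q1 : 1 <= q by rewrite ler1n.
pose p : C := P.*2.+1%:R; have pn0 : p != 0 by rewrite pnatr_eq0.
have pq : p ^- 2 = (q ^- 2)%:C%C by rewrite fmorphV rmorphXn rmorph_nat.
have reg : 2 < complex.Im (- (z / p ^+ 2)^-1).
  rewrite [z / _]mulrC pq Im_inv_scale invrK -/Y.
  move: hP; rewrite ltr_pdivrMr //; nra.
have [h1 h2] := region2 reg; have [n1 n2] := region_neq0 reg.
have s1 : 2 * (z / p ^+ 2) = 2 * z / p ^+ 2 by rewrite mulrA.
have s2 : 3 / 2 * (z / p ^+ 2) = 3 / 2 * z / p ^+ 2 by rewrite mulrA.
have t1 : 0 < complex.Im (2 * z) by rewrite two_C ImZ mulr_gt0.
have t2 : 0 < complex.Im (3 / 2 * z) by rewrite thalf_C ImZ mulr_gt0 //; lra.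
exists (cmult (2 * z / p ^+ 2) / p), (cmult (3 / 2 * z / p ^+ 2) / p); split.
- have := multE_kappa reg; rewrite multEE // s1 s2.
  move: (cmult _) (cmult _) => a b <-; clearbody p; field; by rewrite zn0 pn0.
- by move=> x; rewrite s1 in n1; exact: (theta_inversion x t1 n1).
- by move=> x; rewrite s2 in n2; exact: (theta_inversion x t2 n2).
Qed.

End ThetaMultiplier.

(** * Poisson summation on the hexagonal lattice *)

Section HexagonalPoisson.
Variable R : realType.
Local Notation C := (Cplx R).

Definition hexQ (u v : C) : C := u ^+ 2 + u * v + v ^+ 2.

Lemma three_C : (3 : C) = (3 : R)%:C%C. Proof. by rewrite rmorph_nat. Qed.

Lemma asum_hex (z A B : C) (e : int) : 0 < complex.Im z -> `|e| <= 1 ->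
  asum (fun p : int * int => e2ipi (z * (p.1%:~R ^+ 2 + e%:~R * p.1%:~R * p.2%:~R + p.2%:~R ^+ 2)
     + A * p.1%:~R + B * p.2%:~R)).
Proof.
move=> z0 e1.
pose a := pi * complex.Im z; pose b1 := 2 * pi * cabs A; pose b2 := 2 * pi * cabs B.
have a0 : 0 < a by rewrite mulr_gt0 ?pi_gt0.
apply: asum_le (bsum_prod (gau_ge0 a b1) (gau_ge0 a b2) (bsum_gau b1 a0) (bsum_gau b2 a0)).
move=> [m n] /=; rewrite cabs_e2ipi /gau -expRD ler_expR !ImD.
set x : R := m%:~R; set y : R := n%:~R; set ee : R := e%:~R.
have ee1 : `|ee| <= 1 by rewrite /ee -intr_norm -(ler_int R) in e1 *.
have -> : complex.Im (z * (m%:~R ^+ 2 + e%:~R * m%:~R * n%:~R + n%:~R ^+ 2)) =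
    (x ^+ 2 + ee * x * y + y ^+ 2) * complex.Im z.
  by rewrite mulrC -ImZ !rmorphD !rmorphM /= !rmorph_int.
have -> : complex.Im (A * m%:~R) = x * complex.Im A by rewrite mulrC real_int ImZ.
have -> : complex.Im (B * n%:~R) = y * complex.Im B by rewrite mulrC real_int ImZ.
have hA : - (x * complex.Im A) <= cabs A * `|x|.
  apply: le_trans (ler_norm _) _; rewrite normrN normrM mulrC.
  by rewrite ler_wpM2r // cabs_Im.
have hB : - (y * complex.Im B) <= cabs B * `|y|.
  apply: le_trans (ler_norm _) _; rewrite normrN normrM mulrC.
  by rewrite ler_wpM2r // cabs_Im.
have hq : (x ^+ 2 + y ^+ 2) / 2 <= x ^+ 2 + ee * x * y + y ^+ 2.
  move: ee1; rewrite ler_norml => /andP[l1 l2].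
  have h1 := sqr_ge0 (x + y); have h2 := sqr_ge0 (x - y).
  nra.
have h3 := ler_wpM2r (ltW z0) hq.
have p0 := pi_gt0 R; rewrite /a /b1 /b2; nra.
Qed.

Variable z : C.
Hypothesis z0 : 0 < complex.Im z.

Lemma asum_hexQ (X Y : C) :
  asum (fun p : int * int => e2ipi (z * hexQ (p.1%:~R + X) (p.2%:~R + Y))).
Proof.
have := asumZ (e2ipi (z * hexQ X Y)) (asum_hex (z * (2 * X + Y)) (z * (X + 2 * Y)) z0 (isT : `|1%Z| <= 1)).
apply: bsum_le => -[a b] /=; rewrite le_eqVlt; apply/orP; left; apply/eqP.
by rewrite -e2ipiD; congr (cabs (e2ipi _)); rewrite /hexQ; ring.
Qed.

Lemma asum_hexQ_dual (X Y : C) :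
  asum (fun p : int * int => e2ipi (- ((3 * z)^-1) * hexQ p.1%:~R p.2%:~R
    + (p.1%:~R * Y - p.2%:~R * X))).
Proof.
have h : 0 < complex.Im (- (3 * z)^-1).
  by apply: Im_inv_opp_gt0; rewrite three_C ImZ mulr_gt0.
have := asum_hex Y (- X) h (isT : `|1%Z| <= 1).
apply: bsum_le => -[a b] /=; rewrite le_eqVlt; apply/orP; left; apply/eqP.
by congr (cabs (e2ipi _)); rewrite /hexQ; ring.
Qed.

(** With the square completed in the first variable, inversion is applied there with parameter 2z;
    after exchanging the sums, completing the square in the second variable allows inversion with
    parameter 3z/2. The two multipliers combine to kappa / z. *)
Lemma hex_poisson (X Y : C) :
  csum (fun p : int * int => e2ipi (z * hexQ (p.1%:~R + X) (p.2%:~R + Y))) =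
  kappa R / z * csum (fun p : int * int => e2ipi (- ((3 * z)^-1) * hexQ p.1%:~R p.2%:~R
    + (p.1%:~R * Y - p.2%:~R * X))).
Proof.
have zn0 := tneq0 z0.
have [c1 [c2 [cc t1 t2]]] := theta_multipliers z0.
have z1 : 0 < complex.Im (2 * z) by rewrite two_C ImZ mulr_gt0.
have z2 : 0 < complex.Im (3 / 2 * z) by rewrite thalf_C ImZ mulr_gt0 //; lra.
(* The summand after the first inversion. By [GE] it is a product of two one-variable terms up to a
   sign e(m b / 2), which gives absolute convergence. *)
pose G (b m : int) : C := vterm (2 * z) (X + (b%:~R + Y) / 2) m * e2ipi (3 / 4 * z * (b%:~R + Y) ^+ 2).
have GE b m : G b m = vterm (2 * z) (X + Y / 2) m * thterm (3 / 2 * z) 0 Y b * e2ipi (m%:~R * b%:~R / 2).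
  by rewrite /G /vterm /thterm -!e2ipiD; congr e2ipi; field.
have aG : asum (fun p : int * int => G p.1 p.2).
  apply: asum_le (bsum_prod (fun b => cabs_ge0 (thterm (3 / 2 * z) 0 Y b))
    (fun m => cabs_ge0 (vterm (2 * z) (X + Y / 2) m)) (asum_thtermT z2 0 Y)
    (asum_vterm (X + Y / 2) z1)) => -[b m] /=.
  rewrite GE cabsM (_ : cabs (e2ipi _) = 1) ?mulr1 ?cabsM 1?mulrC //.
  rewrite cabs_e2ipi !real_int -rmorphM two_C -fmorphV -rmorphM /=.
  by rewrite mulr0 oppr0 expR0.
have s1 : csum (fun p : int * int => e2ipi (z * hexQ (p.1%:~R + X) (p.2%:~R + Y))) =
    c1 * csum (fun b => csum (G b)).
  have K1 : cancel (fun p : int * int => (p.2, p.1)) (fun p : int * int => (p.2, p.1)) by case.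
  rewrite (csum_bij K1 K1 (asum_hexQ X Y)) csum_fubini; last first.
    exact: (asum_inj (can_inj K1) (asum_hexQ X Y)).
  rewrite -csumZ; last exact: (asum_csum_row aG).
  apply: eq_csum => b /=.
  transitivity (e2ipi (3 / 4 * z * (b%:~R + Y) ^+ 2) * theta (2 * z) 0 (X + (b%:~R + Y) / 2)).
    rewrite /theta -csumZ; last exact: asum_thtermT.
    by apply: eq_csum => a; rewrite /thterm -e2ipiD; congr e2ipi; rewrite /hexQ; field.
  rewrite t1 mulrCA; congr (_ * _); rewrite /theta_dual -csumZ; last exact: asum_vterm.
  by apply: eq_csum => m; rewrite /G mulrC.
(* The summand after the second inversion; up to (l, -m) it is the summand of the dual lattice. *)
pose H (m l : int) : C := e2ipi (m%:~R * X - m%:~R ^+ 2 / (3 * z)) * vterm (3 / 2 * z) (Y + m%:~R / (3 * z)) l.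
have HE m l : H m l = e2ipi (- ((3 * z)^-1) * hexQ l%:~R (- m)%:~R
    + (l%:~R * Y - (- m)%:~R * X)).
  by rewrite /H /vterm -e2ipiD; congr e2ipi; rewrite /hexQ rmorphN /=; field.
have aD := asum_hexQ_dual X Y.
have K2 : cancel (fun p : int * int => (p.2, - p.1)) (fun p : int * int => (- p.2, p.1)).
  by case=> m l /=; rewrite opprK.
have K3 : cancel (fun p : int * int => (- p.2, p.1)) (fun p : int * int => (p.2, - p.1)).
  by case=> m l /=; rewrite opprK.
have aH : asum (fun p : int * int => H p.1 p.2).
  by apply: bsum_le (asum_inj (can_inj K2) aD) => -[m l] /=; rewrite HE.
have s2 : csum (fun b => csum (G b)) = c2 * csum (fun m => csum (H m)).
  rewrite (csum_swap aG) -csumZ; last exact: (asum_csum_row aH).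
  apply: eq_csum => m.
  transitivity (e2ipi (m%:~R * X - m%:~R ^+ 2 / (3 * z)) * theta (3 / 2 * z) 0 (Y + m%:~R / (3 * z))).
    rewrite /theta -csumZ; last exact: asum_thtermT.
    by apply: eq_csum => b; rewrite /G /vterm /thterm -!e2ipiD; congr e2ipi; field.
  rewrite t2 mulrCA; congr (_ * _); rewrite /theta_dual -csumZ //; exact: asum_vterm.
rewrite s1 s2 mulrA cc; congr (_ * _).
rewrite (csum_bij K2 K3 aD) csum_fubini; last exact: (asum_inj (can_inj K2) aD).
by apply: eq_csum => m; apply: eq_csum => l; rewrite HE.
Qed.

End HexagonalPoisson.

(** * Polynomial weights by differentiation in a parameter *)

Section ExponentialFamilies.
Variable R : realType.
Local Notation C := (Cplx R).

(** Summability against every exponential of [u], so that [expsum A u] is entire and all its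
    derivatives are again of this kind. *)
Definition exp_summable (I : eqType) (A u : I -> C) : Prop :=
  forall r : R, bsum (fun i => cabs (A i) * expR (r * cabs (u i))).

Definition expsum (I : eqType) (A u : I -> C) (t : C) : C :=
  csum (fun i => A i * e2ipi (t * u i)).

Lemma cabs_e2ipi_le (z : C) : cabs (e2ipi z) <= expR (2 * pi * cabs z).
Proof.
rewrite cabs_e2ipi ler_expR; apply: le_trans (ler_norm _) _.
rewrite normrN normrM ger0_norm ?mulr_ge0 ?pi_ge0 //.
by rewrite ler_wpM2l ?mulr_ge0 ?pi_ge0 ?cabs_Im.
Qed.

Lemma cdiff_uniq (f : C -> C) z d e : cdiff f z d -> cdiff f z e -> d = e.
Proof.
move=> [phi [h hphi]] [psi [k hpsi]].
have E s : s != 0 -> psi s = phi s.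
  by move=> s0; apply: (mulfI s0); apply: (addrI (f z)); rewrite -h -k.
apply/eqP; rewrite -subr_eq0 -cabs_eq0; apply/negPn/negP => n.
have e0 : 0 < cabs (d - e) / 2 by rewrite divr_gt0 // lt_neqAle eq_sym n cabs_ge0.
move/lim0P: hphi => /(_ _ e0) [r r0 hr]; move/lim0P: hpsi => /(_ _ e0) [r' r0' hr'].
pose s : C := (Num.min r r' / 2)%:C%C.
have m0 : 0 < Num.min r r' by rewrite lt_min r0.
have cs : cabs s < Num.min r r' by rewrite cabs_real ger0_norm; lra.
have s0 : s != 0.
  by rewrite -cabs_eq0 cabs_real normr_eq0; apply/eqP; lra.
move: cs; rewrite lt_min => /andP[/hr h1 /hr']; rewrite (E s s0) => h2.
have := cabsB (phi s - e) (phi s - d); rewrite (_ : phi s - e - _ = d - e); last ring.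
lra.
Qed.

Lemma exp_summable_mul (I : eqType) (A u : I -> C) :
  exp_summable A u -> exp_summable (fun i => A i * u i) u.
Proof.
move=> h r; have := h (r + 1); apply: bsum_le => i.
rewrite cabsM mulrDl mul1r expRD -mulrA ler_wpM2l ?cabs_ge0 //.
rewrite mulrC ler_wpM2l ?expR_ge0 //.
have := expR_ge1Dx (cabs (u i)); lra.
Qed.

Lemma asum_expsum (I : eqType) (A u : I -> C) (t : C) :
  exp_summable A u -> asum (fun i => A i * e2ipi (t * u i)).
Proof.
move=> h; have := h (2 * pi * cabs t); apply: bsum_le => i.
rewrite cabsM ler_wpM2l ?cabs_ge0 //; apply: le_trans (cabs_e2ipi_le _) _.
by rewrite cabsM mulrA.
Qed.

Lemma expsum_diff (I : eqType) (A u : I -> C) (t : C) : exp_summable A u ->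
  cdiff (expsum A u) t (twopii R * expsum (fun i => A i * u i) u t).
Proof.
move=> h.
have a1 := asum_expsum t h; have a2 := asum_expsum t (exp_summable_mul h).
have [M HM] := h (2 * pi * cabs t + 1 + 2 * pi).
pose K := 16 * pi ^+ 2 * M.
apply: (@cdiff_quadratic _ _ _ _ K 1) => // s hs.
have a3 := asum_expsum (t + s) h.
rewrite mulrA /expsum -csumZ // -csumB // -csumB //; [|exact: asumB|exact: asumZ].
apply: csum_le => B uB.
apply: (@le_trans _ _ (\sum_(i <- B) 16 * pi ^+ 2 * cabs s ^+ 2 *
   (cabs (A i) * expR ((2 * pi * cabs t + 1 + 2 * pi) * cabs (u i))))); last first.
  rewrite -mulr_sumr /K [leRHS]mulrAC ler_wpM2l ?HM //.
  by apply: mulr_ge0; rewrite ?sqr_ge0 // mulr_ge0 ?sqr_ge0.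
apply: ler_sum => i _.
pose v := twopii R * (s * u i).
have -> : A i * e2ipi ((t + s) * u i) - A i * e2ipi (t * u i) - s * twopii R * (A i * u i * e2ipi (t * u i)) =
   A i * e2ipi (t * u i) * (cexp v - 1 - v).
  by rewrite mulrDl e2ipiD [e2ipi (s * _)]/e2ipi -/(twopii R) -/v /v; ring.
have hv : cabs v = 2 * pi * (cabs s * cabs (u i)) by rewrite /v !cabsM cabs_twopii.
have hv1 : cabs v <= 2 * pi * cabs (u i).
  rewrite hv ler_wpM2l ?mulr_ge0 ?pi_ge0 //.
  by rewrite ler_piMl ?cabs_ge0.
set c := cabs (u i) in hv hv1 *.
have c0 : 0 <= c by exact: cabs_ge0.
have e1 : cabs (e2ipi (t * u i)) <= expR (2 * pi * cabs t * c).
  by apply: le_trans (cabs_e2ipi_le _) _; rewrite cabsM mulrA.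
have e2 : cabs (cexp v - 1 - v) <= 16 * pi ^+ 2 * cabs s ^+ 2 * (expR c * expR (2 * pi * c)).
  apply: le_trans (cexp_taylor1 v) _.
  have -> : 16 * pi ^+ 2 * cabs s ^+ 2 * (expR c * expR (2 * pi * c)) =
     2 * ((4 * pi ^+ 2 * cabs s ^+ 2 * (2 * expR c)) * expR (2 * pi * c)) by ring.
  rewrite ler_wpM2l //; apply: ler_pM; rewrite ?sqr_ge0 ?expR_ge0 ?ler_expR //.
  have -> : cabs v ^+ 2 = 4 * pi ^+ 2 * cabs s ^+ 2 * c ^+ 2 by rewrite hv; ring.
  rewrite ler_wpM2l ?expR_ge_sq //.
  by apply: mulr_ge0; rewrite ?sqr_ge0 // mulr_ge0 ?sqr_ge0.
rewrite 2!cabsM [leRHS]mulrCA -[leLHS]mulrA ler_wpM2l ?cabs_ge0 //.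
apply: le_trans (ler_pM (cabs_ge0 _) (cabs_ge0 _) e1 e2) _.
have -> : expR ((2 * pi * cabs t + 1 + 2 * pi) * c) =
    expR (2 * pi * cabs t * c) * (expR c * expR (2 * pi * c)).
  by rewrite -!expRD; congr expR; ring.
by rewrite mulrCA.
Qed.

Lemma expsum_step (I J : eqType) (A u : I -> C) (B v : J -> C) :
  exp_summable A u -> exp_summable B v -> (forall t, expsum A u t = expsum B v t) ->
  forall t, expsum (fun i => A i * u i) u t = expsum (fun j => B j * v j) v t.
Proof.
move=> hA hB e t.
have h1 := expsum_diff t hA; have h2 := cdiff_eq (expsum_diff t hB) (fun s => esym (e s)).
have n0 : twopii R != 0 by rewrite -cabs_eq0 cabs_twopii gt_eqF // mulr_gt0 // pi_gt0.
exact: (mulfI n0 (cdiff_uniq h1 h2)).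
Qed.

Lemma exp_summable_pow (I : eqType) (A u : I -> C) (n : nat) :
  exp_summable A u -> exp_summable (fun i => A i * u i ^+ n) u.
Proof.
move=> h; elim: n => [|n IH].
  by rewrite (_ : (fun i => _) = A) //; apply/funext => i; rewrite mulr1.
rewrite (_ : (fun i => _) = (fun i => A i * u i ^+ n * u i)).
  exact: exp_summable_mul.
by apply/funext => i; rewrite exprSr mulrA.
Qed.

Lemma asum_moment (I : eqType) (A u : I -> C) (n : nat) :
  exp_summable A u -> asum (fun i => A i * u i ^+ n).
Proof.
move=> /(exp_summable_pow n)/(_ 0); apply: bsum_le => i.
by rewrite mul0r expR0 mulr1.
Qed.

(** Equal functions of [t] have equal n-th derivatives; evaluated at t = 0 these are, up to the n-th
    power of 2 pi i, the two moments. *)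
Lemma expsum_moments (I J : eqType) (A u : I -> C) (B v : J -> C) (n : nat) :
  exp_summable A u -> exp_summable B v -> (forall t, expsum A u t = expsum B v t) ->
  csum (fun i => A i * u i ^+ n) = csum (fun j => B j * v j ^+ n).
Proof.
move=> hA hB e.
suff : forall t, expsum (fun i => A i * u i ^+ n) u t = expsum (fun j => B j * v j ^+ n) v t.
  move/(_ 0); rewrite /expsum => h.
  by etransitivity; [|etransitivity; [exact: h|]]; apply: eq_csum => i; rewrite mul0r e2ipi0 mulr1.
suff [_ _ //] : [/\ exp_summable (fun i => A i * u i ^+ n) u,
  exp_summable (fun j => B j * v j ^+ n) v &
  forall t, expsum (fun i => A i * u i ^+ n) u t = expsum (fun j => B j * v j ^+ n) v t].
have x0 (L : eqType) (G w : L -> C) : (fun i => G i * w i ^+ 0) = G.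
  by apply/funext => i; rewrite mulr1.
have xS (L : eqType) (G w : L -> C) k :
    (fun i => G i * w i ^+ k.+1) = (fun i => G i * w i ^+ k * w i).
  by apply/funext => i; rewrite exprSr mulrA.
elim: n => [|n [h1 h2 h3]]; first by rewrite !x0.
by rewrite !xS; split; [exact: exp_summable_mul..|exact: expsum_step].
Qed.

Definition zeta : C := Complex (1 / 2) (Num.sqrt 3 / 2).

Lemma zeta_sq : zeta ^+ 2 = zeta - 1.
Proof.
have h : Num.sqrt 3 * Num.sqrt 3 = 3 :> R by rewrite -expr2 sqr_sqrtr.
by apply/eqP; rewrite eq_complex /=; apply/andP; split; apply/eqP; nra.
Qed.

Lemma cabs_lin_zeta (x y : C) : cabs (x + y * zeta) <= cabs x + cabs y.
Proof.
apply: le_trans (cabsD _ _) _; rewrite lerD2l cabsM.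
suff -> : cabs zeta = 1 by rewrite mulr1.
have h : Num.sqrt 3 * Num.sqrt 3 = 3 :> R by rewrite -expr2 sqr_sqrtr.
rewrite /cabs /= (_ : _ + _ = 1) ?sqrtr1 //; nra.
Qed.

Lemma hex_exp_summable (z c A B : C) (u : int * int -> C) (K : R) : 0 < complex.Im z -> 0 <= K ->
  (forall p, cabs (u p) <= K * (1 + `|p.1%:~R| + `|p.2%:~R|)) ->
  exp_summable (fun p : int * int => c * e2ipi (z * hexQ p.1%:~R p.2%:~R
     + (A * p.1%:~R + B * p.2%:~R))) u.
Proof.
move=> z0 K0 hu r.
pose a := pi * complex.Im z; pose b1 := 2 * pi * cabs A + `|r| * K; pose b2 := 2 * pi * cabs B + `|r| * K.
have a0 : 0 < a by rewrite mulr_gt0 ?pi_gt0.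
have c0 : 0 <= cabs c * expR (`|r| * K) by rewrite mulr_ge0 ?cabs_ge0 ?expR_ge0.
apply: bsum_le (bsumZ c0 (bsum_prod (gau_ge0 a b1) (gau_ge0 a b2) (bsum_gau b1 a0) (bsum_gau b2 a0))).
move=> [m n] /=; rewrite cabsM -!mulrA ler_wpM2l ?cabs_ge0 //.
rewrite cabs_e2ipi /gau -!expRD ler_expR !ImD.
have hu1 := hu (m, n); rewrite /= in hu1.
set x : R := m%:~R in hu1 *; set y : R := n%:~R in hu1 *.
have -> : complex.Im (z * hexQ m%:~R n%:~R) = (x ^+ 2 + x * y + y ^+ 2) * complex.Im z.
  by rewrite mulrC -ImZ !rmorphD !rmorphM /= !rmorph_int.
have -> : complex.Im (A * m%:~R) = x * complex.Im A by rewrite mulrC real_int ImZ.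
have -> : complex.Im (B * n%:~R) = y * complex.Im B by rewrite mulrC real_int ImZ.
have hA : - (x * complex.Im A) <= cabs A * `|x|.
  apply: le_trans (ler_norm _) _; rewrite normrN normrM mulrC.
  by rewrite ler_wpM2r // cabs_Im.
have hB : - (y * complex.Im B) <= cabs B * `|y|.
  apply: le_trans (ler_norm _) _; rewrite normrN normrM mulrC.
  by rewrite ler_wpM2r // cabs_Im.
have hq : (x ^+ 2 + y ^+ 2) / 2 <= x ^+ 2 + x * y + y ^+ 2.
  have h1 := sqr_ge0 (x + y); have h2 := sqr_ge0 (x - y); nra.
have h3 := ler_wpM2r (ltW z0) hq.
have h4 : r * cabs (u (m, n)) <= `|r| * (K * (1 + `|x| + `|y|)).
  apply: (@le_trans _ _ (`|r| * cabs (u (m, n)))).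
    by rewrite ler_wpM2r ?cabs_ge0 // ler_norm.
  by rewrite ler_wpM2l.
have p0 := pi_gt0 R.
have g1 := ler_wpM2l (ltW p0) hA; have g2 := ler_wpM2l (ltW p0) hB.
have g3 := ler_wpM2l (ltW p0) h3.
rewrite /a /b1 /b2; nra.
Qed.

(** Poisson summation at the shift (X - t zeta, Y + t). Since zeta^2 - zeta + 1 = 0, the direction
    (-zeta, 1) is isotropic and the exponent is affine in t: its coefficient is z (1 - 2 zeta) times
    the lattice element on the left and p1 + p2 zeta on the dual side. Comparing j-th moments yields
    the weights x^j. *)
Lemma hex_theta_inversion (j : nat) (z : C) (r1 r2 : R) : 0 < complex.Im z ->
  csum (fun p : int * int =>
    ((p.1%:~R + r1%:C%C) + (p.2%:~R + r2%:C%C) * zeta) ^+ j *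
    e2ipi (z * hexQ (p.1%:~R + r1%:C%C) (p.2%:~R + r2%:C%C))) * (z * (1 - 2 * zeta)) ^+ j =
  kappa R / z * csum (fun p : int * int => (p.1%:~R + p.2%:~R * zeta) ^+ j *
    (e2ipi (p.1%:~R * r2%:C%C - p.2%:~R * r1%:C%C) * e2ipi (- ((3 * z)^-1) * hexQ p.1%:~R p.2%:~R))).
Proof.
move=> z0; set X : C := r1%:C%C; set Y : C := r2%:C%C.
pose al (p : int * int) : C := (p.1%:~R + X) + (p.2%:~R + Y) * zeta.
pose be (p : int * int) : C := p.1%:~R + p.2%:~R * zeta.
have z3 : 0 < complex.Im (- (3 * z)^-1).
  by apply: Im_inv_opp_gt0; rewrite three_C ImZ mulr_gt0.
pose A (p : int * int) : C := e2ipi (z * hexQ X Y) * e2ipi (z * hexQ p.1%:~R p.2%:~R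
     + ((z * (2 * X + Y)) * p.1%:~R + (z * (X + 2 * Y)) * p.2%:~R)).
pose u p : C := z * (1 - 2 * zeta) * al p.
pose B (p : int * int) : C := kappa R / z * e2ipi (- (3 * z)^-1 * hexQ p.1%:~R p.2%:~R
     + (Y * p.1%:~R + (- X) * p.2%:~R)).
have sB : exp_summable B be.
  apply: (@hex_exp_summable _ _ _ _ _ 1) => // p; rewrite mul1r.
  apply: le_trans (cabs_lin_zeta _ _) _; rewrite !cabs_int; lra.
pose K0 := 1 + cabs X + cabs Y.
have K00 : 0 <= K0 by rewrite !addr_ge0 ?cabs_ge0.
have alK p : cabs (al p) <= K0 * (1 + `|p.1%:~R| + `|p.2%:~R|).
  apply: le_trans (cabs_lin_zeta _ _) _.
  have h1 := cabsD p.1%:~R X; have h2 := cabsD p.2%:~R Y.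
  rewrite !cabs_int in h1 h2.
  have c1 := cabs_ge0 X; have c2 := cabs_ge0 Y.
  have n1 := normr_ge0 (p.1%:~R : R); have n2 := normr_ge0 (p.2%:~R : R).
  rewrite /K0; nra.
have sA : exp_summable A u.
  apply: (@hex_exp_summable _ _ _ _ _ (cabs (z * (1 - 2 * zeta)) * K0)) => //.
    by rewrite mulr_ge0 ?cabs_ge0.
  by move=> p; rewrite /u cabsM -[leRHS]mulrA ler_wpM2l ?cabs_ge0.
have e t : expsum A u t = expsum B be t.
  have z2 := zeta_sq.
  have H := hex_poisson z0 (X - t * zeta) (Y + t).
  transitivity (csum (fun p : int * int => e2ipi (z * hexQ (p.1%:~R + (X - t * zeta)) (p.2%:~R + (Y + t))))).
    apply: eq_csum => p; rewrite /A /u /al -!e2ipiD; congr e2ipi.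
    rewrite /hexQ.
    transitivity (z * (hexQ (p.1%:~R + X) (p.2%:~R + Y) +
      t * ((p.1%:~R + X) * (1 - 2 * zeta) + (p.2%:~R + Y) * (2 - zeta)))).
      rewrite /hexQ.
      have e1 : 2 - zeta = zeta - 2 * zeta ^+ 2 by rewrite z2; ring.
      by rewrite e1; ring.
    (* The coefficient of t^2 is the norm form on the isotropic direction, hence 0. *)
    transitivity (z * (hexQ (p.1%:~R + X) (p.2%:~R + Y) +
      t * ((p.1%:~R + X) * (1 - 2 * zeta) + (p.2%:~R + Y) * (2 - zeta)) + t ^+ 2 * (zeta ^+ 2 - zeta + 1))).
      by rewrite z2; ring.
    by rewrite /hexQ; ring.
  rewrite H /expsum -csumZ; last exact: asum_hexQ_dual.
  apply: eq_csum => p; rewrite /B /be -[RHS]mulrA -e2ipiD; congr (_ * e2ipi _).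
  by rewrite /hexQ; ring.
have := expsum_moments j sA sB e.
have zz : forall p, A p * u p ^+ j = (z * (1 - 2 * zeta)) ^+ j * (al p ^+ j * e2ipi (z * hexQ (p.1%:~R + X) (p.2%:~R + Y))).
  move=> p; rewrite /A -e2ipiD exprMn [RHS]mulrA mulrC; congr (_ * e2ipi _).
  by rewrite /hexQ; ring.
have s1 : asum (fun p => al p ^+ j * e2ipi (z * hexQ (p.1%:~R + X) (p.2%:~R + Y))).
  have := asum_moment j (@hex_exp_summable z (e2ipi (z * hexQ X Y)) (z * (2 * X + Y)) (z * (X + 2 * Y)) al K0 z0 K00 alK).
  rewrite (_ : (fun i => _) = (fun p => al p ^+ j * e2ipi (z * hexQ (p.1%:~R + X) (p.2%:~R + Y)))) //.
  apply/funext => p; rewrite mulrC -e2ipiD; congr (_ * e2ipi _).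
  by rewrite /hexQ; ring.
have beK p : cabs (be p) <= 1 * (1 + `|p.1%:~R| + `|p.2%:~R|).
  by rewrite mul1r; apply: le_trans (cabs_lin_zeta _ _) _; rewrite !cabs_int; lra.
have s2 : asum (fun p : int * int => be p ^+ j * (e2ipi (p.1%:~R * Y - p.2%:~R * X) * e2ipi (- ((3 * z)^-1) * hexQ p.1%:~R p.2%:~R))).
  have := asum_moment j (@hex_exp_summable _ 1 Y (- X) be 1 z3 ler01 beK).
  rewrite (_ : (fun i => _) = (fun p : int * int => be p ^+ j * (e2ipi (p.1%:~R * Y - p.2%:~R * X) * e2ipi (- ((3 * z)^-1) * hexQ p.1%:~R p.2%:~R)))) //.
  apply/funext => p; rewrite mul1r mulrC -e2ipiD; congr (_ * e2ipi _).
  by rewrite /hexQ; ring.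
rewrite (eq_csum zz) csumZ // mulrC => ->.
rewrite -csumZ //; apply: eq_csum => p.
rewrite /B -mulrA; congr (_ * _); rewrite [RHS]mulrC -e2ipiD; congr (e2ipi _ * _).
by rewrite /hexQ; ring.
Qed.

End ExponentialFamilies.

(** * Eisenstein integers and the Hecke character *)

Section EisensteinIntegers.

(** The product of x1 + x2 zeta and y1 + y2 zeta, from zeta^2 = zeta - 1; in the same basis the
    conjugate of zeta is 1 - zeta. *)
Definition emul (x y : int * int) : int * int :=
  (x.1 * y.1 - x.2 * y.2, x.1 * y.2 + x.2 * y.1 + x.2 * y.2).
Definition eadd (x y : int * int) : int * int := (x.1 + y.1, x.2 + y.2).
Definition econj (x : int * int) : int * int := (x.1 + x.2, - x.2).
Definition enorm (x : int * int) : int := x.1 ^+ 2 + x.1 * x.2 + x.2 ^+ 2.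

Lemma emulC x y : emul x y = emul y x.
Proof. by rewrite /emul; congr (_, _); ring. Qed.
Lemma emulA x y z : emul x (emul y z) = emul (emul x y) z.
Proof. by rewrite /emul /=; congr (_, _); ring. Qed.
Lemma emul1 x : emul (1, 0) x = x.
Proof. by case: x => a b; rewrite /emul /=; congr (_, _); ring. Qed.
Lemma enormM x y : enorm (emul x y) = enorm x * enorm y.
Proof. by rewrite /enorm /emul /=; ring. Qed.
Lemma enorm_conj x : enorm (econj x) = enorm x.
Proof. by rewrite /enorm /econj /=; ring. Qed.

Lemma emul_conj x : emul x (econj x) = (enorm x, 0).
Proof. by rewrite /emul /enorm /econj /=; congr (_, _); ring. Qed.
Lemma enorm_ge0 x : 0 <= enorm x.
Proof. rewrite /enorm; nia. Qed.
Lemma enorm_eq0 x : enorm x = 0 -> x = (0, 0).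
Proof.
case: x => a b; rewrite /enorm /= => h.
have : (a + b) ^+ 2 + a ^+ 2 + b ^+ 2 = 0 by rewrite -[RHS](mulr0 2) -h; ring.
move=> h2; have a0 : a = 0 by nia.
have b0 : b = 0 by nia.
by rewrite a0 b0.
Qed.

(* The sixth roots of unity, with [eunit 1] the root zeta = (1 + sqrt(-3)) / 2. *)
Definition eunit (j : nat) : int * int := iter j (emul (0, 1)) (1, 0).

(* Generator and norm of the conductor of the Hecke character whose infinity
   type has exponent congruent to s modulo 6; [ewidth s] is the number m such
   that the theta series is a series in exp(2 pi i z / m). *)
Definition econd (s : nat) : int * int :=
  match s with 0%N => (1, 0) | 3%N => (-1, 2) | 2%N | 4%N => (2, 0) | _ => (-2, 4) end.
Definition econdN (s : nat) : nat :=
  match s with 0%N => 1 | 3%N => 3 | 2%N | 4%N => 4 | _ => 12 end.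
Definition ewidth (s : nat) : nat :=
  match s with 0%N => 1 | 3%N => 3 | 2%N | 4%N => 2 | _ => 6 end.

(** Congruence of [x] to 1 modulo the conductor: x - 1 is multiplied by the conjugate of the
    conductor and both coordinates are tested against the norm. *)
Definition cong1 (s : nat) (x : int * int) : bool :=
  let p := emul (x.1 - 1, x.2) (econj (econd s)) in
  ((econdN s)%:Z %| p.1)%Z && ((econdN s)%:Z %| p.2)%Z.

(** The least j for which zeta^j x is congruent to 1 modulo the conductor. Since the six units cover
    all invertible classes, the default 6 of [find] marks exactly the elements not prime to the
    conductor. *)
Definition eidx (s : nat) (x : int * int) : nat :=
  find (fun j => cong1 s (emul (eunit j) x)) (iota 0 6).

Lemma cong1_mod s a b u v : cong1 s (a + 6 * u, b + 6 * v) = cong1 s (a, b).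
Proof.
have key n (p q : int) : (n%:Z %| q)%Z -> (n%:Z %| p + q)%Z = (n%:Z %| p)%Z.
  by move=> h; rewrite rpredDr.
have e : emul (a + 6 * u - 1, b + 6 * v) (econj (econd s)) =
  eadd (emul (a - 1, b) (econj (econd s))) (emul (u, v) (emul (6, 0) (econj (econd s)))).
  by rewrite /emul /eadd /=; congr (_, _); ring.
set q := emul (u, v) _ in e.
have [h1 h2] : ((econdN s)%:Z %| q.1)%Z /\ ((econdN s)%:Z %| q.2)%Z.
  by rewrite /q /emul /=; case: s {e q} => [|[|[|[|[|s]]]]] /=; split; lia.
by rewrite /cong1 e (key _ _ _ h1) (key _ _ _ h2).
Qed.

Lemma eidx_mod s x u : eidx s (eadd x (emul (6, 0) u)) = eidx s x.
Proof.
apply: eq_find => j; case: x u => a b [c d].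
rewrite -[RHS](cong1_mod _ _ _ (emul (eunit j) (c, d)).1 (emul (eunit j) (c, d)).2).
by congr cong1; rewrite /emul /eadd /=; congr (_, _); ring.
Qed.

Definition eres (x : int * int) : int * int := ((x.1 %% 6)%Z, (x.2 %% 6)%Z).

Lemma eresE x : x = eadd (eres x) (emul (6, 0) ((x.1 %/ 6)%Z, (x.2 %/ 6)%Z)).
Proof.
case: x => a b; rewrite /eres /emul /eadd /=; congr (_, _).
  by rewrite {1}(divz_eq a 6); ring.
by rewrite {1}(divz_eq b 6); ring.
Qed.

Lemma eidx_res s x : eidx s x = eidx s (eres x).
Proof. by rewrite {1}(eresE x) eidx_mod. Qed.

Definition residues : seq (int * int) :=
  [seq (i%:Z, j%:Z) | i <- iota 0 6, j <- iota 0 6].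

Lemma mem_eres x : eres x \in residues.
Proof.
apply/allpairsP; exists (absz (x.1 %% 6)%Z, absz (x.2 %% 6)%Z).
have h (a : int) : (absz (a %% 6)%Z < 6)%N /\ (absz (a %% 6)%Z)%:Z = (a %% 6)%Z by lia.
have [h1 e1] := h x.1; have [h2 e2] := h x.2.
by split; [rewrite mem_iota|rewrite mem_iota|rewrite /eres /= e1 e2].
Qed.

(** Every conductor divides 6, so statements about the character depend on [x] modulo 6 and become
    checks over 36 residues. *)
Lemma residue_ind (P : int * int -> bool) : (forall x, P x = P (eres x)) ->
  all P residues -> forall x, P x.
Proof. by move=> h /allP H x; rewrite h H // mem_eres. Qed.

(** The index is determined only up to units congruent to 1 modulo the conductor, whose s-th powers
    are 1; hence indices are compared after multiplication by s. *)
Definition eidx_mul_check (s : nat) (x y : int * int) : bool :=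
  let i := eidx s x in let j := eidx s y in let l := eidx s (emul x y) in
  ((l < 6) == ((i < 6) && (j < 6)))%N &&
  ((l < 6)%N ==> (s * l == s * (i + j) %[mod 6])%N).

Lemma eidx_mul_residues : all (fun s => all (fun x => all (eidx_mul_check s x) residues) residues) (iota 0 6).
Proof. by vm_compute. Qed.

Lemma eidx_mul s x y : (s < 6)%N -> eidx_mul_check s x y.
Proof.
move=> s6; have : s \in iota 0 6 by rewrite mem_iota.
move/(allP eidx_mul_residues) => h.
have e : forall x y, eidx s (emul x y) = eidx s (emul (eres x) (eres y)).
  move=> [a b] [c d]; set x' := (a, b); set y' := (c, d).
  pose q1 := ((a %/ 6)%Z, (b %/ 6)%Z); pose q2 := ((c %/ 6)%Z, (d %/ 6)%Z).
  rewrite -[RHS](eidx_mod s _ (eadd (emul (eres x') q2) (eadd (emul q1 (eres y')) (emul (emul q1 (6, 0)) q2)))).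
  rewrite {1}(eresE x') {1}(eresE y') -/q1 -/q2; congr eidx.
  by rewrite /emul /eadd /=; congr (_, _); ring.
have := allP (allP h _ (mem_eres x)) _ (mem_eres y).
by rewrite /eidx_mul_check -e -!eidx_res.
Qed.

End EisensteinIntegers.

(** * The Hecke character and its finite Fourier transform *)

Section HeckeCharacter.
Variable R : realType.
Local Notation C := (Cplx R).
Local Notation zeta := (zeta R).

Definition toC (x : int * int) : C := x.1%:~R + x.2%:~R * zeta.

Lemma toC_mul x y : toC (emul x y) = toC x * toC y.
Proof.
have h := zeta_sq R.
transitivity (x.1%:~R * y.1%:~R + (x.1%:~R * y.2%:~R + x.2%:~R * y.1%:~R) * zeta +
   x.2%:~R * y.2%:~R * (zeta - 1)); last by rewrite -h /toC; ring.
by rewrite /toC /emul /= rmorphB !rmorphD !rmorphM /=; ring.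
Qed.

Lemma toC_add x y : toC (eadd x y) = toC x + toC y.
Proof. by rewrite /toC /eadd /= !rmorphD /=; ring. Qed.

Lemma toC_eunit j : toC (eunit j) = zeta ^+ j.
Proof.
elim: j => [|j IH]; first by rewrite /toC /= mul0r addr0.
by rewrite /eunit iterS toC_mul -/(eunit j) IH exprS /toC /= mul1r add0r.
Qed.

Lemma zeta6 : zeta ^+ 6 = 1.
Proof. by rewrite -toC_eunit (_ : eunit 6 = (1, 0)) // /toC /= mul0r addr0. Qed.

Lemma zeta_mod n : zeta ^+ n = zeta ^+ (n %% 6).
Proof. by rewrite {1}(divn_eq n 6) exprD mulnC exprM zeta6 expr1n mul1r. Qed.

(** The cube is -1, and the sign of the imaginary part selects the right root of w^2 - w + 1. *)
Lemma e2ipi_sixth : e2ipi (6^-1 : C) = zeta.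
Proof.
set w := e2ipi _.
have w3 : w ^+ 3 = -1 by rewrite -e2ipi_natM -e2ipi_half; congr e2ipi; field.
have e6 : (6^-1 : C) = (6^-1 : R)%:C%C by rewrite fmorphV rmorph_nat.
have Iw : 0 < complex.Im w.
  rewrite /w e6 e2ipi_real /= sin_gt0_pi //.
  have := pi_gt0 R; lra.
have wn : w != -1 by apply: contraTneq Iw => ->; rewrite /= oppr0 ltxx.
have q : w ^+ 2 - w + 1 = 0.
  have : (w + 1) * (w ^+ 2 - w + 1) = 0.
    by rewrite -(addNr 1) -w3; move: (w) => v; ring.
  by move/eqP; rewrite mulf_eq0 -(opprK 1) subr_eq0 (negbTE wn) opprK => /eqP.
have : (w - zeta) * (w + zeta - 1) = 0.
  rewrite (_ : _ * _ = (w ^+ 2 - w + 1) - (zeta ^+ 2 - zeta + 1)); last by move: (w) (zeta) => v u; ring.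
  by rewrite q zeta_sq; ring.
move/eqP; rewrite mulf_eq0 => /orP[|]; first by rewrite subr_eq0 => /eqP.
move/eqP => h; exfalso; move: Iw.
have -> : w = 1 - zeta by apply/eqP; rewrite -subr_eq0 -h; apply/eqP; ring.
rewrite /= sub0r oppr_gt0 ltNge.
by rewrite divr_ge0 // sqrtr_ge0.
Qed.

Lemma cabs_toC_sq x : cabs (toC x) ^+ 2 = (enorm x)%:~R.
Proof.
have h : Num.sqrt 3 ^+ 2 = 3 :> R by rewrite sqr_sqrtr.
rewrite /cabs sqr_sqrtr ?addr_ge0 ?sqr_ge0 // /toC /= !real_int /=.
have -> : x.1%:~R + (x.2%:~R * (1 / 2) - 0 * (Num.sqrt 3 / 2)) = x.1%:~R + x.2%:~R / 2 :> R by field.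
have -> : 0 + (x.2%:~R * (Num.sqrt 3 / 2) + 0 * (1 / 2)) = x.2%:~R * Num.sqrt 3 / 2 :> R by field.
rewrite expr_div_n exprMn h /enorm !rmorphD !rmorphM /=; field=> //.
Qed.

Lemma cabs_zeta : cabs zeta = 1.
Proof.
have := cabs_toC_sq (0, 1); rewrite /toC /= add0r mul1r /enorm /= expr0n mul0r expr1n !add0r.
by move/eqP; rewrite sqrp_eq1 ?cabs_ge0 // => /eqP.
Qed.

(** If zeta^i x is congruent to 1, then eps(x) = zeta^(s i), so that for e congruent to s modulo 6
    the product eps(x) x^e is (zeta^i x)^e: the e-th power of the generator of (x) congruent to
    1. *)
Definition eps (s : nat) (x : int * int) : C :=
  if (eidx s x < 6)%N then zeta ^+ (s * eidx s x) else 0.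

Definition psi (e : nat) (x : int * int) : C := eps (e %% 6) x * toC x ^+ e.

Lemma eps_mul s x y : (s < 6)%N -> eps s (emul x y) = eps s x * eps s y.
Proof.
move=> s6; have /andP[/eqP h1 /implyP h2] := eidx_mul x y s6.
rewrite /eps h1; move: h2; rewrite h1.
case: (_ < 6)%N => //=; last by rewrite mul0r.
case: (_ < 6)%N => [/(_ isT)/eqP h2|_] /=; last by rewrite mulr0.
by rewrite -exprD -mulnDr (zeta_mod (s * eidx s (emul x y))) h2 -zeta_mod.
Qed.

Lemma cabs_eps_le s x : cabs (eps s x) <= 1.
Proof. by rewrite /eps; case: ifP; rewrite ?cabs0 // cabsX cabs_zeta expr1n. Qed.

Lemma psi_mul e x y : psi e (emul x y) = psi e x * psi e y.
Proof. by rewrite /psi eps_mul ?ltn_pmod // toC_mul exprMn; ring. Qed.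

Lemma eps_unit_residues : all (fun s => let i := eidx s (0, 1) in
  (i < 6)%N && (s * i + s == 0 %[mod 6])%N) (iota 0 6).
Proof. by vm_compute. Qed.

Lemma psi_zeta e : psi e (0, 1) = 1.
Proof.
have s6 : (e %% 6 \in iota 0 6)%N by rewrite mem_iota ltn_pmod.
have /andP[h1 /eqP h2] := allP eps_unit_residues _ s6.
rewrite /psi /eps h1 /toC /= add0r mul1r (zeta_mod e) -exprD.
by rewrite zeta_mod h2.
Qed.

Lemma eunitS j : eunit j.+1 = emul (0, 1) (eunit j). Proof. by []. Qed.

Lemma psi_one e : psi e (1, 0) = 1.
Proof. by rewrite -[RHS](psi_zeta e) -[in RHS](emul1 (0, 1)) psi_mul psi_zeta mulr1. Qed.

Lemma psi_eunit e j : psi e (eunit j) = 1.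
Proof. by elim: j => [|j IH]; rewrite ?psi_one // eunitS psi_mul psi_zeta mul1r. Qed.

Lemma cong1_unit_mod s j x : cong1 s (emul (eunit j) x) = cong1 s (emul (eunit j) (eres x)).
Proof.
rewrite {1}(eresE x); set q := (_ %/ 6, _)%Z.
rewrite -[RHS](cong1_mod _ _ _ (emul (eunit j) q).1 (emul (eunit j) q).2).
by congr cong1; rewrite /emul /eadd /=; congr (_, _); ring.
Qed.

Definition hcount (s : nat) : nat := count (fun j => cong1 s (eunit j)) (iota 0 6).

Definition cong_check s x : bool :=
  let i := eidx s x in
  (count (fun j => cong1 s (emul (eunit j) x)) (iota 0 6) == if (i < 6)%N then hcount s else 0%N) &&
  all (fun j => cong1 s (emul (eunit j) x) ==> (s * j == s * i %[mod 6])%N) (iota 0 6).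

Lemma cong_check_residues : all (fun s => all (cong_check s) residues && (0 < hcount s)%N) (iota 0 6).
Proof. by vm_compute. Qed.

Lemma hcount_gt0 s : (s < 6)%N -> (0 < hcount s)%N.
Proof.
by move=> s6; have := allP cong_check_residues s; rewrite mem_iota => /(_ s6)/andP[].
Qed.

(** Writes the character as a sum over the units of the indicator of a single congruence class,
    which is what Poisson summation can handle. [hcount s] counts the units congruent to 1. *)
Lemma cong_sum s x : (s < 6)%N ->
  \sum_(0 <= j < 6) (if cong1 s (emul (eunit j) x) then zeta ^+ (s * j) else 0) =
  (hcount s)%:R * eps s x.
Proof.
move=> s6; have /andP[h _] : all (cong_check s) residues && (0 < hcount s)%N.
  by apply: (allP cong_check_residues s); rewrite mem_iota.
have : cong_check s x.
  apply: (residue_ind _ h) => y; rewrite /cong_check -eidx_res; congr (_ && _).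
    by congr (_ == _); apply: eq_count => j; exact: cong1_unit_mod.
  by apply: eq_all => j; rewrite cong1_unit_mod.
rewrite /cong_check => /andP[/eqP h1 /allP h2].
rewrite -big_mkcond /= big_seq_cond.
transitivity (\sum_(j <- iota 0 6 | (j \in iota 0 6) && cong1 s (emul (eunit j) x)) zeta ^+ (s * eidx s x)).
  apply: eq_bigr => j /andP[j6 hj]; have /implyP/(_ hj)/eqP e := h2 j j6.
  by rewrite zeta_mod e -zeta_mod.
rewrite -big_seq_cond big_const_seq h1 iter_addr_0 /eps.
by case: ifP => _; rewrite ?mulr0 ?mulr_natl.
Qed.

(* Exponent of the additive character p |-> exp(2 pi i (p1 r2 - p2 r1)), with
   r1 + r2 zeta the inverse of the conductor. *)
Definition cidx (s : nat) (p : int * int) : int :=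
  match s with
  | 0%N => 0 | 3%N => - 4 * p.1 - 2 * p.2 | 2%N | 4%N => - 3 * p.2
  | _ => - 2 * p.1 - p.2
  end.

Definition cres s p : nat := absz (cidx s p %% 6)%Z.

(** A Gauss sum over the units. The additive character takes values in the sixth roots of unity, so
    the sum is computed exactly in Z[zeta]. *)
Definition gauss_sum (s : nat) (x : int * int) : int * int :=
  foldr eadd (0, 0) [seq eunit ((s * j + cres s (emul (eunit j) x)) %% 6)%N | j <- iota 0 6].

(** Separability of the Gauss sum: at x it is eps(x) times its value at 1, and it vanishes when x is
    not prime to the conductor. *)
Definition gauss_check s x : bool :=
  gauss_sum s x == if (eidx s x < 6)%N then emul (gauss_sum s (1, 0)) (eunit (s * eidx s x)) else (0, 0).

Lemma gauss_check_residues : all (fun s => all (gauss_check s) residues) (iota 0 6).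
Proof. by vm_compute. Qed.

End HeckeCharacter.

(** * The theta series of the character *)

Section CMTheta.
Variable R : realType.
Local Notation C := (Cplx R).
Local Notation zeta := (zeta R).
Local Notation toC := (toC R).

Lemma csum_reindex (I J : eqType) (phi : J -> I) (g : I -> J) (f : I -> C) :
  cancel phi g -> (forall i, f i != 0 -> phi (g i) = i) -> asum f ->
  csum f = csum (f \o phi).
Proof.
move=> hg hf sf; have [_ ->] := csum_fiber g sf.
apply: eq_csum => j; rewrite (@csum_supp _ _ _ [:: phi j]) //.
  by rewrite big_seq1 hg eqxx.
move=> i; rewrite inE => ij; case: eqP => // gi.
by apply/eqP; apply: contraNT ij => /hf; rewrite gi => ->.
Qed.

Lemma e2ipi_sixth_int (n : int) : e2ipi (n%:~R / 6 : C) = zeta ^+ absz (n %% 6)%Z.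
Proof.
have hn : n%:~R / 6 = (n %/ 6)%Z%:~R + (absz (n %% 6)%Z)%:R * 6^-1 :> C.
  have -> : (absz (n %% 6)%Z)%:R = ((n %% 6)%Z)%:~R :> C.
    by rewrite -[LHS]/((absz (n %% 6)%Z)%:Z%:~R); congr (_ *~ _); lia.
  by rewrite {1}(divz_eq n 6) rmorphD rmorphM /=; field.
by rewrite hn e2ipiD e2ipi_int mul1r e2ipi_natM e2ipi_sixth.
Qed.

(** With r the conjugate of the conductor, six times the exponent (p1 r2 - p2 r1) / D of the dual
    side is congruent to [cidx s p] modulo 6. *)
Lemma cidx_pairing (s : nat) (p : int * int) : exists t : int,
  6 * (p.1 * (econj (econd s)).2 - p.2 * (econj (econd s)).1) = (econdN s)%:Z * (cidx s p + 6 * t).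
Proof.
by case: s => [|[|[|[|[|s]]]]] /=; [exists (- p.2)| exists 0..]; rewrite /cidx /=; lia.
Qed.

Lemma econdN_neq0 s : (econdN s)%:R != 0 :> C.
Proof. by rewrite pnatr_eq0; case: s => [|[|[|[|[|s]]]]]. Qed.

Lemma e2ipi_cres (s : nat) (p : int * int) :
  let r := econj (econd s) in
  e2ipi (p.1%:~R * (r.2%:~R / (econdN s)%:R : R)%:C%C -
         p.2%:~R * (r.1%:~R / (econdN s)%:R : R)%:C%C : C) = zeta ^+ cres s p.
Proof.
move=> r; have [t ht] := cidx_pairing s p; rewrite -/r in ht.
have D0 := econdN_neq0 s.
have -> : cres s p = absz ((cidx s p + 6 * t) %% 6)%Z by rewrite /cres; congr absz; lia.
rewrite -e2ipi_sixth_int; congr e2ipi.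
have {ht} : 6 * (p.1%:~R * r.2%:~R - p.2%:~R * r.1%:~R) = (econdN s)%:R * (cidx s p + 6 * t)%:~R :> C.
  move/(congr1 (fun x : int => x%:~R : C)): ht.
  by rewrite /= !rmorphM rmorphB !rmorphM.
rewrite !(rmorphM, fmorphV, rmorph_int, rmorph_nat).
move: r.1%:~R r.2%:~R => u v; move: (cidx s p + 6 * t)%:~R => X; move: (econdN s)%:R D0 => D D0 h.
have -> : X = 6 * (p.1%:~R * v - p.2%:~R * u) / D by rewrite h mulrAC mulfV ?mul1r.
by field.
Qed.

Lemma cres_mod6 s j x : cres s (emul (eunit j) x) = cres s (emul (eunit j) (eres x)).
Proof.
rewrite {1}(eresE x); set q := (_ %/ 6, _)%Z; set y := eres x.
have -> : emul (eunit j) (eadd y (emul (6, 0) q)) =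
    eadd (emul (eunit j) y) (emul (6, 0) (emul (eunit j) q)).
  by rewrite /emul /eadd /=; congr (_, _); ring.
rewrite /cres /cidx /eadd /emul; congr absz.
by case: s => [|[|[|[|[|s]]]]] /=; lia.
Qed.

Lemma toC_foldr (l : seq (int * int)) : toC (foldr eadd (0, 0) l) = \sum_(x <- l) toC x.
Proof.
elim: l => [|x l IH] /=; last by rewrite big_cons toC_add IH.
by rewrite big_nil /toC mul0r addr0.
Qed.

Lemma gauss_sumE s x : (s < 6)%N ->
  \sum_(0 <= j < 6) zeta ^+ (s * j) * zeta ^+ cres s (emul (eunit j) x) =
  toC (gauss_sum s (1, 0)) * eps R s x.
Proof.
move=> s6; have h := allP gauss_check_residues s; rewrite mem_iota in h; have {}h := h s6.
have /eqP hx : gauss_check s x.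
  apply: (residue_ind _ h) => y; rewrite /gauss_check -eidx_res; congr (_ == _).
  congr (foldr eadd (0, 0) _); apply: eq_map => j; by rewrite cres_mod6.
transitivity (toC (gauss_sum s x)).
  rewrite /gauss_sum toC_foldr big_map; apply: eq_bigr => j _.
  by rewrite toC_eunit -zeta_mod exprD.
rewrite hx /eps; case: ifP => _; last by rewrite mulr0 /toC mul0r addr0.
by rewrite toC_mul toC_eunit.
Qed.

Section Series.
Variable e : nat.
Hypothesis e0 : (0 < e)%N.
Local Notation s := (e %% 6)%N.
Local Notation D := (econdN s).
Local Notation M := (econd s).

Let s6 : (s < 6)%N. Proof. exact: ltn_pmod. Qed.

Lemma cabs_toC_le x : cabs (toC x) <= 1 * (1 + `|x.1%:~R| + `|x.2%:~R|).
Proof.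
apply: le_trans (cabs_lin_zeta _ _) _; rewrite !cabs_int mul1r -addrA.
by rewrite lerDr.
Qed.

Lemma hexQ_enorm x : hexQ x.1%:~R x.2%:~R = (enorm x)%:~R :> C.
Proof. by rewrite /hexQ /enorm !rmorphD !rmorphM. Qed.

Lemma asum_toC_pow (z : C) : 0 < complex.Im z ->
  asum (fun x => toC x ^+ e * e2ipi ((enorm x)%:~R * z)).
Proof.
move=> z0; have h := asum_moment e (@hex_exp_summable R z 1 0 0 toC 1 z0 ler01 cabs_toC_le).
apply: asum_le (h) => x /=.
by rewrite mul1r !mul0r !addr0 hexQ_enorm [_ ^+ e * _]mulrC [z * _]mulrC.
Qed.

Lemma cabs_psi_le x : cabs (psi R e x) <= cabs (toC x ^+ e).
Proof.
rewrite /psi cabsM -[leRHS]mul1r ler_wpM2r ?cabs_ge0 //; exact: cabs_eps_le.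
Qed.

Lemma bsum_psi (y : R) : 0 < y ->
  bsum (fun x => cabs (psi R e x) * expR (- (2 * pi * ((enorm x)%:~R * y)))).
Proof.
move=> y0; apply: bsum_le (asum_toC_pow (z := Complex 0 y) y0) => x.
rewrite cabsM cabs_e2ipi real_int ImZ /=.
by rewrite ler_wpM2r ?expR_ge0 ?cabs_psi_le.
Qed.

Definition cmtheta (z : C) : C := csum (fun x => psi R e x * e2ipi ((enorm x)%:~R * z)).

Lemma asum_cmtheta z : 0 < complex.Im z ->
  asum (fun x => psi R e x * e2ipi ((enorm x)%:~R * z)).
Proof.
move=> z0; apply: asum_le (asum_toC_pow z0) => x.
by rewrite !cabsM ler_wpM2r ?cabs_ge0 // -cabsM cabs_psi_le.
Qed.

Lemma cmtheta_diff z : 0 < complex.Im z -> exists d, cdiff cmtheta z d.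
Proof.
move=> z0; have w0 x : 0 <= (enorm x)%:~R :> R by rewrite ler0z enorm_ge0.
have [d hd] := eser_diff w0 bsum_psi z0; exists d.
by apply: cdiff_eq hd _ => w; apply: eq_csum => x; rewrite real_int.
Qed.

(** Parametrises the elements congruent to 1 modulo the conductor; [cang_inv] is its inverse on that
    class. *)
Definition cang (p : int * int) : int * int := eadd (1, 0) (emul M p).
Definition cang_inv (x : int * int) : int * int :=
  let u := emul (x.1 - 1, x.2) (econj M) in ((u.1 %/ D%:Z)%Z, (u.2 %/ D%:Z)%Z).

Lemma econdN_gt0 : (0 < D)%N.
Proof. by case: s => [|[|[|[|[|t]]]]]. Qed.

Lemma enorm_econd : enorm M = D%:Z.
Proof. by case: s => [|[|[|[|[|t]]]]]. Qed.

Lemma econd_mulK p : emul (emul M p) (econj M) = (D%:Z * p.1, D%:Z * p.2).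
Proof.
rewrite -emulA [emul p _]emulC emulA emul_conj enorm_econd.
by rewrite /emul /=; congr (_, _); ring.
Qed.

Lemma cangK : cancel cang cang_inv.
Proof.
move=> p; have d0 : D%:Z != 0 by have := econdN_gt0; lia.
rewrite /cang_inv /cang.
have -> : ((eadd (1, 0) (emul M p)).1 - 1, (eadd (1, 0) (emul M p)).2) = emul M p.
  by case: (emul M p) => a b; rewrite /eadd /=; congr (_, _); ring.
by rewrite econd_mulK /= !mulKz //; case: p.
Qed.

Lemma cong1_cang p : cong1 s (cang p).
Proof.
rewrite /cong1 /cang.
have -> : ((eadd (1, 0) (emul M p)).1 - 1, (eadd (1, 0) (emul M p)).2) = emul M p.
  by case: (emul M p) => a b; rewrite /eadd /=; congr (_, _); ring.
by rewrite econd_mulK /= !dvdz_mulr.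
Qed.

Lemma cang_invK x : cong1 s x -> cang (cang_inv x) = x.
Proof.
case: x => a b /andP[/= h1 h2]; rewrite /cang /cang_inv /=.
set u := emul (a - 1, b) (econj M) in h1 h2 *.
have d0 : D%:Z != 0 by have := econdN_gt0; lia.
set v := (_ %/ _, _)%Z.
have hu : u = emul (D%:Z, 0) v.
  by rewrite /emul /v /= !mul0r subr0 !addr0 -!(mulrC (_ %/ _)%Z) !divzK //; case: (u).
have : emul (D%:Z, 0) (emul M v) = emul (D%:Z, 0) (a - 1, b).
  rewrite emulA [emul _ M]emulC -emulA -hu /u emulC -emulA [emul _ M]emulC emul_conj enorm_econd.
  exact: emulC.
move: (emul M v) => [c d]; rewrite /emul /= => -[h3 h4].
have {}h3 : D%:Z * c = D%:Z * (a - 1) by lia.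
have {}h4 : D%:Z * d = D%:Z * b by lia.
by rewrite (mulfI d0 h3) (mulfI d0 h4) /eadd /=; congr (_, _); ring.
Qed.

End Series.
End CMTheta.

(** * Inversion of the theta series of the character *)

Section CMThetaInversion.
Variable R : realType.
Local Notation C := (Cplx R).
Local Notation zeta := (zeta R).
Local Notation toC := (toC R).

Lemma eunitD i j : eunit (i + j) = emul (eunit i) (eunit j).
Proof. by elim: i => [|i IH]; rewrite ?emul1 // addSn !eunitS IH emulA. Qed.

Lemma eunit6 j : eunit (6 * j) = (1, 0).
Proof.
elim: j => [|j IH] //; rewrite mulnS eunitD IH.
by rewrite (_ : eunit 6 = (1, 0)) // emul1.
Qed.

Lemma eunitK j : cancel (emul (eunit j)) (emul (eunit (5 * j))).
Proof. by move=> x; rewrite emulA -eunitD -[X in (_ + X)%N]mul1n -mulnDl eunit6 emul1. Qed.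

Lemma eunitKV j : cancel (emul (eunit (5 * j))) (emul (eunit j)).
Proof. by move=> x; rewrite emulA -eunitD -[X in (X + _)%N]mul1n -mulnDl eunit6 emul1. Qed.

Lemma enorm_eunit j : enorm (eunit j) = 1.
Proof. by elim: j => // j IH; rewrite eunitS enormM IH. Qed.

Lemma csum_unit_average (f : int * int -> C) : asum f ->
  6 * csum f = csum (fun x => \sum_(0 <= j < 6) f (emul (eunit j) x)).
Proof.
move=> sf; rewrite csum_sum; last first.
  by move=> j; apply: (asum_inj (can_inj (eunitK j)) sf).
rewrite (eq_bigr (fun=> csum f)); last first.
  by move=> j _; symmetry; exact: (csum_bij (eunitK j) (eunitKV j) sf).
by rewrite big_const_nat iter_addr_0 mulr_natl.
Qed.

Variable e : nat.
Hypothesis e0 : (0 < e)%N.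
Local Notation s := (e %% 6)%N.
Local Notation D := (econdN s).
Local Notation M := (econd s).

Let s6 : (s < 6)%N. Proof. exact: ltn_pmod. Qed.

Lemma zeta_mulmod j : zeta ^+ (j * e) = zeta ^+ (s * j).
Proof. by rewrite zeta_mod -modnMmr -zeta_mod mulnC. Qed.

(** By [cong_sum] the character is a sum of indicators over the units, and each unit contributes the
    same sum over the class of 1, because zeta^(s j) is exactly the e-th power of zeta^j. *)
Lemma cmtheta_cang z : 0 < complex.Im z -> (hcount s)%:R * cmtheta e z =
  6 * csum (fun p => toC (cang e p) ^+ e * e2ipi ((enorm (cang e p))%:~R * z)).
Proof.
move=> z0; pose g (x : int * int) := if cong1 s x then toC x ^+ e * e2ipi ((enorm x)%:~R * z) else 0.
have sg : asum g.
  apply: asum_le (asum_toC_pow e z0) => x; rewrite /g.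
  by case: ifP => // _; rewrite cabs0 cabs_ge0.
rewrite /cmtheta -[LHS]csumZ; last exact: asum_cmtheta.
transitivity (csum (fun x => \sum_(0 <= j < 6) g (emul (eunit j) x))).
  apply: eq_csum => x; rewrite /psi mulrA mulrA -cong_sum // mulr_suml mulr_suml.
  apply: eq_bigr => j _; rewrite /g; case: ifP => _; last by rewrite !mul0r.
  by rewrite toC_mul enormM enorm_eunit mul1r exprMn toC_eunit -exprM zeta_mulmod.
rewrite -csum_unit_average //; congr (_ * _).
rewrite (csum_reindex (cangK e0) _ sg); last first.
  move=> x; rewrite /g; case: ifP => [h _|]; last by rewrite eqxx.
  exact: cang_invK e0 _ h.
by apply: eq_csum => p; rewrite /= /g cong1_cang.
Qed.

(** Averaging over the units replaces the additive character by its Gauss sum, which is a constant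
    times eps. *)
Lemma cmtheta_dual z : 0 < complex.Im z ->
  6 * csum (fun p => toC p ^+ e * (zeta ^+ cres s p * e2ipi ((enorm p)%:~R * z))) =
  toC (gauss_sum s (1, 0)) * cmtheta e z.
Proof.
move=> z0; rewrite csum_unit_average; last first.
  apply: asum_le (asum_toC_pow e z0) => x; rewrite !cabsM.
  by rewrite [cabs (zeta ^+ _)]cabsX cabs_zeta expr1n mul1r.
rewrite /cmtheta -[RHS]csumZ; last exact: asum_cmtheta.
apply: eq_csum => x; rewrite /psi !mulrA -gauss_sumE // !mulr_suml.
apply: eq_bigr => j _.
by rewrite toC_mul enormM enorm_eunit mul1r exprMn toC_eunit -exprM zeta_mulmod; ring.
Qed.

Lemma toC_neq0 x : enorm x != 0 -> toC x != 0.
Proof. by rewrite -cabs_eq0 -[X in _ -> ~~ X]sqrf_eq0 cabs_toC_sq intr_eq0. Qed.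

Lemma cang_shift p : let r := econj M in
  emul r (cang e p) = (D%:Z * p.1 + r.1, D%:Z * p.2 + r.2).
Proof.
move=> r; have -> : emul r (cang e p) = eadd r (emul (emul M p) r).
  by rewrite /cang /emul /eadd /=; congr (_, _); ring.
by rewrite econd_mulK /eadd /=; congr (_, _); ring.
Qed.

Lemma one_sub_two_zeta : (1 - 2 * zeta) ^+ 2 = - 3 :> C.
Proof.
rewrite (_ : _ ^+ 2 = 1 - 4 * zeta + 4 * zeta ^+ 2); last by move: zeta => w; ring.
by rewrite zeta_sq; move: zeta => w; ring.
Qed.

(** Elements congruent to 1 modulo the conductor M have the form M (p + 1/M). Their theta series is
    thus that of the lattice shifted by 1/M = conj(M) / D, at the parameter D z, and
    [hex_theta_inversion] sends it to 3 D z with the additive character attached to 1/M. *)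
Lemma cmtheta_inversion0 : exists c1 c2 : C, c1 != 0 /\ forall z, 0 < complex.Im z ->
  c1 * z ^+ e.+1 * cmtheta e z = c2 * cmtheta e (- ((3 * D)%:R * z)^-1).
Proof.
have D0 : D%:R != 0 :> C := econdN_neq0 R s.
have D0R : D%:R != 0 :> R by rewrite pnatr_eq0 -lt0n econdN_gt0.
pose r := econj M; pose r1 : R := r.1%:~R / D%:R; pose r2 : R := r.2%:~R / D%:R.
pose A : C := toC r / D%:R.
have A0 : A != 0.
  rewrite mulf_neq0 ?invr_eq0 // toC_neq0 // /r enorm_conj enorm_econd.
  by have := econdN_gt0 e; lia.
exists ((hcount s)%:R * A ^+ e * (D%:R * (1 - 2 * zeta)) ^+ e * D%:R).
exists (kappa R * toC (gauss_sum s (1, 0))); split.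
  have z12 : 1 - 2 * zeta != 0.
    by rewrite -sqrf_eq0 one_sub_two_zeta oppr_eq0 pnatr_eq0.
  apply: mulf_neq0 => //; apply: mulf_neq0; last by rewrite expf_neq0 // mulf_neq0.
  by apply: mulf_neq0; rewrite ?expf_neq0 // pnatr_eq0 -lt0n hcount_gt0.
move=> z z0; have zn := tneq0 z0.
have Dz0 : 0 < complex.Im (D%:R * z).
  by rewrite real_nat ImZ mulr_gt0 // ltr0n econdN_gt0.
have h := hex_theta_inversion e r1 r2 Dz0.
have e1 : csum (fun p : int * int =>
    ((p.1%:~R + r1%:C%C) + (p.2%:~R + r2%:C%C) * zeta) ^+ e *
    e2ipi (D%:R * z * hexQ (p.1%:~R + r1%:C%C) (p.2%:~R + r2%:C%C))) =
  A ^+ e * csum (fun p => toC (cang e p) ^+ e * e2ipi ((enorm (cang e p))%:~R * z)).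
  rewrite -csumZ; last exact: (asum_inj (can_inj (cangK e0)) (asum_toC_pow e z0)).
  apply: eq_csum => p; have hs := cang_shift p; rewrite /= -/r in hs.
  have E1 : p.1%:~R + r1%:C%C = (emul r (cang e p)).1%:~R / D%:R :> C.
    rewrite hs /= rmorphD !rmorphM fmorphV /= !rmorph_int !rmorph_nat mulrDl.
    by rewrite mulrAC mulfV ?mul1r.
  have E2 : p.2%:~R + r2%:C%C = (emul r (cang e p)).2%:~R / D%:R :> C.
    rewrite hs /= rmorphD !rmorphM fmorphV /= !rmorph_int !rmorph_nat mulrDl.
    by rewrite mulrAC mulfV ?mul1r.
  rewrite E1 E2 mulrA -exprMn; congr (_ ^+ e * e2ipi _).
    transitivity (toC (emul r (cang e p)) / D%:R); last by rewrite toC_mul /A; ring.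
    by rewrite /toC; ring.
  transitivity (hexQ (emul r (cang e p)).1%:~R (emul r (cang e p)).2%:~R / D%:R * z).
    by rewrite /hexQ; move: (_%:~R) (_%:~R) => u v; field.
  rewrite hexQ_enorm enormM /r enorm_conj enorm_econd rmorphM /= -[D%:Z%:~R]/(D%:R).
  by congr (_ * z); rewrite mulrAC mulfV ?mul1r.
rewrite e1 in h.
have z1 : 0 < complex.Im (- ((3 * D)%:R * z)^-1).
  by apply: Im_inv_opp_gt0; rewrite real_nat ImZ mulr_gt0 // ltr0n muln_gt0 econdN_gt0.
have e2 : csum (fun p : int * int => (p.1%:~R + p.2%:~R * zeta) ^+ e *
    (e2ipi (p.1%:~R * r2%:C%C - p.2%:~R * r1%:C%C) * e2ipi (- ((3 * (D%:R * z))^-1) * hexQ p.1%:~R p.2%:~R))) =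
   csum (fun p => toC p ^+ e * (zeta ^+ cres s p * e2ipi ((enorm p)%:~R * - ((3 * D)%:R * z)^-1))).
  apply: eq_csum => p; rewrite e2ipi_cres hexQ_enorm; congr (_ * (_ * e2ipi _)).
  by rewrite natrM mulrA mulrC.
rewrite e2 in h.
have h1 := cmtheta_cang z0; have h2 := cmtheta_dual z1.
have {h}h : (A ^+ e * (6 * csum (fun p => toC (cang e p) ^+ e * e2ipi ((enorm (cang e p))%:~R * z)))) *
   (D%:R * z * (1 - 2 * zeta)) ^+ e =
  kappa R / (D%:R * z) * (6 * csum (fun p => toC p ^+ e * (zeta ^+ cres s p * e2ipi ((enorm p)%:~R * - ((3 * D)%:R * z)^-1)))).
  by rewrite [A ^+ e * (6 * _)]mulrCA -[LHS]mulrA h mulrCA.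
rewrite -h1 h2 in h.
move: h; move: (cmtheta e z) (cmtheta e (- ((3 * D)%:R * z)^-1)) (toC (gauss_sum _ _)) => u v G h.
transitivity (A ^+ e * ((hcount s)%:R * u) * (D%:R * z * (1 - 2 * zeta)) ^+ e * (D%:R * z)).
  move: (A ^+ e) => X1; rewrite exprSr !exprMn; move: (z ^+ e) => X3.
  move: ((1 - 2 * zeta) ^+ e) => X2.
   move: (D%:R ^+ e) => X4.
 move: (D%:R) => X5.
  by ring.
by rewrite h; field; rewrite zn D0.
Qed.

Lemma enorm1_unit x : enorm x = 1 -> exists j, x = eunit j.
Proof.
case: x => a b; rewrite /enorm /= => h.
have ha : a \in [:: -1; 0; 1] by rewrite !inE; nia.
have hb : b \in [:: -1; 0; 1] by rewrite !inE; nia.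
move: ha hb h; rewrite !inE => /or3P[] /eqP -> /or3P[] /eqP -> //= _.
- by exists 3%N.
- by exists 2%N.
- by exists 4%N.
- by exists 1%N.
- by exists 5%N.
- by exists 0%N.
Qed.

Lemma psi_0 : psi R e (0, 0) = 0.
Proof. by rewrite /psi /toC mul0r addr0 expr0n eqn0Ngt e0 mulr0. Qed.

Lemma csum_norm1 : csum (fun x => if enorm x == 1 then psi R e x else 0) = 6.
Proof.
rewrite (@csum_supp _ _ _ [seq eunit j | j <- iota 0 6]) //.
  rewrite big_map (eq_bigr (fun=> 1)) ?big_const_seq ?iter_addr_0 //.
  by move=> j _; rewrite enorm_eunit eqxx psi_eunit.
move=> x; case: eqP => // /enorm1_unit[j ->] h; exfalso; move: h; rewrite (divn_eq j 6) eunitD.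
rewrite [(_ * 6)%N]mulnC eunit6 emul1; apply/negP; rewrite negbK.
by apply: map_f; rewrite mem_iota ltn_pmod.
Qed.

(* As Im z grows, exp(-2 pi i z) times the series tends to the sum of psi over the six units. *)
Lemma cmtheta_neq0 : exists2 z : C, 0 < complex.Im z & cmtheta e z != 0.
Proof.
pose zn (n : nat) : C := Complex 0 n.+1%:R.
apply: contrapT => H.
have H0 n : cmtheta e (zn n) = 0.
  apply/eqP; apply: contrapT => /negP h; apply: H.
  by exists (zn n); rewrite //= ltr0n.
pose u (n : nat) x := psi R e x * e2ipi ((enorm x - 1)%:~R * zn n).
pose v x := if enorm x == 1 then psi R e x else 0.
have Hu n : csum (u n) = 0.
  transitivity (csum (fun x => e2ipi (- zn n) * (psi R e x * e2ipi ((enorm x)%:~R * zn n)))).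
    apply: eq_csum => x; rewrite /u rmorphB mulrBl mul1r e2ipiD mulrA mulrC.
    by rewrite !mulrA.
  rewrite csumZ; last by apply: asum_cmtheta => /=; rewrite ltr0n.
  by rewrite [csum _](H0 n) mulr0.
have cu n x : cabs (u n x) = cabs (psi R e x) * expR (- (2 * pi * ((enorm x - 1)%:~R * n.+1%:R))).
  by rewrite cabsM cabs_e2ipi real_int ImZ.
have p0 := pi_gt0 R.
have psi0 x : enorm x = 0 -> psi R e x = 0 by move/enorm_eq0 => ->; exact: psi_0.
have n1 (n : nat) : 1 <= n.+1%:R :> R by rewrite ler1n.
have nx1 x : enorm x != 0 -> 1 <= (enorm x)%:~R :> R.
  by have := enorm_ge0 x; rewrite -[1]/(1%:~R) ler_int; lia.
have lim : (fun n => csum (u n)) @ \oo --> csum v.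
  have hb := bsumZ (expR_ge0 (2 * pi)) (bsum_psi e (@ltr01 R)).
  apply: (csum_tannery _ hb).
    exists 0%N => // n _ x; rewrite cu [leRHS]mulrCA.
    have [nx|/nx1 nx] := eqVneq (enorm x) 0; first by rewrite psi0 // cabs0 !mul0r.
    rewrite ler_wpM2l ?cabs_ge0 // -expRD ler_expR rmorphB mulr1.
    have h1 := n1 n; have : (enorm x)%:~R - 1 <= ((enorm x)%:~R - 1) * n.+1%:R :> R by nra.
    by move: (_ * n.+1%:R) => Y hY; nra.
  move=> x; apply/cvgCP => d d0; rewrite /v.
  have [nx|nx0] := eqVneq (enorm x) 0.
    exists 0%N => // n _; rewrite /u psi0 // nx mul0r subr0 cabs0 //.
  case: eqP => [nx|nx]; first by exists 0%N => // n _; rewrite /u nx subrr mul0r e2ipi0 mulr1 subrr cabs0.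
  pose N := Num.trunc (cabs (psi R e x) / d).
  exists N.+1 => // n /= Nn; rewrite subr0 cu.
  have hn : cabs (psi R e x) / d < n.+1%:R.
    apply: lt_le_trans (truncnS_gt _) _; rewrite ler_nat; exact: leqW.
  have h2 : expR (- (2 * pi * ((enorm x - 1)%:~R * n.+1%:R))) <= n.+1%:R^-1 :> R.
    rewrite expRN lef_pV2 ?posrE ?expR_gt0 ?ltr0n //.
    apply: le_trans (expR_ge1Dx _).
    have : 1 <= (enorm x - 1)%:~R :> R by rewrite -[1]/(1%:~R) ler_int; have := enorm_ge0 x; lia.
    have := pi_ge2 R; have := n1 n; move: (_%:~R) (_%:R) => X Y hY hp hX.
    have : Y <= X * Y by nra.
    by move: (X * Y) => Z hZ; nra.
  apply: (le_lt_trans (ler_wpM2l (cabs_ge0 _) h2)).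
  by rewrite ltr_pdivrMr ?ltr0n // mulrC -ltr_pdivrMr.
have lim0 : (fun n => csum (u n)) @ \oo --> (0 : C).
  by rewrite (_ : (fun n => _) = fun=> 0); [exact: cvgC_cst|apply/funext].
have h6 := cvgC_unique _ lim lim0.
have : (6 : C) == 0 by rewrite -csum_norm1; apply/eqP; exact: h6.
by rewrite pnatr_eq0.
Qed.

(** At a point where the series does not vanish the left side of [cmtheta_inversion0] is nonzero, so
    the constant on its right side is nonzero as well. *)
Lemma cmtheta_inversion : exists2 c : C, c != 0 & forall z, 0 < complex.Im z ->
  cmtheta e (- ((3 * D)%:R * z)^-1) = c * z ^+ e.+1 * cmtheta e z.
Proof.
have [c1 [c2 [c10 h]]] := cmtheta_inversion0; have [z0 hz nz] := cmtheta_neq0.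
have c20 : c2 != 0.
  apply/eqP => c20; have := h z0 hz; rewrite c20 mul0r => /eqP.
  by rewrite !mulf_eq0 (negbTE c10) (negbTE nz) expf_eq0 (negbTE (tneq0 hz)) andbF.
exists (c1 / c2) => [|z z0']; first by rewrite mulf_neq0 ?invr_eq0.
apply: (mulfI c20); rewrite -h //.
by move: (z ^+ _) (cmtheta e z) => X Y; field.
Qed.

End CMThetaInversion.

(** * Fourier coefficients and Hecke operators *)

Section Coefficients.
Variable R : realType.
Local Notation C := (Cplx R).
Local Notation psi := (psi R).
Variable e : nat.
Hypothesis e0 : (0 < e)%N.
Local Notation s := (e %% 6)%N.
Local Notation m := (ewidth s).

(** An unordered sum over all elements, cut down to norm [n]; summability is inherited from the
    theta series at the point i instead of an enumeration of the elements of given norm. *)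
Definition norm_sum (P : pred (int * int)) (n : int) : C :=
  csum (fun x => if (enorm x == n) && P x then psi e x else 0).

Lemma asum_norm_sum P n : asum (fun x => if (enorm x == n) && P x then psi e x else 0).
Proof.
have i0 : 0 < complex.Im (Complex 0 1 : C) by rewrite /= ltr01.
have h := asumZ (expR (2 * pi * n%:~R))%:C%C (asum_cmtheta e i0).
apply: asum_le (h) => x; case: ifP => [/andP[/eqP <- _]|_]; last by rewrite cabs0 cabs_ge0.
rewrite !cabsM cabs_real cabs_e2ipi ger0_norm ?expR_ge0 // real_int ImZ /= mulr1.
by rewrite mulrCA -expRD subrr expR0 mulr1.
Qed.

Definition gam (n : nat) : C := norm_sum predT n%:Z / 6.

Lemma gam0 : gam 0 = 0.
Proof.
rewrite /gam (_ : norm_sum _ _ = 0) ?mul0r //.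
transitivity (csum (fun _ : int * int => 0 : C)); last exact: csum0.
by apply: eq_csum => x; case: eqP => // /enorm_eq0 ->; rewrite psi_0.
Qed.

Lemma gam1 : gam 1 = 1.
Proof.
rewrite /gam /norm_sum (eq_csum (g := fun x => if enorm x == 1 then psi e x else 0)).
  by rewrite csum_norm1 // mulfV ?pnatr_eq0.
by move=> x; rewrite andbT.
Qed.

Definition cmform (z : C) : C := cmtheta e z / 6.

Lemma cmform_qexp z : 0 < complex.Im z ->
  asum (fun n => gam n * e2ipi (n%:R * z)) /\
  cmform z = csum (fun n => gam n * e2ipi (n%:R * z)).
Proof.
move=> z0; have [h1 h2] := csum_fiber (fun x => absz (enorm x)) (asum_cmtheta e z0).
have eqf n : csum (fun x => if absz (enorm x) == n then psi e x * e2ipi ((enorm x)%:~R * z) else 0) =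
    6 * (gam n * e2ipi (n%:R * z)).
  rewrite mulrA [6 * _]mulrC /gam divfK ?pnatr_eq0 // mulrC -csumZ; last exact: asum_norm_sum.
  apply: eq_csum => x; rewrite andbT; have := enorm_ge0 x.
  case: eqP => [<- hx|hn hx]; last by case: eqP => [h|_]; rewrite ?mulr0 //; lia.
  by rewrite gez0_abs // eqxx mulrC; congr (e2ipi (_ * z) * _); rewrite -[RHS]/((absz (enorm x))%:Z%:~R) gez0_abs.
split.
  have := asumZ 6^-1 h1; congr asum; apply/funext => n.
  by rewrite eqf mulrA mulVf ?mul1r ?pnatr_eq0.
rewrite /cmform /cmtheta h2 mulrC -csumZ //; apply: eq_csum => n.
by rewrite eqf mulrA mulVf ?mul1r ?pnatr_eq0.
Qed.

Lemma cmform_cusp_expansion : cusp_expansion 1 gam cmform.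
Proof.
move=> z z0; have [h1 ->] := cmform_qexp z0.
have := csum_series h1; rewrite (_ : (fun j => _) = (fun j => \sum_(1 <= n < j) gam n * e2ipi (n%:R * z / 1%:R))) //.
apply/funext => j.
case: j => [|j]; first by rewrite !big_geq.
rewrite big_nat_recl // gam0 mul0r add0r big_add1 /=.
by apply: eq_bigr => i _; rewrite divr1.
Qed.

Lemma enorm_residues : all (fun s => all (fun x =>
  (eidx s x < 6)%N ==> ((absz (enorm x %% 6)%Z) == 1 %[mod ewidth s])%N) residues) (iota 0 6).
Proof. by vm_compute. Qed.

(** Where the character does not vanish, [x] is a unit modulo the conductor times 1, and its norm is
    1 modulo m. This is why the translation by 1/m multiplies the form by e(1/m). *)
Lemma psi_neq0_norm x : psi e x != 0 -> exists t : int, enorm x = 1 + t * m%:Z.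
Proof.
move=> hx; have h : (eidx s x < 6)%N.
  by move: hx; rewrite /psi /eps; case: ifP; rewrite // mul0r eqxx.
have := allP enorm_residues s; rewrite mem_iota ltn_pmod // => /(_ isT) H.
have := residue_ind (P := fun x => (eidx s x < 6)%N ==> ((absz (enorm x %% 6)%Z) == 1 %[mod m])%N) _ H x.
rewrite h /= => H2.
have /eqP : (absz (enorm x %% 6)%Z == 1 %[mod m])%N.
  apply: H2 => -[a b]; rewrite eidx_res; congr (_ ==> (_ == _)); congr (_ %% _)%N; congr absz.
  rewrite [in LHS](eresE (a, b)) /enorm /eadd /emul /eres /= !(mul0r, subr0, addr0).
  set u := (a %% 6)%Z; set v := (b %% 6)%Z; set p := (a %/ 6)%Z; set q := (b %/ 6)%Z.
  rewrite (_ : _ + _ = (u ^+ 2 + u * v + v ^+ 2) + (2 * u * p + 6 * p ^+ 2 + u * q + p * v + 6 * p * q + 2 * v * q + 6 * q ^+ 2) * 6); last by ring.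
  by rewrite addrC modzMDl.
have : (m \in [:: 1; 2; 3; 6])%N by case: s => [|[|[|[|[|t]]]]].
rewrite !inE => /or4P[] /eqP ->; last 1 first.
- by exists ((enorm x) %/ 6)%Z; lia.
- by exists (enorm x - 1); lia.
- by exists ((enorm x) %/ 2)%Z; lia.
- by exists ((enorm x) %/ 3)%Z; lia.
Qed.

Lemma ewidth_gt0 : (0 < m)%N. Proof. by case: s => [|[|[|[|[|t]]]]]. Qed.

Lemma cmform_shift z : 0 < complex.Im z -> cmform (z + m%:R^-1) = e2ipi (m%:R^-1) * cmform z.
Proof.
move=> z0; have m0 : m%:R != 0 :> C by rewrite pnatr_eq0 -lt0n ewidth_gt0.
rewrite /cmform /cmtheta mulrA -csumZ; last exact: asum_cmtheta.
congr (_ / 6); apply: eq_csum => x.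
have [->|/psi_neq0_norm[t ht]] := eqVneq (psi e x) 0; first by rewrite !mul0r mulr0.
rewrite mulrCA -e2ipiD mulrDr addrC; congr (_ * _); rewrite e2ipiD e2ipiD; congr (_ * _).
have -> : (enorm x)%:~R / m%:R = m%:R^-1 + t%:~R :> C.
  by rewrite ht rmorphD rmorphM /= -[m%:Z%:~R]/(m%:R); field.
by rewrite e2ipiD e2ipi_int mulr1.
Qed.

End Coefficients.

(** * Primes as norms of Eisenstein integers *)

Section PrimeNorms.

Variable p : nat.
Hypothesis pp : prime p.

Lemma Fp_int_eq0 (n : int) : (n%:~R == 0 :> 'F_p) = (p%:Z %| n)%Z.
Proof.
have h (a : nat) : (a%:R == 0 :> 'F_p) = (p %| a)%N by rewrite -(dvdn_pcharf (pchar_Fp pp)).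
by case: n => a; rewrite ?NegzE ?rmorphN ?oppr_eq0 /= ?dvdzN ?h // -[(a.+1)%:Z%:~R]/(a.+1%:R) h.
Qed.

Lemma Fp_fermat (x : 'F_p) : x != 0 -> x ^+ p.-1 = 1.
Proof.
move=> x0; apply: (mulfI x0); rewrite -exprS prednK ?prime_gt0 // mulr1.
by rewrite -(natr_Zp x) -natrX -[LHS](Fp_nat_mod pp) fermat_little // Fp_nat_mod.
Qed.

(** With n = (p-1)/3, the polynomial X^n - 1 has at most n roots, so some nonzero u has u^n
    different from 1; by Fermat u^n is a nontrivial cube root of 1. *)
Lemma cube_root_Fp : (p = 1 %[mod 3])%N -> exists t : 'F_p, t ^+ 2 + t + 1 = 0.
Proof.
move=> p1; have p3 := prime_gt1 pp.
pose n := (p.-1 %/ 3)%N; have n3 : p.-1 = (3 * n)%N by rewrite /n; lia.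
have n0 : (0 < n)%N by rewrite /n; lia.
have [u u0 un] : exists2 u : 'F_p, u != 0 & u ^+ n != 1.
  apply: contrapT => H.
  pose rs : seq 'F_p := [seq x <- enum 'F_p | x != 0].
  pose P : {poly 'F_p} := 'X^n - 1.
  have : (size rs < size P)%N.
    apply: max_poly_roots; last by rewrite filter_uniq ?enum_uniq.
      by rewrite -size_poly_eq0 size_XnsubC.
    apply/allP => x; rewrite mem_filter => /andP[x0 _].
    rewrite rootE !hornerE subr_eq0; apply: contrapT => /negP h; apply: H.
    by exists x.
  rewrite /P size_XnsubC // /rs size_filter -(addKn (count (pred1 (0 : 'F_p)) (enum 'F_p)) (count _ _)).
  rewrite (count_predC (pred1 (0 : 'F_p))) -cardE card_Fp // (count_uniq_mem _ (enum_uniq _)) mem_enum inE /=.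
  by rewrite subn1 n3; lia.
exists (u ^+ n); have h : (u ^+ n) ^+ 3 = 1 by rewrite -exprM mulnC -n3 Fp_fermat.
have : (u ^+ n - 1) * (u ^+ n ^+ 2 + u ^+ n + 1) = 0.
  transitivity (u ^+ n ^+ 3 - 1); last by rewrite h subrr.
  by move: (u ^+ n) => t; ring.
by move/eqP; rewrite mulf_eq0 subr_eq0 (negbTE un) => /eqP.
Qed.

(** Thue's pigeonhole argument: u = t v modulo p with |u| and |v| below sqrt(p), so that the norm of
    (u, v) is a positive multiple of p below 3p. *)
Lemma prime_norm_exists : (p = 1 %[mod 3])%N -> exists x : int * int, enorm x = p%:Z.
Proof.
move=> p1; have [t ht] := cube_root_Fp p1.
have [r rp pr] : exists2 r : nat, (r ^ 2 <= p)%N & (p < r.+1 ^ 2)%N.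
  have : exists r, (p < r.+1 ^ 2)%N by exists p; nia.
  move/ex_minnP => [[|r] h1 h2]; first by move: h1; have := prime_gt1 pp; lia.
  by exists r.+1 => //; rewrite leqNgt; apply/negP => /h2; rewrite ltnn.
pose g (ij : 'I_r.+1 * 'I_r.+1) : 'F_p := (ij.1 : nat)%:R - t * (ij.2 : nat)%:R.
have /injectivePn[ij [kl ne eqg]] : ~~ injectiveb g.
  apply/negP => /injectiveP/leq_card; rewrite card_prod card_ord card_Fp //.
  by rewrite leqNgt mulnn pr.
pose u : int := (ij.1 : nat)%:Z - (kl.1 : nat)%:Z; pose v : int := (ij.2 : nat)%:Z - (kl.2 : nat)%:Z.
have uv : u%:~R = t * v%:~R :> 'F_p.
  rewrite /u /v !rmorphB /= -!pmulrn mulrBr; apply/eqP; rewrite subr_eq; apply/eqP.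
  by move: eqg; rewrite /g => /eqP; rewrite subr_eq => /eqP ->; ring.
have hN : (p%:Z %| enorm (u, v))%Z.
  rewrite -Fp_int_eq0 /enorm /= !rmorphD !rmorphM /= uv.
  apply/eqP; transitivity (v%:~R ^+ 2 * (t ^+ 2 + t + 1)); last by rewrite ht mulr0.
  by move: (v%:~R) => w; ring.
have bu : u ^+ 2 <= (r ^ 2)%N%:Z by have := ltn_ord ij.1; have := ltn_ord kl.1; rewrite /u; nia.
have bv : v ^+ 2 <= (r ^ 2)%N%:Z by have := ltn_ord ij.2; have := ltn_ord kl.2; rewrite /v; nia.
have uv0 : enorm (u, v) != 0.
  apply: contra ne => /eqP/enorm_eq0 => -[hu hv]; rewrite [ij]surjective_pairing [kl]surjective_pairing.
  by apply/eqP; congr (_, _); apply: val_inj => /=; [move/eqP: hu|move/eqP: hv]; rewrite subr_eq0 => /eqP[].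
have rp2 : (r ^ 2 != p)%N.
  apply/eqP => h; have /primeP[p1' hd] := pp.
  by have := hd r; rewrite -{1}h dvdn_exp // => /(_ isT)/orP[] /eqP; clear -h p1'; nia.
have n3 : enorm (u, v) < 3 * p%:Z.
  have : (r ^ 2)%N%:Z < p%:Z by lia.
  by clear -bu bv; rewrite /enorm /=; move: (r ^ 2)%N%:Z bu bv => X; nia.
have n0 := enorm_ge0 (u, v).
have [c hc] : exists c, enorm (u, v) = c * p%:Z by apply/dvdzP.
have p0 := prime_gt1 pp.
have : c = 1 \/ c = 2.
  by move: n0 n3 uv0; rewrite hc; clear -p0; nia.
case=> c12; first by exists (u, v); rewrite hc c12 mul1r.
(* Norm 2p is excluded: the form is even only when both coordinates are, and then 4 divides 2p,
   contradicting p = 1 modulo 3. *)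
have [hu hv] : (2 %| u)%Z /\ (2 %| v)%Z.
  move: hc; rewrite c12 /enorm /= => hc.
  have : u * u + u * v + v * v = 2 * p%:Z by rewrite -hc; ring.
  have [u' [ru hu]] : exists u' r', u = 2 * u' + r' /\ (r' = 0 \/ r' = 1) by exists (u %/ 2)%Z, (u %% 2)%Z; lia.
  have [v' [rv hv]] : exists u' r', v = 2 * u' + r' /\ (r' = 0 \/ r' = 1) by exists (v %/ 2)%Z, (v %% 2)%Z; lia.
  case: hu hv => -> hu [-> hv]; case: hu hv => -> [] -> h; first by lia.
  - by exfalso; nia.
  - by exfalso; nia.
  - by exfalso; nia.
exfalso; move: hu hv hc => /dvdzP[u' ->] /dvdzP[v' ->]; rewrite c12 /enorm /= => hc.
have p2 : p = 2%N.
  apply/eqP; rewrite eq_sym -(dvdn_prime2 _ pp) //.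
  have : 2 * p%:Z = 2 * (2 * (u' ^+ 2 + u' * v' + v' ^+ 2)) by rewrite -hc; ring.
  by clear; move: (_ + _) => w; lia.
by move: p1; rewrite p2.
Qed.

Lemma prime_dvdzM (a b : int) : (p%:Z %| a * b)%Z = (p%:Z %| a)%Z || (p%:Z %| b)%Z.
Proof. by rewrite -!Fp_int_eq0 rmorphM mulf_eq0. Qed.

(** Some representation has an even second coordinate 2b, by passing to an associate or the
    conjugate, and u^2 + u (2b) + (2b)^2 = (u + b)^2 + 3 b^2. Primality of p gives b != 0;
    congruence modulo 3 fixes the sign of a. *)
Lemma normalized_rep_exists : (p = 1 %[mod 6])%N -> exists ab, normalized_rep p ab.
Proof.
move=> p1; have [|[u v] huv] := prime_norm_exists; first by lia.
have [u' [b hb]] : exists u' b : int, p%:Z = u' ^+ 2 + u' * (2 * b) + (2 * b) ^+ 2.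
  have [hv|hv] := boolP (2 %| v)%Z.
    by exists u, (v %/ 2)%Z; rewrite -huv /enorm /= [2 * _]mulrC divzK.
  have [hu|hu] := boolP (2 %| u)%Z.
    by exists v, (u %/ 2)%Z; rewrite -huv /enorm /= [2 * _]mulrC divzK //; ring.
  exists (- v), ((u + v) %/ 2)%Z; rewrite -huv /enorm /= [2 * _]mulrC divzK; last by lia.
  by ring.
pose a := u' + b; have {hb}hb : p%:Z = a ^+ 2 + 3 * b ^+ 2 by rewrite hb /a; ring.
have b0 : b != 0.
  apply/eqP => b0; move: hb; rewrite b0 expr0n mulr0 addr0 => hb.
  have /primeP[p1' hd] := pp.
  have pa : p = (absz a ^ 2)%N by lia.
  by have := hd (absz a); rewrite {1}pa dvdn_exp // => /(_ isT)/orP[] /eqP; nia.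
have a3 : (a %% 3)%Z = 1 \/ (- a %% 3)%Z = 1.
  have h0 : (a %% 3)%Z != 0.
    apply/eqP => h0; have : (3 %| p)%N.
      have [c hc] : exists c, a = 3 * c by exists (a %/ 3)%Z; lia.
      have : p%:Z = 3 * (3 * c ^+ 2 + b ^+ 2) by rewrite hb hc; ring.
      by lia.
    by lia.
  by lia.
pose a' := if (a %% 3)%Z == 1 then a else - a.
exists (a', `|b|); split => /=; last by rewrite normr_gt0.
  rewrite hb real_normK ?num_real //; congr (_ + _).
  by rewrite /a'; case: ifP => // _; rewrite sqrrN.
by rewrite /a'; case: ifP => [/eqP //|]; case: a3 => -> //; rewrite eqxx.
Qed.

(** p divides (ad - bc)(ad + bc), and p^2 = (ac + 3bd)^2 + 3 (ad - bc)^2 = (ac - 3bd)^2 + 3 (ad +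
    bc)^2. *)
Lemma normalized_rep_uniq ab cd : normalized_rep p ab -> normalized_rep p cd -> ab = cd.
Proof.
case: ab cd => [a b] [c d] [/= h1 a1 b0] [/= h2 c1 d0].
have key : (p%:Z %| (a * d - b * c) * (a * d + b * c))%Z.
  apply/dvdzP; exists (d ^+ 2 - b ^+ 2).
  have -> : (a * d - b * c) * (a * d + b * c) = (a ^+ 2 + 3 * b ^+ 2) * d ^+ 2 - (c ^+ 2 + 3 * d ^+ 2) * b ^+ 2 by ring.
  by rewrite -h1 -h2; ring.
have pz : 0 < p%:Z by have := prime_gt0 pp; lia.
(* A nonzero multiple of p in the second place would already give 3 p^2 > p^2. *)
have fin (t : int) (x : int) : p%:Z * p%:Z = x ^+ 2 + 3 * (t * p%:Z) ^+ 2 -> t = 0.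
  have [//|t0] := eqVneq t 0; have t1 : 1 <= t ^+ 2 by clear -t0; nia.
  rewrite exprMn -[p%:Z * p%:Z]/(p%:Z ^+ 2); have : 0 < p%:Z ^+ 2 by rewrite exprn_gt0.
  by clear -t1; have := sqr_ge0 x; move: (x ^+ 2) (p%:Z ^+ 2) (t ^+ 2) t1 => X P T; nia.
have adbc : a ^+ 2 * d ^+ 2 = b ^+ 2 * c ^+ 2.
  move: key; rewrite prime_dvdzM => /orP[] /dvdzP[t ht].
    have t0 : t = 0.
      apply: (fin t (a * c + 3 * b * d)); rewrite -ht {1}h1 h2; ring.
    have -> : a ^+ 2 * d ^+ 2 = (a * d - b * c) * (a * d + b * c) + b ^+ 2 * c ^+ 2 by ring.
    by rewrite ht t0 !mul0r add0r.
  have t0 : t = 0.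
    apply: (fin t (a * c - 3 * b * d)); rewrite -ht {1}h1 h2; ring.
  have -> : a ^+ 2 * d ^+ 2 = (a * d - b * c) * (a * d + b * c) + b ^+ 2 * c ^+ 2 by ring.
  by rewrite ht t0 mul0r mulr0 add0r.
have bd : b ^+ 2 = d ^+ 2.
  apply: (mulfI (lt0r_neq0 pz)); rewrite {1}h2 h1.
  transitivity (b ^+ 2 * c ^+ 2 + 3 * b ^+ 2 * d ^+ 2); first by ring.
  by rewrite -adbc; ring.
have {}bd : b = d by clear -bd b0 d0; nia.
have ac : a ^+ 2 = c ^+ 2 by move: h1; rewrite h2 bd => /addIr.
have : (a - c) * (a + c) = 0.
  by transitivity (a ^+ 2 - c ^+ 2); [ring|rewrite ac subrr].
move/eqP; rewrite mulf_eq0 => /orP[] /eqP h; first by rewrite bd; congr (_, _); lia.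
by exfalso; lia.
Qed.

End PrimeNorms.

(** * Divisibility in Z[zeta] and sums over elements of given norm *)

Section NormSums.
Variable R : realType.
Local Notation C := (Cplx R).
Local Notation psi := (psi R).
Local Notation norm_sum := (norm_sum R).

(** y / x equals y conj(x) / N(x), so for nonzero [x] divisibility is tested on two rational
    integers. *)
Definition ediv (x y : int * int) : bool :=
  let u := emul y (econj x) in (enorm x %| u.1)%Z && (enorm x %| u.2)%Z.
Definition equo (x y : int * int) : int * int :=
  let u := emul y (econj x) in ((u.1 %/ enorm x)%Z, (u.2 %/ enorm x)%Z).

Lemma emul_econj_l x y : emul (emul x y) (econj x) = (enorm x * y.1, enorm x * y.2).
Proof.
rewrite -emulA [emul y _]emulC emulA emul_conj.
by rewrite /emul /=; congr (_, _); ring.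
Qed.

Lemma equoK x : enorm x != 0 -> cancel (emul x) (equo x).
Proof. by move=> x0 y; rewrite /equo emul_econj_l /= !mulKz //; case: y. Qed.

Lemma ediv_emul x y : ediv x (emul x y).
Proof. by rewrite /ediv emul_econj_l /= !dvdz_mulr. Qed.

Lemma equo_ediv x y : enorm x != 0 -> ediv x y -> emul x (equo x y) = y.
Proof.
move=> x0; case: y => a b /andP[]; rewrite /equo.
set u := emul (a, b) (econj x) => h1 h2; set v := (_ %/ _, _)%Z.
have hu : u = emul (enorm x, 0) v.
  by rewrite /emul /v /= !mul0r subr0 !addr0 -!(mulrC (_ %/ _)%Z) !divzK //; case: (u).
have : emul (enorm x, 0) (emul x v) = emul (enorm x, 0) (a, b).
  rewrite emulA [emul _ x]emulC -emulA -hu /u emulC -emulA [emul _ x]emulC emul_conj.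
  exact: emulC.
move: (emul x v) => [c d]; rewrite /emul /= => -[h3 h4].
have {}h3 : enorm x * c = enorm x * a by lia.
have {}h4 : enorm x * d = enorm x * b by lia.
by rewrite (mulfI x0 h3) (mulfI x0 h4).
Qed.

(** Multiplication by [x] maps the elements of norm n onto the multiples of [x] of norm N(x) n, and
    the character is multiplicative. *)
Lemma norm_sum_ediv e x n : enorm x != 0 ->
  norm_sum e (ediv x) (enorm x * n) = psi e x * norm_sum e predT n.
Proof.
move=> x0; rewrite /norm_sum -csumZ; last exact: asum_norm_sum.
rewrite (csum_reindex (equoK x0)); last exact: asum_norm_sum.
  apply: eq_csum => y; rewrite /= ediv_emul enormM (inj_eq (mulfI x0)) /=.
  by case: ifP; rewrite ?mulr0 // psi_mul.
by move=> y; case: ifP => [/andP[_ hy] _|]; [exact: equo_ediv|rewrite eqxx].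
Qed.

Lemma norm_sum_eq e (P Q : pred (int * int)) n : (forall x, enorm x = n -> P x = Q x) ->
  norm_sum e P n = norm_sum e Q n.
Proof. by move=> h; apply: eq_csum => x; case: eqP => // /h ->. Qed.

Lemma norm_sum_pred0 e (P : pred (int * int)) n : (forall x, enorm x = n -> ~~ P x) ->
  norm_sum e P n = 0.
Proof.
move=> h; transitivity (csum (fun _ : int * int => 0 : C)); last exact: csum0.
by apply: eq_csum => x; case: eqP => //= /h /negbTE ->.
Qed.

Lemma norm_sum_incl_excl e (P Q S : pred (int * int)) n :
  (forall x, enorm x = n -> (P x || Q x) && (P x && Q x == S x)) ->
  norm_sum e predT n = norm_sum e P n + norm_sum e Q n - norm_sum e S n.
Proof.
move=> h; rewrite -csumD; [|exact: asum_norm_sum|exact: asum_norm_sum].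
rewrite -csumB; [|by apply: asumD; exact: asum_norm_sum|exact: asum_norm_sum].
apply: eq_csum => x; case: eqP => [/h|_] /=; last by rewrite addr0 subr0.
case: (P x) (Q x) (S x) => -[] [] //= _; ring.
Qed.

Variable p : nat.
Hypothesis pp : prime p.

Let pz : (p%:Z != 0). Proof. by have := prime_gt0 pp; lia. Qed.

Lemma ediv_prime u v : ediv (p%:Z, 0) (u, v) = (p%:Z %| u)%Z && (p%:Z %| v)%Z.
Proof.
rewrite /ediv (_ : enorm _ = p%:Z * p%:Z); last by rewrite /enorm /=; ring.
rewrite (_ : emul _ _ = (p%:Z * u, p%:Z * v)); last by rewrite /emul /=; congr (_, _); ring.
by rewrite /= !dvdz_mul2l.
Qed.

(** Over F_p divisibility by a + b zeta, and by its conjugate, is one linear equation in (u, v); the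
    product of the two linear forms is -b^2 N(u, v). The equations are independent because 2a + b is
    nonzero modulo p, which is where p != 3 enters. *)
Lemma split_ediv (a b u v : int) : p != 3%N -> enorm (a, b) = p%:Z ->
  [/\ ediv (a, b) (u, v) = (p%:Z %| v * a - u * b)%Z,
      ediv (econj (a, b)) (u, v) = (p%:Z %| v * (a + b) + u * b)%Z &
      (p%:Z %| enorm (u, v))%Z -> (ediv (a, b) (u, v) || ediv (econj (a, b)) (u, v)) &&
        (ediv (a, b) (u, v) && ediv (econj (a, b)) (u, v) == ediv (p%:Z, 0) (u, v))].
Proof.
move=> p3 hN.
have F x : (p%:Z %| x)%Z = (x%:~R == 0 :> 'F_p) by rewrite Fp_int_eq0.
have N0 : a%:~R ^+ 2 + a%:~R * b%:~R + b%:~R ^+ 2 = 0 :> 'F_p.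
  apply/eqP; rewrite -(rmorphXn _ 2 a) -(rmorphXn _ 2 b) -rmorphM -!rmorphD -F -[_ + _]/(enorm (a, b)) hN.
  exact: dvdzz.
have b0 : b%:~R != 0 :> 'F_p.
  apply/negP => b0; have a0 : a%:~R == 0 :> 'F_p.
    by move: N0; rewrite (eqP b0) mulr0 expr0n !addr0 => /eqP; rewrite expf_eq0.
  move: b0 a0; rewrite -!F => /dvdzP[b' hb] /dvdzP[a' ha].
  have := hN; rewrite ha hb /enorm /= => h.
  have : p%:Z * (p%:Z * (a' ^+ 2 + a' * b' + b' ^+ 2) - 1) = 0 by rewrite -[RHS](subrr p%:Z) -{3}h; ring.
  move/eqP; rewrite mulf_eq0 (negbTE pz) /= subr_eq0 => /eqP.
  move=> hw; have : (p%:Z %| 1)%Z by apply/dvdzP; eexists; rewrite mulrC; symmetry; exact: hw.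
  by rewrite dvdz1; have := prime_gt1 pp; lia.
have ab0 : 2 * a%:~R + b%:~R != 0 :> 'F_p.
  apply/eqP => h; have : 3 * b%:~R ^+ 2 = 0 :> 'F_p.
    transitivity (4 * (a%:~R ^+ 2 + a%:~R * b%:~R + b%:~R ^+ 2) - (2 * a%:~R + b%:~R) ^+ 2 : 'F_p); first by ring.
    by rewrite N0 h; ring.
  move/eqP; rewrite mulf_eq0 expf_eq0 (negbTE b0) andbF orbF.
  rewrite -[3]/(3%:Z%:~R) -F => h3; have {}h3 : (p %| 3)%N by [].
  by move: p3; rewrite -(dvdn_prime2 pp) // h3.
have e1 : ediv (a, b) (u, v) = (p%:Z %| v * a - u * b)%Z.
  rewrite /ediv hN /emul /= !F.
  rewrite !(rmorphD, rmorphB, rmorphN, rmorphM) /= ?(rmorphD, rmorphN) /=.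
  move: (a%:~R) (b%:~R) (u%:~R) (v%:~R) N0 b0 => A B U V N0 B0.
  rewrite [X in _ && (X == 0)](_ : _ = V * A - U * B); last by ring.
  apply: andb_idl => /eqP h.
  have : B * (U * (A + B) - V * - B) = 0.
    transitivity (V * (A ^+ 2 + A * B + B ^+ 2) - (A + B) * (V * A - U * B)); first by ring.
    by rewrite N0 h; ring.
  by move/eqP; rewrite mulf_eq0 (negbTE B0).
have e2 : ediv (econj (a, b)) (u, v) = (p%:Z %| v * (a + b) + u * b)%Z.
  rewrite /ediv enorm_conj hN /emul /= !F.
  rewrite !(rmorphD, rmorphB, rmorphN, rmorphM) /= ?(rmorphD, rmorphN, rmorphM) /=.
  move: (a%:~R) (b%:~R) (u%:~R) (v%:~R) N0 b0 => A B U V N0 B0.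
  rewrite [X in _ && (X == 0)](_ : _ = V * (A + B) + U * B); last by ring.
  apply: andb_idl => /eqP h.
  have : B * (U * (A + B - B) - V * - - B) = 0.
    transitivity (- V * (A ^+ 2 + A * B + B ^+ 2) + A * (V * (A + B) + U * B)); first by ring.
    by rewrite N0 h; ring.
  by move/eqP; rewrite mulf_eq0 (negbTE B0).
split=> //; rewrite e1 e2 ediv_prime !F /enorm /=.
rewrite !(rmorphB, rmorphD, rmorphN, rmorphM, rmorphXn) /=.
move: (a%:~R) (b%:~R) (u%:~R) (v%:~R) N0 b0 ab0 => A B U V N0 B0 AB0 /eqP h.
apply/andP; split.
  rewrite -mulf_eq0; apply/eqP.
  transitivity (V ^+ 2 * (A ^+ 2 + A * B + B ^+ 2) - B ^+ 2 * (U ^+ 2 + U * V + V ^+ 2)); first by ring.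
  by rewrite N0 h; ring.
apply/eqP; apply/idP/idP => [/andP[/eqP h1 /eqP h2]|/andP[/eqP -> /eqP ->]]; last by rewrite !mul0r subr0 addr0 eqxx.
have V0 : V = 0.
  have : V * (2 * A + B) = 0.
    transitivity ((V * A - U * B) + (V * (A + B) + U * B)); first by ring.
    by rewrite h1 h2 addr0.
  by move/eqP; rewrite mulf_eq0 (negbTE AB0) orbF => /eqP.
rewrite V0 eqxx andbT; move/eqP: h1; rewrite V0 mul0r sub0r oppr_eq0 mulf_eq0 (negbTE B0) orbF //.
Qed.

(** A nontrivial zero of the form over F_p satisfies U^3 = V^3; cubing is injective when p = 2
    modulo 3, so U = V and 3 V^2 = 0. *)
Lemma inert_ediv x : (p = 2 %[mod 3])%N -> (p%:Z %| enorm x)%Z -> ediv (p%:Z, 0) x.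
Proof.
case: x => u v p2; rewrite ediv_prime -!Fp_int_eq0 // /enorm /= !rmorphD rmorphM !rmorphXn /=.
move: (u%:~R) (v%:~R) => U V /eqP h.
have [V0|V0] := eqVneq V 0.
  by move: h; rewrite V0 mulr0 expr0n !addr0 => /eqP; rewrite expf_eq0 => /andP[_ ->].
have [U0|U0] := eqVneq U 0.
  by move: h; rewrite U0 mul0r expr0n !add0r => /eqP; rewrite expf_eq0 (negbTE V0).
have h3 : U ^+ 3 = V ^+ 3.
  apply/eqP; rewrite -subr_eq0; apply/eqP.
  by transitivity ((U - V) * (U ^+ 2 + U * V + V ^+ 2)); [ring|rewrite h mulr0].
have pj : p.-1 = (3 * (p.-1 %/ 3)).+1%N by lia.
have UV : U = V.
  have hU : U ^+ 3 ^+ (p.-1 %/ 3) * U = 1 by rewrite -exprM -exprSr -pj Fp_fermat.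
  have hV : V ^+ 3 ^+ (p.-1 %/ 3) * V = 1 by rewrite -exprM -exprSr -pj Fp_fermat.
  by apply: (mulfI (expf_neq0 (p.-1 %/ 3) (expf_neq0 3 V0))); rewrite hV -h3.
have /eqP : 3 * V ^+ 2 = 0 by rewrite -[RHS]h UV; ring.
rewrite mulf_eq0 expf_eq0 (negbTE V0) andbF orbF -[3]/(3%:Z%:~R) Fp_int_eq0 // => h3'.
by move: p2; have : (p %| 3)%N by []; rewrite dvdn_prime2 // => /eqP ->.
Qed.

(** (-1, 2) is sqrt(-3), and modulo 3 the norm form is (u - v)^2. *)
Lemma ramified_ediv x : (3 %| enorm x)%Z -> ediv (-1, 2) x.
Proof.
case: x => u v; rewrite /ediv /enorm /emul /econj /= => h.
have h3 : (3 %| (u - v) * (u - v))%Z.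
  have -> : (u - v) * (u - v) = u ^+ 2 + u * v + v ^+ 2 - u * v * 3 by ring.
  by rewrite rpredB // dvdz_mull.
move: h3; rewrite prime_dvdzM // orbb => h3.
by apply/andP; split; lia.
Qed.

Variable e : nat.
Hypothesis e0 : (0 < e)%N.

Lemma norm_sum_prime (n : nat) : norm_sum e (ediv (p%:Z, 0)) (p * n)%N%:Z =
  if (p %| n)%N then psi e (p%:Z, 0) * norm_sum e predT (n %/ p)%N%:Z else 0.
Proof.
have Np : enorm (p%:Z, 0) = p%:Z * p%:Z by rewrite /enorm /=; ring.
case: ifP => [/dvdnP[n' ->]|pn].
  rewrite mulnK ?prime_gt0 // -norm_sum_ediv; last by rewrite Np mulf_neq0.
  by congr norm_sum; rewrite Np; lia.
apply: norm_sum_pred0 => x hx; apply/negP => hd.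
move: hx; rewrite -(equo_ediv _ hd); last by rewrite Np mulf_neq0.
rewrite enormM Np -mulrA PoszM => /(mulfI pz) h.
by move: pn; rewrite -[(p %| n)%N]/(p%:Z %| n%:Z)%Z -h dvdz_mulr.
Qed.

(** The second coefficient of the Hecke recursion as the factorisation of p in Z[zeta] delivers it;
    [prime_factorE] identifies it with chi(p) p^(k-1). *)
Definition prime_factor : C :=
  if p == 3%N then 0 else if (p %% 3 == 1)%N then psi e (p%:Z, 0) else - psi e (p%:Z, 0).

Lemma norm_sum_1 : norm_sum e predT 1 = 6.
Proof.
rewrite /norm_sum -(csum_norm1 R e0); apply: eq_csum => x; by rewrite andbT.
Qed.

Lemma gam_prime_split x : p != 3%N -> enorm x = p%:Z ->
  forall n, norm_sum e predT (p * n)%N%:Z = (psi e x + psi e (econj x)) * norm_sum e predT n%:Z -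
    if (p %| n)%N then psi e (p%:Z, 0) * norm_sum e predT (n %/ p)%N%:Z else 0.
Proof.
move=> p3 hx n; rewrite -norm_sum_prime (norm_sum_incl_excl e (P := ediv x) (Q := ediv (econj x)) (S := ediv (p%:Z, 0))).
  congr (_ - _); rewrite mulrDl -!norm_sum_ediv ?enorm_conj ?hx //.
case=> u v huv; case: x hx => a b hx; have [_ _] := split_ediv u v p3 hx.
by apply; rewrite huv PoszM dvdz_mulr.
Qed.

(** Elements of norm p n are divisible by sqrt(-3) if p = 3; by one of two conjugate primes, and by
    both exactly when p divides them, if p splits (inclusion-exclusion); and by p itself if p is
    inert. *)
Lemma gam_prime_rel n : gam R e p * gam R e n = gam R e (p * n) +
  if (p %| n)%N then prime_factor * gam R e (n %/ p) else 0.
Proof.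
rewrite /gam /prime_factor; have p1 := prime_gt1 pp.
have pn1 : (p %| 1)%N = false by rewrite dvdn1; lia.
have [p3|p3] := eqVneq p 3%N.
  have h j : norm_sum e predT (p * j)%N%:Z = psi e (-1, 2) * norm_sum e predT j%:Z.
    rewrite -norm_sum_ediv // (_ : enorm _ * _ = (p * j)%N%:Z); last by rewrite p3 PoszM.
    apply: norm_sum_eq => x hx; rewrite ramified_ediv // hx p3 PoszM dvdz_mulr //.
  rewrite h -[X in norm_sum e predT X%:Z / 6 * _]muln1 h norm_sum_1.
  by case: ifP => _; field.
have p30 : (p %% 3 != 0)%N.
  apply/negP => h; move: p3; rewrite eq_sym -dvdn_prime2 // /dvdn h //.
have [p31|p31] := eqVneq (p %% 3)%N 1%N.
  have [x hx] := prime_norm_exists pp p31.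
  have h := gam_prime_split p3 hx.
  rewrite h -[X in norm_sum e predT X%:Z / 6 * _]muln1 h pn1 norm_sum_1.
  by case: ifP => _; field.
have p32 : (p = 2 %[mod 3])%N by move: p30 p31; have := ltn_pmod p (isT : (0 < 3)%N); case: (p %% 3)%N => [|[|[]]].
have h j : norm_sum e predT (p * j)%N%:Z = if (p %| j)%N then psi e (p%:Z, 0) * norm_sum e predT (j %/ p)%N%:Z else 0.
  rewrite -norm_sum_prime; apply: norm_sum_eq => x hx.
  by rewrite inert_ediv // hx PoszM dvdz_mulr.
rewrite h -[X in norm_sum e predT X%:Z / 6 * _]muln1 h pn1.
by case: ifP => _; field.
Qed.

End NormSums.

(** * The Nebentypus and the coefficients at primes *)

Section PrimeValues.
Variable R : realType.
Local Notation C := (Cplx R).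
Local Notation psi := (psi R).
Local Notation zeta := (zeta R).
Local Notation toC := (toC R).

Definition leg3 (n : int) : int :=
  if (n %% 3)%Z == 1 then 1 else if (n %% 3)%Z == 2 then -1 else 0.

Definition level (e : nat) : nat := (3 * econdN (e %% 6))%N.

Definition nebentypus (e : nat) (n : int) : int := if odd e then 1 else leg3 n.

(** The Dirichlet character modulo the level, extended by 0; unlike [nebentypus] it is the one
    occurring in the Hecke recursion. *)
Definition hchar (e n : nat) : int := if coprime n (level e) then nebentypus e n%:Z else 0.

Lemma zeta3 : zeta ^+ 3 = -1.
Proof. by rewrite -toC_eunit (_ : eunit 3 = (-1, 0)) // /toC /= mul0r addr0. Qed.

(** On rational integers the character is real; 7 is a marker for any other value, excluded by
    [eps_int_check]. *)
Definition eps_int (s r : nat) : int :=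
  let i := eidx s (r%:Z, 0) in
  if (i < 6)%N then (if (s * i %% 6 == 0)%N then 1 else if (s * i %% 6 == 3)%N then -1 else 7) else 0.

(** Besides reality, this compares eps(r) for split residues and -eps(r) for inert ones with the
    Nebentypus. Residues 0 and 3 are left out: they are the multiples of 3. *)
Definition eps_int_check (s r : nat) : bool :=
  let v := eps_int s r in
  (v != 7) && ((r == 3) || (r == 0) ||
    ((if (r %% 3 == 1)%N then v else - v) ==
     (if coprime r (3 * econdN s) then (if odd s then 1 else leg3 r%:Z) else 0))).

Lemma eps_int_residues : all (fun s => all (eps_int_check s) (iota 0 6)) (iota 0 6).
Proof. by vm_compute. Qed.

Lemma eps_intE s n : (s < 6)%N -> eps R s (n%:Z, 0) = (eps_int s (n %% 6))%:~R.
Proof.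
move=> s6; have := allP (allP eps_int_residues s _) (n %% 6)%N; rewrite !mem_iota ltn_pmod //.
move=> /(_ s6 isT)/andP[+ _]; rewrite /eps_int /eps [eidx s (n%:Z, 0)]eidx_res.
have -> : eres (n%:Z, 0) = ((n %% 6)%N%:Z, 0) by rewrite /eres /= modz_nat mod0z.
case: ifP => //= i6.
have [h _|_] := eqVneq ((s * eidx s ((n %% 6)%N%:Z, 0%:Z)) %% 6)%N 0%N; first by rewrite zeta_mod h.
have [h _|_] := eqVneq ((s * eidx s ((n %% 6)%N%:Z, 0%:Z)) %% 6)%N 3%N; last by rewrite eqxx.
by rewrite zeta_mod h zeta3.
Qed.

Lemma coprime_level e n : coprime n (level e) = (n %% 3 != 0)%N && (odd (econdN (e %% 6)) || odd n).
Proof.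
have c3 : coprime n 3 = (n %% 3 != 0)%N by rewrite coprime_sym prime_coprime.
have c2 : coprime n 2 = odd n by rewrite coprimen2.
rewrite /level; case: (e %% 6)%N => [|[|[|[|[|t]]]]].
- by rewrite c3 andbT.
- by rewrite (_ : 3 * econdN 1 = 3 ^ 2 * 2 ^ 2)%N // coprimeMr !coprime_pexpr // c2 c3.
- by rewrite (_ : 3 * econdN 2 = 3 * 2 ^ 2)%N // coprimeMr !coprime_pexpr // c2 c3.
- by rewrite (_ : 3 * econdN 3 = 3 ^ 2)%N // !coprime_pexpr // c3 andbT.
- by rewrite (_ : 3 * econdN 4 = 3 * 2 ^ 2)%N // coprimeMr !coprime_pexpr // c2 c3.
by rewrite (_ : 3 * econdN _ = 3 ^ 2 * 2 ^ 2)%N // coprimeMr !coprime_pexpr // c2 c3.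
Qed.

Lemma hchar_mod6 e n : hchar e n = hchar e (n %% 6).
Proof.
rewrite /hchar /nebentypus /leg3 !coprime_level modn_dvdm // odd_mod //.
by rewrite !modz_nat modn_dvdm.
Qed.

Lemma hcharM e m n : hchar e (m * n) = hchar e m * hchar e n.
Proof.
rewrite /hchar coprimeMl /nebentypus; case: (coprime m _); last by rewrite mul0r.
case: (coprime n _); last by rewrite mulr0.
case: ifP => // _; rewrite /leg3 !modz_nat.
have := modnMm m n 3; have := ltn_pmod m (isT : (0 < 3)%N); have := ltn_pmod n (isT : (0 < 3)%N).
by case: (m %% 3)%N => [|[|[|]]] //; case: (n %% 3)%N => [|[|[|]]] // _ _ <-.
Qed.

Lemma hchar1 e : hchar e 1 = 1.
Proof. by rewrite /hchar coprime1n /nebentypus; case: ifP. Qed.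

Variable e : nat.
Hypothesis e0 : (0 < e)%N.
Local Notation s := (e %% 6)%N.

Let s6 : (s < 6)%N. Proof. exact: ltn_pmod. Qed.

Lemma prime_mod6 p : prime p -> p != 3%N -> (p %% 6 \in [:: 1; 2; 5])%N.
Proof.
move=> pp p3; have h2 : (2 %| p)%N -> p = 2%N by rewrite dvdn_prime2 // => /eqP.
have h3 : (3 %| p)%N -> p = 3%N by rewrite dvdn_prime2 // => /eqP.
by rewrite !inE; lia.
Qed.

Lemma prime_factorE p : prime p -> prime_factor R p e = (hchar e p)%:~R * p%:R ^+ e.
Proof.
move=> pp; rewrite /prime_factor; have [->|p3] := eqVneq p 3%N.
  by rewrite /hchar coprime_level mul0r.
have hm := prime_mod6 pp p3; rewrite hchar_mod6.
have h := allP (allP eps_int_residues s _) (p %% 6)%N; rewrite !mem_iota !ltn_pmod // in h.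
have /andP[_] := h isT isT.
have -> : ((p %% 6 == 3) || (p %% 6 == 0))%N = false by move: hm; rewrite !inE => /or3P[]/eqP->.
rewrite /= -/(level e) => /eqP he.
have -> : hchar e (p %% 6) = if (p %% 6 %% 3 == 1)%N then eps_int s (p %% 6) else - eps_int s (p %% 6).
  rewrite he /hchar /nebentypus; case: (coprime _ _) => //; congr (if _ then _ else _).
  by rewrite odd_mod.
rewrite modn_dvdm // /psi eps_intE // /toC /= mul0r addr0.
by case: ifP => _; rewrite ?rmorphN ?mulNr.
Qed.

Lemma toC_conj_sum x : toC x + toC (econj x) = (2 * x.1 + x.2)%:~R.
Proof. by rewrite /toC /econj /= !rmorphD rmorphM rmorphN /=; move: (zeta) => w; ring. Qed.

Lemma toC_conj_mul x : toC x * toC (econj x) = (enorm x)%:~R.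
Proof. by rewrite -toC_mul emul_conj /toC /= mul0r addr0. Qed.

(** Power sums of conjugates satisfy the recursion given by trace and norm, hence the induction over
    two consecutive exponents. *)
Lemma power_sum_int x n : exists t : int, toC x ^+ n + toC (econj x) ^+ n = t%:~R.
Proof.
have h1 := toC_conj_sum x; have h2 := toC_conj_mul x.
suff [] : (exists t : int, toC x ^+ n + toC (econj x) ^+ n = t%:~R) /\
   (exists t : int, toC x ^+ n.+1 + toC (econj x) ^+ n.+1 = t%:~R) by [].
elim: n => [|n [[a ha] [b hb]]].
  by split; [exists 2; rewrite !expr0|exists (2 * x.1 + x.2); rewrite !expr1].
split; first by exists b.
exists ((2 * x.1 + x.2) * b - enorm x * a).
rewrite rmorphB !rmorphM /= -ha -hb -h1 -h2 !exprS.
by move: (toC x) (toC (econj x)) => u v; ring.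
Qed.

Lemma norm_sum_prime1 p : prime p -> gam R e p = norm_sum R e predT (p * 1)%N%:Z / 6.
Proof. by rewrite muln1. Qed.

Lemma gam_split p x : prime p -> p != 3%N -> enorm x = p%:Z ->
  gam R e p = psi e x + psi e (econj x).
Proof.
move=> pp p3 hx; rewrite norm_sum_prime1 // (gam_prime_split R pp e0 p3 hx) norm_sum_1 //.
by rewrite dvdn1; case: eqP => [h|_]; [move: pp; rewrite h|rewrite subr0 mulfK ?pnatr_eq0].
Qed.

Lemma psi_sub_residues : all (fun s => all (fun a => all (fun b =>
    ((a + b) %% 2 == 1)%N && (a %% 3 == 1)%N ==>
      (eidx s ((a%:Z - b%:Z)%R, (2 * b%:Z)%R) == 0%N))
  (iota 0 6)) (iota 0 6)) (iota 0 6).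
Proof. by vm_compute. Qed.

(** a + b sqrt(-3) = (a - b) + 2 b zeta is congruent to 1 modulo 2 and modulo sqrt(-3), hence modulo
    every conductor that occurs. This is the origin of the normalisation a = 1 modulo 3. *)
Lemma eps_normalized (a b : int) : ((a + b) %% 2)%Z = 1 -> (a = 1 %[mod 3])%Z ->
  eps R s (a - b, 2 * b) = 1.
Proof.
move=> h2 h3; pose a' := absz (a %% 6)%Z; pose b' := absz (b %% 6)%Z.
have := allP (allP (allP psi_sub_residues s _) a' _) b'; rewrite !mem_iota.
have -> : (0 <= s < 0 + 6)%N by [].
have -> : (0 <= a' < 0 + 6)%N by rewrite /a'; lia.
have -> : (0 <= b' < 0 + 6)%N by rewrite /b'; lia.
move=> /(_ isT isT isT)/implyP h.
have {h}/eqP h : eidx s (a'%:Z - b'%:Z, 2 * b'%:Z) == 0%N.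
  by apply: h; apply/andP; split; rewrite /a' /b'; lia.
have : eidx s (a - b, 2 * b) = 0%N.
  rewrite -[RHS]h -[RHS](eidx_mod s _ ((a %/ 6)%Z - (b %/ 6)%Z, 2 * (b %/ 6)%Z)); congr eidx.
  by rewrite /eadd /emul /=; congr (_, _); rewrite /a' /b'; lia.
by rewrite /eps => ->; rewrite muln0.
Qed.

Lemma gam_normalized p (a b : int) : prime p -> (p = 1 %[mod 6])%N -> normalized_rep p (a, b) ->
  gam R e p = toC (a - b, 2 * b) ^+ e + toC (a + b, - (2 * b)) ^+ e.
Proof.
move=> pp p1 [/= hp a3 _].
have hx : enorm (a - b, 2 * b) = p%:Z by rewrite /enorm hp /=; ring.
have p3 : p != 3%N by apply/eqP => h; move: p1; rewrite h.
have ab : ((a + b) %% 2)%Z = 1.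
  have [c hc] : exists c, a = c - b + 2 * b by exists (a - b); ring.
  have h4 : p%:Z = (a + b) ^+ 2 - 2 * (a * b) + 2 * b ^+ 2 by rewrite hp; ring.
  have [] : ((a + b) %% 2)%Z = 0 \/ ((a + b) %% 2)%Z = 1 by lia.
    move=> h; have [d hd] : exists d, a + b = 2 * d by exists ((a + b) %/ 2)%Z; lia.
    have : p%:Z = 2 * (2 * d ^+ 2 - a * b + b ^+ 2) by rewrite h4 hd; ring.
    by move: (_ + b ^+ 2) => w; lia.
  by [].
rewrite (gam_split pp p3 hx) /psi eps_normalized // mul1r.
have -> : econj (a - b, 2 * b) = (a - - b, 2 * - b) by rewrite /econj /=; congr (_, _); ring.
rewrite eps_normalized //; last by lia.
by rewrite mul1r opprK mulrN.
Qed.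

Lemma gam_inert p : prime p -> (p = 2 %[mod 3])%N -> gam R e p = 0.
Proof.
move=> pp p2; rewrite /gam norm_sum_pred0 ?mul0r // => x hx; apply/negP => _.
have hd : ediv (p%:Z, 0) x by apply: inert_ediv; rewrite // hx dvdzz.
have Np : enorm (p%:Z, 0) = p%:Z * p%:Z by rewrite /enorm /=; ring.
have p1 := prime_gt1 pp; move: hx; rewrite -(equo_ediv _ hd) ?Np ?mulf_neq0 //; try lia.
rewrite enormM Np; move: (enorm _) => w h.
have : p%:Z * (p%:Z * w - 1) = 0 by rewrite -[RHS](subrr p%:Z) -{3}h; ring.
move/eqP; rewrite mulf_eq0 subr_eq0 => /orP[/eqP|/eqP hw]; first by lia.
have : (p%:Z %| 1)%Z by apply/dvdzP; exists w; rewrite mulrC; symmetry; exact: hw.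
by rewrite dvdz1; lia.
Qed.

Lemma eps_ramified_residues : all (fun s => if odd s then eidx s (-1, 2) == 6%N else eidx s (-1, 2) == 0%N) (iota 0 6).
Proof. by vm_compute. Qed.

Lemma gam_3 : gam R e 3 = if odd e then 0 else (-3) ^+ (e %/ 2).
Proof.
have pp : prime 3 by [].
have h j : norm_sum R e predT (3 * j)%N%:Z = psi e (-1, 2) * norm_sum R e predT j%:Z.
  rewrite -norm_sum_ediv //; apply: norm_sum_eq => x hx.
  by rewrite (ramified_ediv pp) // hx PoszM dvdz_mulr.
rewrite norm_sum_prime1 // h norm_sum_1 // mulfK ?pnatr_eq0 //.
have := allP eps_ramified_residues s; rewrite mem_iota ltn_pmod // => /(_ isT).
rewrite odd_mod // /psi /eps; case: ifP => oe /eqP -> /=; first by rewrite mul0r.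
rewrite muln0 mul1r.
have -> : toC (-1, 2) ^+ e = (toC (-1, 2) ^+ 2) ^+ (e %/ 2).
  by rewrite -exprM; congr (_ ^+ _); lia.
congr (_ ^+ _); rewrite -[RHS](one_sub_two_zeta R) /toC /=.
by rewrite rmorphN /=; move: zeta => w; ring.
Qed.

Lemma gam_prime_int p : prime p -> exists t : int, gam R e p = t%:~R.
Proof.
move=> pp; have [->|p3] := eqVneq p 3%N.
  rewrite gam_3; case: ifP => _; first by exists 0.
  by exists ((-3) ^+ (e %/ 2)); rewrite rmorphXn.
have hm := prime_mod6 pp p3; have [p31|p31] := eqVneq (p %% 3)%N 1%N; last first.
  exists 0; apply: gam_inert => //; move: hm p31; rewrite !inE; lia.
have p1 : (p = 1 %[mod 6])%N by move: hm p31; rewrite !inE; lia.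
have [[a b] hab] := normalized_rep_exists pp p1.
rewrite (gam_normalized pp p1 hab); have [t ht] := power_sum_int (a - b, 2 * b) e.
by exists t; rewrite -ht /econj /=; congr (_ + toC (_, _) ^+ e); ring.
Qed.

(** The Hecke recursion at the least prime factor p expresses the coefficient at n through those at
    p, n/p and n/p^2. *)
Lemma gam_int n : exists t : int, gam R e n = t%:~R.
Proof.
elim/ltn_ind: n => n IH; have [|n1] := leqP n 1.
  by case: n {IH} => [|[]] // _; [exists 0; rewrite gam0|exists 1; rewrite gam1].
have pp := pdiv_prime n1; set p := pdiv n in pp; have p1 := prime_gt1 pp.
have hn : n = (p * (n %/ p))%N by rewrite mulnC divnK ?pdiv_dvd.
set j := (n %/ p)%N in hn; have jn : (j < n)%N by rewrite /j ltn_Pdiv //; lia.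
have [a ha] := gam_prime_int pp; have [b hb] := IH _ jn.
have -> : gam R e n = gam R e p * gam R e j -
    (if (p %| j)%N then prime_factor R p e * gam R e (j %/ p) else 0).
  by rewrite (gam_prime_rel R pp e0 j) -hn addrK.
rewrite ha hb prime_factorE //; case: ifP => _; last by exists (a * b); rewrite subr0 rmorphM.
have [c ->] : exists c : int, gam R e (j %/ p) = c%:~R.
  by apply: IH; apply: leq_ltn_trans jn; exact: leq_div.
exists (a * b - hchar e p * p%:Z ^+ e * c).
by rewrite rmorphB !rmorphM rmorphXn.
Qed.

End PrimeValues.

(** * From the recursion at primes to all Hecke relations *)

Section HeckeRelations.
Variable R : realType.
Local Notation C := (Cplx R).

Variables (g c : nat -> C).
Hypothesis g1 : g 1 = 1.
Hypothesis c1 : c 1 = 1.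
Hypothesis cM : forall p n, prime p -> c (p * n) = c p * c n.
Hypothesis g_rel : forall p n, prime p ->
  g p * g n = g (p * n)%N + if (p %| n)%N then c p * g (n %/ p)%N else 0.

(** The n-th coefficient of T_l applied to the series with coefficients [g]: the sum over common
    divisors a of c(a) g(n l / a^2). *)
Definition hecke_coef (l n : nat) : C :=
  csum (fun a : nat => if (a %| l)%N && (a %| n)%N then c a * g (n * l %/ (a * a))%N else 0).

Lemma asum_dvd (l : nat) (P : pred nat) (F : nat -> C) : (0 < l)%N ->
  asum (fun a : nat => if (a %| l)%N && P a then F a else 0).
Proof.
move=> l0; apply: (asum_supp (iota_uniq 0 l.+1)) => a; rewrite mem_iota /= add0n ltnS => al.
by case: ifP => // /andP[/(dvdn_leq l0)]; rewrite (negbTE al).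
Qed.

(** As a function of n, [hecke_coef l] obeys the same recursion at p as [g]. The common divisors of
    l and p n are those dividing n and the multiples p b not dividing n; the recursion for [g] is
    applied to each term and the corrections match. *)
Lemma hecke_coef_prime (l n p : nat) : (0 < l)%N -> (0 < n)%N -> prime p ->
  hecke_coef l (p * n) = g p * hecke_coef l n -
    if (p %| n)%N then c p * hecke_coef l (n %/ p) else 0.
Proof.
move=> l0 n0 pp; have p0 := prime_gt0 pp.
pose F a := c a * g (p * n * l %/ (a * a))%N.
pose H a := c p * (c a * g (n * l %/ (p * a * a))%N).
have e1 : hecke_coef l (p * n) = csum (fun a => if (a %| l)%N && (a %| n)%N then F a else 0) +
   csum (fun a => if (a %| l)%N && ((a %| p * n)%N && ~~ (a %| n)%N) then F a else 0).
  rewrite -csumD; try exact: asum_dvd.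
  apply: eq_csum => a; rewrite /F; case: (boolP (a %| n)%N) => an; last first.
    by rewrite andbF add0r andbT.
  by rewrite dvdn_mull // andbF addr0.
have e2 : csum (fun a => if (a %| l)%N && ((a %| p * n)%N && ~~ (a %| n)%N) then F a else 0) =
    csum (fun b => if (p * b %| l)%N && ((p * b %| p * n)%N && ~~ (p * b %| n)%N) then H b else 0).
  rewrite (@csum_reindex R _ _ (muln p) (fun a => a %/ p)%N); last by apply: asum_dvd.
  - apply: eq_csum => b; rewrite /=; case: ifP => // _; rewrite /F /H cM // -mulrA.
    by congr (_ * (_ * g _)); rewrite -!mulnA divnMl // mulnCA; congr (_ %/ (_ * _))%N.
  - by move=> b; rewrite mulKn.
  move=> a; case: ifP => [/andP[_ /andP[apn an]] _|]; last by rewrite eqxx.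
  rewrite mulnC divnK //; apply: contraNT an => pa.
  by rewrite -(Gauss_dvdr n (n := p)) // coprime_sym prime_coprime.
have e3 : g p * hecke_coef l n = csum (fun a => if (a %| l)%N && (a %| n)%N then
    F a + (if (p %| n * l %/ (a * a))%N then H a else 0) else 0).
  rewrite /hecke_coef -csumZ; last exact: asum_dvd.
  apply: eq_csum => a; case: ifP => [/andP[al an]|_]; last by rewrite mulr0.
  have aa : (a * a %| n * l)%N by exact: dvdn_mul.
  rewrite mulrCA g_rel // mulrDr muln_divA // mulnA; congr (_ + _).
  case: ifP => _; last by rewrite mulr0.
  by rewrite mulrCA -divnMA /H -[(p * a * a)%N]mulnA [(p * (a * a))%N]mulnC.
have e4 : (if (p %| n)%N then c p * hecke_coef l (n %/ p) else 0) =
   csum (fun a => if (a %| l)%N && ((p %| n)%N && (a %| n %/ p)%N) then H a else 0).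
  case: ifP => pn; last first.
    rewrite -[LHS](csum0 R Datatypes_nat__canonical__eqtype_Equality).
    by apply: eq_csum => a; rewrite andbF.
  rewrite /hecke_coef -csumZ; last exact: asum_dvd.
  apply: eq_csum => a; rewrite andTb; case: ifP => // _; last by rewrite mulr0.
  by rewrite /H divn_mulAC // -divnMA -mulnA.
rewrite e1 e2 e3 e4; apply/eqP; rewrite eq_sym subr_eq; apply/eqP.
have sH : asum (fun b => if (p * b %| l)%N && ((p * b %| p * n)%N && ~~ (p * b %| n)%N) then H b else 0).
  apply: (asum_supp (iota_uniq 0 l.+1)) => a; rewrite mem_iota /= add0n ltnS => al.
  case: ifP => // /andP[/(dvdn_leq l0) h _]; exfalso; move: al; rewrite -ltnNge => al.
  by move: h; rewrite leqNgt (leq_trans al) // leq_pmull.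
rewrite -[X in _ = X + _]csumD //; last exact: asum_dvd.
rewrite -[RHS]csumD; [|by apply: asumD => //; exact: asum_dvd|exact: asum_dvd].
apply: eq_csum => a; rewrite dvdn_pmul2l //.
have pa : (p %| n)%N && (a %| n %/ p)%N = (p * a %| n)%N.
  apply/andP/idP => [[pn an]|h].
    by rewrite -(divnK pn) mulnC dvdn_pmul2r.
  have pn : (p %| n)%N by apply: dvdn_trans h; rewrite dvdn_mulr.
  by split=> //; rewrite -(dvdn_pmul2l p0) [X in (_ %| X)%N]mulnC divnK.
rewrite pa; case: (boolP ((a %| l)%N && (a %| n)%N)) => [/andP[al an]|h]; last first.
  have h1 : (a %| l)%N && (p * a %| n)%N = false.
    apply: contraNF h => /andP[-> h']; apply: dvdn_trans h'; exact: dvdn_mull.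
  have h2 : (p * a %| l)%N && ((a %| n)%N && ~~ (p * a %| n)%N) = false.
    apply: contraNF h => /andP[h' /andP[-> _]]; rewrite andbT; apply: dvdn_trans h'; exact: dvdn_mull.
  by rewrite h1 h2 !addr0.
have a0 : (0 < a)%N by exact: dvdn_gt0 n0 an.
have -> : (p %| n * l %/ (a * a))%N = (p * a %| n)%N || (p * a %| l)%N.
  case/dvdnP: al => l' ->; case/dvdnP: an => n' ->.
  rewrite mulnACA mulnK ?muln_gt0 ?a0 // Euclid_dvdM //.
  by rewrite !dvdn_pmul2r.
rewrite al an /=; case: (p * a %| n)%N; case: (p * a %| l)%N; rewrite /= ?addr0 ?add0r //.
Qed.

Lemma hecke_coefE (l n : nat) : (0 < l)%N -> (0 < n)%N -> hecke_coef l n = g n * g l.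
Proof.
move=> l0; elim/ltn_ind: n => n IH n0; have [n1|n1] := leqP n 1.
  have {IH n0 n1} -> : n = 1%N by lia.
  rewrite /hecke_coef (@csum_supp _ _ _ [:: 1%N]) // ?big_seq1.
    by rewrite dvd1n dvdnn c1 g1 !mul1n divn1.
  by move=> a; rewrite inE dvdn1 => /negbTE ->; rewrite andbF.
have pp := pdiv_prime n1; set p := pdiv n in pp; have p1 := prime_gt1 pp.
have hn : n = (p * (n %/ p))%N by rewrite mulnC divnK ?pdiv_dvd.
set j := (n %/ p)%N in hn; have jn : (j < n)%N by rewrite /j ltn_Pdiv.
have j0 : (0 < j)%N by case: j hn {jn} => //; rewrite muln0 => h; move: n0; rewrite h.
rewrite hn hecke_coef_prime // IH //.
have hr := g_rel j pp.
case: ifP hr => pj hr; last by rewrite subr0 mulrA hr addr0.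
have jp : (j %/ p < n)%N by apply: leq_ltn_trans jn; exact: leq_div.
rewrite (IH _ jp); last by rewrite divn_gt0 ?(prime_gt0 pp) // dvdn_leq.
by rewrite mulrA hr mulrDl [c p * (_ * _)]mulrA addrK.
Qed.

End HeckeRelations.

(** * The Hecke operators on q-expansions *)

Section HeckeAction.
Variable R : realType.
Local Notation C := (Cplx R).

Lemma e2ipi_frac_neq1 (l d : nat) : (0 < l < d)%N -> e2ipi (l%:R / d%:R : C) != 1.
Proof.
move=> /andP[l0 ld]; have d0 : 0 < d%:R :> R by rewrite ltr0n (leq_trans _ ld).
have -> : l%:R / d%:R = (l%:R / d%:R : R)%:C%C :> C by rewrite rmorphM fmorphV !rmorph_nat.
set t : R := l%:R / d%:R.
have t0 : 0 < t by rewrite /t divr_gt0 // ltr0n.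

have t1 : t < 1 by rewrite ltr_pdivrMr // mul1r ltr_nat.
rewrite e2ipi_real; apply/eqP => -[h _].
have := one_sub_cos (2 * pi * t); rewrite h subrr.
rewrite (_ : 2 * pi * t / 2 = pi * t); last by field.
move/eqP; rewrite eq_sym mulf_eq0 pnatr_eq0 expf_eq0 /=; apply/negP.
rewrite lt0r_neq0 // sin_gt0_pi // mulr_gt0 ?pi_gt0 //=.
by rewrite -[ltRHS]mulr1 ltr_pM2l ?pi_gt0.
Qed.

Lemma sum_e2ipi_frac (l d : nat) : (0 < d)%N ->
  \sum_(b < d) e2ipi (l%:R * (b%:R / d%:R) : C) = if (d %| l)%N then d%:R else 0.
Proof.
move=> d0; have dn : d%:R != 0 :> C by rewrite pnatr_eq0 -lt0n.
pose w : C := e2ipi (l%:R / d%:R).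
have -> : \sum_(b < d) e2ipi (l%:R * (b%:R / d%:R) : C) = \sum_(b < d) w ^+ b.
  by apply: eq_bigr => b _; rewrite /w -e2ipi_natM; congr e2ipi; ring.
have wd : w ^+ d = 1 by rewrite /w -e2ipi_natM mulrCA mulfV // mulr1 e2ipi_nat.
case: ifP => dl.
  have -> : w = 1 by case/dvdnP: dl => q hq; rewrite /w hq natrM mulfK // e2ipi_nat.
  by rewrite (eq_bigr (fun=> 1)) ?sumr_const ?card_ord // => b _; rewrite expr1n.
have w1 : w != 1.
  rewrite /w {1}(divn_eq l d) natrD natrM mulrDl mulfK // e2ipiD e2ipi_nat mul1r.
  by apply: e2ipi_frac_neq1; rewrite ltn_pmod // andbT lt0n; apply/negbT.
have := subrX1 w d; rewrite wd subrr => /esym/eqP; rewrite mulf_eq0 subr_eq0 (negbTE w1) /=.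
by move/eqP.
Qed.

Variables (g : nat -> C) (f : C -> C).
Hypothesis g0 : g 0 = 0.
Hypothesis qexp : forall z : C, 0 < complex.Im z ->
  asum (fun n => g n * e2ipi (n%:R * z)) /\ f z = csum (fun n => g n * e2ipi (n%:R * z)).

Let hK (m : nat) : (0 < m)%N -> cancel (muln m) (divn^~ m).
Proof. by move=> m0 x; rewrite mulKn. Qed.

(** Summation over b keeps the exponents divisible by d, by orthogonality of additive characters;
    after l = d l' the exponent becomes L = a l'. *)
Lemma sum_translates (a d : nat) (z : C) : (0 < a)%N -> (0 < d)%N -> 0 < complex.Im z ->
  asum (fun L => if (a %| L)%N then g (d * (L %/ a))%N * e2ipi (L%:R * z) else 0) /\
  \sum_(b < d) f ((a%:R * z + b%:R) / d%:R) =
  d%:R * csum (fun L => if (a %| L)%N then g (d * (L %/ a))%N * e2ipi (L%:R * z) else 0).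
Proof.
move=> a0 d0 z0; have dn : d%:R != 0 :> C by rewrite pnatr_eq0 -lt0n.
have an : a%:R != 0 :> C by rewrite pnatr_eq0 -lt0n.
have Imz (b : nat) : 0 < complex.Im ((a%:R * z + b%:R) / d%:R).
  rewrite mulrC (_ : d%:R^-1 = (d%:R^-1 : R)%:C%C); last by rewrite fmorphV rmorph_nat.
  by rewrite ImZ ImD (real_nat _ a) (real_nat _ b) ImZ /= addr0 !mulr_gt0 ?invr_gt0 ?ltr0n.
pose F (l : nat) := g l * e2ipi (l%:R * (a%:R * z / d%:R)).
have sF : asum F.
  have [h _] := qexp (Imz 0%N); rewrite /F; move: h; congr asum; apply/funext => l.
  by rewrite addr0.
have e1 : \sum_(b < d) f ((a%:R * z + b%:R) / d%:R) = csum (fun l => if (d %| l)%N then d%:R * F l else 0).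
  transitivity (csum (fun l => \sum_(b < d) F l * e2ipi (l%:R * (b%:R / d%:R)))).
    rewrite csum_sum; last first.
      move=> b; have [h _] := qexp (Imz b); move: h; congr asum; apply/funext => l.
      by rewrite /F -mulrA -e2ipiD; congr (_ * e2ipi _); rewrite mulrDl mulrDr.
    apply: eq_bigr => b _; have [_ ->] := qexp (Imz b); apply: eq_csum => l.
    by rewrite /F -mulrA -e2ipiD; congr (_ * e2ipi _); rewrite mulrDl mulrDr.
  apply: eq_csum => l; rewrite -mulr_sumr sum_e2ipi_frac //.
  by case: ifP; rewrite ?mulr0 // mulrC.
have sdF : asum (fun l => if (d %| l)%N then d%:R * F l else 0).
  apply: asum_le (asumZ d%:R sF) => l; case: ifP => // _.
  by rewrite cabs0 cabs_ge0.
have e2 (l : nat) : F (d * l)%N = g (d * l)%N * e2ipi ((a * l)%N%:R * z).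
  rewrite /F; congr (_ * e2ipi _); rewrite !natrM.
  by move: (d%:R) (a%:R) (l%:R) dn => D A L Dn; field.
have sD := asum_inj (can_inj (hK d0)) sdF.
have sG : asum (fun l => g (d * l)%N * e2ipi ((a * l)%N%:R * z)).
  have := asumZ d%:R^-1 sD; congr asum; apply/funext => l /=.
  by rewrite dvdn_mulr // mulrA mulVf // mul1r e2.
have sL : asum (fun L => if (a %| L)%N then g (d * (L %/ a))%N * e2ipi (L%:R * z) else 0).
  pose J := fun L => if (a %| L)%N then g (d * (L %/ a))%N * e2ipi (L%:R * z) else 0.
  case: sG => M hM; exists M => A uA.
  rewrite (bigID (fun L => (a %| L)%N)) /= [X in _ + X]big1 ?addr0; last first.
    by move=> L /negbTE ->; rewrite cabs0.
  apply: le_trans (hM [seq (L %/ a)%N | L <- [seq L <- A | (a %| L)%N]] _).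
    rewrite big_map big_filter le_eqVlt; apply/orP; left; apply/eqP; apply: eq_bigr => L aL.
    by rewrite aL [(a * (L %/ a))%N]mulnC divnK.
  rewrite map_inj_in_uniq ?filter_uniq // => x y; rewrite !mem_filter => /andP[ax _] /andP[ay _] h.
  by rewrite -(divnK ax) -(divnK ay) h.
split=> //; rewrite e1 (csum_reindex (hK d0) _ sdF); last first.
  by move=> l; case: ifP => [dl _|]; rewrite ?eqxx // mulnC divnK.
rewrite (csum_reindex (hK a0) _ sL); last first.
  by move=> l; case: ifP => [al _|]; rewrite ?eqxx // mulnC divnK.
rewrite -csumZ; last by move: sG; congr asum; apply/funext => l /=; rewrite dvdn_mulr // mulKn.
by apply: eq_csum => l /=; rewrite !dvdn_mulr // mulKn // e2.
Qed.

Variables (k N : nat) (chi : int -> C) (c : nat -> C).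
Hypothesis k0 : (0 < k)%N.
Hypothesis cE : forall a : nat, (0 < a)%N ->
  c a = if coprime a N then chi a%:Z * a%:R ^+ k.-1 else 0.
Hypothesis eigen : forall n l, (0 < l)%N -> (0 < n)%N -> hecke_coef g c l n = g n * g l.

(** The factors n^(k-1), (n/a)^(-k) and n/a from [sum_translates] combine to a^(k-1), which [c]
    contains; the coefficients are then those of [hecke_coef]. *)
Lemma hecke_eigen n (z : C) : (0 < n)%N -> 0 < complex.Im z -> hecke k N chi n f z = g n * f z.
Proof.
move=> n0 z0; rewrite /hecke.
pose T (a L : nat) := if (a %| L)%N && (a %| n)%N then c a * g (n * L %/ (a * a))%N * e2ipi (L%:R * z) else 0.
have nn : n%:R != 0 :> C by rewrite pnatr_eq0 -lt0n.
have hT a : asum (T a) /\ (a \in divisors n ->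
  n%:R ^+ k.-1 * (if coprime a N then chi a%:Z * (n %/ a)%:R ^- k *
    \sum_(b < (n %/ a)%N) f ((a%:R * z + b%:R) / (n %/ a)%:R) else 0) = csum (T a)).
  rewrite -dvdn_divisors //; case: (boolP (a %| n)%N) => an; last first.
    split=> //; apply: (@asum_supp _ _ _ [::]) => // L _.
    by rewrite /T (negbTE an) andbF.
  have a0 := dvdn_gt0 n0 an.
  have d0 : (0 < n %/ a)%N by rewrite divn_gt0 // dvdn_leq.
  have [s1 s2] := sum_translates a0 d0 z0.
  have e1 : T a = fun L => c a * (if (a %| L)%N then g (n %/ a * (L %/ a))%N * e2ipi (L%:R * z) else 0).
    apply/funext => L; rewrite /T an andbT; case: ifP => aL; last by rewrite mulr0.
    rewrite -mulrA; congr (_ * (g _ * _)).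
    by rewrite divnMA -muln_divA // -divn_mulAC.
  rewrite e1; split; first exact: asumZ.
  move=> _; rewrite csumZ // cE //; case: ifP => _; last by rewrite mulr0 mul0r.
  rewrite s2; move: (csum _) => S.
  have dn : (n %/ a)%:R != 0 :> C by rewrite pnatr_eq0 -lt0n.
  have -> : n%:R ^+ k.-1 = a%:R ^+ k.-1 * (n %/ a)%:R ^+ k.-1 :> C.
    by rewrite -exprMn -natrM mulnC divnK.
  have -> : (n %/ a)%:R ^+ k = (n %/ a)%:R * (n %/ a)%:R ^+ k.-1 :> C by rewrite -exprS prednK.
  have := expf_neq0 k.-1 dn.
  move: (a%:R ^+ k.-1) ((n %/ a)%:R ^+ k.-1) => A D D0.
  by move: dn D0; move: (n %/ a)%:R => d dn D0; field; rewrite dn D0.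
rewrite big_mkcond mulr_sumr big_seq (eq_bigr (fun a => csum (T a))); last first.
  by move=> a /(hT a).2.
rewrite -big_seq -csum_sum; last by move=> a; exact: (hT a).1.
have [sq ->] := qexp z0; rewrite -csumZ //; apply: eq_csum => L.
have [->|L0] := posnP L.
  by rewrite g0 mul0r mulr0 big1 // => a _; rewrite /T muln0 div0n g0 mulr0 mul0r if_same.
rewrite mulrA -eigen // /hecke_coef (@csum_supp _ _ _ (divisors n)) ?divisors_uniq //.
  by rewrite mulr_suml; apply: eq_bigr => a _; rewrite /T; case: ifP => //; rewrite mul0r.
by move=> a; rewrite -dvdn_divisors // => /negbTE ->; rewrite andbF.
Qed.

End HeckeAction.

(** * Modularity *)

Section Moebius.
Variable R : realType.
Local Notation C := (Cplx R).

(* Euclid's algorithm on the first column: T^{+-1} replaces a by a +- c, and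
   the transpose of T^{+-q} replaces c by c +- q a. *)
Lemma euclid_ind (q : int) (P : int -> int -> int -> int -> Prop) : q = 1 \/ q = 3 ->
  (forall a b d, P a b 0 d) ->
  (forall b c d, c != 0 -> P 0 b c d) ->
  (forall e a b c d, e = 1 \/ e = -1 -> P (a + e * c) (b + e * d) c d -> P a b c d) ->
  (forall e a b c d, e = 1 \/ e = -1 -> P a b (c + q * e * a) (d + q * e * b) -> P a b c d) ->
  forall a b c d, P a b c d.
Proof.
move=> hq P1 P2 PT PV a b c d.
have [n] : exists n : nat, (absz a + absz c <= n)%N by exists (absz a + absz c)%N.
elim: n a b c d => [|n IH] a b c d hn.
  have -> : c = 0 by lia.
  exact: P1.
have [->|c0] := eqVneq c 0; first exact: P1.
have [->|a0] := eqVneq a 0; first exact: P2.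
have [h|h] := leqP (2 * absz a)%N (absz c).
  have [ac|ac] : 0 < a * c \/ a * c < 0 by nia.
    apply: (PV (-1)); [by right|apply: IH; case: hq => ->; nia].
  apply: (PV 1); [by left|apply: IH; case: hq => ->; nia].
have [ac|ac] : 0 < a * c \/ a * c < 0 by nia.
  apply: (PT (-1)); [by right|apply: IH; nia].
apply: (PT 1); [by left|apply: IH; nia].
Qed.

Definition mob (a b c d : int) (z : C) : C := (a%:~R * z + b%:~R) / (c%:~R * z + d%:~R).

Lemma aut_neq0 (a b c d : int) (z : C) : 0 < a * d - b * c -> 0 < complex.Im z ->
  c%:~R * z + d%:~R != 0.
Proof.
move=> D z0; apply/eqP => h.
have hi : complex.Im (c%:~R * z + d%:~R) = 0 by rewrite h.
have hr : complex.Re (c%:~R * z + d%:~R) = 0 by rewrite h.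
move: hi hr; rewrite ImD ReD (real_int _ c) (real_int _ d) ImZ ReZ /= addr0 => /eqP.
rewrite mulf_eq0 (gt_eqF z0) orbF intr_eq0 => /eqP c0.
rewrite c0 mul0r add0r => /eqP; rewrite intr_eq0 => /eqP d0.
by move: D; rewrite c0 d0 !mulr0 subrr ltxx.
Qed.

Lemma Im_mob (a b c d : int) (z : C) : c%:~R * z + d%:~R != 0 ->
  complex.Im (mob a b c d z) = (a * d - b * c)%:~R * complex.Im z / cabs (c%:~R * z + d%:~R) ^+ 2.
Proof.
move=> n0; have n1 : cabs (c%:~R * z + d%:~R) ^+ 2 != 0 by rewrite expf_neq0 // cabs_eq0.
apply: (mulIf n1); rewrite divfK //.
case: z n0 n1 => x y n0 n1; rewrite /mob.
have hw : forall w : C, w = c%:~R * Complex x y + d%:~R -> complex.Re w = c%:~R * x + d%:~R /\ complex.Im w = c%:~R * y.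
  by move=> w ->; rewrite ImD ReD (real_int _ c) (real_int _ d) ImZ ReZ /= addr0.
have hv : forall w : C, w = a%:~R * Complex x y + b%:~R -> complex.Re w = a%:~R * x + b%:~R /\ complex.Im w = a%:~R * y.
  by move=> w ->; rewrite ImD ReD (real_int _ a) (real_int _ b) ImZ ReZ /= addr0.
move: (c%:~R * _ + _) (a%:~R * Complex x y + _) hw hv n0 n1 => w v hw hv.
have [] := hw w erefl; have [] := hv v erefl; case: w v {hw hv} => w1 w2 [v1 v2] /= -> -> -> -> n0.
rewrite /cabs /= sqr_sqrtr ?addr_ge0 ?sqr_ge0 // => n1.
rewrite rmorphB !rmorphM /=; field.
by [].
Qed.

Lemma Im_mob_gt0 (a b c d : int) (z : C) : 0 < a * d - b * c -> 0 < complex.Im z ->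
  0 < complex.Im (mob a b c d z).
Proof.
move=> D z0; have n0 := aut_neq0 D z0; rewrite Im_mob // divr_gt0 ?mulr_gt0 ?ltr0z //.
all: by rewrite cabs_gt0.
Qed.

(** * The action of Gamma_0(q) on a function with translation and inversion formulas *)

Variables (F : C -> C) (q m k : nat) (c0 : C).
Hypothesis q13 : q = 1%N \/ q = 3%N.
Hypothesis m0 : (0 < m)%N.
Hypothesis FT : forall z, 0 < complex.Im z -> F (z + 1) = e2ipi (m%:R^-1) * F z.
Hypothesis FS : forall z, 0 < complex.Im z -> F (- (q%:R * z)^-1) = c0 * z ^+ k * F z.
Hypothesis F0 : exists2 z, 0 < complex.Im z & F z != 0.

Let om (x : int) : C := e2ipi (x%:~R / m%:R).

Let omD x y : om (x + y) = om x * om y.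
Proof. by rewrite /om rmorphD mulrDl e2ipiD. Qed.

Let om0 : om 0 = 1. Proof. by rewrite /om mul0r e2ipi0. Qed.

Let q0 : (0 < q)%N. Proof. by case: q13 => ->. Qed.

Let qn : q%:R != 0 :> C. Proof. by rewrite pnatr_eq0 -lt0n. Qed.

Lemma F_translate (n : int) z : 0 < complex.Im z -> F (z + n%:~R) = om n * F z.
Proof.
have pos (j : nat) w : 0 < complex.Im w -> F (w + j%:R) = om j%:Z * F w.
  move=> w0; elim: j => [|j IH]; first by rewrite addr0 om0 mul1r.
  rewrite -[X in X%:R]addn1 natrD addrA FT; last by rewrite ImD (real_nat _ j) /= addr0.
  by rewrite IH mulrA -[j.+1]add1n PoszD omD /om mul1r.
case: n => n z0; first exact: pos.
have z1 : 0 < complex.Im (z + (Negz n)%:~R) by rewrite ImD (real_int _ (Negz n)) /= addr0.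
have := pos n.+1 _ z1; rewrite NegzE rmorphN /= subrK => ->.
by rewrite mulrA -omD addNr om0 mul1r.
Qed.

(** The inversion is an involution; applying it twice at a point where F does not vanish determines
    the square of its constant. *)
Lemma c0_sq : c0 ^+ 2 = (- q%:R) ^+ k.
Proof.
have [z z0 nz] := F0; have zn := tneq0 z0.
have qz0 : 0 < complex.Im (q%:R * z) by rewrite real_nat ImZ mulr_gt0 // ltr0n.
have w0 := Im_inv_opp_gt0 qz0.
have h := FS w0.
have ew : - (q%:R * (- (q%:R * z)^-1))^-1 = z by field; rewrite zn qn.
rewrite ew (FS z0) in h.
have : 1 = c0 ^+ 2 * (- q%:R^-1) ^+ k.
  apply: (mulIf nz); rewrite mul1r {1}h; transitivity (c0 ^+ 2 * ((- (q%:R * z)^-1) ^+ k * z ^+ k) * F z); first by ring.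
  rewrite -exprMn; congr (_ * _ ^+ k * _); field; by rewrite zn qn.
move=> h1; have hq : (- q%:R : C) ^+ k != 0 by rewrite expf_neq0 // oppr_eq0.
by apply: (mulIf (invr_neq0 hq)); rewrite mulfV // -exprVn invrN -h1.
Qed.

(** The lower triangular generator is inversion, translation by -e, inversion; the two inversions
    bring in c0 squared. *)
Lemma F_V (e : int) z : e = 1 \/ e = -1 -> 0 < complex.Im z ->
  F (z / ((q%:Z * e)%:~R * z + 1)) = om (- e) * ((q%:Z * e)%:~R * z + 1) ^+ k * F z.
Proof.
move=> _ z0; have zn := tneq0 z0.
have qz0 : 0 < complex.Im (q%:R * z) by rewrite real_nat ImZ mulr_gt0 // ltr0n.
have w0 := Im_inv_opp_gt0 qz0; set w := - (q%:R * z)^-1 in w0.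
have w1 : 0 < complex.Im (w + (- e)%:~R) by rewrite ImD (real_int _ (- e)) /= addr0.
have w1n := tneq0 w1.
have hw : F w = c0 * z ^+ k * F z := FS z0.
have h := FS w1; rewrite (F_translate (- e) w0) hw in h.
have E : (w + (- e)%:~R) * z = - (((q%:Z * e)%:~R * z + 1) / q%:R).
  rewrite /w rmorphM rmorphN /= -[q%:Z%:~R]/(q%:R); field; by rewrite zn qn.
have jn : (q%:Z * e)%:~R * z + 1 != 0.
  apply: contra_neq (mulf_neq0 w1n zn) => h0; by rewrite E h0 mul0r oppr0.
have -> : z / ((q%:Z * e)%:~R * z + 1) = - (q%:R * (w + (- e)%:~R))^-1.
  move: ((q%:Z * e)%:~R * z + 1) jn E => J jn E.
  have -> : w + (- e)%:~R = - (J / q%:R) / z by rewrite -E mulfK.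
  by move: (q%:R) qn => Q Q0; field; rewrite jn Q0 zn.
rewrite h; transitivity (om (- e) * (c0 ^+ 2 * ((w + (- e)%:~R) * z) ^+ k) * F z).
  by rewrite exprMn; ring.
rewrite c0_sq E -exprMn; congr (_ * _ ^+ k * _); field; by [].
Qed.

(** Six times the exponent in Petersson's formula for the multiplier of eta^4: e(Xind / 6) is a
    character of SL_2(Z). *)
Definition Xind (a b c d : int) : int := b * d * (1 - c ^+ 2) + c * (a + d - 3).

Definition congr6 (x y : int) : Prop := exists t, x = y + 6 * t.

Let c6r x : congr6 x x. Proof. by exists 0; rewrite mulr0 addr0. Qed.
Let c6D x y x' y' : congr6 x x' -> congr6 y y' -> congr6 (x + y) (x' + y').
Proof. by move=> [t ->] [u ->]; exists (t + u); ring. Qed.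
Let c6N x x' : congr6 x x' -> congr6 (- x) (- x').
Proof. by move=> [t ->]; exists (- t); ring. Qed.
Let c6M x y x' y' : congr6 x x' -> congr6 y y' -> congr6 (x * y) (x' * y').
Proof. by move=> [t ->] [u ->]; exists (x' * u + t * y' + 6 * t * u); ring. Qed.
Let c6X x x' : congr6 x x' -> congr6 (x ^+ 2) (x' ^+ 2).
Proof. by move=> h; apply: c6M. Qed.
Let res6 (a : int) : congr6 a (a %% 6)%Z.
Proof. by exists (a %/ 6)%Z; lia. Qed.

(** [Xind] is a polynomial, so its change under a generator can be checked on residues modulo 6,
    using the determinant modulo 6 and the condition q | c. *)
Definition V_check (qm : int * int) (e a b c d : int) : bool :=
  (((a * d - b * c) %% 6)%Z == 1) && (qm.1 %| c)%Z ==>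
  (qm.2 %| Xind a b (c + qm.1 * e * a) (d + qm.1 * e * b) - Xind a b c d + e)%Z.
Definition T_check (e a b c d : int) : bool :=
  (((a * d - b * c) %% 6)%Z == 1) ==>
  (6 %| Xind (a + e * c) (b + e * d) c d - Xind a b c d - e)%Z.

Definition quads (P : int -> int -> int -> int -> bool) : bool :=
  let r := [seq i%:Z | i <- iota 0 6] in
  all (fun a => all (fun b => all (fun c => all (P a b c) r) r) r) r.

Definition qms : seq (int * int) := [:: (1, 3); (1, 6); (3, 1); (3, 2)].

Lemma V_check_residues : all (fun qm => quads (V_check qm 1) && quads (V_check qm (-1))) qms.
Proof. by vm_compute. Qed.

Lemma T_check_residues : quads (T_check 1) && quads (T_check (-1)).
Proof. by vm_compute. Qed.

Lemma quadsP P : quads P -> forall a b c d, P (a %% 6)%Z (b %% 6)%Z (c %% 6)%Z (d %% 6)%Z.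
Proof.
move=> h a b c d.
have mem x : (x %% 6)%Z \in [seq i%:Z | i <- iota 0 6].
  by apply/mapP; exists (absz (x %% 6)%Z); rewrite ?mem_iota; lia.
exact: (allP (allP (allP (allP h _ (mem a)) _ (mem b)) _ (mem c)) _ (mem d)).
Qed.

Lemma det_res a b c d : a * d - b * c = 1 ->
  (((a %% 6)%Z * (d %% 6)%Z - (b %% 6)%Z * (c %% 6)%Z) %% 6)%Z == 1.
Proof.
move=> h; have [t] : congr6 1 ((a %% 6)%Z * (d %% 6)%Z - (b %% 6)%Z * (c %% 6)%Z).
  by rewrite -{1}h; repeat (apply: c6D || apply: c6N || apply: c6M || apply: res6).
by move: (_ - _) => w; lia.
Qed.

Lemma Xind_T e a b c d : e = 1 \/ e = -1 -> a * d - b * c = 1 ->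
  exists t, Xind (a + e * c) (b + e * d) c d = Xind a b c d + e + 6 * t.
Proof.
move=> he h; have D := det_res h; have /andP[T1 T2] := T_check_residues.
have : T_check e (a %% 6)%Z (b %% 6)%Z (c %% 6)%Z (d %% 6)%Z.
  by case: he => ->; exact: quadsP.
rewrite /T_check D /= => /dvdzP[t ht].
have [u hu] : exists u, Xind (a + e * c) (b + e * d) c d - Xind a b c d - e =
   Xind ((a %% 6)%Z + e * (c %% 6)%Z) ((b %% 6)%Z + e * (d %% 6)%Z) (c %% 6)%Z (d %% 6)%Z
    - Xind (a %% 6)%Z (b %% 6)%Z (c %% 6)%Z (d %% 6)%Z - e + 6 * u.
  rewrite /Xind; repeat (apply: c6D || apply: c6N || apply: c6X || apply: c6M ||
    apply: res6 || apply: c6r).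
by exists (t + u); rewrite ht in hu; lia.
Qed.

Hypothesis hqm : (q%:Z, m%:Z) \in qms.

Lemma Xind_V e a b c d : e = 1 \/ e = -1 -> a * d - b * c = 1 -> (q%:Z %| c)%Z ->
  exists t, Xind a b (c + q%:Z * e * a) (d + q%:Z * e * b) = Xind a b c d - e + m%:Z * t.
Proof.
move=> he h qc; have D := det_res h; have /andP[T1 T2] := allP V_check_residues _ hqm.
have : V_check (q%:Z, m%:Z) e (a %% 6)%Z (b %% 6)%Z (c %% 6)%Z (d %% 6)%Z.
  by case: he => ->; exact: quadsP.
have qc6 : (q%:Z %| c %% 6)%Z by move: q13 qc => [] ->; lia.
rewrite /V_check D qc6 /= => /dvdzP[t ht].
have [u hu] : exists u, Xind a b (c + q%:Z * e * a) (d + q%:Z * e * b) - Xind a b c d + e =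
   Xind (a %% 6)%Z (b %% 6)%Z ((c %% 6)%Z + q%:Z * e * (a %% 6)%Z) ((d %% 6)%Z + q%:Z * e * (b %% 6)%Z)
    - Xind (a %% 6)%Z (b %% 6)%Z (c %% 6)%Z (d %% 6)%Z + e + 6 * u.
  rewrite /Xind; repeat (apply: c6D || apply: c6N || apply: c6X || apply: c6M ||
    apply: res6 || apply: c6r).
have [v hv] : exists v, 6 = m%:Z * v.
  by move: hqm; rewrite !inE => /or4P[] /eqP[_ ->]; [exists 2|exists 1|exists 6|exists 3].
exists (t + v * u); rewrite ht hv in hu.
move: (Xind a b (_ + _) _) (Xind a b c d) hu => X Y hu.
transitivity ((X - Y + e) + Y - e); first by ring.
by rewrite hu; ring.
Qed.

Lemma mob_T e a b c d z : c%:~R * z + d%:~R != 0 ->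
  mob (a + e * c) (b + e * d) c d z = mob a b c d z + e%:~R.
Proof.
move=> n0; rewrite /mob !rmorphD !rmorphM /=.
by move: (a%:~R) (b%:~R) (c%:~R) (d%:~R) (e%:~R) n0 => A B G D E n0; field.
Qed.

Lemma mob_V e a b c d z : c%:~R * z + d%:~R != 0 ->
  (c + e * a)%:~R * z + (d + e * b)%:~R = (c%:~R * z + d%:~R) * (e%:~R * mob a b c d z + 1) :> C.
Proof.
move=> n0; rewrite /mob !rmorphD !rmorphM /=.
by move: (a%:~R) (b%:~R) (c%:~R) (d%:~R) (e%:~R) n0 => A B G D E n0; field.
Qed.

Lemma mob_V_mob e a b c d z : c%:~R * z + d%:~R != 0 ->
  mob a b (c + e * a) (d + e * b) z = mob a b c d z / (e%:~R * mob a b c d z + 1).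
Proof.
move=> n0; rewrite {1}/mob mob_V // invfM mulrA; congr (_ / _).
Qed.

Definition sgq (d : int) : int := if q == 1%N then 1 else leg3 d.
Hypothesis hk : if q == 1%N then ~~ odd k else odd k.

Lemma sgq_unit d : d = 1 \/ d = -1 -> (sgq d)%:~R * d%:~R ^+ k = 1 :> C.
Proof.
rewrite /sgq; move: hk; case: ifP => _ ok [] -> //; rewrite ?expr1n ?mulr1 //.
  by rewrite rmorphN /= -signr_odd (negbTE ok) mulr1.
by rewrite [leg3 _](_ : _ = -1) // !rmorphN /= -signr_odd ok expr1 mulrNN mulr1.
Qed.

(** Euclid's algorithm reduces to translations up to sign, where the formula is immediate; [Xind_T]
    and [Xind_V] show that both sides change by the same root of unity at each step. *)
Lemma F_modular a b c d : a * d - b * c = 1 -> (q%:Z %| c)%Z -> forall z, 0 < complex.Im z ->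
  F (mob a b c d z) = om (Xind a b c d) * (sgq d)%:~R * (c%:~R * z + d%:~R) ^+ k * F z.
Proof.
have mn : m%:R != 0 :> C by rewrite pnatr_eq0 -lt0n.
have om6 x t : om (x + 6 * t) = om x.
  have [v hv] : exists v, 6 = m%:Z * v.
    by move: hqm; rewrite !inE => /or4P[] /eqP[_ ->]; [exists 2|exists 1|exists 6|exists 3].
  rewrite omD hv -mulrA /om [in X in _ * X]rmorphM /= -[m%:Z%:~R]/(m%:R) mulrAC mulfV // mul1r.
  by rewrite e2ipi_int mulr1.
have omm x t : om (x + m%:Z * t) = om x.
  by rewrite omD /om [in X in _ * X]rmorphM /= -[m%:Z%:~R]/(m%:R) mulrAC mulfV // mul1r e2ipi_int mulr1.
have base a' b' d' : a' * d' - b' * 0 = 1 -> forall z, 0 < complex.Im z ->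
    F (mob a' b' 0 d' z) = om (Xind a' b' 0 d') * (sgq d')%:~R * (0%:~R * z + d'%:~R) ^+ k * F z.
  rewrite mulr0 subr0 => h z z0.
  have : (d' %| 1)%Z by apply/dvdzP; exists a'; rewrite h.
  rewrite dvdz1 => d1; have dd : d' = 1 \/ d' = -1 by lia.
  have -> : mob a' b' 0 d' z = z + (b' * d')%:~R.
    have : a' = d' by case: dd h => ->; lia.
    by rewrite /mob mul0r add0r rmorphM /=; case: dd => -> ->; rewrite ?rmorphN /=; field.
  rewrite F_translate // -mulrA -mulrA; congr (_ * _); first by rewrite /Xind; congr om; ring.
  by rewrite mul0r add0r mulrA sgq_unit // mul1r.
have stepT e a' b' c' d' : e = 1 \/ e = -1 ->
   (a' * d' - b' * c' = 1 -> forall z, 0 < complex.Im z ->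
    F (mob (a' + e * c') (b' + e * d') c' d' z) = om (Xind (a' + e * c') (b' + e * d') c' d') * (sgq d')%:~R * (c'%:~R * z + d'%:~R) ^+ k * F z) ->
   a' * d' - b' * c' = 1 -> forall z, 0 < complex.Im z ->
    F (mob a' b' c' d' z) = om (Xind a' b' c' d') * (sgq d')%:~R * (c'%:~R * z + d'%:~R) ^+ k * F z.
  move=> he H D z z0; have D0 : 0 < a' * d' - b' * c' by rewrite D.
  have n0 := aut_neq0 D0 z0; have := H D z z0.
  have [t ->] := Xind_T he D; rewrite om6 mob_T // F_translate; last exact: Im_mob_gt0.
  rewrite [Xind _ _ _ _ + e]addrC omD -!mulrA => /mulfI; apply; exact: e2ipi_neq0.
have stepV e a' b' c' d' : e = 1 \/ e = -1 -> (q%:Z %| c')%Z ->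
   (a' * d' - b' * c' = 1 -> forall z, 0 < complex.Im z ->
    F (mob a' b' (c' + q%:Z * e * a') (d' + q%:Z * e * b') z) =
    om (Xind a' b' (c' + q%:Z * e * a') (d' + q%:Z * e * b')) * (sgq (d' + q%:Z * e * b'))%:~R *
      ((c' + q%:Z * e * a')%:~R * z + (d' + q%:Z * e * b')%:~R) ^+ k * F z) ->
   a' * d' - b' * c' = 1 -> forall z, 0 < complex.Im z ->
    F (mob a' b' c' d' z) = om (Xind a' b' c' d') * (sgq d')%:~R * (c'%:~R * z + d'%:~R) ^+ k * F z.
  move=> he qc H D z z0; have D0 : 0 < a' * d' - b' * c' by rewrite D.
  have n0 := aut_neq0 D0 z0; have := H D z z0; have w0 := Im_mob_gt0 D0 z0.
  have -> : sgq (d' + q%:Z * e * b') = sgq d'.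
    by rewrite /sgq; case: q13 => -> //=; rewrite /leg3 -mulrA addrC mulrC modzMDl.
  have [t ->] := Xind_V he D qc; rewrite omm mob_V_mob // mob_V // F_V //.
  rewrite [Xind _ _ _ _ - e]addrC omD exprMn.
  have j0 : (q%:Z * e)%:~R * mob a' b' c' d' z + 1 != 0.
    have D1 : 0 < 1 * 1 - 0 * (q%:Z * e) by rewrite mul0r subr0.
    by have := aut_neq0 D1 w0.
  have := expf_neq0 k j0; have := e2ipi_neq0 ((- e)%:~R / m%:R : C); rewrite -/(om (- e)).
  move: (((q%:Z * e)%:~R * mob a' b' c' d' z + 1) ^+ k) (om (- e)) (om (Xind a' b' c' d')) => J O X.
  move: (sgq d')%:~R ((c'%:~R * z + d'%:~R) ^+ k) (F (mob a' b' c' d' z)) (F z) => S J' Y Y' O0 J0 h.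
  by apply: (mulfI (mulf_neq0 O0 J0)); rewrite h; ring.
move: a b c d; apply: (euclid_ind (q := q%:Z)).
- by case: q13 => ->; [left|right].
- by move=> a b d D _ z z0; exact: base.
- move=> b c d c1 D qc.
  have q1 : q = 1%N by case: q13 => // q3; move: qc; rewrite q3 => qc; exfalso; lia.
  (* Here q = 1. From a = 0, adding the lower row gives a = c, and subtracting the new upper row
     then makes c vanish. *)
  apply: (stepT 1) => //; first by left.
  move=> _; apply: (stepV (-1)) => //; [by right| |by lia].
  move=> _; rewrite q1 (_ : c + 1 * -1 * _ = 0); last by ring.
  by apply: base; lia.
- move=> e a b c d he IH D qc; apply: (stepT e) => // _; apply: IH => //.
  by rewrite -D; ring.
- move=> e a b c d he IH D qc; apply: (stepV e) => // _; apply: IH => //.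
    by rewrite -D; ring.
  by rewrite rpredD // -mulrA dvdz_mulr.
Qed.

(** Without a congruence condition the algorithm may also stop at a = 0, where one inversion
    finishes. The constant is left implicit: at a cusp only the shape of the expansion matters. *)
Lemma F_reduce a b c d : 0 < a * d - b * c -> exists (A B D : int) (cst : C),
  [/\ 0 < A, 0 < D & forall z, 0 < complex.Im z ->
    F (mob a b c d z) = cst * (c%:~R * z + d%:~R) ^+ k * F ((A%:~R * z + B%:~R) / D%:~R)].
Proof.
move: a b c d; apply: (euclid_ind (q := q%:Z)).
- by case: q13 => ->; [left|right].
- move=> a b d; rewrite mulr0 subr0 => ad.
  have [d0|d0] := ltP 0 d.
    exists a, b, d, (d%:~R ^- k); split=> //; first by nia.
    move=> z z0; rewrite /mob mul0r add0r mulVf ?mul1r // expf_neq0 // intr_eq0; lia.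
  have {}d0 : d < 0 by rewrite lt_neqAle d0 andbT; apply: contraTneq ad => ->; rewrite mulr0 ltxx.
  exists (- a), (- b), (- d), (d%:~R ^- k); split; [by nia|by nia|move=> z z0].
  have dn : d%:~R != 0 :> C by rewrite intr_eq0; lia.
  rewrite /mob mul0r add0r mulVf ?expf_neq0 // mul1r; congr F.
  by rewrite !rmorphN /= mulNr -opprD invrN mulrNN.
- move=> b c d cn; rewrite mul0r sub0r => bc.
  have bn : b%:~R != 0 :> C by rewrite intr_eq0; nia.
  (* The matrix of the remaining affine map, normalised so that its diagonal entries are positive;
     the sign of b decides. *)
  have [A [B [D [A0 D0 hAB]]]] : exists A B D : int, [/\ 0 < A, 0 < D & forall z : C,
      (A%:~R * z + B%:~R) / D%:~R = - (c%:~R * z + d%:~R) / (q%:Z * b)%:~R].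
    have qb : (q%:Z * b)%:~R != 0 :> C by rewrite rmorphM mulf_neq0.
    have [b0|b0] := ltP 0 b.
      exists (- c), (- d), (q%:Z * b); split; [by nia|by nia|move=> z].
      by rewrite !rmorphN /= !mulNr -opprD mulNr.
    exists c, d, (- (q%:Z * b)); split; [by nia|by nia|move=> z].
    by rewrite rmorphN invrN mulrN mulNr.
  exists A, B, D, (c0 * (- (q%:Z * b)%:~R^-1) ^+ k); split=> // z z0.
  have D1 : 0 < 0 * d - b * c by nia.
  have n0 := aut_neq0 D1 z0.
  have w0 : 0 < complex.Im ((A%:~R * z + B%:~R) / D%:~R).
    have := @Im_mob_gt0 A B 0 D z; rewrite /mob mul0r add0r; apply => //.
    by rewrite mulr0 subr0 mulr_gt0.
  have := FS w0; rewrite hAB => h.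
  have -> : mob 0 b c d z = - (q%:R * (- (c%:~R * z + d%:~R) / (q%:Z * b)%:~R))^-1.
    rewrite /mob mul0r add0r rmorphM /= -[q%:Z%:~R]/(q%:R).
    by field; rewrite n0 bn qn.
  rewrite h; congr (_ * _); rewrite -mulrA; congr (_ * _); rewrite -exprMn; congr (_ ^+ k).
  by rewrite !mulNr; congr (- _); exact: mulrC.
- move=> e a b c d he IH D; have [|A [B [D' [cst [A0 D0 h]]]]] := IH.
    by move: D; congr (_ < _); ring.
  exists A, B, D', (om (- e) * cst); split=> // z z0; have n0 := aut_neq0 D z0.
  have := h z z0; rewrite mob_T // F_translate; last exact: Im_mob_gt0.
  rewrite -!mulrA => <-; rewrite mulrA -omD addNr om0 mul1r //.
- move=> e a b c d he IH D; have [|A [B [D' [cst [A0 D0 h]]]]] := IH.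
    by move: D; congr (_ < _); ring.
  exists A, B, D', (om e * cst); split=> // z z0; have n0 := aut_neq0 D z0.
  have w0 := Im_mob_gt0 D z0; have := h z z0; rewrite mob_V_mob // mob_V // F_V // exprMn.
  have j0 : (q%:Z * e)%:~R * mob a b c d z + 1 != 0.
    have D1 : 0 < 1 * 1 - 0 * (q%:Z * e) by rewrite mul0r subr0.
    by have := aut_neq0 D1 w0.
  have ee : om (- e) * om e = 1 by rewrite -omD addNr om0.
  have := expf_neq0 k j0; have : om (- e) != 0 by exact: e2ipi_neq0.
  move: (((q%:Z * e)%:~R * mob a b c d z + 1) ^+ k) (om (- e)) (om e) ee => J O O' ee.
  move: ((c%:~R * z + d%:~R) ^+ k) (F (mob a b c d z)) (F ((A%:~R * z + B%:~R) / D'%:~R)) => J' Y Y' O0 J0 h'.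
  apply: (mulfI (mulf_neq0 O0 J0)); rewrite h'.
  transitivity ((O * O') * J * cst * J' * Y'); last by ring.
  by rewrite ee; ring.
Qed.

End Moebius.

(** * The cusp form f and its level *)

Section CMCuspForm.
Variable R : realType.
Local Notation C := (Cplx R).

Lemma csum_dilate (A : nat) (g : nat -> C) : (0 < A)%N -> asum g ->
  asum (fun L => if (A %| L)%N then g (L %/ A)%N else 0) /\
  csum (fun L => if (A %| L)%N then g (L %/ A)%N else 0) = csum g.
Proof.
move=> A0 sg; have sL : asum (fun L => if (A %| L)%N then g (L %/ A)%N else 0).
  case: sg => M hM; exists M => B uB.
  rewrite (bigID (fun L => (A %| L)%N)) /= [X in _ + X]big1 ?addr0; last first.
    by move=> L /negbTE ->; rewrite cabs0.
  apply: le_trans (hM [seq (L %/ A)%N | L <- [seq L <- B | (A %| L)%N]] _).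
    rewrite big_map big_filter le_eqVlt; apply/orP; left; apply/eqP; apply: eq_bigr => L aL.
    by rewrite aL.
  rewrite map_inj_in_uniq ?filter_uniq // => x y; rewrite !mem_filter => /andP[ax _] /andP[ay _] h.
  by rewrite -(divnK ax) -(divnK ay) h.
have hK : cancel (muln A) (divn^~ A) by move=> x; rewrite mulKn.
split=> //; rewrite (csum_reindex hK _ sL); last first.
  by move=> L; case: ifP => [aL _|]; rewrite ?eqxx // mulnC divnK.
by apply: eq_csum => L /=; rewrite dvdn_mulr // mulKn.
Qed.

Lemma csum_cusp_expansion (h : nat) (a : nat -> C) (G : C -> C) : a 0%N = 0 ->
  (forall z, 0 < complex.Im z -> asum (fun n => a n * e2ipi (n%:R * z / h%:R)) /\
     G z = csum (fun n => a n * e2ipi (n%:R * z / h%:R))) ->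
  cusp_expansion h a G.
Proof.
move=> a0 H z z0; have [h1 ->] := H z z0.
have := csum_series h1; rewrite (_ : (fun j => _) = (fun j => \sum_(1 <= n < j) a n * e2ipi (n%:R * z / h%:R))) //.
apply/funext => j; case: j => [|j]; first by rewrite !big_geq.
by rewrite big_nat_recl // a0 mul0r add0r big_add1.
Qed.

Lemma moebiusE (g : 'M[int]_2) (z : C) : moebius g z = mob (g 0 0) (g 0 1) (g 1 0) (g 1 1) z.
Proof. by []. Qed.

Lemma det2 (g : 'M[int]_2) : \det g = g 0 0 * g 1 1 - g 0 1 * g 1 0.
Proof.
rewrite (expand_det_row _ 0) big_ord_recl big_ord1 /cofactor !det_mx11 !mxE /=.
rewrite expr0 expr1 mul1r mulrA mulrN1 mulNr.
by congr (g _ _ * g _ _ - g _ _ * g _ _); apply: val_inj.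
Qed.

Variable e : nat.
Hypothesis e0 : (0 < e)%N.
Local Notation s := (e %% 6)%N.
Local Notation m := (ewidth s).
Local Notation f := (@cmform R e).

(** The level is q m^2: the form f(z/m) lives on Gamma_0(q) with m-th roots of unity as
    multipliers. *)
Definition qlev (n : nat) : nat := if odd n then 1 else 3.
Local Notation q := (qlev e).

Let s6 : (s \in iota 0 6)%N. Proof. by rewrite mem_iota ltn_pmod. Qed.

Lemma qlev_cases : all (fun s => (3 * econdN s == qlev s * ewidth s ^ 2)%N &&
  (((qlev s)%:Z, (ewidth s)%:Z) \in qms)) (iota 0 6).
Proof. by vm_compute. Qed.

Lemma qlev_mod : q = qlev s. Proof. by rewrite /qlev odd_mod. Qed.

Lemma levelE : level e = (q * m ^ 2)%N.
Proof. by have /andP[/eqP h _] := allP qlev_cases _ s6; rewrite /level h qlev_mod. Qed.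

Lemma qlev_qms : (q%:Z, m%:Z) \in qms.
Proof. by have /andP[_ h] := allP qlev_cases _ s6; rewrite qlev_mod. Qed.

Let q13 : q = 1%N \/ q = 3%N. Proof. by rewrite /qlev; case: odd; [left|right]. Qed.
Let q0 : (0 < q)%N. Proof. by case: q13 => ->. Qed.
Let m0 : (0 < m)%N. Proof. exact: ewidth_gt0. Qed.
Let mn : m%:R != 0 :> C. Proof. by rewrite pnatr_eq0 -lt0n. Qed.

Let F (z : C) := f (z / m%:R).

Let Im_divn z (n : nat) : (0 < n)%N -> 0 < complex.Im (z : C) -> 0 < complex.Im (z / n%:R).
Proof.
move=> n0 z0; rewrite mulrC (_ : n%:R^-1 = (n%:R^-1 : R)%:C%C); last by rewrite fmorphV rmorph_nat.
by rewrite ImZ mulr_gt0 // invr_gt0 ltr0n.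
Qed.

Let Im_muln z (n : nat) : (0 < n)%N -> 0 < complex.Im (z : C) -> 0 < complex.Im (n%:R * z).
Proof. by move=> n0 z0; rewrite real_nat ImZ mulr_gt0 // ltr0n. Qed.

Let FT z : 0 < complex.Im z -> F (z + 1) = e2ipi (m%:R^-1) * F z.
Proof. by move=> z0; rewrite /F mulrDl mul1r cmform_shift //; exact: Im_divn. Qed.

Let FS_ex : exists c0 : C, forall z, 0 < complex.Im z -> F (- (q%:R * z)^-1) = c0 * z ^+ e.+1 * F z.
Proof.
have [c _ h] := @cmtheta_inversion R e e0.
exists (c / m%:R ^+ e.+1) => z z0; rewrite /F /cmform.
have -> : - (q%:R * z)^-1 / m%:R = - ((3 * econdN s)%:R * (z / m%:R))^-1.
  rewrite -/(level e) levelE natrM natrX mulNr -invfM; congr (- _^-1).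
  by move: (m%:R) (q%:R) mn => M Q M0; field.
rewrite h; last exact: Im_divn.
by rewrite expr_div_n; ring.
Qed.

Let F0 : exists2 z, 0 < complex.Im z & F z != 0.
Proof.
have [z z0 nz] := @cmtheta_neq0 R e e0; exists (m%:R * z); first exact: Im_muln.
by rewrite /F mulrAC mulfV // mul1r /cmform mulf_neq0 // invr_eq0 pnatr_eq0.
Qed.

Let hk : if q == 1%N then ~~ odd e.+1 else odd e.+1.
Proof. by rewrite /qlev /=; case: (odd e). Qed.

(** Conjugation by diag(m, 1) turns (b, c) into (b m, c / m). If q m^2 divides c, then m divides
    both, hence also [Xind], and the root of unity disappears. *)
Lemma cmform_modular (a b c d : int) z : a * d - b * c = 1 -> ((level e)%:Z %| c)%Z ->
  0 < complex.Im z ->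
  f (mob a b c d z) = (nebentypus e d)%:~R * (c%:~R * z + d%:~R) ^+ e.+1 * f z.
Proof.
move=> D /dvdzP[c' hc] z0; have [c0 FS] := FS_ex.
have N2 : (level e)%:Z = q%:Z * m%:Z * m%:Z by rewrite levelE -mulnn !PoszM mulrA.
pose c1 := c' * q%:Z * m%:Z; have c1m : c = c1 * m%:Z by rewrite hc N2 /c1; ring.
have D1 : a * d - (b * m%:Z) * c1 = 1 by rewrite -D c1m; ring.
have qc1 : (q%:Z %| c1)%Z by rewrite /c1 mulrAC dvdz_mull.
have z1 := Im_muln m0 z0.
have := F_modular q13 m0 FT FS F0 qlev_qms hk D1 qc1 z1.
have -> : mob a (b * m%:Z) c1 d (m%:R * z) = m%:R * mob a b c d z.
  rewrite /mob c1m !rmorphM /= -[m%:Z%:~R]/(m%:R) [X in X / _](_ : _ = m%:R * (a%:~R * z + b%:~R)); last by ring.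
  by rewrite !mulrA.
have Fm w : F (m%:R * w) = f w by rewrite /F mulrAC mulfV // mul1r.
rewrite !Fm => ->.
have -> : e2ipi ((Xind a (b * m%:Z) c1 d)%:~R / m%:R) = 1 :> C.
  have -> : Xind a (b * m%:Z) c1 d = m%:Z * (b * d * (1 - c1 ^+ 2) + c' * q%:Z * (a + d - 3)).
    by rewrite /Xind /c1; ring.
  by rewrite rmorphM /= -[m%:Z%:~R]/(m%:R) mulrAC mulfV // mul1r e2ipi_int.
rewrite mul1r c1m [in RHS]rmorphM /= -[m%:Z%:~R]/(m%:R) -[_ * m%:R * z]mulrA; congr (_ * _ * _).
by rewrite /sgq /qlev /nebentypus; case: (odd e).
Qed.

Lemma e2ipi_inv_neq1 (p : nat) : p = 2%N \/ p = 3%N -> e2ipi (p%:R^-1) != 1 :> C.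
Proof.
move=> hp; apply/eqP => h.
case: hp h => ->.
  by rewrite e2ipi_half => h; have := congr1 (@complex.Re R) h; rewrite /=; lra.
have -> : 3%:R^-1 = 2%:R * 6%:R^-1 :> C by field.
rewrite e2ipi_natM e2ipi_sixth zeta_sq => /(canRL (subrK _)) h.
by have := congr1 (@complex.Im R) h; rewrite /zeta /= addr0 => /eqP; rewrite gt_eqF // divr_gt0 // sqrtr_gt0.
Qed.

Lemma ewidth_prime (p : nat) : prime p -> (p %| m)%N -> p = 2%N \/ p = 3%N.
Proof.
move=> pp pm; have : p \in primes m by rewrite mem_primes pp m0.
have h : all (fun s => ewidth s \in [:: 1; 2; 3; 6]%N) (iota 0 6) by vm_compute.
have := allP h _ s6; rewrite !inE => /or4P[] /eqP ->; rewrite /= ?inE //.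
- by move=> /eqP; left.
- by move=> /eqP; right.
- by case/orP => /eqP; [left|right].
Qed.

(** After conjugation the matrix is [1, 0; q t, 1] with t = m/p, where [Xind] is -q t; the factor is
    e(-q/p). *)
Lemma cmform_V (p : nat) : prime p -> (p %| m)%N -> exists2 w : C, w != 1 &
  forall z, 0 < complex.Im z -> f (mob 1 0 (level e %/ p)%N%:Z 1 z) =
    w * ((level e %/ p)%N%:Z%:~R * z + 1) ^+ e.+1 * f z.
Proof.
move=> pp /dvdnP[t ht]; have [c0 FS] := FS_ex.
have p0 : (0 < p)%N by exact: prime_gt0.
have p23 : p = 2%N \/ p = 3%N by apply: ewidth_prime => //; rewrite ht dvdn_mull.
have pn : p%:R != 0 :> C by rewrite pnatr_eq0 -lt0n.
have tn : t%:R != 0 :> C by rewrite pnatr_eq0; apply: contraTneq m0 => t0; rewrite ht t0.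
exists (e2ipi (- (q%:R / p%:R))).
  have hw := e2ipi_inv_neq1 p23.
  case: q13 (qlev_qms) => -> hq.
    by rewrite mul1r e2ipiN invr_eq1.
  (* If q = 3 then m is 1 or 2, so p = 2 and e(-3/2) = e(1/2) = -1. *)
  have -> : p = 2%N.
    by move: hq pp ht; rewrite !inE => /or4P[] /eqP[] // hm; case: p23 => // ->; lia.
  have -> : - (3%:R / 2%:R) = (- 2)%:~R + 2%:R^-1 :> C by rewrite rmorphN /=; field.
  by rewrite e2ipiD e2ipi_int mul1r; apply: e2ipi_inv_neq1; left.
move=> z z0.
have D1 : 1 * 1 - 0 * (q%:Z * t%:Z) = 1 :> int by rewrite mul0r subr0 mulr1.
have qc1 : (q%:Z %| q%:Z * t%:Z)%Z by rewrite dvdz_mulr.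
have z1 := Im_muln m0 z0.
have := F_modular q13 m0 FT FS F0 qlev_qms hk D1 qc1 z1.
have lev : (level e %/ p)%N%:Z = q%:Z * t%:Z * m%:Z.
  by rewrite levelE -mulnn {1}ht !mulnA mulnAC mulnK // !PoszM.
have -> : mob 1 0 (q%:Z * t%:Z) 1 (m%:R * z) = m%:R * mob 1 0 (level e %/ p)%N%:Z 1 z.
  rewrite /mob lev [in RHS]rmorphM /= -[m%:Z%:~R]/(m%:R) -[1%:~R]/(1 : C) -[0%:~R]/(0 : C) !mul1r !addr0.
  by rewrite !mulrA.
have Fm w : F (m%:R * w) = f w by rewrite /F mulrAC mulfV // mul1r.
rewrite !Fm => ->.
have -> : (Xind 1 0 (q%:Z * t%:Z) 1)%:~R / m%:R = - (q%:R / p%:R) :> C.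
  have -> : Xind 1 0 (q%:Z * t%:Z) 1 = - (q%:Z * t%:Z) by rewrite /Xind; ring.
  rewrite rmorphN rmorphM /= -[q%:Z%:~R]/(q%:R) -[t%:Z%:~R]/(t%:R) ht natrM; field; by rewrite pn tn.
have -> : sgq q 1 = 1 by rewrite /sgq; case: ifP.
rewrite mulr1 lev [in RHS]rmorphM /= -[m%:Z%:~R]/(m%:R) -[_ * m%:R * z]mulrA.
by rewrite -[1%:~R]/(1 : C).
Qed.

(** f(g z) is f(w/m) at w = m g(z), a matrix of determinant m, so [F_reduce] expresses it through f
    at an affine image of z, whose q-expansion is explicit. *)
Lemma cmform_cusps (g : 'M[int]_2) : SL2Z g -> exists h : nat, (0 < h)%N /\
  exists a : nat -> C, cusp_expansion h a (slash e.+1 f g).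
Proof.
rewrite /SL2Z det2 => D; have [c0 FS] := FS_ex.
have mz : 0 < m%:Z by lia.
have D1 : 0 < (g 0 0 * m%:Z) * g 1 1 - (g 0 1 * m%:Z) * g 1 0.
  suff -> : (g 0 0 * m%:Z) * g 1 1 - (g 0 1 * m%:Z) * g 1 0 = m%:Z by [].
  by rewrite -[RHS]mul1r -D; ring.
have [A [B [Dd [cst [A0 D0 h]]]]] := F_reduce q13 m0 FT FS F0 qlev_qms hk D1.
pose An := absz A; pose Dn := absz Dd.
have An0 : (0 < An)%N by rewrite /An; lia.
have Dn0 : (0 < Dn)%N by rewrite /Dn; lia.
have EA : A%:~R = An%:R :> C by rewrite -[An%:R]/(An%:Z%:~R) gtz0_abs.
have ED : Dd%:~R = Dn%:R :> C by rewrite -[Dn%:R]/(Dn%:Z%:~R) gtz0_abs.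
have Dnn : Dn%:R != 0 :> C by rewrite pnatr_eq0 -lt0n.
(* f is evaluated at (A z + B) / (m D), so exponents are multiples of A over the width m D. *)
exists (m * Dn)%N; split; first by rewrite muln_gt0 m0.
exists (fun L => cst * (if (An %| L)%N then gam R e (L %/ An) * e2ipi ((L %/ An)%:R * (B%:~R / Dn%:R / m%:R)) else 0)).
apply: csum_cusp_expansion; first by rewrite dvdn0 div0n gam0 // mul0r mulr0.
move=> z z0.
pose w : C := (An%:R * z + B%:~R) / Dn%:R / m%:R.
have w0 : 0 < complex.Im w.
  apply: Im_divn => //; apply: Im_divn => //.
  by rewrite ImD (real_int _ B) /= addr0; exact: Im_muln.
have [sw ew] := cmform_qexp e0 w0.
have [s1 s2] := csum_dilate An0 sw.
have term L : cst * (if (An %| L)%N then gam R e (L %/ An) * e2ipi ((L %/ An)%:R * (B%:~R / Dn%:R / m%:R)) else 0) *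
    e2ipi (L%:R * z / (m * Dn)%:R) =
    cst * (if (An %| L)%N then gam R e (L %/ An) * e2ipi ((L %/ An)%:R * w) else 0).
  case: ifP => AL; last by rewrite mulr0 mul0r.
  rewrite -[LHS]mulrA -[_ * _ * e2ipi (L%:R * z / _)]mulrA -e2ipiD; congr (_ * (_ * e2ipi _)).
  rewrite -{2}(divnK AL) !natrM /w; move: (L %/ An)%:R (An%:R) => l a.
  by field; rewrite mn Dnn.
split.
  have := asumZ cst s1; congr asum; apply/funext => L; by rewrite term.
rewrite (eq_csum term) csumZ // s2 -ew.
have n0 : automorphy g z != 0 by apply: (@aut_neq0 R (g 0 0) (g 0 1)) z0; rewrite D.
rewrite /slash moebiusE.
have -> : f (mob (g 0 0) (g 0 1) (g 1 0) (g 1 1) z) = F (mob (g 0 0 * m%:Z) (g 0 1 * m%:Z) (g 1 0) (g 1 1) z).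
  rewrite /F; congr f; rewrite /mob !rmorphM /= -[m%:Z%:~R]/(m%:R).
  rewrite [X in X / _ / _](_ : _ = (g 0 0)%:~R * z * m%:R + (g 0 1)%:~R * m%:R); last by ring.
  by rewrite -mulrDl [RHS]mulrAC mulfK.
rewrite h // EA ED -/(automorphy g z) -[F _]/(f w).
by have := expf_neq0 e.+1 n0; move: (automorphy g z ^+ e.+1) (f w) => J Y J0; field.
Qed.

Lemma cmform_cusp_form (chi : int -> C) : (forall d, chi d = (nebentypus e d)%:~R) ->
  cusp_form e.+1 (level e) chi f.
Proof.
move=> hchi; split.
- move=> z z0; have [d hd] := cmtheta_diff e z0.
  apply: (@cdiff_derivable R f z (d * 6^-1 + cmtheta e z * 0)).
  exact: cdiffM hd (cdiff_cst 6^-1 z).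
- move=> g z [D Nc] z0; rewrite hchi moebiusE /automorphy; apply: cmform_modular => //.
  by rewrite -det2.
- exact: cmform_cusps.
Qed.

Lemma cmform_hecke (chi : int -> C) n z : (forall d, chi d = (nebentypus e d)%:~R) ->
  (0 < n)%N -> 0 < complex.Im z -> hecke e.+1 (level e) chi n f z = gam R e n * f z.
Proof.
move=> hchi n0 z0; pose c (a : nat) : C := (hchar e a)%:~R * a%:R ^+ e.
apply: (@hecke_eigen R (gam R e) f (gam0 R e0) (cmform_qexp e0) e.+1 (level e) chi c) => //.
  by move=> a a0; rewrite /c /hchar hchi; case: ifP; rewrite ?mul0r.
move=> l j l0 j0; apply: hecke_coefE => //.
- exact: gam1.
- by rewrite /c hchar1 expr1n mulr1.
- by move=> p i pp; rewrite /c hcharM rmorphM natrM exprMn; ring.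
by move=> p i pp; rewrite (gam_prime_rel R pp e0) prime_factorE.
Qed.

End CMCuspForm.

(** * The Kronecker symbol of -3 *)

Section Kronecker.

Lemma leg3M (m n : int) : leg3 (m * n) = leg3 m * leg3 n.
Proof.
rewrite /leg3 -modzMm; have : (m %% 3)%Z = 0 \/ (m %% 3)%Z = 1 \/ (m %% 3)%Z = 2 by lia.
have : (n %% 3)%Z = 0 \/ (n %% 3)%Z = 1 \/ (n %% 3)%Z = 2 by lia.
by case=> [->|[->|->]] [->|[->|->]].
Qed.

Lemma leg3X (m : int) n : leg3 (m ^+ n) = leg3 m ^+ n.
Proof. by elim: n => // n IH; rewrite !exprS leg3M IH. Qed.

Lemma kronecker_prime3 p : prime p -> kronecker_prime (-3) p = leg3 p%:Z.
Proof.
move=> pp; rewrite /kronecker_prime; have [->|p2] := eqVneq p 2%N; first by [].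
have [->|p3] := eqVneq p 3%N; first by [].
have hp : ((p %% 3)%N = 1%N) \/ ((p %% 3)%N = 2%N).
  have : ~~ (3 %| p)%N by rewrite dvdn_prime2 // eq_sym.
  by rewrite /dvdn; have := ltn_pmod p (isT : (0 < 3)%N); lia.
have -> : (p%:Z %| -3)%Z = false.
  by apply/negbTE; rewrite -[(p%:Z %| -3)%Z]/(p %| 3)%N dvdn_prime2.
have p1 := prime_gt1 pp.
have -> : [exists x : 'I_p, (x%:Z ^+ 2 == -3 %[mod p%:Z])%Z] = (p %% 3 == 1)%N.
  have E x : (x ^+ 2 == -3 %[mod p%:Z])%Z = (p%:Z %| x ^+ 2 + 3)%Z.
    by rewrite eqz_mod_dvd opprK.
  (* x^2 + 3 is the norm of (x - 1) + 2 zeta, so an inert p dividing it would divide 2. *)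
  apply/existsP/eqP => [[x]|p31].
    rewrite E => hx; case: hp => // hp.
    have h : (p%:Z %| enorm (x%:Z - 1, 2))%Z.
      by rewrite (_ : enorm _ = x%:Z ^+ 2 + 3) // /enorm /=; ring.
    have := inert_ediv pp hp h; rewrite ediv_prime // => /andP[_].
    rewrite -[(p%:Z %| 2)%Z]/(p %| 2)%N dvdn_prime2 // => /eqP p2'.
    by move: p2; rewrite p2'.
  have [[a b] hN] := prime_norm_exists pp p31.
  have hb : b%:~R != 0 :> 'F_p.
    rewrite Fp_int_eq0 //; apply/negP => pb.
    have pa : (p%:Z %| a)%Z.
      have : (p%:Z %| a * a)%Z.
        have -> : a * a = p%:Z - (a + b) * b by rewrite -hN /enorm /=; ring.
        by rewrite rpredB ?dvdzz // dvdz_mull.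
      by rewrite prime_dvdzM // orbb.
    move: hN; case/dvdzP: pa => a' ->; case/dvdzP: pb => b' ->; rewrite /enorm /= => h.
    have : (p%:Z * p%:Z %| p%:Z)%Z.
      apply/dvdzP; exists (a' ^+ 2 + a' * b' + b' ^+ 2); rewrite -{1}h; ring.
    by rewrite -[X in (_ %| X)%Z]mulr1 dvdz_mul2l ?dvdz1; lia.
  (* A square root of -3, from 4 (a^2 + a b + b^2) = (2a + b)^2 + 3 b^2. *)
  pose x : 'F_p := (2 * a%:~R + b%:~R) / b%:~R.
  have xlt : (x < p)%N by rewrite -[X in (_ < X)%N](Fp_cast pp) ltn_ord.
  exists (Ordinal xlt); rewrite E -Fp_int_eq0 // rmorphD rmorphXn /=.
  rewrite -[(x : nat)%:Z%:~R]/((x : nat)%:R) natr_Zp /x.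
  have : a%:~R ^+ 2 + a%:~R * b%:~R + b%:~R ^+ 2 = 0 :> 'F_p.
    apply/eqP; rewrite -!rmorphXn -rmorphM -!rmorphD /= Fp_int_eq0 // -[_ + _]/(enorm (a, b)) hN.
    exact: dvdzz.
  move: (a%:~R) (b%:~R) hb => A B B0 h; apply/eqP.
  transitivity (4 * (A ^+ 2 + A * B + B ^+ 2) / B ^+ 2); last by rewrite h mulr0 mul0r.
  by field.
by rewrite /leg3 modz_nat; case: hp => ->.
Qed.

(** Both sides are multiplicative. For negative n the sign in the Kronecker symbol agrees with
    [leg3] being odd. *)
Lemma kronecker_m3 (n : int) : kronecker (-3) n = leg3 n.
Proof.
rewrite /kronecker; have [->|n0] := eqVneq n 0; first by [].
rewrite andbT.
have n1 : (0 < `|n|)%N by rewrite absz_gt0.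
have -> : \prod_(p <- primes `|n|%N) kronecker_prime (-3) p ^+ logn p `|n| = leg3 `|n|%N%:Z.
  rewrite [in RHS](prod_prime_decomp n1) prime_decompE big_map /=.
  rewrite [LHS]big_seq [X in leg3 X%:Z]big_seq.
  elim/big_rec2: _ => // p x y hp ->; rewrite PoszM leg3M; congr (_ * _).
  by rewrite kronecker_prime3 -?leg3X ?rmorphXn //; move: hp; rewrite mem_primes => /andP[].
case: ltP => nn; last by rewrite mul1r gez0_abs.
have -> : `|n|%N%:Z = - n by lia.
rewrite mulN1r /leg3; have : (n %% 3)%Z = 0 \/ (n %% 3)%Z = 1 \/ (n %% 3)%Z = 2 by lia.
case=> [h|[h|h]]; rewrite h.
- by have -> : (- n %% 3)%Z = 0 by lia.
- by have -> : (- n %% 3)%Z = 2 by lia.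
- by have -> : (- n %% 3)%Z = 1 by lia.
Qed.

End Kronecker.

(** * The hyperbolic plane modulo Gamma_0(N) *)

Section LineMeasure.
Variable R : realType.
Local Notation lam := (@lebesgue_measure R).
Local Open Scope ereal_scope.
Implicit Types (g h : R -> \bar R).

Lemma lam_translate (a : R) (A : set R) : measurable A ->
  pushforward lam ((fun x : R => x + a)%R : _ -> measurableTypeR R) A = lam A.
Proof.
move=> mA; have ma : measurable_fun [set: R] (fun x : R => x + a)%R by exact: measurable_funD.
apply/esym/lebesgue_measure_unique => //= _ [[u v]] _ <-.
rewrite /pushforward (_ : _ @^-1` _ = `](u - a)%R, (v - a)%R]%classic); last first.
  by apply/seteqP; split => x /=; rewrite !in_itv /= ltrBlDr lerBrDr.
by rewrite !lebesgue_measure_itv /= !lte_fin ltrD2r -!EFinB opprB addrA subrK.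
Qed.

Lemma integral_translate (a : R) g : measurable_fun [set: R] g -> (forall x, 0 <= g x) ->
  \int[lam]_x g (x + a)%R = \int[lam]_x g x.
Proof.
move=> mg g0; have ma : measurable_fun [set: R] (fun x : R => x + a)%R by exact: measurable_funD.
transitivity (\int[pushforward lam ((fun x : R => x + a)%R : _ -> measurableTypeR R)]_y g y).
  rewrite ge0_integral_pushforward //.
by apply: eq_measure_integral => A mA _; exact: lam_translate.
Qed.

Lemma integral_reflect g : measurable_fun [set: R] g -> (forall x, 0 <= g x) ->
  \int[lam]_x g (- x)%R = \int[lam]_x g x.
Proof.
move=> mg g0.
transitivity (\int[pushforward lam ((-%R : _ -> measurableTypeR R))]_y g y).
  by rewrite ge0_integral_pushforward // preimage_setT.
by apply: eq_measure_integral => A mA _; exact: lebesgue_measureN.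
Qed.

Lemma integral_scale (c : R) g : (0 < c)%R -> measurable_fun [set: R] g -> (forall x, 0 <= g x) ->
  c%:E * \int[lam]_x g (c * x)%R = \int[lam]_x g x.
Proof.
move=> c0 mg g0.
have mc : measurable_fun [set: R] ((fun x : R => c * x)%R : _ -> measurableTypeR R).
  exact: mulrl_measurable.
have h : \int[pushforward lam ((fun x : R => c * x)%R : _ -> measurableTypeR R)]_y g y = \int[lam]_x g (c * x)%R.
  by rewrite ge0_integral_pushforward // preimage_setT.
rewrite -h; pose k : {nonneg R} := NngNum (ltW c0).
rewrite -(@ge0_integral_mscale _ _ _ (pushforward lam ((fun x : R => c * x)%R : _ -> measurableTypeR R)) _ measurableT k) //.
apply: eq_measure_integral => A mA _; apply/esym/lebesgue_measure_unique => //= _ [[u v]] _ <-.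
rewrite /mscale /= /pushforward (_ : _ @^-1` _ = `](u / c)%R, (v / c)%R]%classic); last first.
  by apply/seteqP; split => x /=; rewrite !in_itv /= ltr_pdivrMr // ler_pdivlMr // ![(x * c)%R]mulrC.
rewrite !lebesgue_measure_itv /= !lte_fin ltr_pM2r ?invr_gt0 //.
by case: ifP => _; rewrite ?mule0 // -!EFinB -EFinM -mulrBl mulrCA mulfV ?mulr1 // gt_eqF.
Qed.


(** An inverse that vanishes for y <= 0: integrals over the whole plane weighted by it live on the
    upper half-plane, and it is measurable everywhere. *)
Definition posinv (y : R) : R := if (0 < y)%R then y^-1%R else 0%R.

Lemma measurable_posinv : measurable_fun [set: R] posinv.
Proof.
rewrite (_ : posinv = (fun y : R => if (0 < y)%R then expR (- ln y) else 0%R)); last first.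
  by apply/funext => y; rewrite /posinv; case: ifP => // y0; rewrite expRN lnK // posrE.
by apply: measurable_fun_ifT => //; [exact: measurable_fun_ltr|apply: measurableT_comp => //; exact: measurableT_comp].
Qed.

Lemma posinv_gt0 y : (0 < y)%R -> posinv y = y^-1%R.
Proof. by rewrite /posinv => ->. Qed.

Lemma posinv_le0 y : (y <= 0)%R -> posinv y = 0%R.
Proof. by rewrite /posinv leNgt; case: ifP. Qed.

Lemma posinv_ge0 y : (0 <= posinv y)%R.
Proof. by rewrite /posinv; case: ifP => // /ltW; rewrite invr_ge0. Qed.

Lemma posinvM c y : (0 < c)%R -> posinv (c * y) = (c^-1 * posinv y)%R.
Proof.
by move=> c0; rewrite /posinv pmulr_rgt0 //; case: ifP => _; rewrite ?mulr0 // invfM.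
Qed.

Lemma posinvK y : (0 < y)%R -> posinv (posinv y) = y.
Proof. by move=> y0; rewrite !posinv_gt0 ?invr_gt0 // invrK. Qed.

Lemma measurable_comp_fun d1 d2 d3 (T1 : measurableType d1) (T2 : measurableType d2) (T3 : measurableType d3)
  (f : T2 -> T3) (g : T1 -> T2) : measurable_fun [set: T2] f -> measurable_fun [set: T1] g ->
  measurable_fun [set: T1] (fun x => f (g x)).
Proof. by move=> mf mg; exact: (measurableT_comp mf mg). Qed.

Lemma measurable_posinv_EFin d (T : measurableType d) (g : T -> R) :
  measurable_fun [set: T] g -> measurable_fun [set: T] (fun x => (posinv (g x))%:E).
Proof. by move=> mg; apply/measurable_EFinP; exact: (measurable_comp_fun measurable_posinv mg). Qed.

Lemma integral_log_scale (c : R) h : (0 < c)%R -> measurable_fun [set: R] h -> (forall y, 0 <= h y) ->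
  \int[lam]_y ((posinv y)%:E * h (c * y)%R) = \int[lam]_y ((posinv y)%:E * h y).
Proof.
move=> c0 mh h0.
have mg : measurable_fun [set: R] (fun y => (posinv y)%:E * h y).
  by apply: emeasurable_funM => //; apply: measurable_posinv_EFin.
rewrite -[RHS](integral_scale c0) //; last by move=> y; rewrite mule_ge0 // lee_fin posinv_ge0.
rewrite -ge0_integralZl_EFin //; last 3 first.
- by move=> y _; rewrite mule_ge0 // lee_fin posinv_ge0.
- by apply: (measurable_comp_fun mg); exact: mulrl_measurable.
- exact: ltW.
apply: eq_integral => y _; rewrite posinvM // muleA -EFinM mulrA mulfV ?mul1r //; exact: lt0r_neq0.
Qed.

(** Against dy/y its integral is the length of ]1, 2], that is 1. *)
Let bump y : \bar R := if (1 < y <= 2)%R then y%:E else 0.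

Let bump_ge0 y : 0 <= bump y.
Proof. by rewrite /bump; case: ifP => // /andP[y1 _]; rewrite lee_fin (le_trans ler01) // ltW. Qed.

Let measurable_bump : measurable_fun [set: R] bump.
Proof.
by apply: measurable_fun_ifT => //; apply: measurable_and; [exact: measurable_fun_ltr|exact: measurable_fun_ler].
Qed.

Let integral_bump : \int[lam]_y ((posinv y)%:E * bump y) = 1.
Proof.
transitivity (\int[lam]_y (\1_(`]1%R, 2%R]%classic : set R)  y)%:E).
  apply: eq_integral => y _; rewrite indicE /bump.
  have -> : (y \in `]1%R, 2%R]%classic) = (1 < y <= 2)%R by apply/idP/idP; rewrite inE /= in_itv.
  case: ifP => [/andP[y1 _]|_]; last by rewrite mule0.
  have y0 : (0 < y)%R by apply: lt_trans y1.
  by rewrite posinv_gt0 // -EFinM mulVf // gt_eqF.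
rewrite integral_indic // setIT; apply: (etrans (@lebesgue_measure_itv R `]1%R, 2%R])).
rewrite /= lte_fin ltr1n -EFinB.
by congr (_%:E); lra.
Qed.

(* Uniqueness of the Haar measure dy/y on the multiplicative group, by Tonelli against a test function of integral 1. *)
Lemma integral_log_inv h : measurable_fun [set: R] h -> (forall y, 0 <= h y) ->
  \int[lam]_y ((posinv y)%:E * h (posinv y)) = \int[lam]_y ((posinv y)%:E * h y).
Proof.
move=> mh h0; have p0 y : 0 <= (posinv y)%:E by rewrite lee_fin posinv_ge0.
have mp : measurable_fun [set: R] (fun y => (posinv y)%:E) by exact: measurable_posinv_EFin.
have mi := measurable_comp_fun mh measurable_posinv.
pose f (p : R * R) := (posinv p.1)%:E * h p.1 * ((posinv p.2)%:E * bump (p.1 * p.2)%R).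
have mf : measurable_fun [set: R * R] f.
  apply: emeasurable_funM; apply: emeasurable_funM.
  - exact: measurable_posinv_EFin.
  - exact: (measurable_comp_fun mh).
  - exact: measurable_posinv_EFin.
  - apply: (measurable_comp_fun measurable_bump); exact: measurable_funM.
have f0 p : 0 <= f p by rewrite !mule_ge0.
have mbs (x : R) : measurable_fun [set: R] (fun y : R => bump (x * y)%R).
  by apply: (measurable_comp_fun measurable_bump); exact: mulrl_measurable.
have mhs (x : R) : measurable_fun [set: R] (fun y : R => h (x * y)%R).
  by apply: (measurable_comp_fun mh); exact: mulrl_measurable.
have mhi (x : R) : measurable_fun [set: R] (fun y : R => h (x * posinv y)%R).
  by apply: (measurable_comp_fun (mhs x)); exact: measurable_posinv.
transitivity (\int[lam]_x \int[lam]_y f (x, y)); last first.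
  apply: eq_integral => x _; rewrite /f /= ge0_integralZl //; last 3 first.
  - exact: (emeasurable_funM mp (mbs x)).
  - by move=> y _; exact: mule_ge0.
  - exact: mule_ge0.
  have [x0|x0] := ltP 0%R x; last by rewrite posinv_le0 // !mul0e.
  by rewrite integral_log_scale // integral_bump mule1.
rewrite fubini_tonelli //.
transitivity (\int[lam]_y \int[lam]_x ((posinv y)%:E * ((posinv x)%:E * (h (x * posinv y)%R * bump x)))); last first.
  apply: eq_integral => y _; symmetry; have [y0|y0] := ltP 0%R y; last first.
    by rewrite !integral0_eq // => x _; rewrite /f /= (posinv_le0 y0) !mul0e ?mule0.
  rewrite ge0_integralZl //; last 2 first.
  - apply: emeasurable_funM => //; apply: emeasurable_funM => //.
    by apply: (measurable_comp_fun mh); exact: measurable_funM.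
  - by move=> x _; rewrite !mule_ge0.
  have y'0 : (0 < posinv y)%R by rewrite posinv_gt0 // invr_gt0.
  rewrite -(@integral_log_scale y (fun x => h (x * posinv y)%R * bump x)) //; last 2 first.
  - by apply: emeasurable_funM => //; apply: (measurable_comp_fun mh); exact: measurable_funM.
  - by move=> x; rewrite mule_ge0.
  rewrite -ge0_integralZl //; last 2 first.
  - apply: emeasurable_funM => //; apply: emeasurable_funM => //.
    by apply: (measurable_comp_fun mh); apply: measurable_funM => //; exact: mulrl_measurable.
    exact: (mbs y).
  - by move=> x _; rewrite !mule_ge0.
  apply: eq_integral => x _; rewrite /f /= (_ : (y * x * posinv y)%R = x); last first.
    by rewrite posinv_gt0 // mulrAC mulfV ?mul1r // gt_eqF.
  by rewrite (mulrC y x) muleCA -!muleA; congr (_ * _); rewrite muleCA.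
have := @fubini_tonelli _ _ _ _ _ lam lam (fun p : R * R => (posinv p.2)%:E * ((posinv p.1)%:E * (h (p.1 * posinv p.2)%R * bump p.1))).
move=> <-; last 2 first.
- apply: emeasurable_funM; [exact: measurable_posinv_EFin|apply: emeasurable_funM; [exact: measurable_posinv_EFin|]].
  apply: emeasurable_funM; last exact: (measurable_comp_fun measurable_bump).
  apply: (measurable_comp_fun mh); apply: measurable_funM => //.
  by apply: (measurable_comp_fun measurable_posinv).
- by move=> p; rewrite !mule_ge0.
rewrite -[LHS]mule1 -integral_bump -ge0_integralZl //; last 3 first.
- exact: (emeasurable_funM mp measurable_bump).
- by move=> x _; exact: mule_ge0.
- by apply: integral_ge0 => x _; exact: mule_ge0.
apply: eq_integral => x _ /=.
have [x0|x0] := ltP 0%R x; last first.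
  by under [RHS]eq_integral do rewrite (posinv_le0 x0) mul0e mule0; rewrite integral0 (posinv_le0 x0) mul0e mule0.
rewrite muleC.
have E : \int[lam]_y ((posinv y)%:E * h (posinv y)) = \int[lam]_y ((posinv y)%:E * h (x * posinv y)%R).
  rewrite -(@integral_log_scale x^-1%R (fun y => h (posinv y))) ?invr_gt0 //.
  by apply: eq_integral => y _; rewrite posinvM ?invr_gt0 // invrK.
rewrite E -ge0_integralZl //; last 3 first.
- exact: (emeasurable_funM mp (mhi x)).
- by move=> y _; exact: mule_ge0.
- exact: mule_ge0.
apply: eq_integral => y _.
by rewrite -!muleA; rewrite [in RHS]muleCA; congr (_ * _); rewrite muleC -!muleA; congr (_ * _).
Qed.

(** The integral over the upper half-plane against dx dy / y^2. *)
Definition hyp_integral (G : R * R -> \bar R) : \bar R :=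
  \int[(lam \x lam)%E]_p ((posinv p.2)%:E * ((posinv p.2)%:E * G p)).

Section Plane.
Variable G : R * R -> \bar R.
Hypothesis mG : measurable_fun [set: R * R] G.
Hypothesis G0 : forall p, 0 <= G p.

Lemma measurable_hyp : measurable_fun [set: R * R] (fun p : R * R => (posinv p.2)%:E * ((posinv p.2)%:E * G p)).
Proof.
by apply: emeasurable_funM; [|apply: emeasurable_funM => //]; exact: measurable_posinv_EFin.
Qed.

Lemma hyp_ge0 p : 0 <= (posinv p.2)%:E * ((posinv p.2)%:E * G p).
Proof. by rewrite !mule_ge0 // lee_fin posinv_ge0. Qed.

Lemma hyp_integral_fubini :
  hyp_integral G = \int[lam]_y \int[lam]_x ((posinv y)%:E * ((posinv y)%:E * G (x, y))).
Proof. exact: (@fubini_tonelli2 _ _ _ _ R lam lam _ measurable_hyp hyp_ge0). Qed.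

End Plane.

Section Plane.
Variable G : R * R -> \bar R.
Hypothesis mG : measurable_fun [set: R * R] G.
Hypothesis G0 : forall p, 0 <= G p.

Let measurable_swap (y : R) : measurable_fun [set: R] (fun x : R => (posinv y)%:E * ((posinv y)%:E * G (x, y))).
Proof.
apply: (measurable_comp_fun (measurable_hyp mG) (g := fun x : R => (x, y))).
exact: measurable_fun_pair.
Qed.

Lemma hyp_integral_translate (a : R) : hyp_integral (fun p => G (p.1 + a, p.2)%R) = hyp_integral G.
Proof.
have mGa : measurable_fun [set: R * R] (fun p : R * R => G (p.1 + a, p.2)%R).
  apply: (measurable_comp_fun mG (g := fun p : R * R => (p.1 + a, p.2)%R)).
  by apply: measurable_fun_pair => //; exact: measurable_funD.
rewrite (hyp_integral_fubini mG G0) (hyp_integral_fubini mGa (fun p => G0 _)).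
apply: eq_integral => y _.
by rewrite (@integral_translate a (fun x => (posinv y)%:E * ((posinv y)%:E * G (x, y)))) // => x; exact: (hyp_ge0 G0 (x, y)).
Qed.

Let polar (p : R * R) : \bar R := (posinv p.2)%:E * G (p.2 * p.1, p.2)%R.

Let measurable_polar : measurable_fun [set: R * R] polar.
Proof.
apply: emeasurable_funM; first exact: measurable_posinv_EFin.
apply: (measurable_comp_fun mG (g := fun p : R * R => (p.2 * p.1, p.2)%R)).
by apply: measurable_fun_pair => //; exact: measurable_funM.
Qed.

Let polar_ge0 p : 0 <= polar p.
Proof. by rewrite mule_ge0 // lee_fin posinv_ge0. Qed.

(** The substitution x = y t turns dx dy / y^2 into dt dy / y, a product of a translation-invariant
    and a scaling-invariant measure. *)
Lemma hyp_integral_polar : hyp_integral G = \int[lam]_t \int[lam]_y ((posinv y)%:E * G (y * t, y)%R).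
Proof.
transitivity (\int[lam]_x \int[lam]_y polar (x, y)); last by [].
rewrite (@fubini_tonelli _ _ _ _ R lam lam _ measurable_polar polar_ge0) (hyp_integral_fubini mG G0).
apply: eq_integral => y _; rewrite /polar /=.
have [y0|y0] := ltP 0%R y; last first.
  by rewrite !integral0_eq // => x _; rewrite (posinv_le0 y0) mul0e.
rewrite -(@integral_scale y (fun x => (posinv y)%:E * ((posinv y)%:E * G (x, y)))) //; last by move=> x; exact: (hyp_ge0 G0 (x, y)).
rewrite -ge0_integralZl_EFin //; last 3 first.
- by move=> x _; exact: (hyp_ge0 G0 (y * x, y)%R).
- apply: (measurable_comp_fun (measurable_swap y)); exact: mulrl_measurable.
- exact: ltW.
apply: eq_integral => x _; rewrite muleA -EFinM posinv_gt0 // mulfV ?gt_eqF // mul1e //.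
Qed.

Lemma measurable_polar_slice (t : R) : measurable_fun [set: R] (fun y : R => G (y * t, y)%R).
Proof.
apply: (measurable_comp_fun mG (g := fun y : R => (y * t, y)%R)).
by apply: measurable_fun_pair => //; exact: mulrr_measurable.
Qed.

Lemma measurable_polar_integral : measurable_fun [set: R] (fun t => \int[lam]_y ((posinv y)%:E * G (y * t, y)%R)).
Proof. exact: (@measurable_fun_fubini_tonelli_F _ _ _ _ _ lam polar measurable_polar polar_ge0). Qed.

End Plane.

Definition circle_inv (p : R * R) : R * R :=
  (- p.1 * posinv (p.1 ^+ 2 + p.2 ^+ 2), p.2 * posinv (p.1 ^+ 2 + p.2 ^+ 2))%R.

Lemma measurable_circle_inv : measurable_fun [set: R * R] circle_inv.
Proof.
have h : measurable_fun [set: R * R] (fun p : R * R => posinv (p.1 ^+ 2 + p.2 ^+ 2)%R).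
  by apply: (measurable_comp_fun measurable_posinv); apply: measurable_funD; apply: measurable_funX.
by apply: measurable_fun_pair; apply: measurable_funM => //; exact: (measurable_comp_fun (@oppr_measurable R setT)).
Qed.

(** In the coordinates (t, y) with x = y t, the map z -> -1/z is t -> -t and y -> 1 / (y (1 + t^2)):
    a reflection combined with an inversion and a scaling, each preserving its measure. *)
Lemma hyp_integral_circle_inv G : measurable_fun [set: R * R] G -> (forall p, 0 <= G p) ->
  hyp_integral (fun p => G (circle_inv p)) = hyp_integral G.
Proof.
move=> mG G0; rewrite (hyp_integral_polar mG G0) (hyp_integral_polar (measurable_comp_fun mG measurable_circle_inv) (fun p => G0 _)).
rewrite -[RHS]integral_reflect; last 2 first.
- exact: measurable_polar_integral.
- by move=> t; apply: integral_ge0 => y _; rewrite mule_ge0 // lee_fin posinv_ge0.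
apply: eq_integral => t _.
pose h y := G (y * - t, y)%R.
have mh : measurable_fun [set: R] h by exact: measurable_polar_slice.
have mhi := measurable_comp_fun mh measurable_posinv.
have c0 : (0 < 1 + t ^+ 2)%R by rewrite ltr_pwDl // sqr_ge0.
have h0 y : 0 <= h y by exact: G0.
rewrite -[RHS](integral_log_inv mh h0) -[RHS](integral_log_scale c0 mhi (fun y => h0 _)).
apply: eq_integral => y _; have [y0|y0] := ltP 0%R y; last by rewrite (posinv_le0 y0) !mul0e.
congr (_ * _); rewrite /h /circle_inv /=.
have -> : (((y * t) ^+ 2 + y ^+ 2) = y ^+ 2 * (1 + t ^+ 2))%R by ring.
have cn := lt0r_neq0 c0; have yn := lt0r_neq0 y0.
rewrite !posinv_gt0 ?mulr_gt0 ?exprn_gt0 //.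
by congr (G (_, _)); field; rewrite yn cn.
Qed.

End LineMeasure.

(** * Matrices of determinant 1 *)

Section Matrices.

Lemma mulz_eq1 (a d : int) : a * d = 1 -> a = d /\ (d = 1 \/ d = -1).
Proof.
move=> h; have := congr1 absz h; rewrite abszM => /eqP.
by rewrite muln_eq1 => /andP[/eqP ha /eqP hd]; clear -h ha hd; nia.
Qed.

Implicit Types g h : 'M[int]_2.

Definition mx2 (a b c d : int) : 'M[int]_2 :=
  \matrix_(i, j) if i == 0 then (if j == 0 then a else b) else (if j == 0 then c else d).

Lemma mx2_eq g h : g 0 0 = h 0 0 -> g 0 1 = h 0 1 -> g 1 0 = h 1 0 -> g 1 1 = h 1 1 -> g = h.
Proof.
move=> h1 h2 h3 h4; apply/matrixP => i j.
have D (k : 'I_2) : k = 0 \/ k = 1 by case: k => -[|[|//]] hk; [left|right]; exact: val_inj.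
by case: (D i) => ->; case: (D j) => ->.
Qed.

Lemma mul2E g h i j : (g *m h) i j = g i 0 * h 0 j + g i 1 * h 1 j.
Proof. by rewrite mxE big_ord_recl big_ord1; congr (_ + g _ _ * h _ _); exact: val_inj. Qed.

Lemma mx2_00 a b c d : mx2 a b c d 0 0 = a. Proof. by rewrite mxE. Qed.
Lemma mx2_01 a b c d : mx2 a b c d 0 1 = b. Proof. by rewrite mxE. Qed.
Lemma mx2_10 a b c d : mx2 a b c d 1 0 = c. Proof. by rewrite mxE. Qed.
Lemma mx2_11 a b c d : mx2 a b c d 1 1 = d. Proof. by rewrite mxE. Qed.
Definition mx2E := (mx2_00, mx2_01, mx2_10, mx2_11).

Definition sinv g := mx2 (g 1 1) (- g 0 1) (- g 1 0) (g 0 0).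

Lemma SL2Z_mx2 a b c d : a * d - b * c = 1 -> SL2Z (mx2 a b c d).
Proof. by rewrite /SL2Z det2 !mx2E. Qed.

Lemma SL2Z_mul g h : SL2Z g -> SL2Z h -> SL2Z (g *m h).
Proof. by rewrite /SL2Z det_mulmx => -> ->. Qed.

Lemma SL2Z_sinv g : SL2Z g -> SL2Z (sinv g).
Proof. by rewrite /SL2Z !det2 !mx2E => <-; ring. Qed.

Lemma sinvV g : SL2Z g -> sinv g *m g = 1%:M.
Proof.
by rewrite /SL2Z det2 => D; apply: mx2_eq; rewrite mul2E !mx2E !mxE /=; rewrite -?D; ring.
Qed.

Lemma sinvKV g : SL2Z g -> g *m sinv g = 1%:M.
Proof.
by rewrite /SL2Z det2 => D; apply: mx2_eq; rewrite mul2E !mx2E !mxE /=; rewrite -?D; ring.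
Qed.

Lemma sinvK g : sinv (sinv g) = g.
Proof. by apply: mx2_eq; rewrite !mx2E ?opprK. Qed.

Lemma SL2Z_1 : SL2Z 1%:M. Proof. exact: det1. Qed.

Lemma SL2Z_opp g : SL2Z g -> SL2Z (- g).
Proof. by rewrite /SL2Z !det2 !mxE !mulrNN. Qed.

Lemma Gamma0_mul N g h : Gamma0 N g -> Gamma0 N h -> Gamma0 N (g *m h).
Proof.
by move=> [g1 g2] [h1 h2]; split; [exact: SL2Z_mul|rewrite mul2E; apply: rpredD; [exact: dvdz_mulr|exact: dvdz_mull]].
Qed.

Lemma Gamma0_sinv N g : Gamma0 N g -> Gamma0 N (sinv g).
Proof. by move=> [g1 g2]; split; [exact: SL2Z_sinv|rewrite mx2E rpredN]. Qed.

End Matrices.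

(** * The Moebius action in real coordinates and invariance of the measure *)

Section Plane.
Variable R : realType.
Local Notation C := (Cplx R).
Implicit Types (p : R * R) (g h : 'M[int]_2).

Definition toC2 p : C := Complex p.1 p.2.

Lemma toC2_inj p q : toC2 p = toC2 q -> p = q.
Proof. by case: p q => [a b] [c d] [-> ->]. Qed.

Definition den4 (c d : int) p : R := (c%:~R * p.1 + d%:~R) ^+ 2 + (c%:~R * p.2) ^+ 2.

(* For ad - bc = 1 this is the real form of the Moebius action on the upper half-plane. *)
Definition rm4 (a b c d : int) p : R * R :=
  (((a%:~R * p.1 + b%:~R) * (c%:~R * p.1 + d%:~R) + a%:~R * c%:~R * p.2 ^+ 2) * posinv (den4 c d p),
   p.2 * posinv (den4 c d p)).

Lemma den4_gt0 (a b c d : int) p : a * d - b * c = 1 -> 0 < p.2 -> 0 < den4 c d p.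
Proof.
move=> D y0; have [c0|c0] := eqVneq c 0.
  have d0 : d != 0 by apply/eqP => d0; move: D; rewrite c0 d0 !mulr0 subrr.
  by rewrite /den4 c0 !mul0r add0r expr0n addr0 exprn_even_gt0 //= intr_eq0.
by rewrite /den4 ltr_wpDl ?sqr_ge0 // exprn_even_gt0 //= mulf_neq0 ?intr_eq0 // gt_eqF.
Qed.

Lemma rm4_gt0 (a b c d : int) p : a * d - b * c = 1 -> 0 < p.2 -> 0 < (rm4 a b c d p).2.
Proof. by move=> D y0; have n0 := den4_gt0 D y0; rewrite /= posinv_gt0 // mulr_gt0 // invr_gt0. Qed.

Lemma toC2_aut (c d : int) p : c%:~R * toC2 p + d%:~R = Complex (c%:~R * p.1 + d%:~R) (c%:~R * p.2).
Proof. by apply/eqP; rewrite eq_complex /= (real_int _ c) (real_int _ d) /= !mul0r subr0 !addr0 !eqxx. Qed.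

Lemma toC2_rm4 (a b c d : int) p : a * d - b * c = 1 -> 0 < p.2 -> toC2 (rm4 a b c d p) = mob a b c d (toC2 p).
Proof.
move=> D y0; have n0 := den4_gt0 D y0.
have z0 : 0 < complex.Im (toC2 p) by [].
have D' : 0 < a * d - b * c by rewrite D.
have n1 := aut_neq0 D' z0.
apply: (mulIf n1); rewrite /mob divfK // !toC2_aut /toC2 /= posinv_gt0 //.
have Dr : a%:~R * d%:~R - b%:~R * c%:~R = 1 :> R by rewrite -!rmorphM -rmorphB D.
have nn : (c%:~R * p.1 + d%:~R) ^+ 2 + (c%:~R * p.2) ^+ 2 != 0 by rewrite gt_eqF.
rewrite /den4; case: p {z0 n0 n1} y0 nn => x y /= y0 nn.
move: (a%:~R) (b%:~R) (c%:~R) (d%:~R) Dr nn => A B C' D0 Dr nn.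
apply/eqP; rewrite eq_complex /=; apply/andP; split; apply/eqP.
  transitivity (((A * x + B) * ((C' * x + D0) ^+ 2 + (C' * y) ^+ 2) + (A * D0 - B * C' - 1) * C' * y ^+ 2) / ((C' * x + D0) ^+ 2 + (C' * y) ^+ 2)); first by field.
  by rewrite Dr subrr !mul0r addr0 mulfK.
transitivity ((A * y * ((C' * x + D0) ^+ 2 + (C' * y) ^+ 2) - (A * D0 - B * C' - 1) * (C' * x + D0) * y) / ((C' * x + D0) ^+ 2 + (C' * y) ^+ 2)); first by field.
by rewrite Dr subrr !mul0r subr0 mulfK.
Qed.

Lemma measurable_den4 (c d : int) : measurable_fun [set: R * R] (fun p => posinv (den4 c d p)).
Proof.
apply: (measurable_comp_fun (@measurable_posinv R)); apply: measurable_funD; apply: measurable_funX.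
  by apply: measurable_funD => //; exact: measurable_funM.
exact: measurable_funM.
Qed.

Lemma measurable_rm4 (a b c d : int) : measurable_fun [set: R * R] (rm4 a b c d).
Proof.
have m1 (u v : int) : measurable_fun [set: R * R] (fun p => u%:~R * p.1 + v%:~R : R).
  by apply: measurable_funD => //; exact: measurable_funM.
apply: measurable_fun_pair; apply: measurable_funM => //; try exact: measurable_den4.
apply: measurable_funD; first exact: measurable_funM.
by apply: measurable_funM => //; exact: measurable_funX.
Qed.

Lemma hyp_integral_eq (G H : R * R -> \bar R) : (forall p, 0 < p.2 -> G p = H p) ->
  hyp_integral G = hyp_integral H.
Proof.
move=> h; apply: eq_integral => p _; have [y0|y0] := ltP 0 p.2; first by rewrite h.
by rewrite posinv_le0 // !mul0e.
Qed.

Lemma toC2_circle_inv p : 0 < p.2 -> toC2 (circle_inv p) = - (toC2 p)^-1.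
Proof.
move=> y0; have z0 : toC2 p != 0 by apply: tneq0.
apply: (mulIf z0); rewrite mulNr mulVf //.
have n0 : 0 < p.1 ^+ 2 + p.2 ^+ 2 by rewrite ltr_wpDl ?sqr_ge0 // exprn_gt0.
have n1 := lt0r_neq0 n0.
apply/eqP; rewrite eq_complex /= posinv_gt0 //; apply/andP; split; apply/eqP; field; exact: n1.
Qed.

Lemma circle_inv_gt0 p : 0 < p.2 -> 0 < (circle_inv p).2.
Proof.
move=> y0; have n0 : 0 < p.1 ^+ 2 + p.2 ^+ 2 by rewrite ltr_wpDl ?sqr_ge0 // exprn_gt0.
by rewrite /= posinv_gt0 // mulr_gt0 // invr_gt0.
Qed.

Lemma toC2_translate (e : int) p : toC2 (p.1 + e%:~R, p.2) = toC2 p + e%:~R.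
Proof. by apply/eqP; rewrite eq_complex /= (real_int _ e) /= addr0 !eqxx. Qed.

(** Euclid's algorithm reduces to translations and z -> -1/z, for which invariance has been shown on
    the integral itself. *)
Lemma hyp_integral_rm4 (a b c d : int) : a * d - b * c = 1 ->
  forall G : R * R -> \bar R, measurable_fun [set: R * R] G -> (forall p, 0 <= G p)%E ->
  hyp_integral (fun p => G (rm4 a b c d p)) = hyp_integral G.
Proof.
move: a b c d; apply: (@euclid_ind 1 (fun a b c d => a * d - b * c = 1 ->
  forall G : R * R -> \bar R, measurable_fun [set: R * R] G -> (forall p, 0 <= G p)%E ->
  hyp_integral (fun p => G (rm4 a b c d p)) = hyp_integral G)).
- by left.
- move=> a b d D G mG G0.
  have D1 : a * d = 1 by rewrite -D mulr0 subr0.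
  rewrite -(hyp_integral_translate mG G0 (b * d)%:~R); apply: hyp_integral_eq => p y0.
  congr G; apply: toC2_inj; rewrite toC2_rm4 // toC2_translate /mob mul0r add0r.
  have d0 : d%:~R != 0 :> C by rewrite intr_eq0; apply/eqP => d0; rewrite d0 mulr0 in D1.
  have ad : a%:~R * d%:~R = 1 :> C by rewrite -rmorphM D1.
  have dd : d%:~R * d%:~R = 1 :> C.
    by rewrite -rmorphM; have [ad' _] := mulz_eq1 D1; rewrite -{1}ad' D1.
  apply: (mulIf d0); rewrite divfK // rmorphM mulrDl -mulrA dd mulr1.
  by have [-> _] := mulz_eq1 D1; rewrite [toC2 p * _]mulrC.
- move=> b c d c0 D G mG G0.
  have D1 : b * c = -1 by clear -D; lia.
  have D2 : - b * c = 1 by rewrite mulNr D1.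
  have [b_c' _] := mulz_eq1 D2.
  have b_c : b = - c by rewrite -b_c' opprK.
  have cc : c * c = 1 by rewrite -{1}b_c'.
  rewrite -(hyp_integral_circle_inv mG G0) -(hyp_integral_translate (measurable_comp_fun mG (@measurable_circle_inv R)) (fun p => G0 _) (c * d)%:~R).
  apply: hyp_integral_eq => p y0; congr G; apply: toC2_inj.
  rewrite toC2_rm4 // toC2_circle_inv // toC2_translate /mob mul0r add0r b_c.
  have cn : c%:~R != 0 :> C by rewrite intr_eq0.
  have ccC : c%:~R * c%:~R = 1 :> C by rewrite -rmorphM cc.
  have -> : c%:~R * toC2 p + d%:~R = c%:~R * (toC2 p + (c * d)%:~R).
    by rewrite mulrDr rmorphM mulrA ccC mul1r.
  by rewrite rmorphN mulNr invfM mulrA mulfV // mul1r.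
- move=> e a b c d he IH D G mG G0.
  have D' : (a + e * c) * d - (b + e * d) * c = 1 by rewrite -D; ring.
  have mT : measurable_fun [set: R * R] (fun p => G (p.1 + (- e)%:~R, p.2)).
    apply: (measurable_comp_fun mG (g := fun p => (p.1 + (- e)%:~R, p.2))).
    by apply: measurable_fun_pair => //; exact: measurable_funD.
  rewrite -(hyp_integral_translate mG G0 (- e)%:~R) -(IH D' _ mT (fun p => G0 _)).
  apply: hyp_integral_eq => p y0; congr G; apply: toC2_inj.
  rewrite toC2_translate !toC2_rm4 // /mob.
  have z0 : 0 < complex.Im (toC2 p) by [].
  have Dp : 0 < a * d - b * c by rewrite D.
  have n1 := aut_neq0 Dp z0.
  rewrite !rmorphD !rmorphM rmorphN /=; field; exact: n1.
- move=> e a b c d he IH; rewrite !mul1r in IH => D G mG G0.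
  have D' : a * (d + e * b) - b * (c + e * a) = 1 by rewrite -D; ring.
  (* z -> z / (1 - e z), as inversion, translation by e, inversion; it undoes the step on the lower
     row. *)
  pose V q := circle_inv ((circle_inv q).1 + e%:~R, (circle_inv q).2) : R * R.
  have mS := measurable_comp_fun mG (@measurable_circle_inv R).
  have mT : measurable_fun [set: R * R] (fun p => G (circle_inv (p.1 + e%:~R, p.2))).
    apply: (measurable_comp_fun mS (g := fun p => (p.1 + e%:~R, p.2))).
    by apply: measurable_fun_pair => //; exact: measurable_funD.
  have mV : measurable_fun [set: R * R] (fun q => G (V q)) := measurable_comp_fun mT (@measurable_circle_inv R).
  rewrite -(hyp_integral_circle_inv mG G0) -(hyp_integral_translate mS (fun p => G0 _) e%:~R).
  rewrite -(hyp_integral_circle_inv mT (fun p => G0 _)) -(IH D' _ mV (fun p => G0 _)).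
  apply: hyp_integral_eq => p y0; congr G; apply: toC2_inj.
  have z0 : 0 < complex.Im (toC2 p) by [].
  have y1 := rm4_gt0 D' y0.
  have w0 : toC2 (rm4 a b (c + e * a) (d + e * b) p) != 0 by apply: tneq0.
  rewrite /V toC2_circle_inv ?circle_inv_gt0 // toC2_translate toC2_circle_inv // !toC2_rm4 // in w0 *.
  have Dp : 0 < a * d - b * c by rewrite D.
  have Dp' : 0 < a * (d + e * b) - b * (c + e * a) by rewrite D'.
  have n1 := aut_neq0 Dp z0; have n2 := aut_neq0 Dp' z0.
  have n3 : a%:~R * toC2 p + b%:~R != 0.
    by apply: contra_neq w0 => h0; rewrite /mob h0 mul0r.
  rewrite /mob in w0 *.
  rewrite invf_div.
  have -> : - (((c + e * a)%:~R * toC2 p + (d + e * b)%:~R) / (a%:~R * toC2 p + b%:~R)) + e%:~R =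
     - ((c%:~R * toC2 p + d%:~R) / (a%:~R * toC2 p + b%:~R)).
    by rewrite !rmorphD !rmorphM /=; field.
  by rewrite invrN opprK invf_div.
Qed.

Definition rmob (g : 'M[int]_2) p := rm4 (g 0 0) (g 0 1) (g 1 0) (g 1 1) p.

Lemma toC2_rmob g p : SL2Z g -> 0 < p.2 -> toC2 (rmob g p) = moebius g (toC2 p).
Proof. by rewrite /SL2Z det2 => D y0; rewrite toC2_rm4. Qed.

Lemma rmob_gt0 g p : SL2Z g -> 0 < p.2 -> 0 < (rmob g p).2.
Proof. by rewrite /SL2Z det2 => D y0; exact: rm4_gt0. Qed.

Lemma measurable_rmob g : measurable_fun [set: R * R] (rmob g).
Proof. exact: measurable_rm4. Qed.

Lemma hyp_integral_rmob g (G : R * R -> \bar R) : SL2Z g ->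
  measurable_fun [set: R * R] G -> (forall p, 0 <= G p)%E ->
  hyp_integral (fun p => G (rmob g p)) = hyp_integral G.
Proof. by rewrite /SL2Z det2 => D mG G0; exact: hyp_integral_rm4. Qed.

Lemma automorphy_neq0 g (z : C) : SL2Z g -> 0 < complex.Im z -> automorphy g z != 0.
Proof. by rewrite /SL2Z det2 => D z0; apply: (@aut_neq0 R (g 0 0) (g 0 1)); rewrite ?D. Qed.

Lemma Im_moebius_gt0 g (z : C) : SL2Z g -> 0 < complex.Im z -> 0 < complex.Im (moebius g z).
Proof. by rewrite /SL2Z det2 => D z0; rewrite moebiusE Im_mob_gt0 // D. Qed.

Lemma automorphyM g h (z : C) : SL2Z h -> 0 < complex.Im z ->
  automorphy (g *m h) z = automorphy g (moebius h z) * automorphy h z.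
Proof.
move=> D z0; have := automorphy_neq0 D z0.
rewrite /automorphy /moebius /automorphy !mul2E => n1.
rewrite !rmorphD !rmorphM /=; field; exact: n1.
Qed.

Lemma moebiusM g h (z : C) : SL2Z g -> SL2Z h -> 0 < complex.Im z ->
  moebius (g *m h) z = moebius g (moebius h z).
Proof.
move=> Dg Dh z0; have n1 := automorphy_neq0 Dh z0.
have n2 := automorphy_neq0 Dg (Im_moebius_gt0 Dh z0).
rewrite {1}/moebius automorphyM // [in RHS]/moebius; apply: (mulIf (mulf_neq0 n2 n1)).
rewrite divfK ?mulf_neq0 // [RHS]mulrA divfK //.
move: n1; rewrite /moebius /automorphy !mul2E => n1.
rewrite !rmorphD !rmorphM /=; field; exact: n1.
Qed.

Lemma moebius1 (z : C) : moebius 1%:M z = z.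
Proof. by rewrite /moebius /automorphy !mxE /= mul0r add0r divr1 mul1r addr0. Qed.

Lemma automorphy1 (z : C) : automorphy 1%:M z = 1.
Proof. by rewrite /automorphy !mxE /= mul0r add0r. Qed.

Lemma rmobM g h p : SL2Z g -> SL2Z h -> 0 < p.2 -> rmob (g *m h) p = rmob g (rmob h p).
Proof.
move=> Dg Dh y0; apply: toC2_inj; rewrite !toC2_rmob ?rmob_gt0 ?moebiusM //; exact: SL2Z_mul.
Qed.

Lemma rmob1 p : 0 < p.2 -> rmob 1%:M p = p.
Proof. by move=> y0; apply: toC2_inj; rewrite toC2_rmob ?moebius1 //; exact: SL2Z_1. Qed.

Lemma rmob_opp g p : rmob (- g) p = rmob g p.
Proof.
have E c d : den4 (- c) (- d) p = den4 c d p by rewrite /den4 !rmorphN /=; ring.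
by rewrite /rmob /rm4 !mxE E !rmorphN /=; congr (_ * _, _); ring.
Qed.

Lemma rmobK g p : SL2Z g -> 0 < p.2 -> rmob (sinv g) (rmob g p) = p.
Proof. by move=> Dg y0; rewrite -rmobM ?sinvV ?rmob1 //; exact: SL2Z_sinv. Qed.

Lemma rmobKV g p : SL2Z g -> 0 < p.2 -> rmob g (rmob (sinv g) p) = p.
Proof. by move=> Dg y0; rewrite -rmobM ?sinvKV ?rmob1 //; exact: SL2Z_sinv. Qed.

End Plane.

(** * Reduction theory for SL_2(Z) *)

Section Reduction.
Variable R : realType.
Implicit Types (p : R * R) (g h : 'M[int]_2).
Local Notation D := (@fundamental_domain R).

Definition open_domain : set (R * R) := [set p | [/\ `|p.1| < 2^-1, 1 < p.1 ^+ 2 + p.2 ^+ 2 & 0 < p.2]].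

Lemma open_domain_sub p : open_domain p -> D p.
Proof. by move=> [h1 h2 h3]; split => //; exact: ltW. Qed.

(** On the domain |c z + d|^2 >= c^2 - |c d| + d^2, a positive integer. *)
Lemma den4_ge1 (c d : int) p : D p -> (c != 0) || (d != 0) -> 1 <= den4 c d p.
Proof.
move=> [h1 h2 h3] cd.
have E : den4 c d p = c%:~R ^+ 2 * (p.1 ^+ 2 + p.2 ^+ 2) + 2 * (c%:~R * d%:~R * p.1) + d%:~R ^+ 2.
  by rewrite /den4; ring.
have I1 : (1 : R) <= c%:~R ^+ 2 - `|c%:~R * d%:~R| + d%:~R ^+ 2.
  rewrite -!rmorphXn -rmorphM -intr_norm -rmorphB -rmorphD /= ler1z.
  by case: (lerP 0 (c * d)) => ?; case/orP: cd => ?; nia.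
apply: (le_trans I1); rewrite E lerD2r.
have I2 : c%:~R ^+ 2 <= c%:~R ^+ 2 * (p.1 ^+ 2 + p.2 ^+ 2) by rewrite ler_peMr ?sqr_ge0.
apply: lerD => //; rewrite -[X in - X]mulr1 lerNl.
have : `|c%:~R * d%:~R * p.1| <= `|c%:~R * d%:~R| * 2^-1 by rewrite normrM ler_wpM2l.
by move=> h; have := ler_norm (- (c%:~R * d%:~R * p.1)); rewrite normrN; lra.
Qed.

Lemma den4_gt1 (c d : int) p : open_domain p -> c != 0 -> 1 < den4 c d p.
Proof.
move=> [h1 h2 h3] c0.
have E : den4 c d p = c%:~R ^+ 2 * (p.1 ^+ 2 + p.2 ^+ 2) + 2 * (c%:~R * d%:~R * p.1) + d%:~R ^+ 2.
  by rewrite /den4; ring.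
have I1 : (1 : R) <= c%:~R ^+ 2 - `|c%:~R * d%:~R| + d%:~R ^+ 2.
  rewrite -!rmorphXn -rmorphM -intr_norm -rmorphB -rmorphD /= ler1z.
  by case: (lerP 0 (c * d)) => ?; nia.
apply: (le_lt_trans I1); rewrite E ltrD2r.
have I2 : c%:~R ^+ 2 < c%:~R ^+ 2 * (p.1 ^+ 2 + p.2 ^+ 2).
  by rewrite ltr_pMr // exprn_even_gt0 //= intr_eq0.
apply: ltr_leD => //; rewrite -[X in - X]mulr1 lerNl.
have : `|c%:~R * d%:~R * p.1| <= `|c%:~R * d%:~R| * 2^-1 by rewrite normrM ler_wpM2l // ltW.
by move=> h; have := ler_norm (- (c%:~R * d%:~R * p.1)); rewrite normrN; lra.
Qed.

(** If c != 0, the height strictly drops on leaving the open domain, whereas it cannot rise on the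
    way back from the closed one. So c = 0, and a translation between points at horizontal distance
    below 1 is trivial. *)
Lemma open_domain_stab g p : SL2Z g -> open_domain p -> D (rmob g p) -> g = 1%:M \/ g = - 1%:M.
Proof.
move=> Dg op Dq; have y0 : 0 < p.2 by case: op.
have q0 : 0 < (rmob g p).2 by case: Dq.
have D1 : g 0 0 * g 1 1 - g 0 1 * g 1 0 = 1 by rewrite -det2.
have n0 := den4_gt0 D1 y0.
have E1 : (rmob g p).2 * den4 (g 1 0) (g 1 1) p = p.2.
  by rewrite /= posinv_gt0 // mulfVK // gt_eqF.
have E2 : p.2 * den4 (- g 1 0) (g 0 0) (rmob g p) = (rmob g p).2.
  have Dn : g 1 1 * g 0 0 - (- g 0 1) * (- g 1 0) = 1 by rewrite -D1; ring.
  have n1 := den4_gt0 Dn q0.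
  move: (rmobK Dg y0) n1; move: (rmob g p) => q; rewrite /rmob !mx2E => <- n1.
  by rewrite [X in X * _]/= posinv_gt0 // mulfVK // gt_eqF.
have cd : (- g 1 0 != 0) || (g 0 0 != 0).
  by apply/negPn/negP; rewrite negb_or !negbK oppr_eq0 => /andP[/eqP h1 /eqP h2]; move: D1; rewrite h1 h2 !mul0r mulr0 subrr.
have g1 := den4_ge1 Dq cd.
have c0 : g 1 0 = 0.
  apply/eqP/negPn/negP => c0; have g2 := den4_gt1 (g 1 1) op c0.
  have : p.2 <= (rmob g p).2 by rewrite -E2 ler_peMr // ltW.
  by rewrite -E1 leNgt => /negP; apply; rewrite ltr_pMr.
have D2 : g 0 0 * g 1 1 = 1 by rewrite -D1 c0 mulr0 subr0.
have [ad hd] := mulz_eq1 D2.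
have b0 : g 0 1 = 0.
  case: op => x1 _ _; case: Dq => x2 _ _; move: x2.
  have -> : (rmob g p).1 = p.1 + (g 0 1 * g 1 1)%:~R.
    rewrite /rmob /rm4 /den4 c0 /= !mul0r !(add0r, addr0, mulr0, mul0r) expr0n /= addr0.
    rewrite ad; case: hd => ->; rewrite ?mulr1 ?mulrN1 ?rmorphN /= posinv_gt0 ?sqrrN ?expr1n ?ltr01 // invr1; ring.
  move=> x2; have : `|(g 0 1 * g 1 1)%:~R| < 1 :> R.
    have -> : (g 0 1 * g 1 1)%:~R = (p.1 + (g 0 1 * g 1 1)%:~R) - p.1 by ring.
    by apply: (le_lt_trans (ler_normB _ _)); lra.
  rewrite -intr_norm -[1]/(1%:~R) ltr_int normrM.
  by case: hd => ->; rewrite ?normrN normr1 mulr1; lia.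
by case: hd ad => h1 ad; [left|right]; apply: mx2_eq; rewrite ?c0 ?b0 ?ad ?h1 !mxE.
Qed.

Lemma exists_SL2Z (c d : int) : coprimez c d -> exists g, [/\ SL2Z g, g 1 0 = c & g 1 1 = d].
Proof.
move=> /coprimezP[[u v] /= h]; exists (mx2 v (- u) c d); split; rewrite ?mx2E //.
by apply: SL2Z_mx2; rewrite -h; ring.
Qed.

Lemma SL2Z_coprime g : SL2Z g -> coprimez (g 1 0) (g 1 1).
Proof.
rewrite /SL2Z det2 => D1; apply/coprimezP; exists (- g 0 1, g 0 0) => /=.
by rewrite -D1; ring.
Qed.

Lemma den4M g h p : SL2Z h -> 0 < p.2 ->
  den4 ((g *m h) 1 0) ((g *m h) 1 1) p = den4 (g 1 0) (g 1 1) (rmob h p) * den4 (h 1 0) (h 1 1) p.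
Proof.
move=> Dh y0; have D1 : h 0 0 * h 1 1 - h 0 1 * h 1 0 = 1 by rewrite -det2.
have n0 := den4_gt0 D1 y0.
have Dr : (h 0 0)%:~R * (h 1 1)%:~R - (h 0 1)%:~R * (h 1 0)%:~R = 1 :> R by rewrite -!rmorphM -rmorphB D1.
have := automorphyM g Dh (y0 : 0 < complex.Im (toC2 p)); rewrite -toC2_rmob // /automorphy !toC2_aut => E.
have E' := congr1 (fun z => cabs z ^+ 2) E; rewrite /= cabsM exprMn in E'.
by move: E'; rewrite /cabs /= !sqr_sqrtr ?addr_ge0 ?sqr_ge0.
Qed.

(** |c z + d|^2 is minimised over coprime pairs, which maximises the height. After an integral
    translation, minimality compared with z -> -1/z gives |z| >= 1. *)
Lemma reduction p : 0 < p.2 -> exists2 g, SL2Z g & D (rmob g p).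
Proof.
move=> y0.
(* A bound for all pairs with |c z + d| <= 1, namely |c| <= 1/y and |d| <= 1 + |x|/y; it makes the
   minimum one over a finite box. *)
have [B hB] : exists B : nat, (p.2^-1 + `|p.1| / p.2 + 1 < B%:R)%R.
  by exists (Num.truncn (p.2^-1 + `|p.1| / p.2 + 1)).+1; exact: truncnS_gt.
pose co (i : 'I_(2 * B).+1) : int := i%:Z - B%:Z.
have coE (c : int) : (`|c| <= B%:Z) -> exists i, co i = c.
  move=> hc; have hi : (absz (c + B%:Z)%R < (2 * B).+1)%N by lia.
  by exists (Ordinal hi); rewrite /co /=; lia.
have box (c d : int) : den4 c d p <= 1 -> `|c| <= B%:Z /\ `|d| <= B%:Z.
  move=> h; have h1 : (c%:~R * p.2) ^+ 2 <= 1 by apply: le_trans h; rewrite lerDr sqr_ge0.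
  have h2 : (c%:~R * p.1 + d%:~R) ^+ 2 <= 1 by apply: le_trans h; rewrite lerDl sqr_ge0.
  have {}h1 : `|c%:~R * p.2| <= 1 by rewrite -(ler_pXn2r (n := 2)) ?nnegrE // expr1n real_normK ?num_real.
  have {}h2 : `|c%:~R * p.1 + d%:~R| <= 1 by rewrite -(ler_pXn2r (n := 2)) ?nnegrE // expr1n real_normK ?num_real.
  have x0 : 0 <= `|p.1| / p.2 by rewrite divr_ge0 // ltW.
  have yi : 0 < p.2^-1 by rewrite invr_gt0.
  have h3 : `|c%:~R| <= p.2^-1 :> R by rewrite normrM (gtr0_norm y0) in h1; rewrite -ler_pdivlMr // div1r in h1.
  split; rewrite -(ler_int R) intr_norm -[B%:~R]/(B%:R).
    by apply: (le_trans h3); apply: ltW; apply: le_lt_trans hB; lra.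
  have -> : d%:~R = (c%:~R * p.1 + d%:~R) - c%:~R * p.1 :> R by ring.
  apply: (le_trans (ler_normB _ _)); apply: ltW; apply: le_lt_trans hB.
  have h4 : `|c%:~R * p.1| <= `|p.1| / p.2 by rewrite normrM mulrC ler_wpM2l.
  by lra.
have [i0 hi0] := coE 0 isT; have [i1 hi1] : exists i, co i = 1.
  apply: coE; have : 0 < B%:R :> R by apply: le_lt_trans hB; rewrite !addr_ge0 ?divr_ge0 ?invr_ge0 // ltW.
  by rewrite ltr0n normr1; lia.
pose P (u : 'I_(2 * B).+1 * 'I_(2 * B).+1) := coprimez (co u.1) (co u.2).
pose M (u : 'I_(2 * B).+1 * 'I_(2 * B).+1) := den4 (co u.1) (co u.2) p.
have P0 : P (i0, i1) by rewrite /P /= hi0 hi1 /coprimez gcd0z.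
have [[c' d'] Pu Mu] := @arg_minP _ R _ (i0, i1) P M P0.
have [g0 [Dg0 gc gd]] := exists_SL2Z Pu.
have min c d : coprimez c d -> den4 (g0 1 0) (g0 1 1) p <= den4 c d p.
  move=> cd; have [h|h] := lerP (den4 c d p) 1; last first.
    apply: (le_trans _ (ltW h)); rewrite gc gd; apply: (le_trans (Mu _ P0)).
    by rewrite /M /= hi0 hi1 /den4 !mul0r add0r expr1n expr0n addr0.
  have [/coE[i hi] /coE[j hj]] := box _ _ h.
  by rewrite gc gd -hi -hj; apply: (Mu (i, j)); rewrite /P /= hi hj.
pose q0 := rmob g0 p; have q0_gt0 : 0 < q0.2 by exact: rmob_gt0.
pose n : int := - Num.floor (q0.1 + 2^-1).
pose T := mx2 1 n 0 1; have DT : SL2Z T by apply: SL2Z_mx2; rewrite mulr0 subr0.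
have DTg : SL2Z (T *m g0) by exact: SL2Z_mul.
have Eden : den4 0 1 q0 = 1 by rewrite /den4 !mul0r add0r expr1n expr0n addr0.
have ET : rmob T q0 = (q0.1 + n%:~R, q0.2).
  by rewrite /rmob !mx2E /rm4 Eden posinv_gt0 ?ltr01 // invr1 -![1%:~R]/(1 : R) mulr1; congr (_, _); ring.
exists (T *m g0) => //; rewrite rmobM // -/q0 ET; split => //=.
  have := floor_le (q0.1 + 2^-1); have := floorD1_gt (q0.1 + 2^-1).
  rewrite /n rmorphN rmorphD /= ler_norml; move: (Num.floor _)%:~R => F h1 h2.
  by apply/andP; split; lra.
pose S := mx2 0 (-1) 1 0; have DS : SL2Z S by apply: SL2Z_mx2.
have := min _ _ (SL2Z_coprime (SL2Z_mul DS DTg)).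
rewrite den4M // rmobM // -/q0 ET [X in _ <= _ * X]den4M // -/q0 !mx2E.
rewrite Eden.
have D0 : g0 0 0 * g0 1 1 - g0 0 1 * g0 1 0 = 1 by rewrite -det2.
have -> : den4 1 0 (q0.1 + n%:~R, q0.2) = (q0.1 + n%:~R) ^+ 2 + q0.2 ^+ 2.
  by rewrite /den4 -[1%:~R]/(1 : R) -[0%:~R]/(0 : R) !mul1r addr0.
by rewrite mul1r -{1}[den4 _ _ p]mul1r ler_pM2r //; exact: (den4_gt0 D0).
Qed.

End Reduction.

(** * Unfolding over Gamma_0(N) *)

Section Tiling.
Variable R : realType.
Local Open Scope ereal_scope.
Implicit Types (p : R * R) (g h : 'M[int]_2) (A : set (R * R)).
Local Notation D := (@fundamental_domain R).
Local Notation SL := [set g : 'M[int]_2 | SL2Z g].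

Lemma esum_pair (T : choiceType) (x y : T) (a : T -> \bar R) : x != y -> (forall i, 0 <= a i) ->
  \esum_(i in [set x] `|` [set y]) a i = a x + a y.
Proof.
move=> xy a0; rewrite esum_fset //.
rewrite fsbigU ?fsbig_set1 //=; try exact: finite_set1.
by move=> i [/= -> yx]; move: xy; rewrite yx eqxx.
Qed.

Lemma SL2Z_neq_opp g : SL2Z g -> (g != - g)%R.
Proof.
move=> Dg; apply/eqP => /matrixP h; move: Dg; rewrite /SL2Z det2.
have e j : g 0%R j = 0%R by have := h 0%R j; rewrite mxE; move: (g 0%R j) => x hx; lia.
by rewrite !e !mul0r subrr.
Qed.

(** A matrix and its negative act alike, so a point reducing to the domain is counted at least
    twice. *)
Lemma tiling_ge2 p : (0 < p.2)%R -> (2%R : R)%:E <= \esum_(g in SL) (\1_D (rmob g p) : R)%:E.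
Proof.
move=> y0; have [g Dg Dp] := reduction y0.
apply: esum_ge; exists ([set g] `|` [set (- g)%R]).
  split; first by [].
  by move=> h [->|->] //=; exact: SL2Z_opp.
rewrite -esum_fset //.
rewrite esum_pair ?SL2Z_neq_opp // rmob_opp indicE mem_set //.
Qed.

Lemma tiling_le2 p : (0 < p.2)%R -> \esum_(g in SL) (\1_(@open_domain R) (rmob g p) : R)%:E <= (2%R : R)%:E.
Proof.
move=> y0; have [[g [Dg og]]|no] := pselect (exists g, SL2Z g /\ open_domain (rmob g p)); last first.
  rewrite esum1 // => g Dg; rewrite indicE memNset // => og; apply: no; exists g; split => //.
have -> : \esum_(g in SL) (\1_(@open_domain R) (rmob g p) : R)%:E =
    \esum_(h in [set g] `|` [set (- g)%R]) (\1_(@open_domain R) (rmob h p) : R)%:E.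
  rewrite esum_mkcond [RHS]esum_mkcond; apply: eq_esum => h _.
  have [oh|noh] := pselect (open_domain (rmob h p)); last first.
    have -> : (\1_(@open_domain R) (rmob h p) : R)%:E = 0 by rewrite indicE memNset.
    by rewrite !if_same.
  congr (if _ then _ else _); apply/idP/idP; rewrite !inE /= => hh; last first.
    by case: hh => -> //; exact: SL2Z_opp.
  have Dq : D (rmob (h *m sinv g) (rmob g p)).
    by rewrite (rmobM hh (SL2Z_sinv Dg) (rmob_gt0 Dg y0)) rmobK //; exact: open_domain_sub.
  have := open_domain_stab (SL2Z_mul hh (SL2Z_sinv Dg)) og Dq.
  have E : h = h *m sinv g *m g by rewrite -mulmxA sinvV // mulmx1.
  by case=> e; [left|right]; rewrite E e ?mulNmx mul1mx.
by rewrite esum_pair ?SL2Z_neq_opp // rmob_opp indicE mem_set.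
Qed.

(** Turns a sum over a countable type into a series, for which monotone convergence under the
    integral is available. *)
Lemma esum_pickle (T : countType) (A : set T) (a : T -> \bar R) : (forall x, 0 <= a x) ->
  \esum_(x in A) a x = \sum_(0 <= n <oo) oapp (fun x => if x \in A then a x else 0) 0 (pickle_inv n).
Proof.
move=> a0; set b := (X in \sum_(0 <= n <oo) X n).
have b0 n : 0 <= b n by rewrite /b; case: (pickle_inv n) => //= x; case: ifP.
rewrite nneseries_esumT // esum_mkcond.
transitivity (\esum_(n in [set pickle x | x in [set: T]]) b n).
  rewrite esum_image; last by move=> x y _ _; exact: (pcan_inj (@pickleK_inv T)).
  by apply: eq_esum => x _; rewrite /b pickleK_inv.
rewrite esum_mkcond; apply: eq_esum => n _; case: ifPn => // nr.
rewrite /b; case E: (pickle_inv n) => [x|] //=.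
move: nr; rewrite notin_setE => nr; exfalso; apply: nr; exists x => //.
by have := @pickle_invK T n; rewrite E.
Qed.

Lemma esumZl (T : countType) (A : set T) (a : T -> \bar R) (k : \bar R) : (forall x, 0 <= a x) ->
  0 <= k -> k \is a fin_num -> \esum_(x in A) (k * a x) = k * \esum_(x in A) a x.
Proof.
move=> a0 k0 /fineK kE; rewrite !esum_pickle //; last by move=> x; exact: mule_ge0.
rewrite -kE -nneseriesZl; last by move=> n _; case: (pickle_inv n) => //= x; case: ifP.
apply: eq_eseriesr => n _; case: (pickle_inv n) => [x|] /=; last by rewrite mule0.
by case: ifP => // _; rewrite mule0.
Qed.

Lemma hyp_integral_esum (T : countType) (A : set T) (F : T -> R * R -> \bar R) :
  (forall x, measurable_fun [set: R * R] (F x)) -> (forall x p, 0 <= F x p) ->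
  hyp_integral (fun p => \esum_(x in A) F x p) = \esum_(x in A) hyp_integral (F x).
Proof.
move=> mF F0.
pose b n p := oapp (fun x => if x \in A then F x p else 0) 0 (pickle_inv n : option T).
have b0 n p : 0 <= b n p by rewrite /b; case: (pickle_inv n) => //= x; case: ifP.
have mb n : measurable_fun [set: R * R] (b n).
  rewrite /b; case: (pickle_inv n) => [x|] /=; last exact: measurable_cst.
  by have [xA|xA] := boolP (x \in A); [exact: mF|exact: measurable_cst].
have h0 x : 0 <= hyp_integral (F x) by apply: integral_ge0 => p _; exact: hyp_ge0.
rewrite esum_pickle //.
transitivity (\sum_(0 <= n <oo) hyp_integral (b n)); last first.
  apply: eq_eseriesr => n _; rewrite /b; case: (pickle_inv n) => [x|] /=.
    by case: ifP => // _; rewrite /hyp_integral; under eq_integral do rewrite !mule0; rewrite integral0.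
  by rewrite /hyp_integral; under eq_integral do rewrite !mule0; rewrite integral0.
rewrite /hyp_integral -integral_nneseries //; last 2 first.
- by move=> n; exact: measurable_hyp.
- by move=> n p _; exact: hyp_ge0.
apply: eq_integral => p _.
rewrite esum_pickle // -/(b _ _).
rewrite -nneseriesZl //; last by move=> n _; exact: b0.
by rewrite -nneseriesZl // => n _; apply: mule_ge0; [rewrite lee_fin posinv_ge0|exact: b0].
Qed.


Variables (N : nat) (s : seq 'M[int]_2).
Hypothesis hs : coset_transversal N s.
Local Notation G0 := [set g : 'M[int]_2 | Gamma0 N g].

Lemma sinvM g h : sinv (g *m h) = sinv h *m sinv g.
Proof. by apply: mx2_eq; rewrite mul2E !mx2E mul2E; ring. Qed.

Let s_SL r : r \in s -> SL2Z r. Proof. by case: hs => _ h _; exact: h. Qed.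

(** SL_2(Z) is the disjoint union of the cosets r^-1 Gamma_0(N): apply the defining property of the
    transversal to the inverse matrix. *)
Lemma esum_transversal (F : 'M[int]_2 -> \bar R) : (forall g, 0 <= F g) ->
  \esum_(c in G0) \sum_(r <- s) F (sinv r *m c) = \esum_(g in SL) F g.
Proof.
move=> F0; have [us _ hr] := hs.
transitivity (\esum_(c in G0) \esum_(r in [set` s]) F (sinv r *m c)).
  by apply: eq_esum => c _; rewrite fsbig_seq // -esum_fset.
rewrite esum_esum //; symmetry.
apply: (reindex_esum _ _ (fun k : 'M[int]_2 * 'M[int]_2 => sinv k.2 *m k.1)); split.
- by move=> [c r] [/= [Dc _] rs]; exact: SL2Z_mul (SL2Z_sinv (s_SL rs)) Dc.
- move=> [c r] [c' r'] /set_mem [/= Gc rs] /set_mem [/= Gc' rs'] E.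
  have [x [_ ux]] := hr _ (SL2Z_sinv (SL2Z_mul (SL2Z_sinv (s_SL rs)) (proj1 Gc))).
  have e1 : x = r.
    by apply: ux; split => //; exists (sinv c); [exact: Gamma0_sinv|rewrite sinvM sinvK].
  have e2 : x = r'.
    by apply: ux; split => //; exists (sinv c'); [exact: Gamma0_sinv|rewrite E sinvM sinvK].
  rewrite -e2 -e1; congr (_, _); rewrite -e1 -e2 e1 in E.
  by rewrite -[c]mul1mx -(sinvKV (s_SL rs)) -mulmxA E mulmxA (sinvKV (s_SL rs)) mul1mx.
- move=> g Dg; have [r [[rs [c Gc E]] _]] := hr _ (SL2Z_sinv Dg).
  exists (sinv c, r) => /=; first by split => //; exact: Gamma0_sinv.
  by rewrite -sinvM -E sinvK.
Qed.

(** For the fundamental domain [A] of SL_2(Z), this counts how many translates r A contain the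
    point; their union is a fundamental domain of Gamma_0(N). *)
Definition Delta A p : \bar R := \sum_(r <- s) (\1_A (rmob (sinv r) p) : R)%:E.

Definition domain_integral A (v : R * R -> \bar R) : \bar R :=
  \sum_(r <- s) hyp_integral (fun p => (\1_A p : R)%:E * v (rmob r p)).

Lemma Delta_ge0 A p : 0 <= Delta A p.
Proof. by apply: sume_ge0 => r _; rewrite lee_fin. Qed.

Lemma Delta_fin A p : Delta A p \is a fin_num.
Proof. by apply/sum_fin_numP. Qed.

Lemma measurable_Delta A : measurable A -> measurable_fun [set: R * R] (Delta A).
Proof.
move=> mA; apply: emeasurable_sum => r; apply/measurable_EFinP.
apply: (measurable_comp_fun (f := \1_A : R * R -> R)); last exact: measurable_rmob.
exact: measurable_indic.
Qed.

Lemma esum_Delta A p : (0 < p.2)%R ->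
  \esum_(c in G0) Delta A (rmob c p) = \esum_(g in SL) (\1_A (rmob g p) : R)%:E.
Proof.
move=> y0; rewrite -esum_transversal; last by move=> g; rewrite lee_fin.
apply: eq_esum => c [Dc _]; apply: eq_big_seq => r rs.
by rewrite rmobM //; exact: SL2Z_sinv (s_SL rs).
Qed.

Section Invariant.
Variable v : R * R -> \bar R.
Hypothesis mv : measurable_fun [set: R * R] v.
Hypothesis v0 : forall p, 0 <= v p.

Lemma domain_integral_Delta A : measurable A -> domain_integral A v = hyp_integral (fun p => Delta A p * v p).
Proof.
move=> mA.
pose F r p := (\1_A (rmob (sinv r) p) : R)%:E * v p.
have mF r : measurable_fun [set: R * R] (F r).
  apply: emeasurable_funM => //; apply/measurable_EFinP.
  apply: (measurable_comp_fun (f := \1_A : R * R -> R)); last exact: measurable_rmob.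
  exact: measurable_indic.
have F0 r p : 0 <= F r p by rewrite mule_ge0 // lee_fin.
transitivity (\sum_(r <- s) hyp_integral (F r)).
  apply: eq_big_seq => r rs; have Dr := s_SL rs.
  rewrite -[LHS](hyp_integral_rmob (SL2Z_sinv Dr)); last 2 first.
  - apply: emeasurable_funM; first by apply/measurable_EFinP; exact: measurable_indic.
    exact: (measurable_comp_fun mv (measurable_rmob _)).
  - by move=> p; rewrite mule_ge0 // lee_fin.
  by apply: hyp_integral_eq => p y0; rewrite rmobKV.
rewrite /hyp_integral -ge0_integral_sum //; last 2 first.
- by move=> r; exact: measurable_hyp.
- by move=> r p _; exact: hyp_ge0.
apply: eq_integral => p _; rewrite /Delta ge0_sume_distrl; last by move=> r _; rewrite lee_fin.
rewrite ge0_sume_distrr; last by move=> r _; exact: F0.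
rewrite ge0_sume_distrr; last by move=> r _; rewrite mule_ge0 ?F0 // lee_fin posinv_ge0.
by [].
Qed.

Lemma hyp_integral_le (F H : R * R -> \bar R) : measurable_fun [set: R * R] F -> measurable_fun [set: R * R] H ->
  (forall p, 0 <= F p) -> (forall p, (0 < p.2)%R -> F p <= H p) -> hyp_integral F <= hyp_integral H.
Proof.
move=> mF mH F0 FH; apply: ge0_le_integral => //.
- by move=> p _; exact: hyp_ge0.
- exact: measurable_hyp.
- exact: measurable_hyp.
move=> p _; have [y0|y0] := ltP 0%R p.2; last by rewrite (posinv_le0 y0) !mul0e.
by rewrite !lee_wpmul2l ?lee_fin ?posinv_ge0 // FH.
Qed.

Lemma hyp_integralZ (c : R) (F : R * R -> \bar R) : (0 <= c)%R -> measurable_fun [set: R * R] F ->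
  (forall p, 0 <= F p) -> hyp_integral (fun p => c%:E * F p) = c%:E * hyp_integral F.
Proof.
move=> c0 mF F0; rewrite /hyp_integral -ge0_integralZl_EFin //; last 2 first.
- by move=> p _; exact: hyp_ge0.
- exact: measurable_hyp.
by apply: eq_integral => p _; rewrite ![c%:E * ((posinv _)%:E * _)]muleCA.
Qed.

Hypothesis vfin : forall p, v p \is a fin_num.
Hypothesis v_inv : forall c p, Gamma0 N c -> (0 < p.2)%R -> v (rmob c p) = v p.

(* Both sides are compared with a double sum over Gamma_0(N): an orbit meets the
   open fundamental domain at most twice and the closed one at least twice. *)
Lemma unfolding (sigma : R * R -> R * R) (phi : 'M[int]_2 -> 'M[int]_2) :
  measurable_fun [set: R * R] sigma -> (forall p, (0 < p.2)%R -> (0 < (sigma p).2)%R) ->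
  set_bij G0 G0 phi ->
  (forall c p, Gamma0 N c -> (0 < p.2)%R -> sigma (rmob c p) = rmob (phi c) (sigma p)) ->
  measurable D -> measurable (@open_domain R) ->
  hyp_integral (fun p => Delta (@open_domain R) p * v p) <= hyp_integral (fun p => Delta D (sigma p) * v p).
Proof.
move=> ms s0 bij hsig mD mO.
have mDs : measurable_fun [set: R * R] (fun p => Delta D (sigma p)).
  by apply: (measurable_comp_fun _ ms); exact: measurable_Delta.
have mOv : measurable_fun [set: R * R] (fun p => Delta (@open_domain R) p * v p).
  by apply: emeasurable_funM => //; exact: measurable_Delta.
have Ov0 p : 0 <= Delta (@open_domain R) p * v p by rewrite mule_ge0 ?Delta_ge0.
pose F c p := Delta D (sigma (rmob c p)) * (Delta (@open_domain R) p * v p).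
have mF c : measurable_fun [set: R * R] (F c).
  by apply: emeasurable_funM => //; exact: (measurable_comp_fun mDs (measurable_rmob c)).
have F0 c p : 0 <= F c p by rewrite mule_ge0 ?Delta_ge0.
pose F' c p := Delta D (sigma p) * (Delta (@open_domain R) (rmob (sinv c) p) * v p).
have mF' c : measurable_fun [set: R * R] (F' c).
  apply: emeasurable_funM => //; apply: emeasurable_funM => //.
  by apply: (measurable_comp_fun _ (measurable_rmob _)); exact: measurable_Delta.
have F'0 c p : 0 <= F' c p by rewrite !mule_ge0 ?Delta_ge0.
have mS (H : 'M[int]_2 -> R * R -> \bar R) : (forall c, measurable_fun [set: R * R] (H c)) -> (forall c p, 0 <= H c p) ->
  measurable_fun [set: R * R] (fun p => \esum_(c in G0) H c p).
  move=> mH H0; under eq_fun do rewrite esum_pickle //.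
  apply: ge0_emeasurable_sum => //.
    by move=> n p _; case: (pickle_inv n) => //= c; case: ifP.
  move=> n _; case: (pickle_inv n) => [c|] /=; last exact: measurable_cst.
  by have [xA|xA] := boolP (c \in G0); [exact: mH|exact: measurable_cst].
have mDv : measurable_fun [set: R * R] (fun p => Delta D (sigma p) * v p) by exact: emeasurable_funM.
have Dv0 p : 0 <= Delta D (sigma p) * v p by rewrite mule_ge0 ?Delta_ge0.
rewrite -(@lee_pmul2l _ (2%R : R)%:E) // -(hyp_integralZ (ler0n R 2) mOv Ov0) -(hyp_integralZ (ler0n R 2) mDv Dv0).
apply: (@le_trans _ _ (hyp_integral (fun p => \esum_(c in G0) F c p))).
  apply: hyp_integral_le; [by apply: emeasurable_funM|by apply: mS|by move=> p; rewrite mule_ge0|].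
  move=> p y0; rewrite /F.
  have -> : \esum_(c in G0) (Delta D (sigma (rmob c p)) * (Delta (@open_domain R) p * v p)) =
    (\esum_(c in G0) Delta D (sigma (rmob c p))) * (Delta (@open_domain R) p * v p).
    by rewrite [RHS]muleC -esumZl ?fin_numM ?Delta_fin //; [apply: eq_esum => c _; rewrite muleC|move=> c; exact: Delta_ge0].
  apply: lee_wpmul2r => //; apply: (le_trans (tiling_ge2 (s0 _ y0))).
  rewrite -esum_Delta ?s0 // (@reindex_esum _ _ _ _ _ phi _ bij).
  by rewrite le_eqVlt; apply/orP; left; apply/eqP/eq_esum => c Gc; rewrite hsig.
rewrite hyp_integral_esum //.
have -> : \esum_(c in G0) hyp_integral (F c) = \esum_(c in G0) hyp_integral (F' c).
  apply: eq_esum => c Gc; have Dc := SL2Z_sinv (proj1 Gc).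
  rewrite -[LHS](hyp_integral_rmob Dc (mF c) (F0 c)); apply: hyp_integral_eq => p y0.
  by rewrite /F /F' rmobKV //; [rewrite v_inv //; exact: Gamma0_sinv|case: Gc].
rewrite -hyp_integral_esum //; apply: hyp_integral_le.
- exact: mS.
- by apply: emeasurable_funM => //; exact: emeasurable_funM.
- by move=> p; exact: esum_ge0.
move=> p y0; rewrite /F'.
have -> : \esum_(c in G0) (Delta D (sigma p) * (Delta (@open_domain R) (rmob (sinv c) p) * v p)) =
  (\esum_(c in G0) Delta (@open_domain R) (rmob (sinv c) p)) * (Delta D (sigma p) * v p).
  rewrite [RHS]muleC -esumZl ?mule_ge0 ?fin_numM ?Delta_fin ?Delta_ge0 //; last by move=> c; exact: Delta_ge0.
  by apply: eq_esum => c _; rewrite -muleA [_ * v p]muleC.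
apply: lee_wpmul2r; first by rewrite mule_ge0 ?Delta_ge0.
apply: le_trans (tiling_le2 y0); rewrite -esum_Delta //.
have bs : set_bij G0 G0 sinv.
  split.
  - by move=> c; exact: Gamma0_sinv.
  - by move=> c c' _ _ E; rewrite -[c]sinvK E sinvK.
  - by move=> c Gc; exists (sinv c); [exact: Gamma0_sinv|rewrite sinvK].
by rewrite [leRHS](@reindex_esum _ _ _ _ _ _ _ bs).
Qed.

End Invariant.

Lemma measurable_domain : measurable D /\ measurable (@open_domain R).
Proof.
have mx : measurable_fun [set: R * R] (fun p => `|p.1|%R) by exact: measurable_comp_fun (@normr_measurable R setT) measurable_fst.
have mn : measurable_fun [set: R * R] (fun p => p.1 ^+ 2 + p.2 ^+ 2)%R by apply: measurable_funD; exact: measurable_funX.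
split.
  have -> : D = (fun p => [&& `|p.1| <= 2^-1, 1 <= p.1 ^+ 2 + p.2 ^+ 2 & 0 < p.2]%R) @^-1` [set true].
    by apply/seteqP; split => p /=; [move=> [-> -> ->]|move=> /and3P[]].
  rewrite -[X in measurable X]setTI; apply: (_ : measurable_fun setT _) => //.
  by apply: measurable_and; [exact: measurable_fun_ler|apply: measurable_and; [exact: measurable_fun_ler|exact: measurable_fun_ltr]].
have -> : @open_domain R = (fun p => [&& `|p.1| < 2^-1, 1 < p.1 ^+ 2 + p.2 ^+ 2 & 0 < p.2]%R) @^-1` [set true].
  by apply/seteqP; split => p /=; [move=> [-> -> ->]|move=> /and3P[]].
rewrite -[X in measurable X]setTI; apply: (_ : measurable_fun setT _) => //.
by apply: measurable_and; [exact: measurable_fun_ltr|apply: measurable_and; exact: measurable_fun_ltr].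
Qed.

(** Each horizontal line meets the difference of the two domains in at most four points. *)
Lemma hyp_integral_boundary (v : R * R -> \bar R) : measurable_fun [set: R * R] v -> (forall p, 0 <= v p) ->
  hyp_integral (fun p => (\1_D p : R)%:E * v p) = hyp_integral (fun p => (\1_(@open_domain R) p : R)%:E * v p).
Proof.
move=> mv v0; have [mD mO] := measurable_domain.
have mm A : measurable A -> measurable_fun [set: R * R] (fun p => (\1_A p : R)%:E * v p).
  by move=> mA; apply: emeasurable_funM => //; apply/measurable_EFinP; exact: measurable_indic.
have m0 A p : 0 <= (\1_A p : R)%:E * v p by rewrite mule_ge0 // lee_fin.
rewrite (hyp_integral_fubini (mm _ mD) (m0 D)) (hyp_integral_fubini (mm _ mO) (m0 (@open_domain R))).
apply: eq_integral => y _.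
have ms A : measurable A -> measurable_fun [set: R] (fun x => (posinv y)%:E * ((posinv y)%:E * ((\1_A (x, y) : R)%:E * v (x, y)))).
  move=> mA; apply: (measurable_comp_fun (measurable_hyp (mm _ mA)) (g := fun x : R => (x, y))).
  exact: measurable_fun_pair.
apply: ge0_ae_eq_integral => //.
- exact: ms.
- exact: ms.
- by move=> x _; exact: (hyp_ge0 (m0 D) (x, y)).
- by move=> x _; exact: (hyp_ge0 (m0 (@open_domain R)) (x, y)).
pose t := Num.sqrt (1 - y ^+ 2).
exists ([set 2^-1] `|` [set - 2^-1] `|` [set t] `|` [set - t])%R; split.
- by do !apply: measurableU; exact: measurable_set1.
- apply: countable_lebesgue_measure0; apply: finite_set_countable.
  by rewrite !finite_setU; do !split; exact: finite_set1.
move=> x /= h; apply: contrapT => nx; apply: h => _.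
congr (_ * (_ * (_%:E * _))); rewrite !indicE; congr (_%:R).
have x1 : x != 2^-1%R by apply/eqP => e; apply: nx; left; left; left.
have x2 : x != (- 2^-1)%R by apply/eqP => e; apply: nx; left; left; right.
have x3 : x != t by apply/eqP => e; apply: nx; left; right.
have x4 : x != (- t)%R by apply/eqP => e; apply: nx; right.
have nx1 : (`|x| != 2^-1)%R by rewrite eqr_norml negb_and negb_or x1 x2.
have nx2 : (1 != x ^+ 2 + y ^+ 2)%R.
  apply/eqP => e; have e2 : (x ^+ 2 = t ^+ 2)%R.
    have E : (1 - y ^+ 2 = x ^+ 2)%R by rewrite e addrK.
    by rewrite /t E sqr_sqrtr ?sqr_ge0.
  by move/eqP: e2; rewrite eqf_sqr (negPf x3) (negPf x4).
apply: congr1; apply/idP/idP => /set_mem [/= h1 h2 h3]; apply/mem_set; split => //=.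
- by rewrite lt_neqAle nx1.
- by rewrite lt_neqAle nx2.
- exact: ltW.
- exact: ltW.
Qed.

(** Conjugation by the translation by e/q. The entries are integral because q^2 divides c and q
    divides d - a. *)
Definition tconj (q : nat) (e : int) g : 'M[int]_2 :=
  let c1 := (g 1%R 0%R %/ (q ^ 2)%N)%Z in let d1 := ((g 1%R 1%R - g 0%R 0%R)%R %/ q)%Z in
  mx2 (g 0 0 + e * q%:Z * c1)%R (g 0 1 + e * d1 - e ^+ 2 * c1)%R (g 1 0)%R (g 1 1 - e * q%:Z * c1)%R.

(** * Translations by 1/q normalising Gamma_0(N) *)

Section Translation.
Variable q : nat.
Hypothesis q23 : q = 2%N \/ q = 3%N.
Hypothesis qN : (q ^ 2 %| N)%N.

Let exact_c g : Gamma0 N g -> (g 1 0 = q%:Z ^+ 2 * (g 1%R 0%R %/ (q ^ 2)%N)%Z)%R.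
Proof.
move=> [_ /dvdzP[u ->]]; have [w ->] := dvdnP qN.
rewrite PoszM mulrA mulzK; last by case: q23 => ->.
by case: q23 => ->; rewrite -[Posz (_ ^ 2)]/(_ : int); ring.
Qed.

(** a d = 1 modulo q, and for q = 2 or 3 every unit modulo q is its own inverse, so a = d modulo
    q. *)
Let exact_d g : Gamma0 N g -> (g 1 1 - g 0 0 = q%:Z * ((g 1%R 1%R - g 0%R 0%R)%R %/ q)%Z)%R.
Proof.
move=> Gg; have hc := exact_c Gg; case: (Gg); rewrite /SL2Z det2 => hD _.
rewrite mulrC divzK //.
move: (_ %/ _)%Z hc hD => c1 ->; move: (g 0%R 0%R) (g 0%R 1%R) (g 1%R 1%R) => a b d hD.
have res (n : nat) (x : int) : (0 < n)%N -> exists x1 r : int, (x = n%:Z * x1 + r)%R /\ (0 <= r < n%:Z)%R.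
  by move=> n0; exists (x %/ n)%Z, (x %% n)%Z; split; [rewrite {1}(divz_eq x n) mulrC|lia].
have q0 : (0 < q)%N by case: q23 => ->.
have [a1 [ra [ea ha]]] := res q a q0; have [d1 [rd [ed hd]]] := res q d q0.
suff rr : rd = ra by apply/dvdzP; exists (d1 - a1)%R; rewrite ea ed rr; ring.
rewrite {}ea {}ed in hD; clear exact_c; clear -q23 hD ha hd.
case: q23 hD ha hd => -> hD ha hd.
  have ra2 : ra = 0%R \/ ra = 1%R by lia.
  have rd2 : rd = 0%R \/ rd = 1%R by lia.
  by case: ra2 => ra'; case: rd2 => rd'; rewrite ra' rd' in hD *; lia.
have ra3 : ra = 0%R \/ ra = 1%R \/ ra = 2%R by lia.
have rd3 : rd = 0%R \/ rd = 1%R \/ rd = 2%R by lia.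
by case: ra3 => [ra'|[ra'|ra']]; case: rd3 => [rd'|[rd'|rd']]; rewrite ra' rd' in hD *; lia.
Qed.

Lemma tconjE e g : Gamma0 N g -> exists c1 d1 : int, [/\ (g 1 0 = q%:Z ^+ 2 * c1)%R,
  (g 1 1 = g 0 0 + q%:Z * d1)%R &
  tconj q e g = mx2 (g 0 0 + e * q%:Z * c1)%R (g 0 1 + e * d1 - e ^+ 2 * c1)%R (g 1 0)%R (g 1 1 - e * q%:Z * c1)%R].
Proof.
move=> Gg; exists (g 1%R 0%R %/ (q ^ 2)%N)%Z, ((g 1%R 1%R - g 0%R 0%R)%R %/ q)%Z; split => //.
  exact: exact_c.
by rewrite -(exact_d Gg) addrC subrK.
Qed.

Lemma tconj_Gamma0 e g : Gamma0 N g -> Gamma0 N (tconj q e g).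
Proof.
move=> Gg; have [c1 [d1 [hc hd ->]]] := tconjE e Gg; case: (Gg) => Dg Ng.
split; last by rewrite mx2E.
apply: SL2Z_mx2; move: Dg; rewrite /SL2Z det2 hc hd => <-; ring.
Qed.

Lemma tconjK e g : Gamma0 N g -> tconj q (- e)%R (tconj q e g) = g.
Proof.
move=> Gg; have [c1 [d1 [hc hd E]]] := tconjE e Gg.
have [c2 [d2 [hc2 hd2 E2]]] := tconjE (- e)%R (tconj_Gamma0 e Gg).
have q0 : (q%:Z != 0)%R by case: q23 => ->.
have ec : c2 = c1.
  by apply: (mulfI (expf_neq0 2 q0)); rewrite -hc2 E mx2E hc.
have ed : (d2 = d1 - 2 * e * c1)%R.
  apply: (mulfI q0); move: hd2; rewrite E !mx2E hd => h.
  have : (q%:Z * d2 = (g 0 0 + q%:Z * d1 - e * q%:Z * c1) - (g 0 0 + e * q%:Z * c1))%R by rewrite h; ring.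
  by move=> ->; ring.
by rewrite E2 ec ed E !mx2E; apply: mx2_eq; rewrite !mx2E; ring.
Qed.

Lemma tconj_bij e : set_bij G0 G0 (tconj q e).
Proof.
split.
- by move=> g; exact: tconj_Gamma0.
- by move=> g h /set_mem Gg /set_mem Gh E; rewrite -(tconjK e Gg) E tconjK.
- move=> g Gg; exists (tconj q (- e)%R g); first exact: tconj_Gamma0.
  by rewrite -{1}[e]opprK tconjK.
Qed.

Definition hshift (a : R) p : R * R := (p.1 + a, p.2)%R.

Lemma tconj_commute e g p : Gamma0 N g -> (0 < p.2)%R ->
  hshift (e%:~R / q%:R) (rmob g p) = rmob (tconj q e g) (hshift (e%:~R / q%:R) p).
Proof.
move=> Gg y0; have [Dt _] := tconj_Gamma0 e Gg; have [Dg _] := Gg.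
apply: toC2_inj; rewrite toC2_rmob //.
have hs' r : toC2 (hshift (e%:~R / q%:R) r) = (toC2 r + e%:~R / q%:R)%R.
  have h : (e%:~R / q%:R = Complex (e%:~R / q%:R) 0 :> Cplx R)%R.
    have qn : (q%:R != 0 :> Cplx R)%R by rewrite pnatr_eq0; case: q23 => ->.
    have qn' : (q%:R != 0 :> R)%R by rewrite pnatr_eq0; case: q23 => ->.
    apply: (mulIf qn); rewrite divfK // (real_nat _ q) (real_int _ e).
    by apply/eqP; rewrite eq_complex /= !mulr0 !mul0r subr0 addr0 divfK ?eqxx.
  by rewrite h; apply/eqP; rewrite eq_complex /= addr0 !eqxx.
rewrite !hs' toC2_rmob //.
have z0 : (0 < complex.Im (toC2 p))%R by [].
have n1 := automorphy_neq0 Dg z0.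
have z1 : (0 < complex.Im (toC2 p + e%:~R / q%:R))%R by rewrite -hs'.
have n2 := automorphy_neq0 Dt z1.
move: n1 n2; rewrite /moebius /automorphy.
have [c1 [d1 [hc hd ->]]] := tconjE e Gg.
rewrite !mx2E hd hc => n1 n2.
have qn : (q%:R != 0 :> Cplx R)%R by rewrite pnatr_eq0; case: q23 => ->.
have E : ((q%:Z ^+ 2 * c1)%:~R * (toC2 p + e%:~R / q%:R) + (g 0 0 + q%:Z * d1 - e * q%:Z * c1)%:~R =
  (q%:Z ^+ 2 * c1)%:~R * toC2 p + (g 0 0 + q%:Z * d1)%:~R :> Cplx R)%R.
  by rewrite !(rmorphM, rmorphB, rmorphD, rmorphXn) /= -[q%:Z%:~R]/(q%:R : Cplx R); field.
rewrite E; apply: (mulIf n1); rewrite divfK // mulrDl divfK //.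
by rewrite !(rmorphM, rmorphB, rmorphD, rmorphXn) /= -[q%:Z%:~R]/(q%:R : Cplx R); field.
Qed.

(** [unfolding] with the opposite translation, followed by invariance of the measure on the plane;
    the open and the closed domain have the same integral. *)
Lemma domain_integral_shift_le e (v : R * R -> \bar R) : measurable_fun [set: R * R] v -> (forall p, 0 <= v p) ->
  (forall p, v p \is a fin_num) -> (forall c p, Gamma0 N c -> (0 < p.2)%R -> v (rmob c p) = v p) ->
  domain_integral D v <= domain_integral D (v \o hshift (e%:~R / q%:R)).
Proof.
move=> mv v0 vf vi; have [mD mO] := measurable_domain.
have msh (a : R) : measurable_fun [set: R * R] (hshift a).
  by apply: measurable_fun_pair => //; exact: measurable_funD.
have mvs : measurable_fun [set: R * R] (v \o hshift (e%:~R / q%:R)) by exact: measurable_comp_fun.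
have -> : domain_integral D v = domain_integral (@open_domain R) v.
  apply: eq_bigr => r _; apply: (@hyp_integral_boundary (fun p => v (rmob r p))) => //.
  exact: (measurable_comp_fun mv (measurable_rmob r)).
rewrite domain_integral_Delta // domain_integral_Delta //; last by move=> p; exact: v0.
have := @unfolding v mv v0 vf vi (hshift ((- e)%:~R / q%:R)) _ (msh _) (fun p y0 => y0) (tconj_bij (- e)%R) _ mD mO.
move=> /(_ _)/le_trans; apply; first by move=> c p Gc y0; exact: tconj_commute.
have mX : measurable_fun [set: R * R] (fun p => Delta D p * (v \o hshift (e%:~R / q%:R)) p).
  by apply: emeasurable_funM => //; exact: measurable_Delta.
have X0 p : 0 <= Delta D p * (v \o hshift (e%:~R / q%:R)) p by rewrite mule_ge0 ?Delta_ge0 /=.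
rewrite -[leRHS](hyp_integral_translate mX X0 ((- e)%:~R / q%:R)).
rewrite le_eqVlt; apply/orP; left; apply/eqP/hyp_integral_eq => p y0.
congr (_ * v _); rewrite /hshift /= rmorphN /= mulNr subrK; by case: p y0.
Qed.

(** The inequality for the translation by 1/q, and for its inverse applied to the translated
    function. *)
Lemma domain_integral_shift (v : R * R -> \bar R) : measurable_fun [set: R * R] v -> (forall p, 0 <= v p) ->
  (forall p, v p \is a fin_num) -> (forall c p, Gamma0 N c -> (0 < p.2)%R -> v (rmob c p) = v p) ->
  domain_integral D (v \o hshift q%:R^-1) = domain_integral D v.
Proof.
move=> mv v0 vf vi.
have msh (a : R) : measurable_fun [set: R * R] (hshift a).
  by apply: measurable_fun_pair => //; exact: measurable_funD.
have e1 : (q%:R^-1 = 1%:~R / q%:R :> R)%R by rewrite -[1%:~R]/(1%R : R) div1r.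
have hle := @domain_integral_shift_le 1 v mv v0 vf vi; rewrite -e1 in hle.
apply/le_anti; rewrite hle andbT.
have := @domain_integral_shift_le (- 1)%R (v \o hshift q%:R^-1) _ _ _ _.
have -> : (v \o hshift q%:R^-1) \o hshift ((- 1)%:~R / q%:R) = v.
  apply/funext => -[x y]; rewrite /= /hshift /=; congr (v (_, _)).
  by rewrite rmorphN /= mulN1r subrK.
apply; [exact: measurable_comp_fun|by move=> p; exact: v0|by move=> p; exact: vf|].
move=> c p Gc y0; rewrite /= e1 tconj_commute // vi //; exact: tconj_Gamma0.
Qed.

End Translation.

End Tiling.

(** * The Petersson product and oldforms *)

Section Tame.
Variable R : realType.
Local Notation C := (Cplx R).
Implicit Types (F G : C -> C) (p : R * R).
Local Notation D := (@fundamental_domain R).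
Local Notation mu := (@lebesgue_measure R \x @lebesgue_measure R)%E.

(** Extension by 0 below the real axis, so that measurability can be stated on the whole plane. *)
Definition plane_Re F p : R := if 0 < p.2 then complex.Re (F (toC2 p)) else 0.
Definition plane_Im F p : R := if 0 < p.2 then complex.Im (F (toC2 p)) else 0.

(* The decay is only needed on the fundamental domain, where Im z >= 1/2. *)
Definition tame F : Prop :=
  [/\ measurable_fun [set: R * R] (plane_Re F), measurable_fun [set: R * R] (plane_Im F)
    & exists B dl : R, [/\ 0 <= B, 0 < dl & forall z, 2^-1 <= complex.Im z ->
        cabs (F z) <= B * expR (- (dl * complex.Im z))]].

Lemma Re_sum (I : Type) (s : seq I) (v : I -> C) :
  complex.Re (\sum_(n <- s) v n) = \sum_(n <- s) complex.Re (v n).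
Proof. by elim/big_rec2: _ => //= i y1 y2 _ <-; rewrite ReD. Qed.

Lemma Im_sum (I : Type) (s : seq I) (v : I -> C) :
  complex.Im (\sum_(n <- s) v n) = \sum_(n <- s) complex.Im (v n).
Proof. by elim/big_rec2: _ => //= i y1 y2 _ <-; rewrite ImD. Qed.

Lemma geometric_sum_le (x : R) (m : nat) : 0 <= x < 1 -> \sum_(1 <= n < m) x ^+ n <= x / (1 - x).
Proof.
move=> /andP[x0 x1]; have x1' : 0 < 1 - x by rewrite subr_gt0.
rewrite ler_pdivlMr //; case: m => [|m]; first by rewrite big_geq // mul0r.
suff -> : (\sum_(1 <= n < m.+1) x ^+ n) * (1 - x) = x - x ^+ m.+1 by rewrite lerBlDr lerDl exprn_ge0.
elim: m => [|m IH]; first by rewrite big_geq // mul0r expr1 subrr.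
by rewrite big_nat_recr //= mulrDl IH [x ^+ m.+2]exprS; ring.
Qed.

Lemma cvg_terms_bounded (u : nat -> C) (l : C) :
  (fun m : nat => \sum_(1 <= n < m) u n) @ \oo --> l -> exists B : R, 0 <= B /\ forall n, (0 < n)%N -> cabs (u n) <= B.
Proof.
move=> /cvgCP/(_ 1 ltr01) [M _ hM].
exists (2 + \sum_(1 <= n < M.+1) cabs (u n)); split.
  by rewrite addr_ge0 // sumr_ge0 // => i _; exact: cabs_ge0.
move=> n n0; have s0 : 0 <= \sum_(1 <= n < M.+1) cabs (u n) by apply: sumr_ge0 => i _; exact: cabs_ge0.
have [nM|Mn] := leqP n M.
  have : cabs (u n) <= \sum_(1 <= n < M.+1) cabs (u n).
    rewrite (big_cat_nat (n := n)) //=; last by rewrite ltnW // ltnS.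
    rewrite [X in _ + X]big_ltn ?ltnS // addrCA lerDl addr_ge0 // sumr_ge0 // => i _; exact: cabs_ge0.
  by move=> h; apply: (le_trans h); rewrite lerDr.
have h1 := hM n (ltnW Mn); have h2 := hM n.+1 (leqW (ltnW Mn)).
rewrite /= in h1 h2; rewrite big_nat_recr //= in h2.
have e : u n = (\sum_(1 <= i < n) u i + u n - l) - (\sum_(1 <= i < n) u i - l) by ring.
by rewrite e; apply: (le_trans (cabsB _ _)); lra.
Qed.

Lemma Im_natM_div (n h : nat) (z : C) : complex.Im (n%:R * z / h%:R) = n%:R * complex.Im z / h%:R.
Proof.
have e : h%:R^-1 = (h%:R^-1 : R)%:C%C :> C by rewrite fmorphV rmorph_nat.
by rewrite e mulrC ImZ real_nat ImZ mulrC.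
Qed.

(** A cusp expansion is assumed to converge, not absolutely. Convergence at height y0/2 bounds its
    terms there, and at heights above y0 they are then dominated by a geometric series with no
    constant term. *)
Lemma cusp_expansion_decay (h : nat) (a : nat -> C) F (y0 : R) : (0 < h)%N -> 0 < y0 -> cusp_expansion h a F ->
  exists B dl : R, [/\ 0 <= B, 0 < dl & forall z, y0 <= complex.Im z -> cabs (F z) <= B * expR (- (dl * complex.Im z))].
Proof.
move=> h0 y00 hF; have hR : 0 < h%:R :> R by rewrite ltr0n.
pose z1 : C := Complex 0 (y0 / 2).
have z1u : upper_half z1 by rewrite /upper_half /= divr_gt0.
have [B [B0 hB]] := cvg_terms_bounded (hF z1 z1u).
(* Half of 2 pi / h, since y - y0/2 >= y/2 for y >= y0. *)
pose dl := pi / h%:R : R; have dl0 : 0 < dl by rewrite divr_gt0 // pi_gt0.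
pose x0 := expR (- (dl * y0)); have x01 : x0 < 1 by rewrite -expR0 ltr_expR oppr_lt0 mulr_gt0.
exists (B / (1 - x0)), dl; split => //; first by rewrite divr_ge0 // subr_ge0 ltW.
move=> z hz; have z0 : 0 < complex.Im z by exact: lt_le_trans hz.
set x := expR _; have xx0 : x <= x0 by rewrite ler_expR lerN2 ler_pM2l.
have x_ge0 : 0 <= x := expR_ge0 _.
apply/ler_addgt0Pr => ep ep0.
have /cvgCP/(_ ep ep0) [M _ hM] := hF z z0.
have h1 := hM M (leqnn _); rewrite /= in h1.
have h2 : cabs (\sum_(1 <= n < M) a n * e2ipi (n%:R * z / h%:R)) <= B / (1 - x0) * x.
  apply: (le_trans (cabs_sum _ _ _)).
  apply: (@le_trans _ _ (B * \sum_(1 <= n < M) x ^+ n)).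
    rewrite mulr_sumr; apply: ler_sum_nat => n /andP[n0 _].
    have hb := hB n n0; rewrite cabsM cabs_e2ipi Im_natM_div /= in hb.
    rewrite cabsM cabs_e2ipi Im_natM_div.
    have -> : expR (- (2 * pi * (n%:R * complex.Im z / h%:R))) =
       expR (- (2 * pi * (n%:R * (y0 / 2) / h%:R))) * expR (- (n%:R * (2 * pi / h%:R) * (complex.Im z - y0 / 2))).
      by rewrite -expRD; congr expR; ring.
    rewrite mulrA; apply: ler_pM => //.
      by rewrite mulr_ge0 ?cabs_ge0 ?expR_ge0.
    rewrite -expRM_natl mulrN ler_expR lerN2 -mulrA; apply: ler_wpM2l => //.
    have -> : 2 * pi / h%:R = 2 * dl by rewrite /dl mulrA.
    have -> : 2 * dl * (complex.Im z - y0 / 2) = dl * (2 * (complex.Im z - y0 / 2)) by ring.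
    by apply: ler_wpM2l; [exact: ltW|lra].
  rewrite -mulrA ler_wpM2l //; apply: (le_trans (geometric_sum_le _ _)).
    by rewrite x_ge0 (le_lt_trans xx0).
  rewrite mulrC ler_wpM2r // lef_pV2 ?posrE ?subr_gt0 ?(le_lt_trans xx0) //; lra.
have -> : F z = \sum_(1 <= n < M) a n * e2ipi (n%:R * z / h%:R) - (\sum_(1 <= n < M) a n * e2ipi (n%:R * z / h%:R) - F z) by ring.
apply: (le_trans (cabsB _ _)); exact: lerD h2 (ltW h1).
Qed.

Lemma e2ipi_toC2 (c : R) p : e2ipi (c%:C%C * toC2 p : C) =
  Complex (expR (- (2 * pi * (c * p.2))) * cos (2 * pi * (c * p.1))) (expR (- (2 * pi * (c * p.2))) * sin (2 * pi * (c * p.1))).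
Proof.
by rewrite /e2ipi /cexp /= !mul0r !(add0r, addr0, subr0, sub0r).
Qed.

Lemma plane_sum (m : nat) (u : nat -> C -> C) : 
  (forall n, measurable_fun [set: R * R] (fun p => complex.Re (u n (toC2 p)))) ->
  (forall n, measurable_fun [set: R * R] (fun p => complex.Im (u n (toC2 p)))) ->
  measurable_fun [set: R * R] (plane_Re (fun z => \sum_(1 <= n < m) u n z)) /\
  measurable_fun [set: R * R] (plane_Im (fun z => \sum_(1 <= n < m) u n z)).
Proof.
move=> h1 h2; have mp : measurable_fun [set: R * R] (fun p => 0 < p.2) by exact: measurable_fun_ltr.
split.
  rewrite /plane_Re; apply: measurable_fun_ifT => //.
  by under eq_fun do rewrite Re_sum; exact: measurable_sum.
rewrite /plane_Im; apply: measurable_fun_ifT => //.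
by under eq_fun do rewrite Im_sum; exact: measurable_sum.
Qed.

(** The function is a pointwise limit of partial sums, which are measurable by explicit formulas. *)
Lemma cusp_expansion_measurable (h : nat) (a : nat -> C) F : cusp_expansion h a F ->
  measurable_fun [set: R * R] (plane_Re F) /\ measurable_fun [set: R * R] (plane_Im F).
Proof.
move=> hF; pose u n (z : C) := a n * e2ipi (n%:R * z / h%:R).
have mexp (c : R) : measurable_fun [set: R * R] (fun p => expR (- (2 * pi * (c * p.2)))).
  apply: (measurable_comp_fun (f := @expR R)); first exact: measurable_expR.
  apply: (measurable_comp_fun (f := fun x : R => - x) (@oppr_measurable R setT)).
  by apply: measurable_funM => //; exact: measurable_funM.
have mlin (c : R) : measurable_fun [set: R * R] (fun p => 2 * pi * (c * p.1)).
  by apply: measurable_funM => //; exact: measurable_funM.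
have mc (c : R) : measurable_fun [set: R * R] (fun p => cos (2 * pi * (c * p.1))).
  apply: (measurable_comp_fun (f := @cos R)) => //; apply: continuous_measurable_fun; exact: continuous_cos.
have msn (c : R) : measurable_fun [set: R * R] (fun p => sin (2 * pi * (c * p.1))).
  apply: (measurable_comp_fun (f := @sin R)) => //; apply: continuous_measurable_fun; exact: continuous_sin.
have E n p : u n (toC2 p) = a n * Complex (expR (- (2 * pi * (n%:R / h%:R * p.2))) * cos (2 * pi * (n%:R / h%:R * p.1)))
     (expR (- (2 * pi * (n%:R / h%:R * p.2))) * sin (2 * pi * (n%:R / h%:R * p.1))).
  rewrite /u -e2ipi_toC2; congr (_ * e2ipi _); rewrite rmorphM fmorphV !rmorph_nat /=.
  by rewrite mulrAC.
have mu1 n : measurable_fun [set: R * R] (fun p => complex.Re (u n (toC2 p))).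
  under eq_fun do rewrite E; case: (a n) => x y /=.
  by apply: measurable_funB; apply: measurable_funM => //; exact: measurable_funM.
have mu2 n : measurable_fun [set: R * R] (fun p => complex.Im (u n (toC2 p))).
  under eq_fun do rewrite E; case: (a n) => x y /=.
  by apply: measurable_funD; apply: measurable_funM => //; exact: measurable_funM.
split.
  apply: (@measurable_fun_cvg _ _ _ _ (fun m => plane_Re (fun z => \sum_(1 <= n < m) u n z))).
    by move=> m; exact: (plane_sum m mu1 mu2).1.
  move=> p _; rewrite /plane_Re; case: ifP => [p0|_]; last exact: cvg_cst.
  apply/cvgrPdist_lt => ep ep0; have /cvgCP/(_ ep ep0) := hF (toC2 p) p0.
  apply: filterS => m; apply: le_lt_trans; rewrite -[X in `|X|](_ : complex.Re (F (toC2 p) - \sum_(1 <= n < m) u n (toC2 p)) = _); last by rewrite ReD ReN.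
  by rewrite cabs_distC; exact: cabs_Re.
apply: (@measurable_fun_cvg _ _ _ _ (fun m => plane_Im (fun z => \sum_(1 <= n < m) u n z))).
  by move=> m; exact: (plane_sum m mu1 mu2).2.
move=> p _; rewrite /plane_Im; case: ifP => [p0|_]; last exact: cvg_cst.
apply/cvgrPdist_lt => ep ep0; have /cvgCP/(_ ep ep0) := hF (toC2 p) p0.
apply: filterS => m; apply: le_lt_trans; rewrite -[X in `|X|](_ : complex.Im (F (toC2 p) - \sum_(1 <= n < m) u n (toC2 p)) = _); last by rewrite ImD ImN.
by rewrite cabs_distC; exact: cabs_Im.
Qed.

Lemma cusp_expansion_tame (h : nat) (a : nat -> C) F : (0 < h)%N -> cusp_expansion h a F -> tame F.
Proof.
move=> h0 hF; have [m1 m2] := cusp_expansion_measurable hF; split => //.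
by apply: (cusp_expansion_decay h0 _ hF); rewrite invr_gt0.
Qed.

End Tame.

(** * Decay of dilated forms at all cusps, and integrability *)

Section TameForms.
Variable R : realType.
Local Notation C := (Cplx R).
Implicit Types (F G : C -> C) (p : R * R).
Local Notation D := (@fundamental_domain R).
Local Notation lam := (@lebesgue_measure R).
Local Notation mu := (@lebesgue_measure R \x @lebesgue_measure R)%E.

Lemma tame_eq F G : (forall z, 0 < complex.Im z -> F z = G z) -> tame F -> tame G.
Proof.
move=> e [m1 m2 [B [dl [B0 d0 h]]]]; split.
- by rewrite (_ : plane_Re G = plane_Re F) //; apply/funext => p; rewrite /plane_Re; case: ifP => // p0; rewrite e.
- by rewrite (_ : plane_Im G = plane_Im F) //; apply/funext => p; rewrite /plane_Im; case: ifP => // p0; rewrite e.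
by exists B, dl; split => // z hz; rewrite -e ?h //; apply: lt_le_trans hz; rewrite invr_gt0.
Qed.

Lemma tameZ (c : C) F : tame F -> tame (fun z => c * F z).
Proof.
move=> [m1 m2 [B [dl [B0 d0 h]]]]; split.
- rewrite (_ : plane_Re _ = fun p => complex.Re c * plane_Re F p - complex.Im c * plane_Im F p).
    by apply: measurable_funB; exact: measurable_funM.
  apply/funext => p; rewrite /plane_Re /plane_Im; case: ifP => _; last by rewrite !mulr0 subr0.
  by case: c (F _) => a b [x y].
- rewrite (_ : plane_Im _ = fun p => complex.Re c * plane_Im F p + complex.Im c * plane_Re F p).
    by apply: measurable_funD; exact: measurable_funM.
  apply/funext => p; rewrite /plane_Re /plane_Im; case: ifP => _; last by rewrite !mulr0 addr0.
  by case: c (F _) => a b [x y].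
exists (cabs c * B), dl; split => //; first by rewrite mulr_ge0 ?cabs_ge0.
by move=> z hz; rewrite cabsM -mulrA ler_wpM2l ?cabs_ge0 ?h.
Qed.

Lemma tame_affine (n : nat) (a : nat -> C) F (A B d : int) : (0 < n)%N -> cusp_expansion n a F ->
  0 < A -> 0 < d -> tame (fun z => F ((A%:~R * z + B%:~R) / d%:~R)).
Proof.
move=> n0 hF A0 d0.
have AR : 0 < A%:~R :> R by rewrite ltr0z.
have dR : 0 < d%:~R :> R by rewrite ltr0z.
have [m1 m2] := cusp_expansion_measurable hF.
have hz (z : C) : complex.Im ((A%:~R * z + B%:~R) / d%:~R) = A%:~R * complex.Im z / d%:~R.
  have e : d%:~R^-1 = (d%:~R^-1 : R)%:C%C :> C by rewrite fmorphV rmorph_int.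
  by rewrite e mulrC ImZ ImD !real_int ImZ /= addr0 mulrC.
have hr p : toC2 ((A%:~R * p.1 + B%:~R) / d%:~R, A%:~R * p.2 / d%:~R) = (A%:~R * toC2 p + B%:~R) / d%:~R :> C.
  have e : d%:~R^-1 = (d%:~R^-1 : R)%:C%C :> C by rewrite fmorphV rmorph_int.
  rewrite e !real_int; apply/eqP; rewrite eq_complex /=; apply/andP; split; apply/eqP; ring.
have mw : measurable_fun [set: R * R] (fun p : R * R => ((A%:~R * p.1 + B%:~R) / d%:~R, A%:~R * p.2 / d%:~R) : R * R).
  apply: measurable_fun_pair; apply: measurable_funM => //; last exact: measurable_funM.
  by apply: measurable_funD => //; exact: measurable_funM.
have pos p : (0 < A%:~R * p.2 / d%:~R) = (0 < p.2) by rewrite pmulr_lgt0 ?invr_gt0 // pmulr_rgt0.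
split.
- rewrite (_ : plane_Re _ = fun p => plane_Re F ((A%:~R * p.1 + B%:~R) / d%:~R, A%:~R * p.2 / d%:~R)).
    exact: (measurable_comp_fun m1 mw).
  by apply/funext => p; rewrite /plane_Re /= pos hr.
- rewrite (_ : plane_Im _ = fun p => plane_Im F ((A%:~R * p.1 + B%:~R) / d%:~R, A%:~R * p.2 / d%:~R)).
    exact: (measurable_comp_fun m2 mw).
  by apply/funext => p; rewrite /plane_Im /= pos hr.
have y0 : 0 < 2^-1 * A%:~R / d%:~R :> R by rewrite !mulr_gt0 ?invr_gt0.
have [K [dl [K0 dl0 h]]] := cusp_expansion_decay n0 y0 hF.
exists K, (dl * A%:~R / d%:~R); split => //; first by rewrite !mulr_gt0 ?invr_gt0.
move=> z z0; have := h ((A%:~R * z + B%:~R) / d%:~R); rewrite hz.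
rewrite (_ : dl * (A%:~R * complex.Im z / d%:~R) = dl * A%:~R / d%:~R * complex.Im z); last by ring.
apply; apply: ler_wpM2r; first by rewrite invr_ge0 ltW.
by rewrite mulrC; apply: ler_wpM2l => //; exact: ltW.
Qed.

Lemma cusp_form_tame (k N : nat) (chi : int -> C) f g : cusp_form k N chi f -> SL2Z g -> tame (slash k f g).
Proof. by move=> [_ _ h] Dg; have [n [n0 [a ha]]] := h _ Dg; exact: cusp_expansion_tame n0 ha. Qed.

(** The Hermite form of diag(n, 1) g, obtained from a Bezout relation for its first column. *)
Lemma dilate_factor (n : nat) (g : 'M[int]_2) : (0 < n)%N -> SL2Z g -> exists (c : 'M[int]_2) (A B d : int),
  [/\ SL2Z c, 0 < A, 0 < d & mx2 (n%:Z * g 0 0) (n%:Z * g 0 1) (g 1 0) (g 1 1) = c *m mx2 A B 0 d].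
Proof.
move=> n0; rewrite /SL2Z det2; move: (g 0 0) (g 0 1) (g 1 0) (g 1 1) => a b c d D1.
have [u [v huv]] := Bezoutz (n%:Z * a) c.
pose A := gcdz (n%:Z * a) c.
have A0 : 0 < A.
  rewrite lt_neqAle (_ : 0 <= A) // andbT eq_sym gcdz_eq0 negb_and.
  have [c0|c0] := eqVneq c 0; last by rewrite orbT.
  by rewrite orbF mulf_neq0 //; [lia|apply/eqP => a0; move: D1; rewrite a0 c0 mul0r mulr0 subrr].
have /dvdzP[al hal] := dvdz_gcdl (n%:Z * a) c.
have /dvdzP[be hbe] := dvdz_gcdr (n%:Z * a) c.
rewrite -/A in hal hbe huv.
have E : u * al + v * be = 1.
  by apply: (mulIf (lt0r_neq0 A0)); rewrite mul1r -{2}huv hal hbe; ring.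
have AD : A * (al * d - be * (n%:Z * b)) = n%:Z.
  transitivity (n%:Z * (a * d - b * c)); last by rewrite D1 mulr1.
  have -> : A * (al * d - be * (n%:Z * b)) = (al * A) * d - (be * A) * (n%:Z * b) by ring.
  by rewrite -hal -hbe; ring.
exists (mx2 al (- v) be u), A, (u * (n%:Z * b) + v * d), (al * d - be * (n%:Z * b)); split => //.
- by apply: SL2Z_mx2; rewrite -E; ring.
- by rewrite -(pmulr_rgt0 _ A0) AD; lia.
apply: mx2_eq; rewrite mul2E !mx2E ?hal ?hbe; try ring.
  transitivity ((u * al + v * be) * (n%:Z * b)); first by rewrite E mul1r.
  ring.
transitivity ((u * al + v * be) * d); first by rewrite E mul1r.
ring.
Qed.

(** By [dilate_factor], the dilated form at a cusp is the original form at some other cusp evaluated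
    at an affine image of z. *)
Lemma dilate_tame (k M n : nat) (chi : int -> C) h (r : 'M[int]_2) : cusp_form k M chi h -> (0 < n)%N -> SL2Z r ->
  tame (slash k (fun z => h (n%:R * z)) r).
Proof.
move=> hh n0 Dr; have [c [A [B [d [Dc A0 d0 E]]]]] := dilate_factor n0 Dr.
case: hh => _ _ hc; have [w [w0 [a ha]]] := hc _ Dc.
have := tameZ (d%:~R ^- k) (tame_affine B w0 ha A0 d0); apply: tame_eq => z z0.
have dC : d%:~R != 0 :> C by rewrite intr_eq0; lia.
have AR : 0 < A%:~R :> R by rewrite ltr0z.
have dR : 0 < d%:~R :> R by rewrite ltr0z.
pose t := (A%:~R * z + B%:~R) / d%:~R.
have t0 : 0 < complex.Im t.
  have e : d%:~R^-1 = (d%:~R^-1 : R)%:C%C :> C by rewrite fmorphV rmorph_int.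
  by rewrite /t e mulrC ImZ ImD !real_int ImZ /= addr0 !mulr_gt0 ?invr_gt0.
have e00 := congr1 (fun X : 'M[int]_2 => X 0 0) E; have e01 := congr1 (fun X : 'M[int]_2 => X 0 1) E.
have e10 := congr1 (fun X : 'M[int]_2 => X 1 0) E; have e11 := congr1 (fun X : 'M[int]_2 => X 1 1) E.
rewrite /= !mul2E !mx2E !mulr0 !addr0 in e00 e01 e10 e11.
have j1 : automorphy c t = automorphy r z / d%:~R.
  rewrite /automorphy e10 e11 /t !rmorphD !rmorphM /=; field; exact: dC.
have n1 := automorphy_neq0 Dr z0; have n2 := automorphy_neq0 Dc t0.
have m1 : moebius c t = n%:R * moebius r z.
  have num : (c 0 0)%:~R * t + (c 0 1)%:~R = n%:R * ((r 0 0)%:~R * z + (r 0 1)%:~R) / d%:~R.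
    apply: (mulIf dC); rewrite divfK // mulrDr mulrA -[n%:R]/(n%:Z%:~R) -!rmorphM e00 e01 /t.
    by rewrite !rmorphD !rmorphM /=; field.
  rewrite /moebius num j1; move: n1 ((r 0 0)%:~R * z + _) => n1 X.
  by move: (automorphy r z) n1 => J J0; field; rewrite J0 dC.
rewrite /slash -/t m1 j1 expr_div_n invf_div mulrA; congr (_ * _).
by rewrite mulrA mulVf ?mul1r // expf_neq0.
Qed.

Lemma domain_height p : D p -> 2^-1 <= p.2.
Proof.
move=> [h1 h2 h3]; have : p.1 ^+ 2 <= 2^-1 ^+ 2 by rewrite -real_normK ?num_real // ler_pXn2r ?nnegrE.
by move: h2 h3; clear; nra.
Qed.

Local Open Scope ereal_scope.

(** The domain lies in the strip |x| <= 1/2, y >= 1/2; the inversion y -> 1/y for dy/y converts the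
    remaining integral of dy / y^2 into the length of ]0, 2]. *)
Lemma hyp_volume_finite : hyp_integral (fun p => (\1_D p : R)%:E) < +oo.
Proof.
have [mD _] := @measurable_domain R.
pose h (y : R) : \bar R := if (2^-1 <= y)%R then (posinv y)%:E else 0.
have mh : measurable_fun [set: R] h.
  by apply: measurable_fun_ifT => //; [exact: measurable_fun_ler|exact: measurable_posinv_EFin].
have h0 y : 0 <= h y by rewrite /h; case: ifP => // _; rewrite lee_fin posinv_ge0.
pose ix (x : R) : \bar R := (\1_(`[(- 2^-1)%R, 2^-1%R]%classic : set R) x)%:E.
have mi : measurable_fun [set: R] ix by apply/measurable_EFinP; exact: measurable_indic.
apply: (@le_lt_trans _ _ (\int[lam]_y ((posinv y)%:E * h y))); last first.
  rewrite -integral_log_inv //.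
  rewrite (_ : \int[lam]_y _ = \int[lam]_y (\1_(`]0%R, 2%R]%classic : set R) y)%:E); last first.
    apply: eq_integral => y _; rewrite indicE /h.
    have -> : (y \in (`]0%R, 2%R]%classic : set R)) = (0 < y <= 2)%R by apply/idP/idP; rewrite inE /= in_itv.
    have [y0|y0] := ltP 0%R y; last by rewrite (posinv_le0 y0) mul0e.
    rewrite posinvK // posinv_gt0 // lef_pV2 ?posrE //=.
    by case: ifP => _; rewrite ?mule0 // -EFinM mulVf // gt_eqF.
  rewrite integral_indic // setIT.
  apply: (@le_lt_trans _ _ (2%R : R)%:E); last exact: ltry.
  rewrite le_eqVlt; apply/orP; left; apply/eqP; apply: (etrans (@lebesgue_measure_itv R `]0%R, 2%R])).
  by rewrite /= lte_fin ltr0n -EFinB subr0.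
have mDE : measurable_fun [set: R * R] (fun p => (\1_D p : R)%:E) by apply/measurable_EFinP; exact: measurable_indic.
rewrite (hyp_integral_fubini mDE); last by move=> p; rewrite lee_fin.
apply: ge0_le_integral => //.
- by move=> y _; apply: integral_ge0 => x _; rewrite !mule_ge0 // lee_fin ?posinv_ge0.
- exact: (@measurable_fun_fubini_tonelli_G _ _ _ _ R lam _ (measurable_hyp mDE) (fun p => hyp_ge0 (fun q => _) p)).
- by apply: emeasurable_funM => //; exact: measurable_posinv_EFin.
move=> y _; have [y0|y0] := ltP 0%R y; last by rewrite (posinv_le0 y0) integral0_eq ?mul0e // => x _; rewrite mul0e.
apply: (@le_trans _ _ (\int[lam]_x ((posinv y)%:E * h y * ix x))).
  apply: ge0_le_integral => //.
  - by move=> x _; rewrite !mule_ge0 // lee_fin ?posinv_ge0.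
  - apply: (measurable_comp_fun (measurable_hyp mDE) (g := fun x : R => (x, y))).
    exact: measurable_fun_pair.
  - by apply: emeasurable_funM.
  move=> x _; rewrite -muleA; apply: lee_wpmul2l; first by rewrite lee_fin posinv_ge0.
  rewrite indicE; case: (boolP ((x, y) \in D)) => [/set_mem [/= h1 h2 h3]|_]; last first.
    by rewrite mule0 mule_ge0 // lee_fin.
  have hx : ix x = 1.
    by rewrite /ix indicE mem_set //= in_itv /= -ler_norml.
  have hy : (2^-1 <= y)%R by apply: (@domain_height (x, y)); split.
  by rewrite hx /h hy !mule1.
rewrite ge0_integralZl //; [|by move=> x _; rewrite lee_fin|by rewrite mule_ge0 // lee_fin posinv_ge0].
rewrite /ix integral_indic // setIT.
have e := @lebesgue_measure_itv R `[(- 2^-1)%R, 2^-1%R].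
rewrite /= lte_fin ifT in e; last by lra.
rewrite (_ : (2^-1%:E - (- 2^-1)%:E) = 1%:E) in e; last by rewrite -EFinB opprK; congr (_%:E); lra.
rewrite -[leRHS]mule1 le_eqVlt; apply/orP; left; apply/eqP; congr (_ * _); exact: e.
Qed.


Local Close Scope ereal_scope.

Definition prod_Re F G p := plane_Re F p * plane_Re G p + plane_Im F p * plane_Im G p.
Definition prod_Im F G p := plane_Im F p * plane_Re G p - plane_Re F p * plane_Im G p.

Lemma mul_conjE (a b : C) : a * b^* = Complex (complex.Re a * complex.Re b + complex.Im a * complex.Im b)
  (complex.Im a * complex.Re b - complex.Re a * complex.Im b).
Proof.
case: a b => [x y] [u v]; apply/eqP; rewrite eq_complex /=; apply/andP; split; apply/eqP; ring.
Qed.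

Lemma cabs_conj (a : C) : cabs a^* = cabs a.
Proof. by case: a => x y; rewrite /cabs /= sqrrN. Qed.

(** From exp(x) >= x at x = dl y / k, raised to the k-th power. *)
Lemma pow_exp_bounded (k : nat) (dl : R) : 0 < dl -> exists K : R, 0 <= K /\
  forall y, 0 <= y -> y ^+ k * expR (- (dl * y)) <= K.
Proof.
move=> d0; case: k => [|k].
  exists 1; split => // y y0; rewrite expr0 mul1r -expR0 ler_expR oppr_le0 mulr_ge0 // ltW //.
have kR : 0 < k.+1%:R :> R by rewrite ltr0n.
exists ((k.+1%:R / dl) ^+ k.+1); split; first by rewrite exprn_ge0 // divr_ge0 // ltW.
move=> y y0; rewrite expRN ler_pdivrMr ?expR_gt0 //.
have -> : expR (dl * y) = expR (dl * y / k.+1%:R) ^+ k.+1.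
  by rewrite -expRM_natl; congr expR; field; exact: lt0r_neq0.
have hx : 0 <= k.+1%:R / dl by rewrite divr_ge0 // ltW.
rewrite -exprMn; apply: lerXn2r; rewrite ?nnegrE //; first by apply: mulr_ge0 => //; exact: expR_ge0.
have E : y = k.+1%:R / dl * (dl * y / k.+1%:R) by field; rewrite !gt_eqF.
rewrite {1}E ler_wpM2l //; apply: le_trans (expR_ge1Dx _); by rewrite lerDr.
Qed.

Section Pair.
Variables (F G : C -> C) (k : nat).
Hypotheses (tF : tame F) (tG : tame G).

Lemma tame_prod_bound : exists2 K : R, 0 <= K & forall p, D p ->
  cabs (F (toC2 p)) * cabs (G (toC2 p)) * p.2 ^+ k <= K.
Proof.
have [_ _ [B [dl [B0 dl0 hB]]]] := tF; have [_ _ [B' [dl' [B'0 dl'0 hB']]]] := tG.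
have [K [K0 hK]] := pow_exp_bounded k dl0.
exists (B * B' * K); first by rewrite !mulr_ge0.
move=> p Dp; have hy := domain_height Dp.
have y0 : 0 <= p.2 by apply: le_trans hy; rewrite invr_ge0.
have h1 := hB (toC2 p) hy; have h2 := hB' (toC2 p) hy; rewrite /= in h1 h2.
have h2' : cabs (G (toC2 p)) <= B'.
  by apply: (le_trans h2); rewrite -[leRHS]mulr1 ler_wpM2l // -expR0 ler_expR oppr_le0 mulr_ge0 // ltW.
apply: (@le_trans _ _ (B * expR (- (dl * p.2)) * B' * p.2 ^+ k)).
  by rewrite ler_wpM2r ?exprn_ge0 // ler_pM ?cabs_ge0.
have -> : B * expR (- (dl * p.2)) * B' * p.2 ^+ k = B * B' * (p.2 ^+ k * expR (- (dl * p.2))) by ring.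
by rewrite ler_wpM2l ?hK ?mulr_ge0.
Qed.

Lemma tame_integrable (u : R * R -> R) : measurable_fun [set: R * R] u ->
  (forall p, 0 < p.2 -> `|u p| <= cabs (F (toC2 p)) * cabs (G (toC2 p)) * p.2 ^+ k) ->
  mu.-integrable D (EFin \o (fun p => u p / p.2 ^+ 2)).
Proof.
move=> m hu; have [mD _] := @measurable_domain R; have [K K0 hK] := tame_prod_bound.
have mw : measurable_fun [set: R * R] (fun p => u p * (posinv p.2 * posinv p.2)).
  have mp : measurable_fun [set: R * R] (fun p => posinv p.2) by exact: (measurable_comp_fun (@measurable_posinv R)).
  by apply: measurable_funM => //; exact: measurable_funM.
have e p : D p -> u p / p.2 ^+ 2 = u p * (posinv p.2 * posinv p.2).
  by move=> [_ _ y0]; rewrite posinv_gt0 // -invfM -expr2.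
apply/integrableP; split.
  apply/measurable_EFinP; apply: (eq_measurable_fun (fun p => u p * (posinv p.2 * posinv p.2))).
    by move=> p /set_mem Dp; rewrite e.
  exact: measurable_funTS.
apply: (@le_lt_trans _ _ (\int[mu]_(p in D) (K%:E * ((posinv p.2)%:E * (posinv p.2)%:E)))%E).
  apply: ge0_le_integral => //.
  - by apply/measurable_EFinP; apply: measurableT_comp => //; apply: (eq_measurable_fun (fun p => u p * (posinv p.2 * posinv p.2))); [move=> p /set_mem Dp; rewrite e|exact: measurable_funTS].
  - apply: measurable_funTS; apply: emeasurable_funM => //; apply: emeasurable_funM; exact: measurable_posinv_EFin.
  - move=> p Dp; have [_ _ y0] := Dp; rewrite /= -!EFinM lee_fin e // normrM [X in _ * X]ger0_norm ?mulr_ge0 ?posinv_ge0 //.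
    by rewrite ler_wpM2r ?mulr_ge0 ?posinv_ge0 // (le_trans (hu p y0)) // hK.
rewrite ge0_integralZl_EFin //; last 2 first.
- by move=> p _; rewrite -EFinM lee_fin mulr_ge0 ?posinv_ge0.
- by apply: measurable_funTS; apply: emeasurable_funM; exact: measurable_posinv_EFin.
have E : (\int[mu]_(p in D) ((posinv p.2)%:E * (posinv p.2)%:E))%E = hyp_integral (fun p => (\1_D p : R)%:E).
  rewrite integral_mkcond; apply: eq_integral => p _; rewrite patchE indicE.
  by case: ifP => _; rewrite ?mule1 ?mule0.
rewrite E; apply: lte_mul_pinfty => //; exact: hyp_volume_finite.
Qed.

End Pair.

End TameForms.

(** * The Petersson product as an integral over cosets *)

Section PeterssonIntegral.
Variable R : realType.
Local Notation C := (Cplx R).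
Implicit Types (f g : C -> C) (p : R * R) (u v : R * R -> R) (r : 'M[int]_2).
Local Notation D := (@fundamental_domain R).
Local Notation mu := (@lebesgue_measure R \x @lebesgue_measure R)%E.

Let mD : @measurable _ (measurableTypeR R * measurableTypeR R)%type D.
Proof. exact: (@measurable_domain R).1. Qed.

Section Functional.
Variable s : seq 'M[int]_2.
Hypothesis s_SL : forall r, r \in s -> SL2Z r.

Definition coset_integral u : R := \sum_(r <- s) \int[mu]_(p in D) (u (rmob r p) / p.2 ^+ 2).

Definition admissible u : Prop := measurable_fun [set: R * R] u /\
  forall r, r \in s -> mu.-integrable D (EFin \o (fun p => u (rmob r p) / p.2 ^+ 2)).

Lemma admissible_lin (a b : R) u v : admissible u -> admissible v -> admissible (fun p => a * u p + b * v p).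
Proof.
move=> [mu1 i1] [mv i2]; split; first by apply: measurable_funD; exact: measurable_funM.
move=> r rs; have h := integrableD mD (integrableZl mD a (i1 r rs)) (integrableZl mD b (i2 r rs)).
apply: eq_integrable h => // p _ /=; rewrite -!EFinM -EFinD; congr EFin; ring.
Qed.

Lemma coset_integral_lin (a b : R) u v : admissible u -> admissible v ->
  coset_integral (fun p => a * u p + b * v p) = a * coset_integral u + b * coset_integral v.
Proof.
move=> [mu1 i1] [mv i2]; rewrite /coset_integral !mulr_sumr -big_split /=.
apply: eq_big_seq => r rs.
rewrite -(RintegralZl a mD (i1 r rs)) -(RintegralZl b mD (i2 r rs)).
rewrite -RintegralD //; [|exact: (integrableZl mD a (i1 r rs))|exact: (integrableZl mD b (i2 r rs))].
by apply: eq_Rintegral => p _; ring.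
Qed.

Lemma coset_integral_eq u v : (forall p, 0 < p.2 -> u p = v p) -> coset_integral u = coset_integral v.
Proof.
move=> h; apply: eq_big_seq => r rs; apply: eq_Rintegral => p /set_mem [_ _ y0].
by rewrite h // rmob_gt0 //; exact: s_SL.
Qed.

(** The shift invariance was shown for non-negative extended real functions; splitting into positive
    and negative parts carries it over to integrable real ones. *)
Lemma coset_integral_fine u : admissible u -> coset_integral u =
  fine (domain_integral s D (fun p => (Num.max (u p) 0)%:E)) - fine (domain_integral s D (fun p => (Num.max (- u p) 0)%:E)).
Proof.
move=> [m i].
have part (w : R * R -> R) : (\int[mu]_(p in D) (Num.max (w p / p.2 ^+ 2) 0)%:E)%E =
    hyp_integral (fun p => ((\1_D p : R)%:E * (Num.max (w p) 0)%:E)%E).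
  rewrite integral_mkcond; apply: eq_integral => p _; rewrite patchE indicE.
  case: ifP => [/set_mem [_ _ y0]|_]; last by rewrite mul0e !mule0.
  rewrite mul1e posinv_gt0 // -!EFinM; congr EFin.
  have y2 : 0 <= (p.2 ^+ 2)^-1 by rewrite invr_ge0 sqr_ge0.
  rewrite mulrA -invfM -expr2 mulrC maxr_pMr // mulr0; congr (Num.max _ _); exact: mulrC.
pose w r p := u (rmob r p) / p.2 ^+ 2.
have e1 r : (\int[mu]_(p in D) (EFin \o w r)^\+ p)%E = hyp_integral (fun p => ((\1_D p : R)%:E * (Num.max (u (rmob r p)) 0)%:E)%E).
  by rewrite -part; apply: eq_integral => p _; rewrite funeposE /= EFin_max.
have e2 r : (\int[mu]_(p in D) (EFin \o w r)^\- p)%E = hyp_integral (fun p => ((\1_D p : R)%:E * (Num.max (- u (rmob r p)) 0)%:E)%E).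
  by rewrite -part; apply: eq_integral => p _; rewrite funenegE /= EFin_max /w mulNr.
rewrite /coset_integral /domain_integral big_seq [X in fine X - _]big_seq [X in _ - fine X]big_seq.
rewrite -!sum_fine; last 2 first.
- by move=> r rs; rewrite -e2; exact: (integrable_neg_fin_num mD (i r rs)).
- by move=> r rs; rewrite -e1; exact: (integrable_pos_fin_num mD (i r rs)).
rewrite -sumrB; apply: eq_bigr => r rs; rewrite -e1 -e2 -fineB; last 2 first.
- exact: (integrable_pos_fin_num mD (i r rs)).
- exact: (integrable_neg_fin_num mD (i r rs)).
by rewrite -integralE.
Qed.

Lemma coset_integral_shift (N q : nat) u : coset_transversal N s -> q = 2%N \/ q = 3%N -> (q ^ 2 %| N)%N ->
  admissible u -> admissible (u \o hshift q%:R^-1) ->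
  (forall c p, Gamma0 N c -> 0 < p.2 -> u (rmob c p) = u p) ->
  coset_integral (u \o hshift q%:R^-1) = coset_integral u.
Proof.
move=> hs hq qN au aus ui; rewrite !coset_integral_fine //.
have mx (w : R * R -> R) : measurable_fun [set: R * R] w -> measurable_fun [set: R * R] (fun p => (Num.max (w p) 0)%:E).
  by move=> mw; apply/measurable_EFinP; exact: measurable_maxr.
have [m _] := au.
congr (fine _ - fine _).
  rewrite -[RHS](domain_integral_shift hs hq qN) //; first exact: mx.
  - by move=> p; rewrite lee_fin le_max lexx orbT.
  - by move=> c p Gc p0; rewrite ui.
rewrite -[RHS](domain_integral_shift hs hq qN) //.
- by apply: (mx (fun p => - u p)); exact: (measurable_comp_fun (f := fun x : R => - x) (@oppr_measurable R setT)).
- by move=> p; rewrite lee_fin le_max lexx orbT.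
- by move=> c p Gc p0; rewrite ui.
Qed.

End Functional.

Variable k : nat.

Definition tame_form f : Prop := forall r, SL2Z r -> tame (slash k f r).

Definition pair_fun f g p : C := f (toC2 p) * (g (toC2 p))^* * (p.2 ^+ k)%:C%C.
Definition pair_Re f g p : R := if 0 < p.2 then complex.Re (pair_fun f g p) else 0.
Definition pair_Im f g p : R := if 0 < p.2 then complex.Im (pair_fun f g p) else 0.

Lemma slash1 f z : slash k f 1%:M z = f z.
Proof. by rewrite /slash moebius1 automorphy1 expr1n invr1 mul1r. Qed.

Lemma slashE f r z : SL2Z r -> 0 < complex.Im z -> f (moebius r z) = automorphy r z ^+ k * slash k f r z.
Proof. by move=> Dr z0; rewrite /slash mulrA mulfV ?mul1r // expf_neq0 // automorphy_neq0. Qed.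

Lemma conj_normsq (a : C) : a * a^* = (cabs a ^+ 2)%:C%C.
Proof.
rewrite mul_conjE /cabs sqr_sqrtr ?addr_ge0 ?sqr_ge0 //.
by apply/eqP; rewrite eq_complex /= -!expr2 eqxx mulrC subrr eqxx.
Qed.

(** The height at r z is y / |j|^2 for the automorphy factor j, and its k-th power cancels j^k times
    its conjugate. *)
Lemma pair_fun_rmob f g r p : SL2Z r -> 0 < p.2 ->
  pair_fun f g (rmob r p) = slash k f r (toC2 p) * (slash k g r (toC2 p))^* * (p.2 ^+ k)%:C%C.
Proof.
move=> Dr p0; have z0 : 0 < complex.Im (toC2 p) by [].
rewrite /pair_fun toC2_rmob // !slashE //.
have -> : (rmob r p).2 = p.2 / cabs (automorphy r (toC2 p)) ^+ 2.
  have /(congr1 (@complex.Im R)) /= -> := toC2_rmob Dr p0.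
  rewrite moebiusE Im_mob; last exact: automorphy_neq0.
  have -> : r 0 0 * r 1 1 - r 0 1 * r 1 0 = 1 by rewrite -det2.
  by rewrite mul1r.
have := automorphy_neq0 Dr z0; move: (automorphy r (toC2 p)) => j j0.
have jR : cabs j ^+ 2 != 0 by rewrite expf_neq0 // cabs_eq0.
have E : j ^+ k * (j ^+ k)^* * ((p.2 / cabs j ^+ 2) ^+ k)%:C%C = (p.2 ^+ k)%:C%C.
  rewrite conj_normsq cabsX -exprM mulnC exprM -rmorphM -exprMn mulrC.
  by rewrite -mulrA mulVf ?mulr1.
by rewrite -E; move: (slash k f r _) (slash k g r _) => a b; rewrite [(_ * b)^*]rmorphM /=; ring.
Qed.

Lemma pair_admissible f g (s : seq 'M[int]_2) : (forall r, r \in s -> SL2Z r) -> tame_form f -> tame_form g ->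
  admissible s (pair_Re f g) /\ admissible s (pair_Im f g).
Proof.
move=> s_SL tf tg.
have t1 (h : C -> C) : tame_form h -> tame h by move=> th; apply: tame_eq (th _ SL2Z_1) => z _; rewrite slash1.
have [mf1 mf2 _] := t1 _ tf; have [mg1 mg2 _] := t1 _ tg.
have mk : measurable_fun [set: R * R] (fun p => p.2 ^+ k) by exact: measurable_funX.
have mRe : measurable_fun [set: R * R] (pair_Re f g).
  rewrite (_ : pair_Re f g = fun p => prod_Re f g p * p.2 ^+ k).
    by apply: measurable_funM => //; apply: measurable_funD; exact: measurable_funM.
  apply/funext => p; rewrite /pair_Re /prod_Re /plane_Re /plane_Im; case: ifP => _; last by rewrite !mul0r addr0 mul0r.
  by rewrite /pair_fun mul_conjE /= mulr0 subr0.
have mIm : measurable_fun [set: R * R] (pair_Im f g).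
  rewrite (_ : pair_Im f g = fun p => prod_Im f g p * p.2 ^+ k).
    by apply: measurable_funM => //; apply: measurable_funB; exact: measurable_funM.
  apply/funext => p; rewrite /pair_Im /prod_Im /plane_Re /plane_Im; case: ifP => _; last by rewrite !mul0r subr0 mul0r.
  by rewrite /pair_fun mul_conjE /= mulr0 add0r.
have bound r p : SL2Z r -> 0 < p.2 -> cabs (pair_fun f g (rmob r p)) <= cabs (slash k f r (toC2 p)) * cabs (slash k g r (toC2 p)) * p.2 ^+ k.
  move=> Dr p0; rewrite pair_fun_rmob //; move: (slash k f r _) (slash k g r _) => a b; rewrite !cabsM cabs_conj cabs_real.
  have h : 0 <= p.2 ^+ k by rewrite exprn_ge0 // ltW.
  by rewrite (ger0_norm h).
split; split => // r rs; have Dr := s_SL r rs.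
  apply: (@tame_integrable _ _ _ k (tf _ Dr) (tg _ Dr) (fun p => pair_Re f g (rmob r p))).
    exact: (measurable_comp_fun mRe (measurable_rmob r)).
  by move=> p p0; rewrite /pair_Re rmob_gt0 //; apply: le_trans (bound _ _ Dr p0); exact: cabs_Re.
apply: (@tame_integrable _ _ _ k (tf _ Dr) (tg _ Dr) (fun p => pair_Im f g (rmob r p))).
  exact: (measurable_comp_fun mIm (measurable_rmob r)).
by move=> p p0; rewrite /pair_Im rmob_gt0 //; apply: le_trans (bound _ _ Dr p0); exact: cabs_Im.
Qed.

Lemma Rintegral_seq_sum (s : seq 'M[int]_2) (w : 'M[int]_2 -> R * R -> R) :
  (forall r, r \in s -> mu.-integrable D (EFin \o w r)) ->
  \int[mu]_(p in D) (\sum_(r <- s) w r p) = \sum_(r <- s) \int[mu]_(p in D) w r p.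
Proof.
elim: s => [|r s IH] h.
  rewrite big_nil /Rintegral; under eq_integral do rewrite big_nil.
  by rewrite integral0.
rewrite big_cons -IH; last by move=> r' hr'; apply: h; rewrite in_cons hr' orbT.
rewrite -RintegralD //; first by apply: eq_Rintegral => p _; rewrite big_cons.
  by apply: h; rewrite in_cons eqxx.
have hs : mu.-integrable D (fun p => (\sum_(r <- s | r \in s) (w r p)%:E)%E).
  by apply: integrable_sum => // r' r's; apply: h; rewrite in_cons r's orbT.
by apply: eq_integrable hs => // p _; rewrite /= -sumEFin [RHS]big_seq.
Qed.

Lemma petersson_coset_integral (N : nat) f g : tame_form f -> tame_form g ->
  (forall r, r \in coset_reps N -> SL2Z r) ->
  petersson k N f g = Complex (coset_integral (coset_reps N) (pair_Re f g)) (coset_integral (coset_reps N) (pair_Im f g)).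
Proof.
move=> tf tg s_SL; have [[_ i1] [_ i2]] := pair_admissible s_SL tf tg.
rewrite /petersson /coset_integral -!Rintegral_seq_sum //; congr Complex; apply: eq_Rintegral => p /set_mem [_ _ y0].
  rewrite Re_sum !mulr_suml; apply: eq_big_seq => r rs; have Dr := s_SL r rs.
  rewrite /pair_Re rmob_gt0 // pair_fun_rmob //; congr (_ / _).
  by case: (_ * _^*) => x y; rewrite /= mulr0 subr0.
rewrite Im_sum !mulr_suml; apply: eq_big_seq => r rs; have Dr := s_SL r rs.
rewrite /pair_Im rmob_gt0 // pair_fun_rmob //; congr (_ / _).
by case: (_ * _^*) => x y; rewrite /= mulr0 add0r.
Qed.

(** [xget] falls back to the empty list, over which the Petersson integrand is an empty sum;
    [oldform_orthogonal] treats both cases. *)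
Lemma coset_reps_cases N : coset_transversal N (coset_reps N) \/ coset_reps N = [::].
Proof.
have [[s hs]|no] := pselect (exists s, coset_transversal N s).
  by left; exact: (xgetPex [::] (ex_intro _ s hs)).
by right; rewrite /coset_reps xgetPN // => s hs; apply: no; exists s.
Qed.

End PeterssonIntegral.

(** * Two mechanisms forcing a Petersson product to vanish *)

Section Orthogonality.
Variable R : realType.
Local Notation C := (Cplx R).
Implicit Types (p : R * R) (r : 'M[int]_2) (z : C).

(** Conjugation by diag(n, 1) carries the matrix into Gamma_0(M). *)
Lemma dilate_modular (k M n : nat) (chi : int -> C) h (c : 'M[int]_2) z : cusp_form k M chi h -> (0 < n)%N ->
  SL2Z c -> ((n * M)%N%:Z %| c 1%R 0%R)%Z -> 0 < complex.Im z ->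
  h (n%:R * moebius c z) = chi (c 1 1) * automorphy c z ^+ k * h (n%:R * z).
Proof.
move=> [_ hm _] n0 Dc /dvdzP[u hu] z0.
have nz : 0 < complex.Im (n%:R * z) by rewrite real_nat ImZ mulr_gt0 // ltr0n.
pose c' := mx2 (c 0 0) (n%:Z * c 0 1) (u * M%:Z) (c 1 1).
have Gc' : Gamma0 M c'.
  split; last by rewrite mx2E dvdz_mull.
  by apply: SL2Z_mx2; move: Dc; rewrite /SL2Z det2 hu PoszM => <-; ring.
have nn : n%:R != 0 :> C by rewrite pnatr_eq0 -lt0n.
have a1 : automorphy c' (n%:R * z) = automorphy c z.
  by rewrite /automorphy !mx2E hu PoszM !rmorphM /= -[n%:Z%:~R]/(n%:R); ring.
have := hm _ _ Gc' nz; rewrite a1 /c' mx2E => <-; congr h; rewrite /moebius a1 !mx2E mulrA; congr (_ / _).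
by rewrite rmorphM /= -[n%:Z%:~R]/(n%:R); ring.
Qed.

(** Left multiplication by a matrix normalising Gamma_0(N) permutes the cosets; injectivity
    suffices, as the list is finite. *)
Lemma transversal_perm (N : nat) (s : seq 'M[int]_2) (V : 'M[int]_2) : coset_transversal N s -> SL2Z V ->
  (forall c, Gamma0 N c -> Gamma0 N (sinv V *m c *m V)) ->
  exists pi : 'M[int]_2 -> 'M[int]_2, perm_eq [seq pi r | r <- s] s /\
    forall r, r \in s -> exists2 c, Gamma0 N c & V *m r = c *m pi r.
Proof.
move=> [us sS hr] DV nV.
have ex r : exists r', r \in s -> r' \in s /\ exists2 c, Gamma0 N c & V *m r = c *m r'.
  have [rs|nrs] := boolP (r \in s); last by exists r.
  by have [r' [h _]] := hr _ (SL2Z_mul DV (sS _ rs)); exists r'.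
have [pi hpi] := choice ex; exists pi; split; last by move=> r /hpi[].
have inj : {in s &, injective pi}.
  move=> r1 r2 r1s r2s E; have [h1 [c1 G1 e1]] := hpi _ r1s; have [h2 [c2 G2 e2]] := hpi _ r2s.
  have [x [_ ux]] := hr _ (sS _ r1s).
  have x1 : x = r1.
    apply: ux; split => //; exists 1%:M; last by rewrite mul1mx.
    by split; [exact: SL2Z_1|rewrite mxE].
  suff x2 : x = r2 by rewrite -x1 x2.
  apply: ux; split => //; exists (sinv V *m (c1 *m sinv c2) *m V).
    by apply: nV; apply: Gamma0_mul => //; exact: Gamma0_sinv.
  rewrite -[LHS]mul1mx -(sinvV DV) -mulmxA e1 E -!mulmxA e2; congr (_ *m _); congr (_ *m _).
  by rewrite mulmxA sinvV ?mul1mx //; case: G2.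
have um : uniq [seq pi r | r <- s] by rewrite map_inj_in_uniq.
apply: uniq_perm => //; have [] := uniq_min_size um (s2 := s) => //.
- by move=> _ /mapP[r rs ->]; exact: (hpi _ rs).1.
- by rewrite size_map.
Qed.

Lemma Rintegral_zero (w : R * R -> R) : (forall p, @fundamental_domain R p -> w p = 0) ->
  \int[(@lebesgue_measure R \x @lebesgue_measure R)%E]_(p in @fundamental_domain R) w p = 0.
Proof. by move=> h; rewrite /Rintegral integral0_eq // => p Dp; rewrite h. Qed.

Variable k : nat.
Implicit Types (f g h : C -> C).

Lemma pair_fun_slash f g (a b : C) r p : SL2Z r -> 0 < p.2 ->
  slash k f r (toC2 p) = a * f (toC2 p) -> slash k g r (toC2 p) = b * g (toC2 p) ->
  pair_fun k f g (rmob r p) = a * b^* * pair_fun k f g p.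
Proof.
move=> Dr p0 e1 e2; rewrite pair_fun_rmob // e1 e2 /pair_fun.
by move: (f _) (g _) => x y; rewrite [(b * y)^*]rmorphM /=; ring.
Qed.

(** The sum over cosets of the invariant function is unchanged when each r is replaced by V r, yet
    it is multiplied by w != 1, so it vanishes at every point. *)
Lemma pair_vanish_perm (N : nat) (s : seq 'M[int]_2) (V : 'M[int]_2) (w : C) f g : coset_transversal N s -> SL2Z V ->
  (forall c, Gamma0 N c -> Gamma0 N (sinv V *m c *m V)) -> tame_form k f -> tame_form k g ->
  (forall c p, Gamma0 N c -> 0 < p.2 -> pair_fun k f g (rmob c p) = pair_fun k f g p) ->
  w != 1 -> (forall p, 0 < p.2 -> pair_fun k f g (rmob V p) = w * pair_fun k f g p) ->
  coset_integral s (pair_Re k f g) = 0 /\ coset_integral s (pair_Im k f g) = 0.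
Proof.
move=> hs DV nV tf tg inv w1 hw.
have sS r : r \in s -> SL2Z r by case: hs => _ h _; exact: h.
have [pi [ppi hpi]] := transversal_perm hs DV nV.
have z p : 0 < p.2 -> \sum_(r <- s) pair_fun k f g (rmob r p) = 0.
  move=> p0; have E : w * \sum_(r <- s) pair_fun k f g (rmob r p) = \sum_(r <- s) pair_fun k f g (rmob r p).
    rewrite mulr_sumr -[RHS](perm_big _ ppi) big_map; apply: eq_big_seq => r rs.
    have pis : pi r \in s by rewrite -(perm_mem ppi) map_f.
    rewrite -hw ?rmob_gt0 ?sS //; last exact: sS.
    have [c Gc e] := hpi _ rs; rewrite -rmobM // ?e; [|exact: sS].
    have Dc : SL2Z c by case: Gc.
    by rewrite (rmobM Dc (sS _ pis) p0) inv //; exact: rmob_gt0 (sS _ pis) p0.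
  apply/eqP; have /eqP : (w - 1) * \sum_(r <- s) pair_fun k f g (rmob r p) = 0 by rewrite mulrBl mul1r E subrr.
  by rewrite mulf_eq0 subr_eq0 (negPf w1).
have [[_ i1] [_ i2]] := pair_admissible sS tf tg.
rewrite /coset_integral -!Rintegral_seq_sum //; split.
  apply: Rintegral_zero => p [_ _ p0]; rewrite -mulr_suml.
  suff -> : \sum_(r <- s) pair_Re k f g (rmob r p) = 0 by rewrite mul0r.
  rewrite -[RHS]/(complex.Re (0 : C)) -(z p p0) Re_sum.
  by apply: eq_big_seq => r rs; rewrite /pair_Re rmob_gt0 //; exact: sS.
apply: Rintegral_zero => p [_ _ p0]; rewrite -mulr_suml.
suff -> : \sum_(r <- s) pair_Im k f g (rmob r p) = 0 by rewrite mul0r.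
rewrite -[RHS]/(complex.Im (0 : C)) -(z p p0) Im_sum.
by apply: eq_big_seq => r rs; rewrite /pair_Im rmob_gt0 //; exact: sS.
Qed.

(** The translation by 1/q is not in SL_2(Z) and does not act on the cosets; instead the complex
    integral equals w times itself by [coset_integral_shift], applied to real and imaginary parts,
    which w mixes. *)
Lemma pair_vanish_shift (N q : nat) (s : seq 'M[int]_2) (w : C) f g : coset_transversal N s ->
  q = 2%N \/ q = 3%N -> (q ^ 2 %| N)%N -> tame_form k f -> tame_form k g ->
  (forall c p, Gamma0 N c -> 0 < p.2 -> pair_fun k f g (rmob c p) = pair_fun k f g p) ->
  w != 1 -> (forall p, 0 < p.2 -> pair_fun k f g (hshift q%:R^-1 p) = w * pair_fun k f g p) ->
  coset_integral s (pair_Re k f g) = 0 /\ coset_integral s (pair_Im k f g) = 0.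
Proof.
move=> hs hq qN tf tg inv w1 hw.
have sS r : r \in s -> SL2Z r by case: hs => _ h _; exact: h.
have [a1 a2] := pair_admissible sS tf tg.
set U := pair_Re k f g in a1 *; set V := pair_Im k f g in a2 *.
have mRe (a b : C) : complex.Re (a * b) = complex.Re a * complex.Re b + (- complex.Im a) * complex.Im b.
  by case: a b => a1' a2' [b1 b2] /=; rewrite mulNr.
have mIm (a b : C) : complex.Im (a * b) = complex.Im a * complex.Re b + complex.Re a * complex.Im b.
  by case: a b => a1' a2' [b1 b2] /=; rewrite addrC.
have eU : U \o hshift q%:R^-1 = fun p => complex.Re w * U p + (- complex.Im w) * V p.
  apply/funext => p; rewrite /= /U /V /pair_Re /pair_Im /=; case: ifP => [p0|_]; last by rewrite !mulr0 addr0.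
  by rewrite hw // mRe.
have eV : V \o hshift q%:R^-1 = fun p => complex.Im w * U p + complex.Re w * V p.
  apply/funext => p; rewrite /= /U /V /pair_Re /pair_Im /=; case: ifP => [p0|_]; last by rewrite !mulr0 addr0.
  by rewrite hw // mIm.
have hU := coset_integral_shift hs hq qN a1 _ _.
have hV := coset_integral_shift hs hq qN a2 _ _.
rewrite eU eV in hU hV.
have {}hU := hU (admissible_lin _ _ a1 a2) _; have {}hV := hV (admissible_lin _ _ a1 a2) _.
have iU c p : Gamma0 N c -> 0 < p.2 -> U (rmob c p) = U p.
  by move=> Gc p0; rewrite /U /pair_Re p0 rmob_gt0 ?inv //; case: Gc.
have iV c p : Gamma0 N c -> 0 < p.2 -> V (rmob c p) = V p.
  by move=> Gc p0; rewrite /V /pair_Im p0 rmob_gt0 ?inv //; case: Gc.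
have {}hU := hU iU; have {}hV := hV iV.
rewrite !coset_integral_lin // in hU hV.
move: (coset_integral s U) (coset_integral s V) hU hV => x y hx hy.
have E : (w - 1) * Complex x y = 0 :> C.
  rewrite mulrBl mul1r; apply/eqP; rewrite subr_eq0 eq_complex /=.
  case: w hx hy {w1 hw eU eV} => a b /= hx hy.
  by apply/andP; split; apply/eqP; [rewrite -{2}hx mulNr|rewrite -{2}hy addrC].
move/eqP: E; rewrite mulf_eq0 subr_eq0 (negPf w1) /= => /eqP e.
by split; [have := congr1 (@complex.Re R) e|have := congr1 (@complex.Im R) e].
Qed.

Lemma tame_add F G : tame F -> tame G -> tame (fun z : C => F z + G z).
Proof.
move=> [m1 m2 [B [dl [B0 d0 hb]]]] [m1' m2' [B' [dl' [B0' d0' hb']]]]; split.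
- rewrite (_ : plane_Re _ = fun p => plane_Re F p + plane_Re G p); first exact: measurable_funD.
  by apply/funext => p; rewrite /plane_Re; case: ifP => _; rewrite ?addr0 // ReD.
- rewrite (_ : plane_Im _ = fun p => plane_Im F p + plane_Im G p); first exact: measurable_funD.
  by apply/funext => p; rewrite /plane_Im; case: ifP => _; rewrite ?addr0 // ImD.
exists (B + B'), (Num.min dl dl'); split; first exact: addr_ge0.
  by rewrite lt_min d0.
move=> z hz; have z0 : 0 <= complex.Im z by apply: le_trans hz; rewrite invr_ge0.
apply: (le_trans (cabsD _ _)); rewrite mulrDl; apply: lerD.
  apply: (le_trans (hb z hz)); rewrite ler_wpM2l // ler_expR lerN2 ler_wpM2r // ge_min lexx //.
apply: (le_trans (hb' z hz)); rewrite ler_wpM2l // ler_expR lerN2 ler_wpM2r // ge_min lexx orbT //.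
Qed.

Lemma tame_form_add g h : tame_form k g -> tame_form k h -> tame_form k (fun z => g z + h z).
Proof.
move=> tg th r Dr; apply: tame_eq (tame_add (tg r Dr) (th r Dr)) => z _.
by rewrite /slash mulrDr.
Qed.

Lemma tame_form_eq g h : (forall z, 0 < complex.Im z -> g z = h z) -> tame_form k g -> tame_form k h.
Proof.
by move=> e tg r Dr; apply: tame_eq (tg r Dr) => z z0; rewrite /slash e //; exact: Im_moebius_gt0.
Qed.

Lemma tame_form0 : tame_form k (fun _ => 0 : C).
Proof.
move=> r Dr; split.
- by rewrite (_ : plane_Re _ = fun _ => 0) //; apply/funext => p; rewrite /plane_Re /slash mulr0 /= if_same.
- by rewrite (_ : plane_Im _ = fun _ => 0) //; apply/funext => p; rewrite /plane_Im /slash mulr0 /= if_same.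
by exists 0, 1; split => // z _; rewrite /slash mulr0 cabs0 mul0r.
Qed.

(** Tameness is part of the notion so that it is stable under finite sums, where integrability is
    required. *)
Definition orthogonal_to (s : seq 'M[int]_2) f g : Prop := [/\ tame_form k g,
  coset_integral s (pair_Re k f g) = 0 & coset_integral s (pair_Im k f g) = 0].

Lemma orthogonal_to_eq s f g h : (forall r, r \in s -> SL2Z r) -> (forall z, 0 < complex.Im z -> g z = h z) ->
  orthogonal_to s f g -> orthogonal_to s f h.
Proof.
move=> sS e [tg h1 h2]; split; first exact: tame_form_eq tg.
- by rewrite -h1; apply: coset_integral_eq => // p p0; rewrite /pair_Re /pair_fun p0 e.
- by rewrite -h2; apply: coset_integral_eq => // p p0; rewrite /pair_Im /pair_fun p0 e.
Qed.

Lemma orthogonal_to_sum s f (I : Type) (l : seq I) (G : I -> C -> C) : (forall r, r \in s -> SL2Z r) -> tame_form k f ->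
  (forall i, orthogonal_to s f (G i)) -> orthogonal_to s f (fun z => \sum_(i <- l) G i z).
Proof.
move=> sS tf hG; elim: l => [|i l [tg h1 h2]].
  apply: (@orthogonal_to_eq _ _ (fun _ => 0)) => //; first by move=> z _; rewrite big_nil.
  split; first exact: tame_form0.
  - rewrite /coset_integral big1 // => r _; apply: Rintegral_zero => p _.
    by rewrite /pair_Re /pair_fun conjC0 mulr0 mul0r /= if_same mul0r.
  - rewrite /coset_integral big1 // => r _; apply: Rintegral_zero => p _.
    by rewrite /pair_Im /pair_fun conjC0 mulr0 mul0r /= if_same mul0r.
have [ti i1 i2] := hG i.
apply: (@orthogonal_to_eq _ _ (fun z => G i z + \sum_(j <- l) G j z)) => //; first by move=> z _; rewrite big_cons.
have [a1 a2] := pair_admissible sS tf ti; have [b1 b2] := pair_admissible sS tf tg.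
have E p (u v : C -> C) : pair_fun k f (fun z => u z + v z) p = pair_fun k f u p + pair_fun k f v p.
  by rewrite /pair_fun; move: (u _) (v _) => x y; rewrite [(x + y)^*]rmorphD /=; ring.
split; first exact: tame_form_add.
- have := coset_integral_lin 1 1 a1 b1; rewrite i1 h1 !mulr0 addr0 => <-.
  apply: coset_integral_eq => // p p0; rewrite /pair_Re p0 E ReD !mul1r //.
- have := coset_integral_lin 1 1 a2 b2; rewrite i2 h2 !mulr0 addr0 => <-.
  apply: coset_integral_eq => // p p0; rewrite /pair_Im p0 E ImD !mul1r //.
Qed.

End Orthogonality.

(** * Orthogonality of f to oldforms *)

Section Oldforms.
Variable R : realType.
Local Notation C := (Cplx R).
Implicit Types (p : R * R) (r : 'M[int]_2) (z : C).

Variable e : nat.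
Hypothesis e0 : (0 < e)%N.
Local Notation k := e.+1.
Local Notation N := (level e).
Local Notation m := (ewidth (e %% 6)).
Local Notation f := (@cmform R e).

Variable chi : int -> C.
Hypothesis hchi : forall n, coprimez n N%:Z -> chi n = (nebentypus e n)%:~R.

Let N0 : (0 < N)%N.
Proof. by rewrite levelE muln_gt0 expn_gt0 ewidth_gt0 /qlev; case: odd. Qed.

Let m0 : (0 < m)%N. Proof. exact: ewidth_gt0. Qed.

Lemma cmform_tame : tame_form k f.
Proof. by move=> r Dr; exact: (cusp_form_tame (cmform_cusp_form e0 (fun d => erefl)) Dr). Qed.

Lemma nebentypus_sq (n : int) : coprimez n N%:Z -> (nebentypus e n) ^+ 2 = 1.
Proof.
rewrite /nebentypus; case: odd => //; rewrite /coprimez => h.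
have h3 : ~~ (3%:Z %| n)%Z.
  apply/negP => n3; have : (3%:Z %| gcdz n N%:Z)%Z.
    by rewrite dvdz_gcd n3 /level PoszM dvdz_mulr.
  by rewrite (eqP h).
rewrite /leg3; have : (n %% 3)%Z = 1 \/ (n %% 3)%Z = 2 by lia.
by case=> ->.
Qed.

Lemma width_prime_level (q : nat) : prime q -> (q %| m)%N -> (q ^ 2 %| N)%N.
Proof. by move=> pq qm; rewrite levelE dvdn_mull // dvdn_exp2r. Qed.

Section Generator.
Variables (M n : nat) (chi' : int -> C) (h : C -> C).
Hypotheses (nM : (n * M %| N)%N) (MN : (M < N)%N) (chi'D : dirichlet_character M chi').
Hypothesis chi'E : forall x, coprimez x N%:Z -> chi' x = chi x.
Hypothesis hh : cusp_form k M chi' h.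

Let g z := h (n%:R * z).

Let n0 : (0 < n)%N.
Proof. by case: posnP nM => // ->; rewrite mul0n dvd0n => /eqP N00; move: N0; rewrite N00. Qed.

Let M0 : (0 < M)%N.
Proof. by case: (posnP M) nM => // ->; rewrite muln0 dvd0n => /eqP N00; move: N0; rewrite N00. Qed.

Let tg : tame_form k g. Proof. by move=> r Dr; exact: dilate_tame hh n0 Dr. Qed.

Let cop1 : coprimez 1 N%:Z. Proof. by rewrite /coprimez gcd1z. Qed.

Let chi'1 : chi' 1 = 1.
Proof. by rewrite chi'E // hchi // /nebentypus; case: odd. Qed.

Let pair_inv c p : Gamma0 N c -> 0 < p.2 -> pair_fun k f g (rmob c p) = pair_fun k f g p.
Proof.
move=> [Dc Nc] p0; have z0 : 0 < complex.Im (toC2 p) by [].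
have D1 : c 0 0 * c 1 1 - c 0 1 * c 1 0 = 1 by rewrite -det2.
have cop : coprimez (c 1 1) N%:Z.
  have /dvdzP[u hu] := Nc; apply/coprimezP; exists (c 0 0, - c 0 1 * u) => /=.
  by rewrite -D1 hu; ring.
have j0 := automorphy_neq0 Dc z0.
have Nc' : ((n * M)%N%:Z %| c 1%R 0%R)%Z by apply: dvdz_trans Nc; rewrite dvdzE.
rewrite (@pair_fun_slash _ _ _ _ (nebentypus e (c 1 1))%:~R (nebentypus e (c 1 1))%:~R) //.
- by rewrite [_^*]rmorph_int -rmorphM -expr2 nebentypus_sq // mul1r.
- rewrite /slash moebiusE cmform_modular // mulrA -/(automorphy c (toC2 p)).
  by rewrite [X in X * _](_ : _ = (nebentypus e (c 1 1))%:~R) //; field; rewrite expf_neq0.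
- rewrite /slash /g (dilate_modular hh n0 Dc Nc' z0) chi'E // hchi // mulrA.
  by rewrite [X in X * _](_ : _ = (nebentypus e (c 1 1))%:~R) //; field; rewrite expf_neq0.
Qed.

(** For odd e the level is m^2, so any prime factor of N/M divides m. For even e the level is 3 m^2
    with m^2 dividing 4, and the character has conductor 3; this forces 3 | M, so N/M divides
    m^2. *)
Lemma exists_level_prime : exists q, [/\ prime q, (q %| m)%N & (q %| N %/ M)%N].
Proof.
have MdN : (M %| N)%N by apply: dvdn_trans nM; exact: dvdn_mull.
have /dvdnP[t ht] := MdN.
have t1 : (1 < t)%N.
  by case: t ht => [|[|t]] // ht; [move: N0; rewrite ht|move: MN; rewrite ht mul1n ltnn].
exists (pdiv t); have pq := pdiv_prime t1; split => //; last first.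
  by rewrite ht mulnK // pdiv_dvd.
suff : (pdiv t %| m ^ 2)%N by rewrite Euclid_dvdX // => /andP[].
have qN : (pdiv t %| N)%N by rewrite ht dvdn_mulr // pdiv_dvd.
move: (levelE e); rewrite /qlev; case: ifP => oe lE; first by rewrite -[(m ^ 2)%N]mul1n -lE.
have M3 : (3 %| M)%N.
  apply/negPn/negP => nM3.
  have cM3 : coprime M 3 by rewrite coprime_sym prime_coprime.
  have Mm : (M %| m ^ 2)%N by rewrite -(Gauss_dvdr _ cM3) -lE.
  have M4 : (M %| 4)%N.
    apply: dvdn_trans Mm _; have s6 : (e %% 6 \in iota 0 6)%N by rewrite mem_iota ltn_pmod.
    have H : all (fun s => odd s || (ewidth s ^ 2 %| 4)%N) (iota 0 6) by vm_compute.
    by have := allP H _ s6; rewrite odd_mod // oe.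
  (* If 3 does not divide M, then M divides 4 and chi' has period 4; but 5 = 1 + 4 is prime to the
     level and has character value -1. *)
  have [_ per _] := chi'D.
  have pern (j : nat) x : chi' (x + (j * M)%N%:Z) = chi' x.
    elim: j x => [|j IH] x; first by rewrite addr0.
    by rewrite mulSn PoszD addrA IH per.
  have /dvdnP[j hj] := M4.
  have c5 : coprimez 5 N%:Z.
    rewrite /coprimez lE; have s6 : (e %% 6 \in iota 0 6)%N by rewrite mem_iota ltn_pmod.
    have H : all (fun s => odd s || (gcdz 5 (3 * ewidth s ^ 2)%N%:Z == 1)) (iota 0 6) by vm_compute.
    by have := allP H _ s6; rewrite odd_mod // oe.
  have := pern j 1; rewrite -hj chi'1 chi'E // hchi // /nebentypus oe.
  have -> : leg3 (1 + 4%:Z) = -1 by [].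
  by move=> h1; have := congr1 (@complex.Re R) h1; rewrite real_int /=; lra.
have /dvdnP[M' hM'] := M3.
have : (t * M' = m ^ 2)%N.
  by apply/eqP; rewrite -(eqn_pmul2l (isT : (0 < 3)%N)) -lE ht hM'; apply/eqP; lia.
by move=> <-; rewrite dvdn_mulr // pdiv_dvd.
Qed.

(** If q | n, the translation by 1/q moves n z by an integer, under which h is invariant. Otherwise
    n M divides N/q, so the lower triangular matrix with entry N/q acts on h(n z) with trivial
    character. Either way f alone acquires a factor different from 1. *)
Lemma generator_orthogonal s : coset_transversal N s -> orthogonal_to k s f g.
Proof.
move=> hs; have [q [pq qm qNM]] := exists_level_prime.
have q23 : q = 2%N \/ q = 3%N by apply: (@ewidth_prime e).
have q2N := width_prime_level pq qm.
have MdN : (M %| N)%N by apply: dvdn_trans nM; exact: dvdn_mull.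
suff [h1 h2] : coset_integral s (pair_Re k f g) = 0 /\ coset_integral s (pair_Im k f g) = 0 by split.
have qn : q%:R != 0 :> C by rewrite pnatr_eq0 -lt0n prime_gt0.
have [qd|qd] := boolP (q %| n)%N.
  apply: (pair_vanish_shift hs q23 q2N cmform_tame tg pair_inv (e2ipi_inv_neq1 R q23)).
  move=> p p0; have z0 : 0 < complex.Im (toC2 p) by [].
  have hz : toC2 (hshift q%:R^-1 p) = toC2 p + q%:R^-1.
    have -> : q%:R^-1 = (q%:R^-1 : R)%:C%C :> C by rewrite fmorphV rmorph_nat.
    by apply/eqP; rewrite eq_complex /= addr0 !eqxx.
  have /dvdnP[t ht] := qm.
  have fs (j : nat) : f (toC2 p + j%:R / m%:R) = e2ipi (j%:R / m%:R) * f (toC2 p).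
    elim: j => [|j IH]; first by rewrite mul0r addr0 e2ipi0 mul1r.
    rewrite -[j.+1]addn1 natrD mulrDl mul1r addrA (cmform_shift e0); last first.
      have -> : j%:R / m%:R = (j%:R / m%:R : R)%:C%C :> C by rewrite rmorphM fmorphV !rmorph_nat.
      by rewrite ImD /= addr0.
    by rewrite IH mulrA -e2ipiD addrC.
  have tq : t%:R / m%:R = q%:R^-1 :> C.
    have tn : t%:R != 0 :> C by rewrite pnatr_eq0; apply: contraTneq m0 => t0; rewrite ht t0.
    by rewrite ht natrM; field; rewrite tn qn.
  have gs : g (toC2 p + q%:R^-1) = g (toC2 p).
    have /dvdnP[j hj] := qd.
    have nz : 0 < complex.Im (n%:R * toC2 p) by rewrite real_nat ImZ mulr_gt0 // ltr0n.
    have Gt : Gamma0 M (mx2 1 j%:Z 0 1) by split; [apply: SL2Z_mx2; rewrite mulr0 subr0|rewrite mx2E].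
    have [_ hm _] := hh; have := hm _ _ Gt nz.
    rewrite /moebius /automorphy !mx2E chi'1 -[1%:~R]/(1 : C) -[0%:~R]/(0 : C) !mul0r !add0r expr1n !mul1r divr1 => hj'.
    rewrite /g mulrDr; have -> : n%:R / q%:R = j%:Z%:~R :> C by rewrite hj natrM mulfK.
    exact: hj'.
  by rewrite /pair_fun hz gs -tq fs tq -!mulrA.
have [w w1 hw] := cmform_V R e0 pq qm.
pose v := (N %/ q)%N%:Z; pose V := mx2 1 0 v 1.
have DV : SL2Z V by apply: SL2Z_mx2; rewrite mul0r subr0.
have qN : (q %| N)%N by apply: dvdn_trans q2N; rewrite dvdn_exp.
have Nv : N%:Z = q%:Z * v by rewrite /v -PoszM mulnC divnK.
have vv : (N%:Z %| v ^+ 2)%Z.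
  have /dvdnP[t ht] := q2N; have q0 : (0 < q)%N := prime_gt0 pq.
  have vt : v = (t * q)%N%:Z by rewrite /v ht -mulnn mulnA mulnK.
  by rewrite vt ht expr2 -PoszM dvdzE /=; apply/dvdnP; exists t; lia.
(* Write N = u n M. Then q divides N/M = u n but not n, hence q divides u. *)
have nMv : ((n * M)%N%:Z %| v)%Z.
  rewrite dvdzE /v /=; have /dvdnP[u hu] := nM; have q0 : (0 < q)%N := prime_gt0 pq.
  have : (q %| u * n)%N.
    by move: qNM; rewrite hu mulnA mulnK.
  rewrite Euclid_dvdM // (negPf qd) orbF => /dvdnP[u' hu'].
  by rewrite hu hu' mulnAC mulnK //; apply: dvdn_mull.
have Vz p : rmob V p = rm4 1 0 v 1 p by rewrite /rmob !mx2E.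
apply: (@pair_vanish_perm _ _ N s V w) => //.
(* The lower left entry of the conjugate is c + v (d - a) - b v^2. It is divisible by N = q v
   because q divides d - a and N divides v^2; [tconjE] at 0 supplies the former. *)
- move=> c Gc; have [c1 [d1 [hc hd _]]] := tconjE q23 q2N 0 Gc.
  split; first by apply: SL2Z_mul => //; apply: SL2Z_mul; [exact: SL2Z_sinv|case: Gc].
  have /dvdzP[x hx] := vv; have [_ /dvdzP[y hy]] := Gc.
  rewrite !mul2E !mx2E; apply/dvdzP; exists (y + d1 - c 0 1 * x).
  transitivity (c 1 0 + v * (c 1 1 - c 0 0) - c 0 1 * v ^+ 2); first by ring.
  by rewrite hx hy hd; move: Nv; move: (N%:Z) => X ->; ring.
- exact: cmform_tame.
move=> p p0; have z0 : 0 < complex.Im (toC2 p) by [].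
have j0 := automorphy_neq0 DV z0.
rewrite (@pair_fun_slash _ _ _ _ w 1) //.
- by rewrite conjC1 mulr1.
- rewrite /slash moebiusE !mx2E hw // /automorphy !mx2E -[1%:~R]/(1 : C).
  move: j0; rewrite /automorphy !mx2E -[1%:~R]/(1 : C) => j0.
  by move: (f _) => y; field; rewrite expf_neq0.
rewrite /slash /g (dilate_modular hh n0 DV) // ?mx2E // chi'1 mul1r mulrA mul1r.
by rewrite mulVf ?mul1r // expf_neq0.
Qed.

End Generator.

Lemma oldform_orthogonal g : oldform k N chi g -> petersson k N f g = 0.
Proof.
move=> [l [G [hG gE]]].
have sS r : r \in coset_reps N -> SL2Z r.
  by case: (coset_reps_cases N) => [[_ h _]|->] //; exact: h.
have gen i : orthogonal_to k (coset_reps N) f (G i).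
  have [M [n [chi' [h [[nM MN] chi'D chi'E hh GE]]]]] := hG i.
  apply: (@orthogonal_to_eq _ _ _ _ (fun z => h (n%:R * z))) => //; first by move=> z z0; rewrite GE.
  have [hs|s0] := coset_reps_cases N; first exact: generator_orthogonal nM MN chi'D chi'E hh _ hs.
  rewrite s0; split; rewrite ?/coset_integral ?big_nil //.
  have n0 : (0 < n)%N by case: posnP nM => // ->; rewrite mul0n dvd0n => /eqP N00; move: N0; rewrite N00.
  by move=> r Dr; exact: dilate_tame hh n0 Dr.
have [tg h1 h2] : orthogonal_to k (coset_reps N) f g.
  by apply: (orthogonal_to_eq sS _ (orthogonal_to_sum (index_enum 'I_l) sS cmform_tame gen)) => z z0; rewrite gE.
by rewrite petersson_coset_integral // ?h1 ?h2 //; exact: cmform_tame.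
Qed.

End Oldforms.

(** * The newform *)

Section Assembly.
Variable R : realType.
Local Notation C := (Cplx R).

Lemma prime_count_unbounded K : exists x, (K <= count prime (iota 0 x.+1))%N.
Proof.
elim: K => [|K [x hx]]; first by exists 0%N.
have [p xp pp] := prime_above x; exists p.
have -> : p.+1 = (x.+1 + (p - x))%N by lia.
rewrite iotaD count_cat -addn1 leq_add // -has_count; apply/hasP; exists p => //.
by rewrite mem_iota add0n xp /=; lia.
Qed.

(** Leaving out one prime changes the count by at most 1, while the number of primes is
    unbounded. *)
Lemma density_one_not3 : prime_density_one R (fun p => p != 3%N).
Proof.
apply/cvgrPdist_lt => ep ep0.
pose K := (Num.truncn ep^-1).+1; have hK : ep^-1 < K%:R by exact: truncnS_gt.
have [x0 hx0] := prime_count_unbounded K.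
exists x0 => // x hx'; have hx : (x0 <= x)%N := hx'.
change (`|1 - (count (fun p => prime p && (p != 3%N)) (iota 0 x.+1))%:R / (count prime (iota 0 x.+1))%:R| < ep).
set a := count _ _; set b := count prime _.
have Kb : (K <= b)%N.
  apply: (leq_trans hx0); rewrite /b (_ : x.+1 = (x0.+1 + (x - x0))%N); last by lia.
  by rewrite iotaD count_cat leq_addr.
have b0 : 0 < b%:R :> R by rewrite ltr0n; apply: leq_trans Kb.
have ab : (a <= b)%N by apply: sub_count => p /andP[].
have ba : (b <= a + 1)%N.
  apply: (@leq_trans (count (predU (fun p => prime p && (p != 3%N)) (pred1 3%N)) (iota 0 x.+1))).
    by apply: sub_count => p /= ->; case: eqP.
  apply: (@leq_trans (a + count (pred1 3%N) (iota 0 x.+1))); first by rewrite /a -count_predUI leq_addr.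
  by rewrite leq_add2l count_uniq_mem ?iota_uniq // leq_b1.
have E : 1 - a%:R / b%:R = (b - a)%N%:R / b%:R :> R by rewrite natrB // mulrBl mulfV ?gt_eqF.
rewrite E ger0_norm ?divr_ge0 // ltr_pdivrMr //.
apply: (@le_lt_trans _ _ 1); first by rewrite lern1; lia.
rewrite -ltr_pdivrMl // mulr1; apply: (lt_le_trans hK); by rewrite ler_nat.
Qed.

Variable e : nat.
Hypothesis e0 : (0 < e)%N.

(** The prime 3 is excluded because the quadratic character vanishes there, whereas for odd weight
    the coefficient does not. At the other primes either the character is 1 or the prime is inert
    and the coefficient is 0. *)
Lemma gam_CM : has_CM_by (-3) (gam R e).
Proof.
exists (fun p => p != 3%N); split; first exact: density_one_not3.
move=> p pp p3; have -> : quad_disc (-3) = -3 by [].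
rewrite kronecker_m3 /leg3 modz_nat.
have : (p %% 3 = 1)%N \/ (p %% 3 = 2)%N.
  have : ~~ (3 %| p)%N by rewrite dvdn_prime2 // eq_sym.
  by rewrite /dvdn; lia.
case=> h; first by rewrite h mul1r.
by rewrite gam_inert // mulr0.
Qed.

(** 2 zeta - 1 is a square root of -3. It may differ in sign from [sqrtC (- 3)], which only
    exchanges the two summands. *)
Lemma gam_prime_value p (a b : int) : prime p -> (p = 1 %[mod 6])%N -> normalized_rep p (a, b) ->
  gam R e p = (a%:~R + b%:~R * sqrtC (- 3)) ^+ e + (a%:~R - b%:~R * sqrtC (- 3)) ^+ e.
Proof.
move=> pp p1 hab; rewrite (gam_normalized R e0 pp p1 hab) /toC /=.
pose w : C := 2 * zeta R - 1.
have w2 : w ^+ 2 = -3 by rewrite /w; transitivity (4 * zeta R ^+ 2 - 4 * zeta R + 1 : C); [ring|rewrite zeta_sq; ring].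
have -> : (a - b)%:~R + (2 * b)%:~R * zeta R = a%:~R + b%:~R * w :> C by rewrite /w !rmorphD !rmorphM rmorphN /=; ring.
have -> : (a + b)%:~R + (- (2 * b))%:~R * zeta R = a%:~R - b%:~R * w :> C by rewrite /w !rmorphD rmorphN !rmorphM /=; ring.
have : w ^+ 2 = sqrtC (- 3) ^+ 2 by rewrite w2 sqrtCK.
by move/eqP; rewrite eqf_sqr => /orP[] /eqP -> //; rewrite mulrN opprK addrC.
Qed.

Lemma cmform_newform (chi : int -> C) : (forall n, chi n = (nebentypus e n)%:~R) ->
  newform e.+1 (level e) chi (@cmform R e) (gam R e).
Proof.
move=> hchi; split.
- exact: cmform_cusp_form.
- exact: cmform_cusp_expansion.
- exact: gam1.
- by apply: oldform_orthogonal => // n _; exact: hchi.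
- by move=> n n0; exists (gam R e n) => z z0; exact: cmform_hecke.
Qed.

End Assembly.

Theorem theorem1p1 (R : realType) (k : nat) (hk : (2 <= k)%N) :
  exists (f : Cplx R -> Cplx R) (gamma : nat -> Cplx R),
    [/\ [/\ (k = 0 %[mod 6] \/ k = 2 %[mod 6])%N ->
              newform k 36 (fun _ : int => 1) f gamma,
            (k = 1 %[mod 6])%N ->
              newform k 3 (fun n : int => (kronecker (- 3) n)%:~R) f gamma,
            (k = 3 %[mod 6] \/ k = 5 %[mod 6])%N ->
              newform k 12 (fun n : int => (kronecker (- 3) n)%:~R) f gamma
          & (k = 4 %[mod 6])%N ->
              newform k 9 (fun _ : int => 1) f gamma],
        has_CM_by (- 3) gamma,
        forall p : nat, prime p -> odd p ->
          [/\ (p = 1 %[mod 6])%N ->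
                (exists! ab : int * int, normalized_rep p ab) /\
                (forall a b : int, normalized_rep p (a, b) ->
                   gamma p =
                     (a%:~R + b%:~R * sqrtC (- 3)) ^+ (k - 1)
                     + (a%:~R - b%:~R * sqrtC (- 3)) ^+ (k - 1)),
              p = 3%N -> odd k -> gamma p = (- 3) ^+ ((k - 1) %/ 2)
            & (p <> 1 %[mod 6])%N -> ~ (p = 3%N /\ odd k) -> gamma p = 0]
      & forall n : nat, (1 <= n)%N -> exists m : int, gamma n = m%:~R].
Proof.
(* The exponent of the character is e = k - 1, so each residue of k modulo 6 corresponds to the
   residue of e one below it. *)
case: k hk => [|e] // e0; have {}e0 : (0 < e)%N by [].
exists (@cmform R e), (gam R e); rewrite subn1 /=.
have levelM s : (e %% 6 = s)%N -> level e = (3 * econdN s)%N by rewrite /level => ->.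
have newE s N (chi : int -> Cplx R) : (e %% 6 = s)%N -> (3 * econdN s)%N = N ->
    (forall n, chi n = (nebentypus e n)%:~R) -> newform e.+1 N chi (@cmform R e) (gam R e).
  by move=> es <- hchi; rewrite -(levelM s) //; exact: cmform_newform.
have oddE : odd e = odd (e %% 6) by rewrite odd_mod.
split.
- split.
  + case=> h.
      by apply: (newE 5%N) => //; [lia|move=> n; rewrite /nebentypus oddE (_ : (e %% 6)%N = 5%N) //; lia].
    by apply: (newE 1%N) => //; [lia|move=> n; rewrite /nebentypus oddE (_ : (e %% 6)%N = 1%N) //; lia].
  + move=> h; apply: (newE 0%N) => //; first by lia.
    by move=> n; rewrite kronecker_m3 /nebentypus oddE (_ : (e %% 6)%N = 0%N) //; lia.
  + case=> h.
      apply: (newE 2%N) => //; first by lia.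
      by move=> n; rewrite kronecker_m3 /nebentypus oddE (_ : (e %% 6)%N = 2%N) //; lia.
    apply: (newE 4%N) => //; first by lia.
    by move=> n; rewrite kronecker_m3 /nebentypus oddE (_ : (e %% 6)%N = 4%N) //; lia.
  + by move=> h; apply: (newE 3%N) => //; [lia|move=> n; rewrite /nebentypus oddE (_ : (e %% 6)%N = 3%N) //; lia].
- exact: gam_CM.
- move=> p pp op; split.
  + move=> p1; split; last by move=> a b hab; exact: gam_prime_value.
    have [ab hab] := normalized_rep_exists pp p1; exists ab; split => // cd hcd.
    exact: (normalized_rep_uniq pp hab hcd).
  + by move=> -> oe; rewrite gam_3 // (negPf oe).
  + move=> p1 np; have [p3|p3] := eqVneq p 3%N.
      have oe : odd e by apply/negPn/negP => ne; apply: np.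
      by rewrite p3 gam_3 // oe.
    apply: gam_inert => //.
    have : ~~ (3 %| p)%N by rewrite dvdn_prime2 // eq_sym.
    by rewrite /dvdn; lia.
- by move=> n _; exact: gam_int.
Qed.
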